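(* Let $L\subset\mathbb{C}$ be a lattice whose $j$-invariant $j(L)$ is real, and suppose its multiplier ring $\mathcal{O}_L$ is different from $\mathbb{Z}$, $\mathbb{Z}[i]$ and $\mathbb{Z}\!\left[\frac{1-\sqrt{-3}}{2}\right]$. Then the set of values $\{\tilde D_L(a,c) : a,c\in\mathcal{O}_L,\ c\neq 0\}$ of the normalized elliptic Dedekind sum with respect to $L$ is dense in $\mathbb{R}$.
   Context: A lattice $L$ is a non-degenerate lattice in $\mathbb{C}$ (a discrete subgroup of rank $2$ spanning $\mathbb{C}$ over $\mathbb{R}$). Its multiplier ring is $\mathcal{O}_L=\{m\in\mathbb{C}: mL\subset L\}$; here it is an order in an imaginary quadratic field $K$, written $\mathcal{O}_L=\mathbb{Z}\!\left[f\frac{d_K+\sqrt{d_K}}{2}\right]$ where $d_K$ is the discriminant of the ring of integers of $K$ and $f\ge1$ is the conductor of $\mathcal{O}_L$; set $d_L=f^2d_K$. For an integer $k\ge1$ and $z\in\mathbb{C}$, define $E_k(z)$ to be the value at $s=0$ of the analytic continuation in $s$ of $\sum_{l\in L,\ l+z\neq0}(l+z)^{-k}|l+z|^{-s}$ (convergent for $\mathrm{Re}\, s$ large). For $h,k\in\mathcal{O}_L$ with $k\neq0$, the elliptic Dedekind sum is $D_L(h,k)=\frac1k\sum_{\mu\in L/kL}E_1\!\left(\frac{h\mu}{k}\right)E_1\!\left(\frac{\mu}{k}\right)$, and the normalized elliptic Dedekind sum is $\tilde D_L(h,k)=\left(i\sqrt{|d_L|}\,E_2(0)\right)^{-1}D_L(h,k)$.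 *)

(* Defs.v *)
From HB Require Import structures.
From mathcomp Require Import all_boot all_order all_algebra.
From mathcomp Require Import complex.
From mathcomp Require Import all_classical all_reals all_analysis.
From mathcomp.analysis.showcase Require Import summability.
Set Implicit Arguments.
Unset Strict Implicit.
Unset Printing Implicit Defensive.
Import Order.TTheory GRing.Theory Num.Theory.
Import numFieldNormedType.Exports.
Local Open Scope classical_set_scope.
Local Open Scope ring_scope.
Local Open Scope complex_scope.

(* MathComp-Analysis world: R : realType, and the complex numbers are R[i].
   The topology and the normed-module structure on R[i] are those of R[i]^o. *)

Section Lattices.
Variable R : realType.
Implicit Types (L A K : set R[i]) (z s w l h k : R[i]).

Definition Zbasis w1 w2 A : Prop :=
  A = [set x | exists m n : int, x = m%:~R * w1 + n%:~R * w2] /\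
  forall m n : int, m%:~R * w1 + n%:~R * w2 = 0 -> m = 0 /\ n = 0.

Record is_lattice L : Prop := IsLattice {
  lattice_rank2 : exists w1 w2, Zbasis w1 w2 L;
  lattice_discrete : forall l, L l ->
    exists2 e : R[i], 0 < e & forall l', L l' -> `|l' - l| < e -> l' = l;
  lattice_span : forall z, exists l1 l2, [/\ L l1, L l2 &
    exists a b : R, z = a%:C * l1 + b%:C * l2]
}.

Definition Zadjoin z : set R[i] :=
  [set x | exists p : {poly int}, x = (map_poly intr p).[z]].

Definition multiplier_ring L : set R[i] :=
  [set m | forall l, L l -> L (m * l)].

Definition fraction_field A : set R[i] :=
  [set x | exists m n, [/\ A m, A n, n != 0 & x = m / n]].

Definition ring_of_integers K : set R[i] :=
  [set x | K x /\ integralOver (intr : int -> R[i]) x].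

(* Discriminant of a rank-2 Z-module stable under complex conjugation, which
   is the nontrivial automorphism of an imaginary quadratic field. *)
Definition has_discriminant A (d : int) : Prop :=
  exists w1 w2, Zbasis w1 w2 A /\
    d%:~R = (w1 * w2^* - w2 * w1^*) ^+ 2.

(* sqrtC of a negative integer has positive imaginary part. *)
Definition is_lattice_disc L (dL : int) : Prop :=
  exists (dK : int) (f : nat),
    [/\ has_discriminant
          (ring_of_integers (fraction_field (multiplier_ring L))) dK,
        (1 <= f)%N,
        multiplier_ring L = Zadjoin (f%:R * ((dK%:~R + sqrtC dK%:~R) / 2)) &
        dL = f%:Z ^+ 2 * dK].

Definition lattice_disc L : int := xget 0 (is_lattice_disc L).

(* Unordered sums over a subset A of R[i], as limits of finite partial sums. *)
Definition has_sum A (u : R[i] -> R[i]) (v : R[i]) : Prop :=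
  partial_sum (fun l => (if l \in A then u l else 0) : R[i]^o) @ totally
    --> (v : R[i]^o).

Definition set_sum A (u : R[i] -> R[i]) : R[i] := xget 0 (has_sum A u).

Definition G_ (n : nat) L : R[i] :=
  set_sum (L `\ 0) (fun l => l ^- n).

Definition j_invariant L : R[i] :=
  let g2 := 60 * G_ 4 L in
  let g3 := 140 * G_ 6 L in
  1728 * g2 ^+ 3 / (g2 ^+ 3 - 27 * g3 ^+ 2).

Definition expC z : R[i] :=
  (expR (complex.Re z))%:C * (cos (complex.Im z) +i* sin (complex.Im z)).

(* |z|^s for z != 0 *)
Definition norm_cpow z s : R[i] :=
  expC (s * (ln (ComplexField.Normc.normc z))%:C).

Definition holomorphic_on (U : set R[i]) (F : R[i] -> R[i]) : Prop :=
  forall s, U s -> derivable (F : R[i]^o -> R[i]^o) s 1.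

(* F continues the series, convergent for Re s large, to a half-plane
   Re s > sigma containing 0; half-planes being connected, F 0 is unique. *)
Definition is_EisKron_continuation L (k : nat) z (F : R[i] -> R[i]) : Prop :=
  exists2 sigma : R, sigma < 0 &
    holomorphic_on [set s | sigma < complex.Re s] F /\
    exists tau : R, forall s, tau < complex.Re s ->
      has_sum [set l | L l /\ l + z != 0]
        (fun l => (l + z) ^- k * norm_cpow (l + z) (- s)) (F s).

Definition E_ (k : nat) L z : R[i] :=
  xget 0 [set e | exists2 F, is_EisKron_continuation L k z F & e = F 0].

Definition coset L k mu : set R[i] := [set mu + k * l | l in L].

(* Each class mu + kL is represented by a chosen element; E_ 1 L is
   L-periodic, so the terms do not depend on the choice. *)
Definition dedekind_sum L h k : R[i] :=
  k^-1 * \sum_(X \in [set coset L k mu | mu in L])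
           E_ 1 L (h * xget 0 X / k) * E_ 1 L (xget 0 X / k).

Definition normalized_dedekind_sum L h k : R[i] :=
  ('i * sqrtC `|(lattice_disc L)%:~R| * E_ 2 L 0)^-1 * dedekind_sum L h k.

Definition normalized_values L : set R[i] :=
  [set x | exists a c, [/\ multiplier_ring L a, multiplier_ring L c, c != 0 &
                           x = normalized_dedekind_sum L a c]].

End Lattices.

(* Main.v *)
(* Write h' for the complex conjugate of h.  After rescaling, L = Z + Z tau with
   tau in the standard fundamental domain.  Off L one has
   E_1(z) = zeta(z) - s z - c z' with s = E_2(0), and Liouville's theorem gives
   the addition formula for E_1 and its distribution relations.  Summing the
   addition formula over torsion points yields, for an integer n and h prime to n,
     D(h, n) + D(n, h) = s ((h - h') / n - (n^2 + 1) (h - h') / (n h h')),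
   while the Lambert expansion of E_1 shows that E_1 on the n-torsion is its own
   finite Fourier transform, whence D(h, n) = - D(h', n) and, more generally,
   D(h, k) = - D(h', k').
   If h h' = 1 mod n then D(h, n) = D(h', n), so D(h, n) = 0 and D(n, h) is
   explicit.  With d = d_L, n = m^2 and h = 1 + m w sqrt d + m^2 t the normalized
   sum tends to 2 w / m as t grows, which gives density.
   A real j-invariant forces L' = lam L, because the Eisenstein sums G_4 and G_6
   determine all the others, hence the lattice; together with the antisymmetry
   this gives real values.  It also puts tau on Re tau = 0, |Re tau| = 1/2 or
   |tau| = 1, where the q-expansion of E_2 shows s <> 0 away from i and the sixth
   roots of unity. *)
Require Import Defs.
From HB Require Import structures.
From mathcomp Require Import all_boot all_order all_algebra.
From mathcomp Require Import complex finmap.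
From mathcomp Require Import all_classical all_reals all_analysis.
From mathcomp.analysis.showcase Require Import summability.
From mathcomp Require Import ring lra zify.
From mathcomp Require algC algnum.
Set Implicit Arguments.
Unset Strict Implicit.
Unset Printing Implicit Defensive.
Import Order.TTheory GRing.Theory Num.Theory.
Import numFieldNormedType.Exports.
Local Open Scope classical_set_scope.
Local Open Scope ring_scope.
Local Open Scope complex_scope.
Local Notation "x ^*" := (conjc x) : ring_scope.

(** The series for E_1 and E_2 do not converge absolutely at s = 0. Removing the first-order Taylor
    part of each summand continues them up to two functions of s alone, and these are recovered at
    the half periods, where the full series vanishes by oddness. Their values at 0 are [ca tau 0] =
    E_2(0), the s above, and [cb tau 0] = pi / Im tau, the c above. No residue calculus is used:
    identities between elliptic functions come from Liouville's theorem, which rests on Goursat's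
    lemma and on a maximum principle tolerating locally bounded exceptional points, so arbitrary
    values at poles do no harm. The square n = m^2 has this origin: h = 1 + m w sqrt d + m^2 t
    satisfies h h' = 1 mod m^2, while h - h' = 2 m w sqrt d is only of order m, so the leading term
    (h - h') / n keeps the denominator m and 2 w / m runs through a grid of step as small as
    desired. D(h, n) = D(h', n) because multiplication by h' permutes the n-torsion. For E_2(0) the
    crux is a comparison with the zeros at i and at the sixth roots of unity, which exist by
    symmetry; the zero at i even supplies the bounds on pi that the comparison needs. *)

Section ComplexNorm.
Variable R : realType.
Implicit Types (x y e : R) (z w h : R[i]).

(** The norm of [R[i]] takes its values in [R[i]], which is only partially ordered; this real-valued
    copy lets [lra] and [nra] work on estimates. *)
Definition nrm z : R := ComplexField.Normc.normc z.

Arguments nrm : simpl never.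

Lemma normE z : `|z| = (nrm z)%:C. Proof. by case: z. Qed.

Lemma nrm_ge0 z : 0 <= nrm z. Proof. by case: z => a b; rewrite sqrtr_ge0. Qed.

Lemma nrm0 : nrm 0 = 0. Proof. exact: ComplexField.Normc.normc0. Qed.

Lemma nrm1 : nrm 1 = 1. Proof. exact: ComplexField.Normc.normc1. Qed.

Lemma nrm_eq0 z : (nrm z == 0) = (z == 0).
Proof.
apply/idP/idP => [/eqP /ComplexField.Normc.eq0_normc -> //|/eqP ->].
by rewrite nrm0.
Qed.

Lemma nrm_gt0 z : (0 < nrm z) = (z != 0).
Proof. by rewrite lt_neqAle nrm_ge0 andbT eq_sym nrm_eq0. Qed.

Lemma nrmM z w : nrm (z * w) = nrm z * nrm w.
Proof. exact: ComplexField.Normc.normcM. Qed.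

Lemma nrmV z : nrm z^-1 = (nrm z)^-1. Proof. exact: ComplexField.Normc.normcV. Qed.

Lemma nrmN z : nrm (- z) = nrm z. Proof. by rewrite /nrm normcN. Qed.

Lemma nrmD z w : nrm (z + w) <= nrm z + nrm w. Proof. exact: le_normcD. Qed.

Lemma nrmC z w : nrm (z - w) = nrm (w - z). Proof. by rewrite -nrmN opprB. Qed.

Lemma nrmB z w : nrm (z - w) <= nrm z + nrm w.
Proof. by rewrite -[nrm w]nrmN nrmD. Qed.

Lemma nrmB_ge z w : nrm z - nrm w <= nrm (z - w).
Proof. by have := nrmD (z - w) w; rewrite subrK; lra. Qed.

Lemma nrmD_ge z w : nrm z - nrm w <= nrm (z + w).
Proof. by have := nrmB_ge z (- w); rewrite opprK nrmN. Qed.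

Lemma nrm_real x : nrm x%:C = `|x|.
Proof. by rewrite /nrm /= expr0n addr0 sqrtr_sqr. Qed.

Lemma nrmX z n : nrm (z ^+ n) = nrm z ^+ n.
Proof. by elim: n => [|n IH]; rewrite ?expr0 ?nrm1 // !exprS nrmM IH. Qed.

Lemma nrm_nat n : nrm n%:R = n%:R.
Proof. by rewrite -(rmorph_nat (real_complex R)) nrm_real normr_nat. Qed.

Lemma nrm_int (m : int) : nrm m%:~R = `|m%:~R|.
Proof. by rewrite -(rmorph_int (real_complex R)) nrm_real. Qed.

Lemma nrm_conj z : nrm z^* = nrm z.
Proof. by case: z => a b; rewrite /nrm /= sqrrN. Qed.

Lemma nrm_sqr z : nrm z ^+ 2 = complex.Re z ^+ 2 + complex.Im z ^+ 2.
Proof. by case: z => a b; rewrite /nrm /= sqr_sqrtr // addr_ge0 ?sqr_ge0. Qed.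

Lemma Re_le_nrm z : `|complex.Re z| <= nrm z.
Proof.
rewrite -(@ler_pXn2r _ 2) ?nnegrE ?nrm_ge0 // nrm_sqr real_normK ?num_real //.
by rewrite lerDl sqr_ge0.
Qed.

Lemma Im_le_nrm z : `|complex.Im z| <= nrm z.
Proof.
rewrite -(@ler_pXn2r _ 2) ?nnegrE ?nrm_ge0 // nrm_sqr real_normK ?num_real //.
by rewrite lerDr sqr_ge0.
Qed.

Lemma nrm_i : nrm 'i = 1.
Proof. by rewrite /nrm /= expr0n add0r expr1n sqrtr1. Qed.

Lemma nrm_sum (I : Type) (r : seq I) (P : pred I) (F : I -> R[i]) :
  nrm (\sum_(i <- r | P i) F i) <= \sum_(i <- r | P i) nrm (F i).
Proof.
elim/big_rec2: _ => [|i y1 y2 _ H]; first by rewrite nrm0.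
by apply: le_trans (nrmD _ _) _; rewrite lerD2l.
Qed.

Lemma nrm_prod (I : Type) (r : seq I) (P : pred I) (F : I -> R[i]) :
  nrm (\prod_(i <- r | P i) F i) = \prod_(i <- r | P i) nrm (F i).
Proof. by elim/big_rec2: _ => [|i y1 y2 _ <-]; rewrite ?nrm1 ?nrmM. Qed.

Lemma nrm_le0 z : (forall e, 0 < e -> nrm z <= e) -> z = 0.
Proof.
move=> H; apply/eqP; rewrite -nrm_eq0 eq_le nrm_ge0 andbT.
by apply/ler_addgt0Pr => e e0; rewrite add0r; apply: H.
Qed.

Lemma ReD z w : complex.Re (z + w) = complex.Re z + complex.Re w.
Proof. by case: z w => [a b] [c d]. Qed.
Lemma ImD z w : complex.Im (z + w) = complex.Im z + complex.Im w.
Proof. by case: z w => [a b] [c d]. Qed.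
Lemma ReN z : complex.Re (- z) = - complex.Re z. Proof. by case: z. Qed.
Lemma ImN z : complex.Im (- z) = - complex.Im z. Proof. by case: z. Qed.
Lemma cReM z w : complex.Re (z * w) =
  complex.Re z * complex.Re w - complex.Im z * complex.Im w.
Proof. by case: z w => [a b] [c d]. Qed.
Lemma cImM z w : complex.Im (z * w) =
  complex.Re z * complex.Im w + complex.Im z * complex.Re w.
Proof. by case: z w => [a b] [c d]. Qed.

Lemma complex_ReIm z : z = (complex.Re z)%:C + 'i * (complex.Im z)%:C.
Proof. exact: complexE. Qed.

End ComplexNorm.

Arguments nrm : simpl never.

(** * Complex differentiability in epsilon-delta form *)

Section Differentiability.
Variable R : realType.
Implicit Types (e d : R) (z w h : R[i]) (P Q : R[i] -> Prop) (f g : R[i] -> R[i]).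

Definition nb z P := exists2 d : R, 0 < d & forall w, nrm (w - z) < d -> P w.

Lemma nb_and z P Q : nb z P -> nb z Q -> nb z (fun w => P w /\ Q w).
Proof.
move=> [d d0 H] [d' d0' H']; exists (Num.min d d'); first by rewrite lt_min d0.
by move=> w; rewrite lt_min => /andP[/H ? /H'].
Qed.

Lemma nbW z P Q : (forall w, P w -> Q w) -> nb z P -> nb z Q.
Proof. by move=> PQ [d d0 H]; exists d => // w /H /PQ. Qed.

Lemma nb_self z P : nb z P -> P z.
Proof. by move=> [d d0]; apply; rewrite subrr nrm0. Qed.

Lemma nb_near z d : 0 < d -> nb z (fun w => nrm (w - z) < d).
Proof. by move=> d0; exists d. Qed.

Lemma nbT z P : (forall w, P w) -> nb z P.
Proof. by move=> H; exists 1. Qed.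

Lemma nb_all (I : eqType) (s : seq I) z (P : I -> R[i] -> Prop) :
  (forall i, i \in s -> nb z (P i)) -> nb z (fun w => forall i, i \in s -> P i w).
Proof.
elim: s => [|a s IH] H; first exact: nbT.
have H1 := H a (mem_head _ _).
have /IH H2 : forall i, i \in s -> nb z (P i).
  by move=> i si; apply: H; rewrite inE si orbT.
apply: nbW (nb_and H1 H2) => w [Ha Hs] i.
by rewrite inE => /orP[/eqP -> //|/Hs].
Qed.

Lemma nb_neq z a : z != a -> nb z (fun w => w != a).
Proof.
move=> za; exists (nrm (z - a)); first by rewrite nrm_gt0 subr_eq0.
by move=> w H; apply/eqP => E; move: H; rewrite E nrmC ltxx.
Qed.

Lemma nb_nb z P : nb z P -> nb z (fun w => nb w P).
Proof.
move=> [d d0 H]; exists d => // w wd.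
exists (d - nrm (w - z)); first by rewrite subr_gt0.
move=> v vw; apply: H; rewrite (_ : v - z = (v - w) + (w - z)); last by ring.
by apply: le_lt_trans (nrmD _ _) _; lra.
Qed.

Definition ccont f z := forall e, 0 < e -> nb z (fun w => nrm (f w - f z) <= e).

(** Free of quotients, so [w = z] needs no exclusion and the rules of calculus become plain
    estimates. *)
Definition cdiff f z c := forall e, 0 < e ->
  nb z (fun w => nrm (f w - f z - (w - z) * c) <= e * nrm (w - z)).

Lemma cdiff_lip f z c : cdiff f z c ->
  nb z (fun w => nrm (f w - f z) <= (nrm c + 1) * nrm (w - z)).
Proof.
move=> /(_ 1 ltr01); apply: nbW => w H.
rewrite (_ : f w - f z = (f w - f z - (w - z) * c) + (w - z) * c); last by ring.
apply: le_trans (nrmD _ _) _; rewrite nrmM; lra.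
Qed.

Lemma cdiff_cont f z c : cdiff f z c -> ccont f z.
Proof.
move=> /cdiff_lip H e e0.
have k0 : 0 < nrm c + 1 by have := nrm_ge0 c; lra.
apply: nbW (nb_and H (@nb_near z (e / (nrm c + 1)) _)); last exact: divr_gt0.
move=> w [H1 H2]; apply: le_trans H1 _.
by rewrite mulrC -ler_pdivlMr // ltW.
Qed.

Lemma ccont_bnd f z : ccont f z -> nb z (fun w => nrm (f w) <= nrm (f z) + 1).
Proof.
move=> /(_ 1 ltr01); apply: nbW => w.
by have := nrmB_ge (f w) (f z); lra.
Qed.

Lemma ccont_ge f z : f z != 0 -> ccont f z ->
  nb z (fun w => nrm (f z) / 2 <= nrm (f w)).
Proof.
rewrite -nrm_gt0 => fz H; have := H (nrm (f z) / 2) ltac:(lra).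
by apply: nbW => w; have := nrmB_ge (f z) (f w); rewrite nrmC; lra.
Qed.

Lemma cdiff_near f g z c : nb z (fun w => f w = g w) -> cdiff f z c -> cdiff g z c.
Proof.
move=> E H e e0; have Ez := nb_self E.
by apply: nbW (nb_and E (H e e0)) => w [<-]; rewrite Ez.
Qed.

Lemma cdiff_ext f g z c : f =1 g -> cdiff f z c -> cdiff g z c.
Proof. by move=> E; apply: cdiff_near; apply: nbT. Qed.

Lemma cdiff_eq f z c c' : c = c' -> cdiff f z c -> cdiff f z c'.
Proof. by move=> ->. Qed.

Lemma cdiff_uniq f z c c' : cdiff f z c -> cdiff f z c' -> c = c'.
Proof.
move=> H H'; apply/eqP; rewrite -subr_eq0; apply/eqP/nrm_le0 => e e0.
have [d d0 K] := nb_and (H (e / 2) ltac:(lra)) (H' (e / 2) ltac:(lra)).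
have [] := K (z + (d / 2)%:C).
  rewrite addrC addKr nrm_real gtr0_norm; lra.
have D : nrm (z + (d / 2)%:C - z) = d / 2.
  rewrite addrC addKr nrm_real gtr0_norm; lra.
rewrite D => K1 K2.
have : nrm ((z + (d / 2)%:C - z) * (c - c')) <= e * (d / 2).
  set w := z + _ in D K1 K2 *.
  rewrite (_ : (w - z) * (c - c') =
    (f w - f z - (w - z) * c') - (f w - f z - (w - z) * c)); last by ring.
  by apply: le_trans (nrmB _ _) _; lra.
by rewrite nrmM D mulrC ler_pM2r //; lra.
Qed.

Lemma cdiff_cst a z : cdiff (fun=> a) z 0.
Proof.
by move=> e e0; apply: nbT => w; rewrite subrr mulr0 subr0 nrm0 mulr_ge0 ?nrm_ge0 ?ltW.
Qed.

Lemma cdiff_id z : cdiff id z 1.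
Proof.
by move=> e e0; apply: nbT => w; rewrite mulr1 subrr nrm0 mulr_ge0 ?nrm_ge0 ?ltW.
Qed.

Lemma cdiffD f g z c c' : cdiff f z c -> cdiff g z c' ->
  cdiff (fun w => f w + g w) z (c + c').
Proof.
move=> H H' e e0.
apply: nbW (nb_and (H (e / 2) ltac:(lra)) (H' (e / 2) ltac:(lra))) => w [K K'].
rewrite (_ : _ - _ - _ = (f w - f z - (w - z) * c) + (g w - g z - (w - z) * c')); last by ring.
by apply: le_trans (nrmD _ _) _; lra.
Qed.

Lemma cdiffM f g z c c' : cdiff f z c -> cdiff g z c' ->
  cdiff (fun w => f w * g w) z (c * g z + f z * c').
Proof.
move=> H H' e e0.
set B := nrm (g z) + 1; set A := nrm (f z) + 1; set E := nrm c + 1.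
have B0 : 0 < B by rewrite /B; have := nrm_ge0 (g z); lra.
have A0 : 0 < A by rewrite /A; have := nrm_ge0 (f z); lra.
have E0 : 0 < E by rewrite /E; have := nrm_ge0 c; lra.
have b := ccont_bnd (cdiff_cont H').
have K1 := H (e / 3 / B) ltac:(by rewrite !divr_gt0).
have K2 := H' (e / 3 / A) ltac:(by rewrite !divr_gt0).
have K3 := cdiff_cont H' (e := e / 3 / E) ltac:(by rewrite !divr_gt0).
apply: nbW (nb_and b (nb_and K1 (nb_and K2 K3))) => w [h0 [h1 [h2 h3]]].
rewrite (_ : _ - _ - _ = (f w - f z - (w - z) * c) * g w +
   (f z * (g w - g z - (w - z) * c') + (w - z) * c * (g w - g z))); last by ring.
have n0 := nrm_ge0 (w - z).
have T1 : nrm ((f w - f z - (w - z) * c) * g w) <= e / 3 * nrm (w - z).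
  rewrite nrmM; apply: le_trans (ler_pM (nrm_ge0 _) (nrm_ge0 _) h1 h0) _.
  by rewrite -/B mulrAC divfK // gt_eqF.
have T2 : nrm (f z * (g w - g z - (w - z) * c')) <= e / 3 * nrm (w - z).
  rewrite nrmM; have h4 : nrm (f z) <= A by rewrite /A; lra.
  apply: le_trans (ler_pM (nrm_ge0 _) (nrm_ge0 _) h4 h2) _.
  by rewrite mulrA (mulrC A) divfK // gt_eqF.
have T3 : nrm ((w - z) * c * (g w - g z)) <= e / 3 * nrm (w - z).
  rewrite !nrmM; have h4 : nrm c <= E by rewrite /E; lra.
  rewrite -mulrA mulrC ler_wpM2r //.
  apply: le_trans (ler_pM (nrm_ge0 _) (nrm_ge0 _) h4 h3) _.
  by rewrite (mulrC E) divfK // gt_eqF.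
have T4 := nrmD (f z * (g w - g z - (w - z) * c')) ((w - z) * c * (g w - g z)).
apply: le_trans (nrmD _ _) _; lra.
Qed.

Lemma cdiffZ a f z c : cdiff f z c -> cdiff (fun w => a * f w) z (a * c).
Proof.
move=> H; apply: cdiff_eq (cdiffM (cdiff_cst a z) H); by rewrite mul0r add0r.
Qed.

Lemma cdiffN f z c : cdiff f z c -> cdiff (fun w => - f w) z (- c).
Proof.
move=> /(cdiffZ (-1)); rewrite mulN1r; apply: cdiff_ext => w; by rewrite mulN1r.
Qed.

Lemma cdiffB f g z c c' : cdiff f z c -> cdiff g z c' ->
  cdiff (fun w => f w - g w) z (c - c').
Proof. by move=> H /cdiffN; apply: cdiffD. Qed.

Lemma cdiff_sum (I : eqType) (r : seq I) (f : I -> R[i] -> R[i]) z (c : I -> R[i]) :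
  (forall i, i \in r -> cdiff (f i) z (c i)) ->
  cdiff (fun w => \sum_(i <- r) f i w) z (\sum_(i <- r) c i).
Proof.
elim: r => [|a r IH] H.
  rewrite big_nil; apply: cdiff_ext (cdiff_cst 0 z) => w; by rewrite big_nil.
rewrite big_cons; apply: (@cdiff_ext (fun w => f a w + \sum_(i <- r) f i w)).
  by move=> w; rewrite big_cons.
apply: cdiffD; first by apply: H; rewrite mem_head.
by apply: IH => i ri; apply: H; rewrite inE ri orbT.
Qed.

Lemma cdiff_comp f g z c c' : cdiff f z c -> cdiff g (f z) c' ->
  cdiff (fun w => g (f w)) z (c' * c).
Proof.
move=> H H' e e0.
set A := nrm c' + 1; set E := nrm c + 1.
have A0 : 0 < A by rewrite /A; have := nrm_ge0 c'; lra.
have E0 : 0 < E by rewrite /E; have := nrm_ge0 c; lra.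
have [d d0 K1] := H' (e / 2 / E) ltac:(by rewrite !divr_gt0).
have K2 := H (e / 2 / A) ltac:(by rewrite !divr_gt0).
have K3 := cdiff_lip H.
have K4 := cdiff_cont H (e := d / 2) ltac:(by rewrite divr_gt0).
apply: nbW (nb_and K2 (nb_and K3 K4)) => w [h1 [h2 h3]].
have n0 := nrm_ge0 (w - z).
rewrite (_ : _ - _ - _ = (g (f w) - g (f z) - (f w - f z) * c') +
   c' * (f w - f z - (w - z) * c)); last by ring.
have T1 : nrm (g (f w) - g (f z) - (f w - f z) * c') <= e / 2 * nrm (w - z).
  apply: le_trans (K1 _ _) _; first by apply: le_lt_trans h3 _; lra.
  apply: le_trans (ler_wpM2l _ h2) _; first by rewrite ltW // !divr_gt0.
  by rewrite -/E mulrA divfK // gt_eqF.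
have T2 : nrm (c' * (f w - f z - (w - z) * c)) <= e / 2 * nrm (w - z).
  rewrite nrmM; have h4 : nrm c' <= A by rewrite /A; lra.
  apply: le_trans (ler_pM (nrm_ge0 _) (nrm_ge0 _) h4 h1) _.
  by rewrite mulrA (mulrC A) divfK // gt_eqF.
by apply: le_trans (nrmD _ _) _; lra.
Qed.

Lemma cdiff_inv z : z != 0 -> cdiff (fun w => w^-1) z (- (z ^+ 2)^-1).
Proof.
move=> z0 e e0; have nz : 0 < nrm z by rewrite nrm_gt0.
have K1 := ccont_ge z0 (cdiff_cont (@cdiff_id z)).
have K2 := @nb_near z (e * nrm z ^+ 3 / 2) ltac:(by rewrite divr_gt0 ?mulr_gt0 ?exprn_gt0).
apply: nbW (nb_and K1 K2) => w [/= h1 h2].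
have nw : 0 < nrm w by lra.
have w0 : w != 0 by rewrite -nrm_gt0.
rewrite (_ : _ - _ - _ = (w - z) ^+ 2 / (w * z ^+ 2)); last by field; rewrite w0 z0.
rewrite nrmM nrmV nrmM !nrmX expr2 -mulrA mulrC ler_wpM2r ?nrm_ge0 //.
rewrite ler_pdivrMr ?mulr_gt0 ?exprn_gt0 //.
apply: le_trans (ltW h2) _; rewrite -mulrA ler_pM2l //.
rewrite exprS mulrAC ler_wpM2r ?exprn_ge0 ?nrm_ge0 //; lra.
Qed.

Lemma cdiffV f z c : f z != 0 -> cdiff f z c ->
  cdiff (fun w => (f w)^-1) z (- c / f z ^+ 2).
Proof.
move=> fz H; apply: cdiff_eq (cdiff_comp H (cdiff_inv fz)).
by rewrite mulrC mulrN mulNr.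
Qed.

Lemma cdiffX f z c n : cdiff f z c ->
  cdiff (fun w => f w ^+ n) z (n%:R * f z ^+ n.-1 * c).
Proof.
move=> H; elim: n => [|n IH].
  by rewrite mul0r mul0r; apply: cdiff_ext (cdiff_cst 1 z) => w; rewrite expr0.
apply: (@cdiff_ext (fun w => f w * f w ^+ n)) => [w|]; first by rewrite exprS.
apply: cdiff_eq (cdiffM H IH); rewrite -natr1 /=.
by case: n {IH} => [|n] /=; rewrite ?expr0 ?exprS; ring.
Qed.

Lemma cdiff_shift a f z c : cdiff f (z + a) c -> cdiff (fun w => f (w + a)) z c.
Proof.
move=> H; apply: cdiff_eq (cdiff_comp (cdiffD (cdiff_id z) (cdiff_cst a z)) H).
by rewrite addr0 mulr1.
Qed.

Lemma cdiff_lin a f z c : cdiff f (a * z) c -> cdiff (fun w => f (a * w)) z (a * c).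
Proof.
move=> H; apply: cdiff_eq (cdiff_comp (cdiffZ a (cdiff_id z)) H).
by rewrite mulr1 mulrC.
Qed.

(** The link with the derivative used in [holomorphic_on]; all complex analysis below is done with
    [cdiff]. *)
Lemma derivable_cdiff f z :
  derivable (f : R[i]^o -> R[i]^o) z 1 <-> exists c, cdiff f z c.
Proof.
split=> [/cvg_ex[/= l fl]|[c fc]]; [exists l|apply/cvg_ex; exists c].
- move=> e e0; have e0' : 0 < e%:C by rewrite ltcR.
  move/cvgrPdist_lt/(_ _ e0'): fl.
  rewrite near_withinE => /nbhs_ballP[d /= d0 H].
  have dR : d = (complex.Re d)%:C.
    by case: d d0 {H} => a b; rewrite ltcE /= => /andP[/eqP-> _].
  move: d0 H; rewrite dR ltcR => d0 H; exists (complex.Re d) => // w wd.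
  case: (eqVneq w z) => [->|wz].
    by rewrite !subrr mul0r subr0 nrm0 mulr0.
  have wz0 : w - z != 0 by rewrite subr_eq0.
  have := H (w - z); rewrite /ball /= sub0r normrN normE ltcR => /(_ wd wz0).
  rewrite /GRing.scale /= mulr1 subrK normE ltcR => K.
  rewrite (_ : _ - _ - _ = - ((w - z) * (l - (w - z)^-1 * (f w - f z)))); last first.
    by rewrite mulrBr mulrA divff // mul1r; ring.
  by rewrite nrmN nrmM mulrC ler_wpM2r ?nrm_ge0 // ltW.
- apply/cvgrPdist_lt => e e0.
  have eR : e = (complex.Re e)%:C.
    by case: e e0 => a b; rewrite ltcE /= => /andP[/eqP-> _].
  move: e0; rewrite eR ltcR => e0.
  have [d d0 H] := fc (complex.Re e / 2) ltac:(lra).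
  rewrite near_withinE; apply/nbhs_ballP; exists d%:C; first by rewrite /= ltcR.
  move=> h; rewrite /ball /= sub0r normrN normE ltcR => hd h0.
  have := H (h + z); rewrite addrK => /(_ hd) K.
  rewrite /GRing.scale /= mulr1 normE ltcR.
  have nh : 0 < nrm h by rewrite nrm_gt0.
  rewrite (_ : c - _ = - (h^-1 * (f (h + z) - f z - h * c))); last by field.
  rewrite nrmN nrmM nrmV mulrC ltr_pdivrMr //.
  by apply: le_lt_trans K _; rewrite ltr_pM2r //; lra.
Qed.

End Differentiability.

(** * Absolutely summable families: reindexing, Fubini, dominated convergence *)

Section UnorderedSums.
Variable R : realType.
Implicit Types (e M : R) (v w : R[i]).

Lemma sum_uniq_sub (V : zmodType) (I : eqType) (s0 s : seq I) (F : I -> V) :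
  uniq s0 -> uniq s -> {subset s0 <= s} ->
  \sum_(i <- s) F i = \sum_(i <- s0) F i + \sum_(i <- s | i \notin s0) F i.
Proof.
move=> u0 us sub; rewrite (bigID (mem s0)) /=; congr (_ + _).
rewrite -big_filter; apply: perm_big; apply: uniq_perm => //.
  exact: filter_uniq.
by move=> i; rewrite mem_filter; case: (boolP (i \in s0)) => //= /sub.
Qed.

Lemma ler_sum_uniq_sub (I : eqType) (s0 s : seq I) (F : I -> R) :
  (forall i, 0 <= F i) -> uniq s0 -> uniq s -> {subset s0 <= s} ->
  \sum_(i <- s0) F i <= \sum_(i <- s) F i.
Proof.
by move=> F0 u0 us sub; rewrite (sum_uniq_sub _ u0 us sub) lerDl sumr_ge0.
Qed.

Lemma sum_cst_seq (I : Type) (s : seq I) (c : R) :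
  \sum_(i <- s) c = (size s)%:R * c.
Proof. by rewrite big_const_seq count_predT iter_addr_0 mulr_natl. Qed.

Section OneIndex.
Variable I : choiceType.
Implicit Types (f g : I -> R[i]) (s : seq I).

(** Finite index sets are duplicate-free lists. [absm] is absolute summability, as a uniform bound
    on finite sums of norms; [hs] is convergence along finite sets, identified with [has_sum] in
    [has_sumE]. *)
Definition absb f M := forall s, uniq s -> \sum_(i <- s) nrm (f i) <= M.
Definition absm f := exists M, absb f M.
Definition hs f v := forall e, 0 < e -> exists s0 : seq I,
  forall s, uniq s -> {subset s0 <= s} -> nrm (\sum_(i <- s) f i - v) <= e.
Definition csum f : R[i] := xget 0 (hs f).

Lemma absb_le f g M : (forall i, nrm (f i) <= nrm (g i)) -> absb g M -> absb f M.
Proof. by move=> fg H s us; apply: le_trans (H s us); apply: ler_sum. Qed.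

Lemma absm_le f g : (forall i, nrm (f i) <= nrm (g i)) -> absm g -> absm f.
Proof. by move=> fg [M H]; exists M; apply: absb_le H. Qed.

Lemma absm_ext f g : f =1 g -> absm f -> absm g.
Proof. by move=> E; apply: absm_le => i; rewrite E. Qed.

(** A list that almost attains the supremum of the finite norm sums leaves at most [e] to any list
    disjoint from it. *)
Lemma absm_tail f : absm f -> forall e, 0 < e -> exists s0 : seq I,
  forall s, uniq s -> (forall i, i \in s -> i \notin s0) ->
  \sum_(i <- s) nrm (f i) <= e.
Proof.
move=> [M HM] e e0.
pose S : set R := [set x | exists2 s, uniq s & x = \sum_(i <- s) nrm (f i)].
have S0 : S !=set0 by exists 0, [::] => //; rewrite big_nil.
have Sb : has_ubound S by exists M => x [s us ->]; apply: HM.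
have [x [s0 u0 ->] H] := sup_adherent e0 (conj S0 Sb).
exists s0 => s us dis.
have u2 : uniq (s0 ++ s).
  rewrite cat_uniq u0 us andbT; apply/hasPn => i /dis /=.
  by [].
have := ub_le_sup Sb (x := \sum_(i <- s0 ++ s) nrm (f i)) ltac:(by exists (s0 ++ s)).
rewrite big_cat /= => K; lra.
Qed.

Lemma hs_uniq f v w : hs f v -> hs f w -> v = w.
Proof.
move=> Hv Hw; apply/eqP; rewrite -subr_eq0; apply/eqP/nrm_le0 => e e0.
have [s0 H0] := Hv (e / 2) ltac:(lra); have [s1 H1] := Hw (e / 2) ltac:(lra).
have us : uniq (undup (s0 ++ s1)) by exact: undup_uniq.
have K0 := H0 _ us ltac:(by move=> i; rewrite mem_undup mem_cat => ->).
have K1 := H1 _ us ltac:(by move=> i; rewrite mem_undup mem_cat orbC => ->).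
set a := \sum_(i <- _) _ in K0 K1.
rewrite (_ : v - w = (a - w) - (a - v)); last by ring.
by apply: le_trans (nrmB _ _) _; lra.
Qed.

Lemma csum_eq f v : hs f v -> csum f = v.
Proof. by move=> H; apply: xget_unique => // y /hs_uniq; apply. Qed.

Lemma hs_ext f g v : f =1 g -> hs f v -> hs g v.
Proof. by move=> /funext ->. Qed.

Lemma csum_ext f g : f =1 g -> csum f = csum g.
Proof. by move=> /funext ->. Qed.

Lemma hsD f g v w : hs f v -> hs g w -> hs (fun i => f i + g i) (v + w).
Proof.
move=> Hf Hg e e0; have [s0 H0] := Hf (e / 2) ltac:(lra).
have [s1 H1] := Hg (e / 2) ltac:(lra).
exists (s0 ++ s1) => s us sub.
have K0 := H0 s us ltac:(by move=> i si; apply: sub; rewrite mem_cat si).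
have K1 := H1 s us ltac:(by move=> i si; apply: sub; rewrite mem_cat si orbT).
rewrite big_split /= opprD addrACA; apply: le_trans (nrmD _ _) _; lra.
Qed.

Lemma hsZ a f v : hs f v -> hs (fun i => a * f i) (a * v).
Proof.
move=> Hf e e0; have n0 := nrm_ge0 a.
have [s0 H0] := Hf (e / (nrm a + 1)) ltac:(by rewrite divr_gt0 //; lra).
exists s0 => s us /H0 - /(_ us) K.
rewrite -mulr_sumr -mulrBr nrmM.
have : nrm a * nrm (\sum_(i <- s) f i - v) <= nrm a * (e / (nrm a + 1)) by rewrite ler_wpM2l.
have : nrm a * (e / (nrm a + 1)) <= e.
  by rewrite mulrCA ger_pMr // ler_pdivrMr; lra.
lra.
Qed.

Lemma hsN f v : hs f v -> hs (fun i => - f i) (- v).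
Proof.
by move=> /(hsZ (-1)); rewrite mulN1r; apply: hs_ext => i; rewrite mulN1r.
Qed.

Lemma hsB f g v w : hs f v -> hs g w -> hs (fun i => f i - g i) (v - w).
Proof. by move=> H /hsN; apply: hsD. Qed.

Lemma hs0 : hs (fun=> 0) 0.
Proof. by move=> e e0; exists [::] => s _ _; rewrite big1 // subrr nrm0 ltW. Qed.

Lemma hs_sum (J : Type) (r : seq J) (f : J -> I -> R[i]) (v : J -> R[i]) :
  (forall j, hs (f j) (v j)) -> hs (fun i => \sum_(j <- r) f j i) (\sum_(j <- r) v j).
Proof.
move=> H; elim: r => [|j r IH].
  by rewrite big_nil; apply: hs_ext hs0 => i; rewrite big_nil.
rewrite big_cons; apply: hs_ext (hsD (H j) IH) => i; by rewrite big_cons.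
Qed.

Lemma hs_fin f s0 : uniq s0 -> (forall i, i \notin s0 -> f i = 0) ->
  hs f (\sum_(i <- s0) f i).
Proof.
move=> u0 f0 e e0; exists s0 => s us sub.
by rewrite (sum_uniq_sub _ u0 us sub) addrAC subrr add0r big1 ?nrm0 ?ltW.
Qed.

Lemma hs_ge0 (g : I -> R) M : (forall i, 0 <= g i) ->
  absb (fun i => (g i)%:C) M -> exists v : R, hs (fun i => (g i)%:C) v%:C.
Proof.
move=> g0 HM.
pose S : set R := [set x | exists2 s, uniq s & x = \sum_(i <- s) g i].
have S0 : S !=set0 by exists 0, [::] => //; rewrite big_nil.
have Sb : has_ubound S.
  exists M => x [s us ->]; apply: le_trans (HM s us); apply: ler_sum => i _.
  by rewrite nrm_real ger0_norm.
exists (sup S) => e e0.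
have [x [s0 u0 ->] H] := sup_adherent e0 (conj S0 Sb).
exists s0 => s us sub.
have K := ub_le_sup Sb (x := \sum_(i <- s) g i) ltac:(by exists s).
have K2 := ler_sum_uniq_sub g0 u0 us sub.
rewrite -rmorph_sum -rmorphB nrm_real ler_norml; apply/andP; split; lra.
Qed.

Lemma absmD f g : absm f -> absm g -> absm (fun i => f i + g i).
Proof.
move=> [M H] [N K]; exists (M + N) => s us; apply: le_trans (lerD (H s us) (K s us)).
by rewrite -big_split /=; apply: ler_sum => i _; apply: nrmD.
Qed.

Lemma absmZ a f : absm f -> absm (fun i => a * f i).
Proof.
move=> [M H]; exists (nrm a * M) => s us; apply: le_trans (ler_wpM2l (nrm_ge0 a) (H s us)).
by rewrite mulr_sumr; apply: ler_sum => i _; rewrite nrmM.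
Qed.

Lemma absmN f : absm f -> absm (fun i => - f i).
Proof. by apply: absm_le => i; rewrite nrmN. Qed.

Lemma absmB f g : absm f -> absm g -> absm (fun i => f i - g i).
Proof. by move=> H /absmN; apply: absmD. Qed.

Lemma absm_fin f (s0 : seq I) : (forall i, i \notin s0 -> f i = 0) -> absm f.
Proof.
move=> f0; exists (\sum_(i <- undup s0) nrm (f i)) => s us.
rewrite (bigID (mem s0)) /= [X in _ + X]big1 ?addr0; last first.
  by move=> i /f0 ->; rewrite nrm0.
rewrite -big_filter; apply: ler_sum_uniq_sub; rewrite ?undup_uniq ?filter_uniq //.
  by move=> i; exact: nrm_ge0.
by move=> i; rewrite mem_filter mem_undup => /andP[].
Qed.

(** The positive and negative parts of the real and imaginary parts are nonnegative families with
    bounded finite sums, and each such family sums to its supremum. *)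
Lemma absm_hs f : absm f -> exists v, hs f v.
Proof.
move=> [M HM].
pose p x : R := (`|x| + x) / 2; pose n x : R := (`|x| - x) / 2.
have pn x : x = p x - n x by rewrite /p /n; lra.
have p0 x : 0 <= p x by have := ler_norm (- x); rewrite normrN /p; lra.
have n0 x : 0 <= n x by have := ler_norm x; rewrite /n; lra.
have pl x : p x <= `|x| by have := ler_norm x; rewrite /p; lra.
have nl x : n x <= `|x| by have := ler_norm (- x); rewrite normrN /n; lra.
have K (q : R -> R) (h : R[i] -> R) : (forall x, 0 <= q x) -> (forall x, q x <= `|x|) ->
    (forall z, `|h z| <= nrm z) -> exists v : R, hs (fun i => (q (h (f i)))%:C) v%:C.
  move=> q0 ql hl; apply: (@hs_ge0 _ M) => // s us; apply: le_trans (HM s us).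
  apply: ler_sum => i _; rewrite nrm_real ger0_norm //; exact: le_trans (ql _) (hl _).
have [v1 h1] := K p _ p0 pl (@Re_le_nrm R); have [v2 h2] := K n _ n0 nl (@Re_le_nrm R).
have [v3 h3] := K p _ p0 pl (@Im_le_nrm R); have [v4 h4] := K n _ n0 nl (@Im_le_nrm R).
exists ((v1%:C - v2%:C) + 'i * (v3%:C - v4%:C)).
apply: hs_ext (hsD (hsB h1 h2) (hsZ 'i (hsB h3 h4))) => i.
by rewrite -!rmorphB -!pn -complex_ReIm.
Qed.

Lemma csumP f : absm f -> hs f (csum f).
Proof. by move=> /absm_hs[v H]; rewrite (csum_eq H). Qed.

Lemma csumD f g : absm f -> absm g -> csum (fun i => f i + g i) = csum f + csum g.
Proof. by move=> /csumP H /csumP K; apply: csum_eq; apply: hsD. Qed.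

Lemma csumB f g : absm f -> absm g -> csum (fun i => f i - g i) = csum f - csum g.
Proof. by move=> /csumP H /csumP K; apply: csum_eq; apply: hsB. Qed.

Lemma csumZ a f : absm f -> csum (fun i => a * f i) = a * csum f.
Proof. by move=> /csumP H; apply: csum_eq; apply: hsZ. Qed.

Lemma csumN f : absm f -> csum (fun i => - f i) = - csum f.
Proof. by move=> /csumP H; apply: csum_eq; apply: hsN. Qed.

Lemma hs_nrm_le f v M : absb f M -> hs f v -> nrm v <= M.
Proof.
move=> HM H; apply/ler_addgt0Pr => e e0; have [s0 K] := H e e0.
have us : uniq (undup s0) by exact: undup_uniq.
have := K _ us ltac:(by move=> i; rewrite mem_undup).
have := HM _ us; set a := \sum_(i <- _) f i.
have := nrm_sum (undup s0) xpredT f; rewrite -/a.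
have := nrmB_ge v a; rewrite nrmC; lra.
Qed.

Lemma csum_nrm_le f M : absb f M -> nrm (csum f) <= M.
Proof. by move=> H; apply: (hs_nrm_le H); apply: csumP; exists M. Qed.

Definition restr (P : pred I) f i := if P i then f i else 0.

Lemma absb_restr P f M : absb f M -> absb (restr P f) M.
Proof. by apply: absb_le => i; rewrite /restr; case: ifP; rewrite ?nrm0 ?nrm_ge0. Qed.

Lemma absm_restr P f : absm f -> absm (restr P f).
Proof. by move=> [M H]; exists M; apply: absb_restr. Qed.

Lemma csum_split (s0 : seq I) f : absm f -> uniq s0 ->
  csum f = \sum_(i <- s0) f i + csum (restr (fun i => i \notin s0) f).
Proof.
move=> H u0; have K : hs (restr (mem s0) f) (\sum_(i <- s0) f i).
  have := @hs_fin (restr (mem s0) f) s0 u0.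
  rewrite (eq_big_seq f) => [|i si]; last by rewrite /restr /= si.
  by apply=> i si; rewrite /restr /= (negbTE si).
have K2 := csumP (absm_restr (fun i => i \notin s0) H).
apply: csum_eq; apply: hs_ext (hsD K K2) => i; rewrite /restr /=.
by case: (i \in s0); rewrite ?addr0 ?add0r.
Qed.

Lemma csum_fin f s0 : uniq s0 -> (forall i, i \notin s0 -> f i = 0) ->
  csum f = \sum_(i <- s0) f i.
Proof. by move=> u0 /(hs_fin u0); exact: csum_eq. Qed.

Lemma tail_bound f : absm f -> forall e, 0 < e -> exists s0 : seq I,
  uniq s0 /\ forall g, (forall i, nrm (g i) <= nrm (f i)) ->
    (forall i, i \in s0 -> g i = 0) -> absb g e.
Proof.
move=> /absm_tail H e e0; have [s0 K] := H e e0; exists (undup s0).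
split=> [|g gf g0 s us]; first exact: undup_uniq.
rewrite (bigID (mem s0)) /= big1 ?add0r => [|i si]; last by rewrite g0 ?nrm0 ?mem_undup.
rewrite -big_filter; set t := [seq i <- s | i \notin s0].
have ut : uniq t by rewrite filter_uniq.
have dt : forall i, i \in t -> i \notin s0 by move=> i; rewrite mem_filter => /andP[].
by apply: le_trans (K t ut dt); apply: ler_sum.
Qed.

(** Dominated convergence: up to [e / 4] each, both sums live on one finite list, where convergence
    is uniform. It serves the averaging argument in [eps_eq0]. *)
Lemma csum_dominated (F : nat -> I -> R[i]) (G : I -> R[i]) f :
  absm f -> (forall n i, nrm (F n i) <= nrm (f i)) ->
  (forall i e, 0 < e -> exists N, forall n, (N <= n)%N -> nrm (F n i - G i) <= e) ->
  forall e, 0 < e -> exists N, forall n, (N <= n)%N -> nrm (csum (F n) - csum G) <= e.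
Proof.
move=> Hf Ff FG e e0.
have Gf i : nrm (G i) <= nrm (f i).
  apply/ler_addgt0Pr => d d0; have [N /(_ N (leqnn _))] := FG i d d0.
  by have := Ff N i; have := nrmB_ge (G i) (F N i); rewrite nrmC; lra.
have [s0 [u0 K]] := tail_bound Hf (e := e / 4) ltac:(lra).
have aF n : absm (F n) by apply: absm_le Hf.
have aG : absm G by apply: absm_le Hf.
have [N HN] : exists N, forall n, (N <= n)%N ->
    \sum_(i <- s0) nrm (F n i - G i) <= e / 2.
  have e2 : 0 < e / 2 by lra.
  elim: (s0) (e / 2) e2 => [|i s IH] d d0.
    by exists 0%N => n _; rewrite big_nil ltW.
  have [N1 H1] := FG i (d / 2) ltac:(lra); have [N2 H2] := IH (d / 2) ltac:(lra).
  exists (maxn N1 N2) => n; rewrite geq_max => /andP[/H1 k1 /H2 k2].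
  by rewrite big_cons; lra.
exists N => n /HN Hn.
rewrite (csum_split (aF n) u0) (csum_split aG u0) opprD addrACA -sumrB.
have k1 : nrm (csum (restr (fun i => i \notin s0) (F n))) <= e / 4.
  apply: csum_nrm_le; apply: K => i; rewrite /restr; first by case: ifP; rewrite ?nrm0 ?nrm_ge0.
  by move=> ->.
have k2 : nrm (csum (restr (fun i => i \notin s0) G)) <= e / 4.
  apply: csum_nrm_le; apply: K => i; rewrite /restr; first by case: ifP; rewrite ?nrm0 ?nrm_ge0.
  by move=> ->.
have k3 := nrm_sum s0 xpredT (fun i => F n i - G i).
set A := \sum_(i <- s0) _ in k3 *; set B := csum _ in k1 *; set D := csum _ in k2 *.
apply: le_trans (nrmD _ _) _; have := nrmB B D; lra.
Qed.

End OneIndex.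

Section Reindex.
Variables I J : choiceType.
Implicit Types (f : I -> R[i]) (h : J -> I).

Lemma partial_inverse h : exists g : I -> option J, forall i,
  match g i with Some j => h j = i | None => forall j, i <> h j end.
Proof.
pose P i (o : option J) :=
  match o with Some j => h j = i | None => forall j, i <> h j end.
have [g gP] : {g & forall i, P i (g i)}; last by exists g.
apply: boolp.choice => i; case: (pselect (exists j, h j = i)) => [[j E]|N].
  by exists (Some j).
by exists None => j E; apply: N; exists j.
Qed.

Lemma absb_inj f M h : injective h -> absb f M -> absb (f \o h) M.
Proof.
move=> ei H s us; rewrite -(big_map h xpredT (fun i => nrm (f i))).
by apply: H; rewrite map_inj_uniq.
Qed.

Lemma absm_inj f h : injective h -> absm f -> absm (f \o h).
Proof. by move=> ei [M H]; exists M; apply: absb_inj. Qed.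

Lemma hs_reindex f v h : injective h -> (forall i, (forall j, i <> h j) -> f i = 0) ->
  hs (f \o h) v <-> hs f v.
Proof.
move=> ei f0.
have [g gP] := partial_inverse h.
have gK : pcancel h g.
  by move=> j; have := gP (h j); case: (g (h j)) => [j' /ei ->//|/(_ j)].
have S s : uniq s -> \sum_(i <- s) f i = \sum_(j <- pmap g s) (f \o h) j.
  move=> _; elim: s => [|i s IH]; first by rewrite !big_nil.
  rewrite big_cons /= IH; have := gP i; case: (g i) => [j E|/f0 ->] /=.
    by rewrite big_cons /= E.
  by rewrite add0r.
have U s : uniq s -> uniq (pmap g s).
  elim: s => //= i s IH /andP[si /IH us]; have := gP i; case: (g i) => [j E|] //=.
  rewrite us andbT; apply/negP; rewrite mem_pmap => /mapP[i' si' E'].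
  by have := gP i'; rewrite -E' E => E2; move: si; rewrite E2 si'.
split=> H d d0; have [s0 H0] := H d d0.
- exists (map h s0) => s us sub; rewrite S //; apply: H0; first exact: U.
  move=> j sj; rewrite mem_pmap; apply/mapP; exists (h j); last by rewrite gK.
  by apply: sub; apply: map_f.
- exists (pmap g s0) => s us sub.
  have us' : uniq (undup (map h s ++ s0)) by exact: undup_uniq.
  have := H0 _ us' ltac:(by move=> i; rewrite mem_undup mem_cat orbC => ->).
  rewrite S //; have -> : \sum_(j <- pmap g (undup (map h s ++ s0))) (f \o h) j =
     \sum_(j <- s) (f \o h) j; last by [].
  apply: perm_big; apply: uniq_perm => //; first exact: U.
  move=> j; rewrite mem_pmap; apply/mapP/idP => [[i0]|sj]; last first.
    by exists (h j); rewrite ?gK // mem_undup mem_cat map_f.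
  rewrite mem_undup mem_cat => /orP[/mapP[j' sj' ->]|si E].
    by rewrite gK => -[] ->.
  by apply: sub; rewrite mem_pmap; apply/mapP; exists i0.
Qed.

Lemma csum_reindex f h : injective h -> (forall i, (forall j, i <> h j) -> f i = 0) ->
  csum (f \o h) = csum f.
Proof.
move=> ei f0; rewrite /csum; congr xget; apply/funext => v.
by apply/propext/hs_reindex.
Qed.

Lemma absm_reindex f h : injective h -> (forall i, (forall j, i <> h j) -> f i = 0) ->
  absm (f \o h) -> absm f.
Proof.
move=> ei f0 [M H]; exists M => s us.
have [g gP] := partial_inverse h.
have U : uniq (pmap g s).
  elim: s us => //= i s IH /andP[si /IH us]; have := gP i; case: (g i) => [j E|] //=.
  rewrite us andbT; apply/negP; rewrite mem_pmap => /mapP[i' si' E'].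
  by have := gP i'; rewrite -E' E => E2; move: si; rewrite E2 si'.
apply: le_trans (H _ U); rewrite le_eqVlt; apply/orP; left; apply/eqP.
elim: {us U} s => [|i s IH]; first by rewrite !big_nil.
rewrite big_cons /= IH; have := gP i; case: (g i) => [j E|/f0 ->] /=.
  by rewrite big_cons /= E.
  by rewrite nrm0 add0r.
Qed.

Lemma csum_bij f h (h' : I -> J) : cancel h h' -> cancel h' h -> csum (f \o h) = csum f.
Proof.
move=> K K'; apply: csum_reindex; first exact: can_inj K.
by move=> i /(_ (h' i)); rewrite K'.
Qed.

End Reindex.

Section Fubini.
Variables I J : choiceType.
Implicit Types f : I * J -> R[i].

Lemma sum_pairs (V : zmodType) (F : I * J -> V) (s : seq I) (t : seq J) :
  \sum_(p <- [seq (i, j) | i <- s, j <- t]) F p =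
  \sum_(i <- s) \sum_(j <- t) F (i, j).
Proof. by rewrite big_allpairs. Qed.

Lemma absm_row f i : absm f -> absm (fun j => f (i, j)).
Proof. by apply: (@absm_inj _ _ f (fun j => (i, j))) => j j' [->]. Qed.

Lemma row_approx (f : I * J -> R[i]) (s : seq I) e : absm f -> 0 < e ->
  exists t0 : seq J, forall t, uniq t -> {subset t0 <= t} -> forall i, i \in s ->
    nrm (\sum_(j <- t) f (i, j) - csum (fun j => f (i, j))) <= e.
Proof.
move=> af e0; elim: s => [|i s [t0 H]]; first by exists [::].
have [t1 H1] := csumP (absm_row i af) e0.
exists (t0 ++ t1) => t ut sub k; rewrite inE => /orP[/eqP ->|ks].
  by apply: H1 => // j tj; apply: sub; rewrite mem_cat tj orbT.
by apply: H => // j tj; apply: sub; rewrite mem_cat tj.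
Qed.

Lemma uniq_pairs (s : seq I) (t : seq J) : uniq s -> uniq t ->
  uniq [seq (i, j) | i <- s, j <- t].
Proof. by move=> us ut; apply: allpairs_uniq => // -[a b] [c d] _ _ /= ->. Qed.

Lemma absm_rows f : absm f -> absm (fun i => csum (fun j => f (i, j))).
Proof.
move=> af; have [M HM] := af; exists (M + 1) => s us.
have d0 : 0 < ((size s)%:R + 1)^-1 :> R by rewrite invr_gt0 ltr_wpDl.
have [t0 H] := row_approx s af d0.
pose t := undup t0; have ut : uniq t by exact: undup_uniq.
have sub : {subset t0 <= t} by move=> j; rewrite mem_undup.
have K := HM _ (uniq_pairs us ut).
rewrite (sum_pairs (fun p => nrm (f p))) in K.
have L : \sum_(i <- s) nrm (csum (fun j => f (i, j))) <=
   \sum_(i <- s) (\sum_(j <- t) nrm (f (i, j)) + ((size s)%:R + 1)^-1).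
  rewrite big_seq [leRHS]big_seq; apply: ler_sum => i si.
  have := H t ut sub i si; have := nrm_sum t xpredT (fun j => f (i, j)).
  set a := \sum_(j <- t) f _; set b := csum _.
  by have := nrmB_ge b a; rewrite nrmC; lra.
apply: le_trans L _; rewrite big_split /= lerD // sum_cst_seq.
by rewrite ler_pdivrMr ?mul1r ?lerDl // ltr_wpDl.
Qed.

(** A finite rectangle containing the rows under consideration approximates the double sum and, by
    [row_approx], all the row sums at once. *)
Lemma csum_fubini f : absm f -> csum f = csum (fun i => csum (fun j => f (i, j))).
Proof.
move=> af; symmetry; apply: csum_eq => e e0.
have [p0 Hp] := csumP af (e := e / 2) ltac:(lra).
exists (map fst p0) => s us sub.
have d0 : 0 < e / 2 / ((size s)%:R + 1) :> R by rewrite !divr_gt0 // ltr_wpDl.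
have [t0 H] := row_approx s af d0.
pose t := undup (t0 ++ map snd p0); have ut : uniq t by exact: undup_uniq.
have sub1 : {subset t0 <= t} by move=> j; rewrite mem_undup mem_cat => ->.
have K := Hp _ (uniq_pairs us ut).
have {}K : nrm (\sum_(i <- s) \sum_(j <- t) f (i, j) - csum f) <= e / 2.
  rewrite -sum_pairs; apply: K => -[i j] ij; apply/allpairsP; exists (i, j); split=> //.
    by apply: sub; apply: (map_f fst ij).
  by rewrite mem_undup mem_cat; apply/orP; right; apply: (map_f snd ij).
have L : nrm (\sum_(i <- s) (\sum_(j <- t) f (i, j) - csum (fun j => f (i, j)))) <= e / 2.
  apply: le_trans (nrm_sum _ _ _) _.
  apply: (@le_trans _ _ (\sum_(i <- s) (e / 2 / ((size s)%:R + 1)))).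
    by rewrite big_seq [leRHS]big_seq; apply: ler_sum => i si; apply: H.
  rewrite sum_cst_seq mulrCA ger_pMr; last lra.
  by rewrite ler_pdivrMr ?mul1r ?lerDl // ltr_wpDl.
rewrite sumrB in L.
set a := \sum_(i <- s) \sum_(j <- t) _ in K L; set b := \sum_(i <- s) _ in L *.
rewrite (_ : b - _ = (a - csum f) - (a - b)); last by ring.
by apply: le_trans (nrmB _ _) _; lra.
Qed.

Lemma absm_prod (f : I -> R[i]) (g : J -> R[i]) : absm f -> absm g ->
  absm (fun p : I * J => f p.1 * g p.2).
Proof.
move=> [M HM] [N HN]; exists (M * N) => s us.
pose s1 := undup (map fst s); pose s2 := undup (map snd s).
apply: (@le_trans _ _ (\sum_(p <- [seq (i, j) | i <- s1, j <- s2]) nrm (f p.1 * g p.2))).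
  apply: ler_sum_uniq_sub => //; first by move=> p; exact: nrm_ge0.
    by rewrite uniq_pairs // undup_uniq.
  move=> [i j] ij; apply/allpairsP; exists (i, j); rewrite !mem_undup; split=> //.
    exact: (map_f fst ij).
  exact: (map_f snd ij).
rewrite (sum_pairs (fun p => nrm (f p.1 * g p.2))) /=.
under eq_bigr do under eq_bigr do rewrite nrmM.
under eq_bigr do rewrite -mulr_sumr.
rewrite -mulr_suml ler_pM ?sumr_ge0 ?HM ?HN ?undup_uniq //.
  by move=> i _; exact: nrm_ge0.
by move=> i _; exact: nrm_ge0.
Qed.

Lemma csum_prod (f : I -> R[i]) (g : J -> R[i]) : absm f -> absm g ->
  csum (fun p : I * J => f p.1 * g p.2) = csum f * csum g.
Proof.
move=> af ag; rewrite (csum_fubini (absm_prod af ag)) /=.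
rewrite (@csum_ext _ _ (fun i => csum g * f i)); first by rewrite csumZ // mulrC.
by move=> i /=; rewrite csumZ // mulrC.
Qed.

End Fubini.

Lemma csum_swap (I J : choiceType) (f : I * J -> R[i]) :
  csum (fun p : J * I => f (p.2, p.1)) = csum f.
Proof.
pose h (p : J * I) := (p.2, p.1); pose h' (p : I * J) := (p.2, p.1).
by apply: (@csum_bij _ _ f h h') => -[].
Qed.

Lemma has_sumE (A : set R[i]) (u : R[i] -> R[i]) v :
  has_sum A u v <-> hs (fun l => if l \in A then u l else 0) v.
Proof.
set f := fun l => _.
have PS (B : {fset R[i]}) : partial_sum (f : R[i] -> R[i]^o) B = \sum_(l <- enum_fset B) f l.
  by rewrite /partial_sum -(big_seq_fsetE _ B xpredT f).
have FF : Filter (@totally R[i]) by apply: @filter_filter; exact: totally_filter.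
split=> [H e e0|H].
- have e0' : 0 < e%:C by rewrite ltcR.
  have /cvgrPdist_lt/(_ _ e0') [A0 _ HA] := H; exists (enum_fset A0) => s us sub.
  pose B := [fset l in s]%fset.
  have := HA B; rewrite /= normE ltcR PS => K.
  rewrite nrmC ltW //; move: K.
  have -> : \sum_(l <- enum_fset B) f l = \sum_(l <- s) f l.
    apply: perm_big; apply: uniq_perm => //.
    by move=> l; rewrite inE.
  by apply; apply/fsubsetP => l /sub; rewrite inE.
- apply/cvgrPdist_lt => e e0.
  have eR : e = (complex.Re e)%:C.
    by case: e e0 => a b; rewrite ltcE /= => /andP[/eqP-> _].
  move: e0; rewrite eR ltcR => e0; have [s0 K] := H (complex.Re e / 2) ltac:(lra).
  exists [fset l in s0]%fset => // B /= /fsubsetP sub.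
  rewrite normE ltcR PS nrmC; apply: le_lt_trans (K _ _ _) _; last lra.
    exact: fset_uniq.
  by move=> l sl; apply: sub; rewrite inE.
Qed.

End UnorderedSums.

(** * Integration along segments by means of primitives *)

Section Goursat.
Variable R : realType.
Implicit Types (a b c d e x y t M : R) (z w v : R[i]) (phi psi : R -> R[i]).

(** The compactness principle behind all the bisection arguments: [isI_bound], [goursat] and
    [rect_bounded]. *)
Lemma nested_point (u v : nat -> R) :
  (forall n, u n <= u n.+1) -> (forall n, v n.+1 <= v n) -> (forall n, u n <= v n) ->
  exists x, forall n, u n <= x <= v n.
Proof.
move=> ui vd uv.
have um m n : (m <= n)%N -> u m <= u n.
  by move=> /subnK <-; elim: (n - m)%N => // k /le_trans; apply; rewrite addSn.
have vm m n : (m <= n)%N -> v n <= v m.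
  by move=> /subnK <-; elim: (n - m)%N => // k; apply: le_trans; rewrite addSn.
have uvm m n : u m <= v n.
  case: (leqP m n) => [/um k|/ltnW /vm k]; first exact: le_trans k (uv n).
  exact: le_trans (uv m) k.
pose S : set R := [set x | exists n, x = u n].
have S0 : S !=set0 by exists (u 0), 0.
have Sb : has_ubound S by exists (v 0) => x [n ->].
exists (sup S) => n; apply/andP; split; first by apply: ub_le_sup => //; exists n.
by apply: ge_sup => // x [m ->].
Qed.

(** An integral is an increment of a primitive, so neither Riemann sums nor measures appear in later
    arguments; [isI_uniq] shows that the value is well defined. *)
Definition isI phi a b v := exists P : R -> R[i],
  (forall x, a <= x <= b -> forall e, 0 < e -> exists2 d, 0 < d &
     forall y, a <= y <= b -> `|y - x| < d ->
       nrm (P y - P x - (y - x)%:C * phi x) <= e * `|y - x|) /\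
  v = P b - P a.

Lemma straddle (P : R -> R[i]) (k : R[i]) (x u v d e : R) : u <= x <= v -> v - u < d ->
  (`|u - x| < d -> nrm (P u - P x - (u - x)%:C * k) <= e * `|u - x|) ->
  (`|v - x| < d -> nrm (P v - P x - (v - x)%:C * k) <= e * `|v - x|) ->
  nrm (P v - P u) <= e * (v - u) + nrm k * (v - u).
Proof.
move=> /andP[ux xv] uvd.
have -> : `|u - x| = x - u by rewrite distrC ger0_norm; lra.
have -> : `|v - x| = v - x by rewrite ger0_norm; lra.
move=> /(_ ltac:(lra)) ku /(_ ltac:(lra)) kv.
have -> : P v - P u = (P v - P x - (v - x)%:C * k) -
   (P u - P x - (u - x)%:C * k) + k * (v - u)%:C by rewrite !rmorphB /=; ring.
apply: le_trans (nrmD _ _) _; apply: lerD.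
  by apply: le_trans (nrmB _ _) _; lra.
by rewrite nrmM nrm_real (@ger0_norm _ (v - u)) //; lra.
Qed.

(** Mean value inequality by bisection: if the mean slope [K] exceeded [M], one half of each
    interval would keep slope at least [K], contradicting [nrm (phi x) <= M] at the common point. *)
Lemma isI_bound phi a b v M : a <= b -> (forall x, a <= x <= b -> nrm (phi x) <= M) ->
  isI phi a b v -> nrm v <= M * (b - a).
Proof.
move=> ab Hphi [P [HP ->]]; rewrite leNgt; apply/negP => bad.
have M0 : 0 <= M by apply: le_trans (nrm_ge0 _) (Hphi a _); rewrite lexx.
have ab0 : 0 < b - a.
  rewrite subr_gt0 lt_neqAle ab andbT; apply/eqP => E.
  by move: bad; rewrite E !subrr nrm0 mulr0 ltxx.
pose K := nrm (P b - P a) / (b - a).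
have KM : M < K by rewrite /K ltr_pdivlMr.
pose bd (q : R * R) := K * (q.2 - q.1) <= nrm (P q.2 - P q.1).
pose mid (q : R * R) := (q.1 + q.2) / 2.
pose st (q : R * R) := if bd (q.1, mid q) then (q.1, mid q) else (mid q, q.2).
pose q n := iter n st (a, b).
have qle n : (q n).2 - (q n).1 = (b - a) / 2 ^+ n.
  elim: n => [|n IH]; first by rewrite expr0 divr1.
  rewrite /q iterS -/(q n) /st /mid; case: ifP => _ /=; rewrite exprS invfM mulrCA -IH; lra.
have qlt n : (q n).1 <= (q n).2.
  by rewrite -subr_ge0 qle divr_ge0 ?exprn_ge0 ?ltW.
have qb n : bd (q n).
  elim: n => [|n IH]; first by rewrite /bd /= /K divfK ?gt_eqF.
  rewrite /q iterS -/(q n) /st; case: ifP => // /negbT; rewrite /bd /= -ltNge => k.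
  move: IH; rewrite /bd => IH.
  rewrite (_ : P (q n).2 - P (mid (q n)) =
     (P (q n).2 - P (q n).1) - (P (mid (q n)) - P (q n).1)); last by ring.
  have := nrmB_ge (P (q n).2 - P (q n).1) (P (mid (q n)) - P (q n).1).
  move: k IH; rewrite /mid; set A := nrm _; set B := nrm _; lra.
have q1 n : (q n).1 <= (q n.+1).1.
  rewrite {2}/q iterS -/(q n) /st; case: ifP => //= _; rewrite /mid; have := qlt n; lra.
have q2 n : (q n.+1).2 <= (q n).2.
  rewrite {1}/q iterS -/(q n) /st; case: ifP => //= _; rewrite /mid; have := qlt n; lra.
have [x Hx] := nested_point q1 q2 qlt.
have xab : a <= x <= b by have := Hx 0%N.
have inab n : (a <= (q n).1 <= b) && (a <= (q n).2 <= b).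
  have : a <= (q n).1.
    by elim: n => // n IH; exact: le_trans IH (q1 n).
  have : (q n).2 <= b.
    by elim: n => // n IH; apply: le_trans (q2 n) IH.
  have := qlt n; lra.
have [d d0 H] := HP x xab ((K - M) / 2) ltac:(lra).
have [n Hn] : exists n, (b - a) / 2 ^+ n < d.
  exists (Num.Def.archi_bound ((b - a) / d)).
  by rewrite ltr_pdivrMr ?exprn_gt0 // -ltr_pdivrMl // mulrC upper_nthrootP.
have := inab n; have := qle n; have := qb n; have := qlt n.
rewrite /bd; set u0 := (q n).1; set v0 := (q n).2 => uv b1 b2 /andP[b3 b4].
have uxv : u0 <= x <= v0 by have := Hx n.
have D0 : v0 - u0 < d by rewrite b2.
have k1 := straddle uxv D0 (H u0 b3) (H v0 b4).
have k2 := Hphi x xab.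
have uv0 : 0 < v0 - u0 by rewrite b2 divr_gt0 ?exprn_gt0.
have {}k2 : nrm (phi x) * (v0 - u0) <= M * (v0 - u0) by rewrite ler_wpM2r // ltW.
move: b1 k1 k2 uv0; clearbody u0 v0 K; move: KM; clear => KM b1 k1 k2 uv0.
have : K * (v0 - u0) <= (K + M) / 2 * (v0 - u0) by apply: le_trans b1 _; lra.
by rewrite ler_pM2r //; lra.
Qed.

Lemma isI_uniq phi a b v w : a <= b -> isI phi a b v -> isI phi a b w -> v = w.
Proof.
move=> ab [P [HP ->]] [Q [HQ ->]].
have H : isI (fun=> 0) a b ((P b - Q b) - (P a - Q a)).
  exists (fun x => P x - Q x); split=> // x xab e e0.
  have [d d0 K] := HP x xab (e / 2) ltac:(lra).
  have [d' d0' K'] := HQ x xab (e / 2) ltac:(lra).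
  exists (Num.min d d'); first by rewrite lt_min d0.
  move=> y yab; rewrite lt_min => /andP[/(K y yab) k /(K' y yab) k'].
  rewrite mulr0 subr0 (_ : _ - _ = (P y - P x - (y - x)%:C * phi x) -
     (Q y - Q x - (y - x)%:C * phi x)); last by ring.
  by apply: le_trans (nrmB _ _) _; lra.
have Z x : a <= x <= b -> nrm ((fun=> 0 : R[i]) x) <= 0 :> R by rewrite nrm0.
have := isI_bound ab Z H.
rewrite mul0r => n0; apply/eqP; rewrite -subr_eq0 -nrm_eq0 eq_le nrm_ge0 andbT.
by rewrite (_ : _ - _ = P b - Q b - (P a - Q a)) //; ring.
Qed.

Lemma isID phi psi a b v w : isI phi a b v -> isI psi a b w ->
  isI (fun x => phi x + psi x) a b (v + w).
Proof.
move=> [P [HP ->]] [Q [HQ ->]].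
exists (fun x => P x + Q x); split=> [x xab e e0|]; last by ring.
have [d d0 K] := HP x xab (e / 2) ltac:(lra).
have [d' d0' K'] := HQ x xab (e / 2) ltac:(lra).
exists (Num.min d d'); first by rewrite lt_min d0.
move=> y yab; rewrite lt_min => /andP[/(K y yab) k /(K' y yab) k'].
rewrite (_ : _ - _ - _ = (P y - P x - (y - x)%:C * phi x) +
     (Q y - Q x - (y - x)%:C * psi x)); last by ring.
by apply: le_trans (nrmD _ _) _; lra.
Qed.

Lemma isIZ u phi a b v : isI phi a b v -> isI (fun x => u * phi x) a b (u * v).
Proof.
move=> [P [HP ->]]; exists (fun x => u * P x); split=> [x xab e e0|]; last by ring.
have n0 := nrm_ge0 u.
have [d d0 K] := HP x xab (e / (nrm u + 1)) ltac:(by rewrite divr_gt0 //; lra).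
exists d => // y yab /(K y yab) k.
rewrite (_ : _ - _ - _ = u * (P y - P x - (y - x)%:C * phi x)); last by ring.
rewrite nrmM; apply: le_trans (ler_wpM2l n0 k) _.
rewrite mulrA ler_wpM2r // mulrCA ger_pMr // ler_pdivrMr; lra.
Qed.

Lemma isI_affine u w a b :
  isI (fun x => u + w * x%:C) a b (u * (b - a)%:C + w * (b ^+ 2 - a ^+ 2)%:C / 2).
Proof.
exists (fun x => u * x%:C + w * (x ^+ 2)%:C / 2); split=> [x _ e e0|]; last first.
  by rewrite !rmorphB /=; ring.
have n0 := nrm_ge0 w; exists (e / (nrm w + 1)); first by rewrite divr_gt0 //; lra.
move=> y _; rewrite ltr_pdivlMr; last lra.
rewrite (_ : _ - _ - _ = w * (y - x)%:C ^+ 2 / 2); last first.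
  by rewrite !rmorphB !rmorphXn /=; field.
rewrite !nrmM !nrm_real nrmV nrm_nat => k.
have k0 := normr_ge0 (y - x); set q := `|y - x| in k k0 *.
have k1 : nrm w * q <= e by nra.
have k2 : nrm w * q * q <= e * q by rewrite ler_wpM2r.
have k3 : 0 <= nrm w * q * q by rewrite !mulr_ge0.
rewrite (mulrA _ q q); lra.
Qed.

Lemma isI_split phi a b c u v w : a <= b -> b <= c -> isI phi a c u ->
  isI phi a b v -> isI phi b c w -> u = v + w.
Proof.
move=> ab bc [P [HP ->]] Hv Hw.
have E1 : isI phi a b (P b - P a).
  exists P; split=> // x xab e e0; have xac : a <= x <= c by lra.
  have [d d0 H] := HP x xac e e0; exists d => // y yab; apply: H; lra.
have E2 : isI phi b c (P c - P b).
  exists P; split=> // x xab e e0; have xac : a <= x <= c by lra.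
  have [d d0 H] := HP x xac e e0; exists d => // y yab; apply: H; lra.
by rewrite (isI_uniq ab Hv E1) (isI_uniq bc Hw E2); ring.
Qed.

Lemma is_derive_eps (F : R -> R) x l : is_derive x 1 F l ->
  forall e, 0 < e -> exists2 d, 0 < d & forall y, `|y - x| < d ->
    `|F y - F x - (y - x) * l| <= e * `|y - x|.
Proof.
move=> [/cvg_ex[/= l' Fl] E] e e0.
have -> : l = l'.
  by rewrite -E; apply: cvg_lim => //; exact: Fl.
move/cvgrPdist_lt/(_ _ e0): Fl.
rewrite near_withinE => /nbhs_ballP[d /= d0 H]; exists d => // y yd.
case: (eqVneq y x) => [->|yx].
  by rewrite !subrr mul0r subr0 normr0 mulr0.
have yx0 : y - x != 0 by rewrite subr_eq0.
have := H (y - x); rewrite /ball /= sub0r normrN => /(_ yd yx0).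
rewrite /GRing.scale /= mulr1 subrK => K.
rewrite (_ : _ - _ - _ = - ((y - x) * (l' - (y - x)^-1 * (F y - F x)))); last first.
  by rewrite mulrBr mulrA divff // mul1r; ring.
by rewrite normrN normrM mulrC ler_wpM2r // ltW.
Qed.

Lemma real_primitive (psi : R -> R) : continuous psi -> forall a b, a < b ->
  exists F : R -> R, forall x, a < x < b -> is_derive x 1 F (psi x).
Proof.
move=> pc a b ab; eexists => x /andP[ax xb].
have I : lebesgue_measure.-integrable `[a, b] (EFin \o psi).
  apply: continuous_compact_integrable; first exact: segment_compact.
  by apply: continuous_subspaceT.
have [D E] := continuous_FTC1_closed xb I ax (pc x).
by apply: DeriveDef D _; rewrite -derive1E E.
Qed.

Definition rcont phi a b := forall x, a <= x <= b -> forall e, 0 < e ->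
  exists2 d, 0 < d & forall y, a <= y <= b -> `|y - x| < d -> nrm (phi y - phi x) <= e.

Lemma isI_exists phi a b : a <= b -> rcont phi a b -> exists v, isI phi a b v.
Proof.
(* Clamping extends [phi] continuously to the whole line, so that [a] and [b] become interior points
   for the fundamental theorem of calculus. *)
move=> ab H; pose cl x : R := Num.max a (Num.min x b).
have cli x : a <= cl x <= b.
  by rewrite /cl le_max lexx /= ge_max ab ge_min lexx orbT.
have clid x : a <= x <= b -> cl x = x.
  by move=> /andP[ax xb]; rewrite /cl (min_idPl xb) (max_idPr ax).
have mx (u v : R) : `|Num.max a u - Num.max a v| <= `|u - v| :> R.
  have k1 := ler_norm (u - v); have k2 := ler_norm (v - u); rewrite (distrC v) in k2.
  by rewrite !maxEle ler_norml; case: (leP a u) => h1; case: (leP a v) => h2; lra.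
have mn (u v : R) : `|Num.min u b - Num.min v b| <= `|u - v| :> R.
  have k1 := ler_norm (u - v); have k2 := ler_norm (v - u); rewrite (distrC v) in k2.
  by rewrite !minEle ler_norml; case: (leP u b) => h1; case: (leP v b) => h2; lra.
have cll x y : `|cl y - cl x| <= `|y - x| by exact: le_trans (mx _ _) (mn _ _).
have cont (q : R[i] -> R) : (forall z w, `|q z - q w| <= nrm (z - w)) ->
    continuous (fun x => q (phi (cl x))).
  move=> ql x; apply/cvgrPdist_lt => e e0.
  have [d d0 K] := H (cl x) (cli x) (e / 2) ltac:(lra).
  apply/nbhs_ballP; exists d => //= y; rewrite /ball /= distrC => yx.
  have := K (cl y) (cli y) (le_lt_trans (cll _ _) yx).
  by have := ql (phi (cl x)) (phi (cl y)); rewrite nrmC; lra.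
have [F1 H1] : exists F : R -> R, forall x, a - 1 < x < b + 1 -> is_derive x 1 F (complex.Re (phi (cl x))).
  apply: real_primitive; last lra.
  by apply: cont => z w; rewrite -ReN -ReD; apply: Re_le_nrm.
have [F2 H2] : exists F : R -> R, forall x, a - 1 < x < b + 1 -> is_derive x 1 F (complex.Im (phi (cl x))).
  apply: real_primitive; last lra.
  by apply: cont => z w; rewrite -ImN -ImD; apply: Im_le_nrm.
pose P x := (F1 x)%:C + 'i * (F2 x)%:C.
exists (P b - P a), P; split=> // x xab e e0.
have xab' : a - 1 < x < b + 1 by lra.
have [d d0 K] := is_derive_eps (H1 x xab') (e := e / 2) ltac:(lra).
have [d' d0' K'] := is_derive_eps (H2 x xab') (e := e / 2) ltac:(lra).
exists (Num.min d d'); first by rewrite lt_min d0.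
move=> y _; rewrite lt_min => /andP[/K k /K' k']; move: k k'; rewrite clid // => k k'.
rewrite {1}(complex_ReIm (phi x)) /P (_ : _ - _ - _ =
  (F1 y - F1 x - (y - x) * complex.Re (phi x))%:C +
  'i * (F2 y - F2 x - (y - x) * complex.Im (phi x))%:C); last first.
  by rewrite !rmorphB !rmorphM !rmorphB /=; ring.
apply: le_trans (nrmD _ _) _; rewrite nrmM nrm_i mul1r !nrm_real; lra.
Qed.

Definition integ phi a b := xget 0 (isI phi a b).

Lemma integP phi a b : a <= b -> rcont phi a b -> isI phi a b (integ phi a b).
Proof.
move=> ab /(isI_exists ab)[v H]; rewrite /integ.
by rewrite (@xget_unique _ 0 (isI phi a b) v) // => w /(isI_uniq ab H).
Qed.

End Goursat.

Ltac cring := apply/eqP; rewrite eq_complex /=; apply/andP; split; apply/eqP; ring.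

(** * Goursat's lemma for rectangles *)

Section GoursatTheorem.
Variable R : realType.
Variable f : R[i] -> R[i].
Implicit Types (a b c d e x y t M : R) (z w v : R[i]).

Definition hz y x : R[i] := f (x +i* y).
Definition vt x y : R[i] := f (x +i* y).

Definition boundary a b c d : R[i] :=
  integ (hz c) a b - integ (hz d) a b + 'i * (integ (vt b) c d - integ (vt a) c d).

Definition cdiff_rect a b c d := forall x y, a <= x <= b -> c <= y <= d ->
  exists k, cdiff f (x +i* y) k.

Lemma hz_cont a b c d y : c <= y <= d -> cdiff_rect a b c d -> rcont (hz y) a b.
Proof.
move=> ycd D x xab e e0; have [k /cdiff_cont /(_ e e0)[r r0 K]] := D x y xab ycd.
exists r => // x' _ xx; apply: K.
by rewrite (_ : _ - _ = (x' - x)%:C) ?nrm_real //; cring.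
Qed.

Lemma vt_cont a b c d x : a <= x <= b -> cdiff_rect a b c d -> rcont (vt x) c d.
Proof.
move=> xab D y ycd e e0; have [k /cdiff_cont /(_ e e0)[r r0 K]] := D x y xab ycd.
exists r => // y' _ yy; apply: K.
rewrite (_ : _ - _ = 'i * (y' - y)%:C) ?nrmM ?nrm_i ?mul1r ?nrm_real //.
by cring.
Qed.

Lemma hz_integ a b c d y : a <= b -> c <= y <= d -> cdiff_rect a b c d ->
  isI (hz y) a b (integ (hz y) a b).
Proof. by move=> ab ycd D; apply: integP => //; apply: hz_cont D. Qed.

Lemma vt_integ a b c d x : c <= d -> a <= x <= b -> cdiff_rect a b c d ->
  isI (vt x) c d (integ (vt x) c d).
Proof. by move=> cd xab D; apply: integP => //; apply: vt_cont D. Qed.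

Lemma cdiff_rect_sub a b c d a' b' c' d' : a <= a' -> b' <= b -> c <= c' -> d' <= d ->
  cdiff_rect a b c d -> cdiff_rect a' b' c' d'.
Proof.
move=> aa bb cc dd D x y /andP[x1 x2] /andP[y1 y2]; apply: D; apply/andP; split.
- exact: le_trans x1. - exact: le_trans bb. - exact: le_trans y1. - exact: le_trans dd.
Qed.

Lemma boundary_split a b c d m n : a <= m <= b -> c <= n <= d -> cdiff_rect a b c d ->
  boundary a b c d = boundary a m c n + boundary m b c n +
                     (boundary a m n d + boundary m b n d).
Proof.
move=> /andP[am mb] /andP[cn nd] D.
have ab := le_trans am mb; have cd := le_trans cn nd.
have H y : c <= y <= d -> integ (hz y) a b = integ (hz y) a m + integ (hz y) m b.
  move=> ycd; apply: (isI_split am mb (hz_integ ab ycd D)).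
    by apply: hz_integ ycd _ => //; apply: cdiff_rect_sub D.
  by apply: hz_integ ycd _ => //; apply: cdiff_rect_sub D.
have V x : a <= x <= b -> integ (vt x) c d = integ (vt x) c n + integ (vt x) n d.
  move=> xab; apply: (isI_split cn nd (vt_integ cd xab D)).
    by apply: vt_integ xab _ => //; apply: cdiff_rect_sub D.
  by apply: vt_integ xab _ => //; apply: cdiff_rect_sub D.
rewrite /boundary !H ?V ?lexx ?cd ?ab //; ring.
Qed.

(** The affine part [f z + (w - z) * k] has explicit side integrals that cancel around the
    rectangle; the remainder is at most [e] times the diameter, integrated over the perimeter. *)
Lemma boundary_small a b c d z k e : a <= b -> c <= d -> cdiff_rect a b c d ->
  0 <= e -> a <= complex.Re z <= b -> c <= complex.Im z <= d ->
  (forall x y, a <= x <= b -> c <= y <= d -> let w := x +i* y in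
     nrm (f w - f z - (w - z) * k) <= e * nrm (w - z)) ->
  nrm (boundary a b c d) <= 2 * e * ((b - a) + (d - c)) ^+ 2.
Proof.
move=> ab cd D e0 zx zy K.
set p := complex.Re z in zx; set q := complex.Im z in zy.
set W := (b - a) + (d - c).
have zE : z = p%:C + 'i * q%:C by exact: complex_ReIm.
have xyE x y : x +i* y = x%:C + 'i * y%:C :> R[i] by cring.
have small x y : a <= x <= b -> c <= y <= d ->
    nrm (f (x +i* y) - f z - ((x +i* y) - z) * k) <= e * W.
  move=> xab ycd; apply: le_trans (K x y xab ycd) _; rewrite ler_wpM2l //.
  rewrite xyE zE (_ : _ - _ = (x - p)%:C + 'i * (y - q)%:C); last by rewrite !rmorphB /=; ring.
  apply: le_trans (nrmD _ _) _; rewrite nrmM nrm_i mul1r !nrm_real /W.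
  by apply: lerD; rewrite ler_norml; lra.
pose A y : R[i] := f z + ('i * y%:C - z) * k.
pose B x : R[i] := f z + (x%:C - z) * k.
have H y : c <= y <= d -> exists2 v, nrm v <= e * W * (b - a) &
    integ (hz y) a b = v + (A y * (b - a)%:C + k * (b ^+ 2 - a ^+ 2)%:C / 2).
  move=> ycd; have I1 := hz_integ ab ycd D.
  have I2 := isI_affine (A y) k a b.
  have I3 := isID I1 (isIZ (-1) I2).
  exists (integ (hz y) a b + -1 * (A y * (b - a)%:C + k * (b ^+ 2 - a ^+ 2)%:C / 2)); last by ring.
  apply: isI_bound ab _ I3 => x xab; have := small x y xab ycd.
  rewrite /hz /A xyE; congr (nrm _ <= _); ring.
have V x : a <= x <= b -> exists2 v, nrm v <= e * W * (d - c) &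
    integ (vt x) c d = v + (B x * (d - c)%:C + ('i * k) * (d ^+ 2 - c ^+ 2)%:C / 2).
  move=> xab; have I1 := vt_integ cd xab D.
  have I2 := isI_affine (B x) ('i * k) c d.
  have I3 := isID I1 (isIZ (-1) I2).
  exists (integ (vt x) c d + -1 * (B x * (d - c)%:C + ('i * k) * (d ^+ 2 - c ^+ 2)%:C / 2)); last by ring.
  apply: isI_bound cd _ I3 => y ycd; have := small x y xab ycd.
  rewrite /vt /B xyE; congr (nrm _ <= _); ring.
have c1 : c <= c <= d by rewrite lexx cd.
have c2 : c <= d <= d by rewrite lexx cd.
have c3 : a <= a <= b by rewrite lexx ab.
have c4 : a <= b <= b by rewrite lexx ab.
have [v1 n1 E1] := H c c1; have [v2 n2 E2] := H d c2.
have [v3 n3 E3] := V b c4; have [v4 n4 E4] := V a c3.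
have -> : boundary a b c d = (v1 - v2) + 'i * (v3 - v4).
  rewrite /boundary E1 E2 E3 E4 /A /B !rmorphB /=.
  by ring.
apply: le_trans (nrmD _ _) _; rewrite nrmM nrm_i mul1r.
have := nrmB v1 v2; have := nrmB v3 v4.
have -> : 2 * e * W ^+ 2 = 2 * (e * W * (b - a)) + 2 * (e * W * (d - c)) by rewrite /W; ring.
lra.
Qed.

(** Quadrisection: some quarter keeps at least a fourth of the boundary integral, while its sides
    are halved. The quadratic bound of [boundary_small] at the common point therefore beats the
    loss. *)
Lemma goursat a b c d : a <= b -> c <= d -> cdiff_rect a b c d -> boundary a b c d = 0.
Proof.
move=> ab cd D.
pose T := (R * R * (R * R))%type.
pose bd (q : T) := nrm (boundary q.1.1 q.1.2 q.2.1 q.2.2).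
pose m1 (q : T) := (q.1.1 + q.1.2) / 2; pose m2 (q : T) := (q.2.1 + q.2.2) / 2.
pose s1 (q : T) : T := ((q.1.1, m1 q), (q.2.1, m2 q)).
pose s2 (q : T) : T := ((m1 q, q.1.2), (q.2.1, m2 q)).
pose s3 (q : T) : T := ((q.1.1, m1 q), (m2 q, q.2.2)).
pose s4 (q : T) : T := ((m1 q, q.1.2), (m2 q, q.2.2)).
pose st (q : T) := if bd q <= 4 * bd (s1 q) then s1 q else
  if bd q <= 4 * bd (s2 q) then s2 q else if bd q <= 4 * bd (s3 q) then s3 q else s4 q.
pose q n := iter n st ((a, b), (c, d)).
have qS n : q n.+1 = st (q n) by [].
have stc (r : T) : [\/ st r = s1 r, st r = s2 r, st r = s3 r | st r = s4 r].
  rewrite /st; case: ifP => _; first by constructor 1.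
  case: ifP => _; first by constructor 2.
  by case: ifP => _; [constructor 3|constructor 4].
have w1 n : (q n).1.2 - (q n).1.1 = (b - a) / 2 ^+ n.
  elim: n => [|n IH]; first by rewrite expr0 divr1.
  rewrite qS exprS invfM mulrCA -IH; case: (stc (q n)) => -> /=; rewrite /m1; lra.
have w2 n : (q n).2.2 - (q n).2.1 = (d - c) / 2 ^+ n.
  elim: n => [|n IH]; first by rewrite expr0 divr1.
  rewrite qS exprS invfM mulrCA -IH; case: (stc (q n)) => -> /=; rewrite /m2; lra.
have l1 n : (q n).1.1 <= (q n).1.2 by rewrite -subr_ge0 w1 divr_ge0 ?subr_ge0 ?exprn_ge0.
have l2 n : (q n).2.1 <= (q n).2.2 by rewrite -subr_ge0 w2 divr_ge0 ?subr_ge0 ?exprn_ge0.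
have i1 n : (q n).1.1 <= (q n.+1).1.1.
  rewrite qS; case: (stc (q n)) => -> //=; rewrite /m1; have := l1 n; lra.
have i2 n : (q n.+1).1.2 <= (q n).1.2.
  rewrite qS; case: (stc (q n)) => -> //=; rewrite /m1; have := l1 n; lra.
have i3 n : (q n).2.1 <= (q n.+1).2.1.
  rewrite qS; case: (stc (q n)) => -> //=; rewrite /m2; have := l2 n; lra.
have i4 n : (q n.+1).2.2 <= (q n).2.2.
  rewrite qS; case: (stc (q n)) => -> //=; rewrite /m2; have := l2 n; lra.
have j1 n : a <= (q n).1.1 by elim: n => // n IH; apply: le_trans IH (i1 n).
have j2 n : (q n).1.2 <= b by elim: n => // n; apply: le_trans (i2 n).
have j3 n : c <= (q n).2.1 by elim: n => // n IH; apply: le_trans IH (i3 n).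
have j4 n : (q n).2.2 <= d by elim: n => // n; apply: le_trans (i4 n).
have Dn n : cdiff_rect (q n).1.1 (q n).1.2 (q n).2.1 (q n).2.2.
  by apply: cdiff_rect_sub D.
have bn n : bd (q n) <= 4 * bd (q n.+1).
  rewrite qS /st; case: ifP => // /negbT; rewrite -ltNge => h1.
  case: ifP => // /negbT; rewrite -ltNge => h2.
  case: ifP => // /negbT; rewrite -ltNge => h3.
  rewrite leNgt; apply/negP => h4; move: h1 h2 h3 h4.
  have lm1 : (q n).1.1 <= m1 (q n) <= (q n).1.2 by rewrite /m1; have := l1 n; lra.
  have lm2 : (q n).2.1 <= m2 (q n) <= (q n).2.2 by rewrite /m2; have := l2 n; lra.
  have := congr1 (@nrm R) (boundary_split lm1 lm2 (Dn n)).
  rewrite -[LHS]/(bd (q n)) => ->.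
  rewrite /bd /=; set B1 := boundary _ _ _ _; set B2 := boundary _ _ _ _.
  set B3 := boundary _ _ _ _; set B4 := boundary _ _ _ _.
  have := nrmD (B1 + B2) (B3 + B4); have := nrmD B1 B2; have := nrmD B3 B4; lra.
have b0 n : bd (q 0) <= 4 ^+ n * bd (q n).
  elim: n => [|n IH]; first by rewrite expr0 mul1r.
  by apply: le_trans IH _; rewrite exprSr -mulrA ler_pM2l ?exprn_gt0.
have [x Hx] := nested_point i1 i2 l1; have [y Hy] := nested_point i3 i4 l2.
have [k Hk] := D x y (Hx 0%N) (Hy 0%N).
apply: nrm_le0 => e e0; rewrite -[nrm _]/(bd (q 0)).
set W := (b - a) + (d - c).
have W0 : 0 <= W by rewrite /W; lra.
pose e' := e / (2 * W ^+ 2 + 1).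
have W2 : 0 < 2 * W ^+ 2 + 1 by rewrite ltr_wpDl // mulr_ge0 // sqr_ge0.
have e'0 : 0 < e' by rewrite divr_gt0.
have [r r0 K] := Hk e' e'0.
have [n Hn] : exists n, W / 2 ^+ n < r.
  exists (Num.Def.archi_bound (W / r)).
  by rewrite ltr_pdivrMr ?exprn_gt0 // -ltr_pdivrMl // mulrC upper_nthrootP.
have S := @boundary_small _ _ _ _ (x +i* y) k e' (l1 n) (l2 n) (Dn n) (ltW e'0) (Hx n) (Hy n).
apply: le_trans (b0 n) _.
have {}S : bd (q n) <= 2 * e' * ((b - a) / 2 ^+ n + (d - c) / 2 ^+ n) ^+ 2.
  rewrite -w1 -w2; apply: S => x' y' hx' hy' /=; apply: K.
  have -> : (x' +i* y') - (x +i* y) = (x' - x)%:C + 'i * (y' - y)%:C by cring.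
  apply: le_lt_trans (nrmD _ _) _; rewrite nrmM nrm_i mul1r !nrm_real.
  apply: le_lt_trans Hn; rewrite /W mulrDl -w1 -w2; apply: lerD; rewrite ler_norml.
    by have := Hx n; lra.
  by have := Hy n; lra.
apply: le_trans (ler_wpM2l _ S) _; first by rewrite exprn_ge0.
rewrite -mulrDl -/W.
have -> : 4 ^+ n = (2 ^+ n) ^+ 2 :> R.
  by rewrite -exprM mulnC exprM; congr (_ ^+ n); rewrite expr2; lra.
have p0 : 2 ^+ n != 0 :> R by rewrite expf_neq0.
have -> : (2 ^+ n) ^+ 2 * (2 * e' * (W / 2 ^+ n) ^+ 2) =
    e * (2 * W ^+ 2 / (2 * W ^+ 2 + 1)) by rewrite /e'; field; rewrite p0 gt_eqF.
by rewrite ger_pMr // ler_pdivrMr // mul1r lerDl.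
Qed.

End GoursatTheorem.

(** * The complex exponential and its remainder bounds *)

Section ComplexExponential.
Variable R : realType.
Implicit Types (x y t : R) (z w : R[i]).

Lemma expC0 : expC (0 : R[i]) = 1.
Proof. by rewrite /expC /= expR0 cos0 sin0 mul1r. Qed.

Lemma expCD z w : expC (z + w) = expC z * expC w.
Proof.
case: z w => [a b] [c d]; rewrite /expC /= expRD cosD sinD.
by cring.
Qed.

Lemma nrm_expC z : nrm (expC z) = expR (complex.Re z).
Proof.
rewrite /expC nrmM nrm_real ger0_norm ?expR_ge0 //.
by rewrite /nrm /= cos2Dsin2 sqrtr1 mulr1.
Qed.

Lemma expC_neq0 z : expC z != 0.
Proof. by rewrite -nrm_gt0 nrm_expC expR_gt0. Qed.

Lemma expCN z : expC (- z) = (expC z)^-1.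
Proof.
by apply: (mulfI (expC_neq0 z)); rewrite -expCD subrr expC0 divff ?expC_neq0.
Qed.

Lemma expCX n z : expC (n%:R * z) = expC z ^+ n.
Proof.
elim: n => [|n IH]; first by rewrite mul0r expC0 expr0.
by rewrite -natr1 mulrDl mul1r expCD IH exprSr.
Qed.

Lemma expC_real x : expC x%:C = (expR x)%:C.
Proof. by rewrite /expC /= cos0 sin0 mulr1. Qed.

Lemma expC_i x : expC ('i * x%:C) = cos x +i* sin x.
Proof.
have -> : 'i * x%:C = 0 +i* x by cring.
by rewrite /expC /= expR0; cring.
Qed.

Lemma expC_2pi : expC ('i * (2 * pi)%:C) = 1 :> R[i].
Proof. by rewrite expC_i mulr_natl cos2pi sin2pi. Qed.

Lemma expC_conj z : (expC z)^* = expC z^*.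
Proof.
case: z => a b; rewrite /expC /= cosN sinN.
by cring.
Qed.

Lemma cdiff_expC0 : cdiff (@expC R) (0 : R[i]) 1.
Proof.
(* The four error terms [T1] to [T4] add up to at most [6 * k * n], so [e / 8] is enough. *)
move=> e e0; pose k : R := Num.min (e / 8) 1.
have k0 : 0 < k by rewrite lt_min divr_gt0 ?ltr01 //.
have ke : k <= e / 8 by rewrite ge_min lexx.
have k1 : k <= 1 by rewrite ge_min lexx orbT.
have [d1 d10 H1] := is_derive_eps (is_derive_expR (0 : R)) k0.
have [d2 d20 H2] := is_derive_eps (is_derive_cos (0 : R)) k0.
have [d3 d30 H3] := is_derive_eps (is_derive_sin (0 : R)) k0.
exists (Num.min (Num.min d1 d2) (Num.min d3 (k / 2))).
  by rewrite !lt_min d10 d20 d30 divr_gt0.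
move=> w; rewrite !subr0 !lt_min => /andP[/andP[w1 w2] /andP[w3 w4]].
have xn := Re_le_nrm w; have yn := Im_le_nrm w.
move: w1 w2 w3 w4 xn yn; set n := nrm w; set x := complex.Re w; set y := complex.Im w.
move=> w1 w2 w3 w4 xn yn.
have K1 := H1 x; have K2 := H2 y; have K3 := H3 y; move: K1 K2 K3.
rewrite expC0 !subr0 expR0 cos0 sin0 oppr0 !mulr0 !mulr1 !(subr0, addr0).
move=> /(_ (le_lt_trans xn w1)) K1 /(_ (le_lt_trans yn w2)) K2 /(_ (le_lt_trans yn w3)) K3.
have -> : expC w - 1 - w = (expR x * (cos y - 1) + (expR x - 1 - x))%:C +
   'i * (expR x * (sin y - y) + y * (expR x - 1))%:C.
  have wE : w = x +i* y by rewrite /x /y; case: (w).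
  by rewrite [X in _ - X]wE /expC -/x -/y; cring.
apply: le_trans (nrmD _ _) _; rewrite nrmM nrm_i mul1r !nrm_real.
have n0 : 0 <= n := nrm_ge0 w.
have ax := normr_ge0 x; have ay := normr_ge0 y.
have E1 : `|expR x - 1| <= 2 * `|x|.
  have -> : expR x - 1 = (expR x - 1 - x) + x by ring.
  apply: le_trans (ler_normD _ _) _; nra.
have E2 : `|expR x| <= 2.
  have -> : expR x = (expR x - 1) + 1 by ring.
  apply: le_trans (ler_normD _ _) _; rewrite normr1; lra.
have T1 : `|expR x * (cos y - 1)| <= 2 * (k * n).
  by rewrite normrM; apply: ler_pM => //; apply: le_trans K2 _; rewrite ler_pM2l.
have T2 : `|expR x * (sin y - y)| <= 2 * (k * n).
  by rewrite normrM; apply: ler_pM => //; apply: le_trans K3 _; rewrite ler_pM2l.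
have T3 : `|y * (expR x - 1)| <= n * k.
  by rewrite normrM; apply: ler_pM => //; lra.
have T4 : `|expR x - 1 - x| <= k * n by apply: le_trans K1 _; rewrite ler_pM2l.
have := ler_normD (expR x * (cos y - 1)) (expR x - 1 - x).
have := ler_normD (expR x * (sin y - y)) (y * (expR x - 1)).
have e1 : k * n <= e / 8 * n by rewrite ler_wpM2r.
have e2 : 0 <= e * n by rewrite mulr_ge0 // ltW.
lra.
Qed.

Lemma cdiff_expC z : cdiff (@expC R) z (expC z).
Proof.
have H : cdiff (@expC R) (z + - z) 1 by rewrite subrr; apply: cdiff_expC0.
have := cdiffZ (expC z) (cdiff_shift H); rewrite mulr1; apply: cdiff_ext => w /=.
by rewrite -expCD; congr (@expC R _); ring.
Qed.

(** Pulled back to [[0, 1]], the increment is an integral in the sense of [isI], and [isI_bound]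
    applies. *)
Lemma segment_bound (F : R[i] -> R[i]) z w M : (forall t, 0 <= t <= 1 ->
    exists2 k, cdiff F (z + t%:C * w) k & nrm k <= M) ->
  nrm (F (z + w) - F z) <= M * nrm w.
Proof.
move=> H.
pose Q (t : R) (k : R[i]) := 0 <= t <= 1 -> cdiff F (z + t%:C * w) k /\ nrm k <= M.
have [k Hk] : {k : R -> R[i] & forall t, Q t (k t)}.
  apply: boolp.choice => t; case: (boolP (0 <= t <= 1)) => [ht|/negP ht].
    by have [u] := H t ht; exists u.
  by exists 0.
have I : isI (fun t => w * k t) 0 1 (F (z + w) - F z).
  exists (fun t => F (z + t%:C * w)); split; last by rewrite mul0r mul1r addr0.
  move=> x xab e e0; have [D _] := Hk x xab.
  have n0 := nrm_ge0 w.
  have [d d0 K] := D (e / (nrm w + 1)) ltac:(by rewrite divr_gt0 //; lra).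
  exists (d / (nrm w + 1)); first by rewrite divr_gt0 //; lra.
  move=> y _; rewrite ltr_pdivlMr; last lra.
  move=> yd.
  have E : z + y%:C * w - (z + x%:C * w) = (y - x)%:C * w by rewrite rmorphB /=; ring.
  have := K (z + y%:C * w); rewrite E nrmM nrm_real -(mulrA (y - x)%:C) => K'.
  have a0 := normr_ge0 (y - x).
  apply: le_trans (K' _) _.
    by apply: le_lt_trans yd; rewrite ler_wpM2l // lerDl.
  rewrite (mulrC `|_|) mulrA ler_wpM2r //.
  by rewrite mulrAC ler_pdivrMr ?ler_wpM2l ?lerDl ?ltW // ltr_wpDl.
have := isI_bound (M := M * nrm w) ler01 _ I; rewrite subr0 mulr1; apply.
by move=> t /Hk[_ km]; rewrite nrmM mulrC ler_wpM2r ?nrm_ge0.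
Qed.

Lemma expC_bound1 w : nrm (expC w - 1) <= expR (nrm w) * nrm w.
Proof.
rewrite -{1}expC0 -{1}(add0r w); apply: segment_bound => t /andP[t0 t1].
exists (expC (0 + t%:C * w)); first exact: cdiff_expC.
rewrite nrm_expC ler_expR add0r.
apply: le_trans (ler_norm _) _; apply: le_trans (Re_le_nrm _) _.
by rewrite nrmM nrm_real ger0_norm // ler_piMl ?nrm_ge0.
Qed.

Lemma expC_bound2 w : nrm (expC w - 1 - w) <= expR (nrm w) * nrm w ^+ 2.
Proof.
have -> : expC w - 1 - w = (expC (0 + w) - (0 + w)) - (expC 0 - 0).
  by rewrite expC0 add0r; ring.
rewrite expr2 mulrA.
apply: (@segment_bound (fun v => expC v - v)) => t /andP[t0 t1].
exists (expC (0 + t%:C * w) - 1).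
  by apply: cdiffB; [exact: cdiff_expC|exact: cdiff_id].
have tw : nrm (0 + t%:C * w) <= nrm w.
  by rewrite add0r nrmM nrm_real ger0_norm // ler_piMl ?nrm_ge0.
apply: le_trans (expC_bound1 _) _.
by apply: ler_pM; rewrite ?expR_ge0 ?nrm_ge0 ?ler_expR.
Qed.

End ComplexExponential.

(** * Mean values on circles and the maximum principle *)

Section MaximumPrinciple.
Variable R : realType.
Implicit Types (e r t M K : R) (z w c k : R[i]) (f g : R[i] -> R[i]).

(* Goursat for f o exp on the rectangle [rho, 0] x [0, 2 pi]: the horizontal
   sides cancel by periodicity, so the circle means do not depend on rho. *)
Lemma mean_bound f M : (forall z, nrm z <= 1 -> exists k, cdiff f z k) ->
  (forall t, 0 <= t <= 2 * pi -> nrm (f (expC ('i * t%:C))) <= M) -> nrm (f 0) <= M.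
Proof.
move=> D HM; have p0 : 0 < pi :> R := pi_gt0 R.
have p20 : 0 <= 2 * pi :> R by rewrite mulr_ge0 // ltW.
apply/ler_addgt0Pr => e e0.
have [k /cdiff_cont /(_ e e0)[d d0 Hd]] := D 0 ltac:(by rewrite nrm0 ler01).
(* With this [rho] the inner circle has radius [expR rho < d], since [expR (1 / d)] exceeds
   [1 / d]. *)
pose rho : R := - ((1 / d) : R).
have rho0 : rho <= 0 by rewrite oppr_le0 divr_ge0 // ltW.
have erho : expR rho < d.
  rewrite /rho expRN -[ltRHS]invrK ltf_pV2 ?posrE ?expR_gt0 ?invr_gt0 //.
  by rewrite div1r; have := expR_ge1Dx (d^-1); lra.
have Dg : cdiff_rect (fun w => f (expC w)) rho 0 0 (2 * pi).
  move=> x y /andP[_ x0] _; have [k' Hk'] := D (expC (x +i* y)) ltac:(by rewrite nrm_expC -expR0 ler_expR).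
  by exists (k' * expC (x +i* y)); apply: cdiff_comp Hk'; exact: cdiff_expC.
have G := goursat rho0 p20 Dg; rewrite /boundary in G.
have E : hz (fun w => f (expC w)) 0 = hz (fun w => f (expC w)) (2 * pi).
  apply/funext => x; rewrite /hz; congr f.
  have -> : x +i* (2 * pi) = x%:C + 'i * (2 * pi)%:C by cring.
  by rewrite expCD expC_2pi mulr1.
move: G; rewrite E subrr add0r => /eqP; rewrite mulf_eq0 -nrm_eq0 nrm_i oner_eq0 /=.
rewrite subr_eq0 => /eqP Ev.
have V0 := vt_integ p20 (_ : rho <= 0 <= 0) Dg; rewrite rho0 lexx in V0; have {}V0 := V0 isT.
have V1 := vt_integ p20 (_ : rho <= rho <= 0) Dg; rewrite rho0 lexx in V1; have {}V1 := V1 isT.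
set v := integ _ _ _ in Ev V0; rewrite -Ev in V1.
have B0 : nrm v <= M * (2 * pi - 0).
  apply: isI_bound p20 _ V0 => t /HM; rewrite /vt; congr (nrm (f (expC _)) <= _).
  by cring.
have C := isI_affine (- f 0) 0 0 (2 * pi).
have B1 := isI_bound (M := e) p20 _ (isID V1 C).
have {}B1 : nrm (v + (- f 0 * (2 * pi - 0)%:C + 0 * ((2 * pi) ^+ 2 - 0 ^+ 2)%:C / 2)) <= e * (2 * pi - 0).
  apply: B1 => t _; rewrite mul0r addr0 /vt; apply: Hd.
  by rewrite subr0 nrm_expC.
move: B0 B1; rewrite !mul0r addr0 !subr0 => B0 B1.
have : nrm (f 0 * (2 * pi)%:C) <= (M + e) * (2 * pi).
  rewrite (_ : f 0 * _ = v - (v + - f 0 * (2 * pi)%:C)); last by ring.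
  by apply: le_trans (nrmB _ _) _; lra.
by rewrite nrmM nrm_real ger0_norm // ler_pM2r // mulr_gt0.
Qed.

(** The difference of the squared norms factors as [(1 - |a|^2) (1 - |w|^2)]. The resulting
    automorphism of the disc moves its centre to an arbitrary point, which is how [max_disc] follows
    from a bound at the centre. *)
Lemma mobius_le (a w : R[i]) : nrm a < 1 -> nrm w <= 1 ->
  [/\ 1 + a^* * w != 0, nrm (w + a) <= nrm (1 + a^* * w) &
      nrm w = 1 -> nrm (w + a) = nrm (1 + a^* * w)].
Proof.
move=> a1 w1.
have S : nrm (1 + a^* * w) ^+ 2 - nrm (w + a) ^+ 2 = (1 - nrm a ^+ 2) * (1 - nrm w ^+ 2).
  by rewrite !nrm_sqr; case: a {a1} => a b; case: w {w1} => c d /=; ring.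
have ha : nrm a ^+ 2 < 1 by rewrite expr_lt1 // nrm_ge0.
have hw : nrm w ^+ 2 <= 1 by rewrite expr_le1 // nrm_ge0.
have N0 : 1 + a^* * w != 0.
  rewrite -nrm_gt0; have := nrmD_ge 1 (a^* * w); rewrite nrm1 nrmM nrm_conj.
  have := nrm_ge0 a; have := nrm_ge0 w; nra.
split=> //.
  rewrite -(@ler_pXn2r _ 2) ?nnegrE ?nrm_ge0 // -subr_ge0 S.
  by rewrite mulr_ge0 // subr_ge0 // ltW.
move=> E; move: S; rewrite E expr1n subrr mulr0 => /eqP; rewrite subr_eq0 => /eqP S.
by apply/eqP; rewrite -(@eqrXn2 _ 2) ?nrm_ge0 // S.
Qed.

Lemma max_disc f c r M z1 : 0 < r ->
  (forall z, nrm (z - c) <= r -> exists k, cdiff f z k) -> nrm (z1 - c) < r ->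
  (forall z, nrm (z - c) = r -> nrm (f z) <= M) -> nrm (f z1) <= M.
Proof.
move=> r0 D z1r HM; have rC : r%:C != 0 by rewrite eq_complex /= gt_eqF.
pose a := (z1 - c) / r%:C.
have a1 : nrm a < 1.
  by rewrite nrmM nrmV nrm_real ger0_norm ?ltW // ltr_pdivrMr // mul1r.
pose p w := c + r%:C * ((w + a) / (1 + a^* * w)).
have pn w : nrm (p w - c) = r * (nrm (w + a) / nrm (1 + a^* * w)).
  by rewrite /p addrC addKr !nrmM nrmV nrm_real ger0_norm ?ltW.
have p0 : p 0 = z1 by rewrite /p /a mulr0 addr0 divr1 add0r mulrC divfK // addrC subrK.
rewrite -p0; apply: (@mean_bound (fun w => f (p w))) => [w w1|t _].
  have [N0 L _] := mobius_le a1 w1.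
  have pd : exists k, cdiff p w k.
    eexists; apply: cdiffD; first exact: cdiff_cst.
    apply: cdiffZ; apply: cdiffM; first by apply: cdiffD; [exact: cdiff_id|exact: cdiff_cst].
    apply: cdiffV; first exact: N0.
    by apply: cdiffD; [exact: cdiff_cst|apply: cdiffZ; exact: cdiff_id].
  have [k Hk] := pd; have [k' Hk'] := D (p w) ltac:(by
    rewrite pn ger_pMr // ler_pdivrMr ?mul1r // nrm_gt0).
  by exists (k' * k); apply: cdiff_comp Hk'.
have w1 : nrm (expC ('i * t%:C)) = 1.
  by rewrite nrm_expC /= !mul0r mulr0 subrr expR0.
have [N0 _ /(_ w1) E] := mobius_le a1 (w := expC ('i * t%:C)) ltac:(by rewrite w1).
by apply: HM; rewrite pn E divff ?mulr1 // nrm_eq0.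
Qed.

Lemma bernoulli_ineq (x : R) n : 0 <= x -> 1 + n%:R * x <= (1 + x) ^+ n.
Proof.
move=> x0; elim: n => [|n IH]; first by rewrite mul0r addr0 expr0.
have n0 : 0 <= n%:R :> R by [].
rewrite exprS -natr1; nra.
Qed.

Lemma pow_large (q B : R) : 1 < q -> exists n, B < q ^+ n.
Proof.
move=> q1; have B0 : 0 <= `|B| / (q - 1) by rewrite divr_ge0 //; lra.
exists (Num.Def.archi_bound (`|B| / (q - 1))).
have := archi_boundP B0; rewrite ltr_pdivrMr; last lra.
set n := Num.Def.archi_bound _ => H.
have := bernoulli_ineq n (x := q - 1) ltac:(lra).
rewrite (_ : 1 + (q - 1) = q); last by ring.
have := ler_norm B; lra.
Qed.

Lemma pow_small (q e : R) : 0 <= q -> q < 1 -> 0 < e -> exists n, q ^+ n < e.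
Proof.
move=> q0 q1 e0; move: q0; rewrite le_eqVlt => /orP[/eqP <-|q0].
  by exists 1%N; rewrite expr1.
have q2 : 1 < q^-1 by rewrite invf_gt1.
have [n Hn] := @pow_large q^-1 e^-1 q2.
by exists n; move: Hn; rewrite exprVn ltf_pV2 ?posrE ?exprn_gt0.
Qed.

Definition lbdd f z := exists K, nb z (fun w => nrm (f w) <= K).

Lemma cdiff_lbdd f z k : cdiff f z k -> lbdd f z.
Proof. by move=> /cdiff_cont /ccont_bnd H; exists (nrm (f z) + 1). Qed.

Lemma lbddD f g z : lbdd f z -> lbdd g z -> lbdd (fun w => f w + g w) z.
Proof.
move=> [K H] [K' H']; exists (K + K'); apply: nbW (nb_and H H') => w [h h'].
by apply: le_trans (nrmD _ _) _; lra.
Qed.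

Lemma lbddM f g z : lbdd f z -> lbdd g z -> lbdd (fun w => f w * g w) z.
Proof.
move=> [K H] [K' H']; exists (K * K'); apply: nbW (nb_and H H') => w [h h'].
by rewrite nrmM ler_pM ?nrm_ge0.
Qed.

Lemma lbddX f z n : lbdd f z -> lbdd (fun w => f w ^+ n) z.
Proof.
move=> [K H]; exists (K ^+ n); apply: nbW H => w h.
rewrite nrmX; have K0 : 0 <= K by apply: le_trans h; exact: nrm_ge0.
by rewrite lerXn2r ?nnegrE ?nrm_ge0.
Qed.

(** A double zero turns a bounded singularity into a point of differentiability, whatever the value
    of [f] at that point. *)
Lemma lbdd_sq f z : lbdd f z -> cdiff (fun w => (w - z) ^+ 2 * f w) z 0.
Proof.
move=> [K H] e e0; have K1 : 0 < `|K| + 1 by rewrite ltr_wpDl.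
apply: nbW (nb_and H (@nb_near R z (e / (`|K| + 1)) _)); last exact: divr_gt0.
move=> w [h1 h2]; rewrite subrr expr0n /= mul0r subr0 mulr0 subr0.
rewrite nrmM nrmX expr2 -mulrA mulrC ler_wpM2r ?nrm_ge0 //.
move: h2; rewrite ltr_pdivlMr // => h2; apply: le_trans (ltW h2).
rewrite ler_wpM2l ?nrm_ge0 //; have := ler_norm K; lra.
Qed.

(** Multiplying [f ^+ n] by a polynomial [Q] with double zeros at the exceptional points makes it
    differentiable everywhere; letting [n] grow then removes the influence of [Q] on the bound. *)
Lemma max_disc_exc f c r M z1 (E : seq R[i]) : 0 < r ->
  (forall z, nrm (z - c) <= r -> z \notin E -> exists k, cdiff f z k) ->
  (forall a, a \in E -> lbdd f a) ->
  nrm (z1 - c) < r -> z1 \notin E ->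
  (forall z, nrm (z - c) = r -> nrm (f z) <= M) -> nrm (f z1) <= M.
Proof.
move=> r0 D L z1r z1E HM.
have M0 : 0 <= M.
  apply: le_trans (nrm_ge0 _) (HM (c + r%:C) _).
  by rewrite addrC addKr nrm_real ger0_norm ?ltW.
pose Q z := \prod_(a <- undup E) (z - a) ^+ 2.
have Qd z : exists k, cdiff Q z k.
  rewrite /Q; elim: (undup E) => [|a s [k Hk]].
    by exists 0; apply: cdiff_ext (cdiff_cst 1 z) => w; rewrite big_nil.
  eexists; apply: (@cdiff_ext _ (fun w => (w - a) ^+ 2 * \prod_(a <- s) (w - a) ^+ 2)).
    by move=> w; rewrite big_cons.
  apply: cdiffM Hk; apply: cdiffX; apply: cdiffB; [exact: cdiff_id|exact: cdiff_cst].
have Q1 : 0 < nrm (Q z1).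
  rewrite nrm_gt0 /Q prodf_seq_neq0; apply/allP => a; rewrite mem_undup => aE /=.
  rewrite expf_neq0 // subr_eq0; apply/eqP => E1; move: z1E; by rewrite E1 aE.
pose S := \prod_(a <- undup E) (r + nrm (c - a)) ^+ 2.
have QS z : nrm (z - c) = r -> nrm (Q z) <= S.
  move=> zr; rewrite /Q /S nrm_prod ler_prod // => a _.
  rewrite nrmX exprn_ge0 ?nrm_ge0 //= ler_pXn2r ?nnegrE ?addr_ge0 ?nrm_ge0 ?(ltW r0) //.
  rewrite (_ : z - a = (z - c) + (c - a)); last by ring.
  by apply: le_trans (nrmD _ _) _; rewrite zr.
have key n : nrm (f z1) ^+ n * nrm (Q z1) <= M ^+ n * S.
  rewrite -nrmX -nrmM.
  apply: (@max_disc (fun z => f z ^+ n * Q z) c r) => // [z zr|z zr].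
    have [k Hk] := Qd z; case: (boolP (z \in E)) => zE; last first.
      have [k' Hk'] := D z zr zE; eexists.
      by apply: cdiffM Hk; apply: cdiffX Hk'.
    exists 0; pose Q' w := \prod_(a <- rem z (undup E)) (w - a) ^+ 2.
    apply: (@cdiff_ext _ (fun w => (w - z) ^+ 2 * (f w ^+ n * Q' w))) => [w|].
      rewrite /Q (perm_big _ (perm_to_rem (_ : z \in undup E))) /=; last by rewrite mem_undup.
      by rewrite big_cons /Q'; ring.
    apply: lbdd_sq; apply: lbddM; first by apply: lbddX; apply: L.
    rewrite /Q'; elim: (rem z _) => [|a s IH].
      by exists 1; apply: nbT => w; rewrite big_nil nrm1.
    have [K HK] : lbdd (fun w => (w - a) ^+ 2 * \prod_(a <- s) (w - a) ^+ 2) z.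
      apply: lbddM IH; apply: cdiff_lbdd; apply: cdiffX.
      by apply: cdiffB; [exact: cdiff_id|exact: cdiff_cst].
    by exists K; apply: nbW HK => w; rewrite big_cons.
  rewrite nrmM nrmX ler_pM ?exprn_ge0 ?nrm_ge0 ?QS //.
  by rewrite lerXn2r ?nnegrE ?nrm_ge0 ?HM.
rewrite leNgt; apply/negP => bad.
move: M0; rewrite le_eqVlt => /orP[/eqP M0|M0].
  have := key 1%N; rewrite -M0 !expr1 mul0r; apply/negP; rewrite -ltNge.
  by rewrite mulr_gt0 // M0.
have [n] := @pow_large (nrm (f z1) / M) (S / nrm (Q z1)) ltac:(by rewrite ltr_pdivlMr ?mul1r).
rewrite ltr_pdivrMr // expr_div_n -mulrA mulrC -mulrA.
rewrite ltr_pdivlMl ?exprn_gt0 // mulrC [X in _ < X]mulrC => H.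
by have := key n; rewrite (mulrC (nrm (f z1) ^+ n)) leNgt H.
Qed.

End MaximumPrinciple.

(** * Unique continuation, Liouville's theorem, termwise differentiation *)

Section GlobalTheorems.
Variable R : realType.
Implicit Types (a b c d e r t M K : R) (z w k : R[i]) (f g : R[i] -> R[i]).

(** Compactness by quadrisection: an unbounded rectangle always has an unbounded quarter, against
    local boundedness at the common point. *)
Lemma rect_bounded f a b c d : a <= b -> c <= d ->
  (forall x y, a <= x <= b -> c <= y <= d -> lbdd f (x +i* y)) ->
  exists K, forall x y, a <= x <= b -> c <= y <= d -> nrm (f (x +i* y)) <= K.
Proof.
move=> ab cd L; apply: contrapT => bad.
pose T := (R * R * (R * R))%type.
pose bd (q : T) := exists K, forall x y, q.1.1 <= x <= q.1.2 -> q.2.1 <= y <= q.2.2 ->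
  nrm (f (x +i* y)) <= K.
pose m1 (q : T) := (q.1.1 + q.1.2) / 2; pose m2 (q : T) := (q.2.1 + q.2.2) / 2.
pose s1 (q : T) : T := ((q.1.1, m1 q), (q.2.1, m2 q)).
pose s2 (q : T) : T := ((m1 q, q.1.2), (q.2.1, m2 q)).
pose s3 (q : T) : T := ((q.1.1, m1 q), (m2 q, q.2.2)).
pose s4 (q : T) : T := ((m1 q, q.1.2), (m2 q, q.2.2)).
pose st (q : T) := if `[< ~ bd (s1 q) >] then s1 q else
  if `[< ~ bd (s2 q) >] then s2 q else if `[< ~ bd (s3 q) >] then s3 q else s4 q.
pose q n := iter n st ((a, b), (c, d)).
have qS n : q n.+1 = st (q n) by [].
have stc (r : T) : [\/ st r = s1 r, st r = s2 r, st r = s3 r | st r = s4 r].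
  rewrite /st; case: ifP => _; first by constructor 1.
  case: ifP => _; first by constructor 2.
  by case: ifP => _; [constructor 3|constructor 4].
have w1 n : (q n).1.2 - (q n).1.1 = (b - a) / 2 ^+ n.
  elim: n => [|n IH]; first by rewrite expr0 divr1.
  rewrite qS exprS invfM mulrCA -IH; case: (stc (q n)) => -> /=; rewrite /m1; lra.
have w2 n : (q n).2.2 - (q n).2.1 = (d - c) / 2 ^+ n.
  elim: n => [|n IH]; first by rewrite expr0 divr1.
  rewrite qS exprS invfM mulrCA -IH; case: (stc (q n)) => -> /=; rewrite /m2; lra.
have l1 n : (q n).1.1 <= (q n).1.2 by rewrite -subr_ge0 w1 divr_ge0 ?subr_ge0 ?exprn_ge0.
have l2 n : (q n).2.1 <= (q n).2.2 by rewrite -subr_ge0 w2 divr_ge0 ?subr_ge0 ?exprn_ge0.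
have i1 n : (q n).1.1 <= (q n.+1).1.1.
  rewrite qS; case: (stc (q n)) => -> //=; rewrite /m1; have := l1 n; lra.
have i2 n : (q n.+1).1.2 <= (q n).1.2.
  rewrite qS; case: (stc (q n)) => -> //=; rewrite /m1; have := l1 n; lra.
have i3 n : (q n).2.1 <= (q n.+1).2.1.
  rewrite qS; case: (stc (q n)) => -> //=; rewrite /m2; have := l2 n; lra.
have i4 n : (q n.+1).2.2 <= (q n).2.2.
  rewrite qS; case: (stc (q n)) => -> //=; rewrite /m2; have := l2 n; lra.
have bn n : ~ bd (q n).
  elim: n => // n IH; rewrite qS /st; case: asboolP => // /contrapT[K1 h1].
  case: asboolP => // /contrapT[K2 h2]; case: asboolP => // /contrapT[K3 h3] [K4 h4].
  apply: IH; exists (Num.max (Num.max K1 K2) (Num.max K3 K4)) => x y /andP[x1 x2] /andP[y1 y2].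
  rewrite !le_max; case: (leP x (m1 (q n))) => x3; case: (leP y (m2 (q n))) => y3.
  - by rewrite h1 ?x1 ?y1.
  - by rewrite h3 ?x1 ?y2 ?andbT ?(ltW y3) ?orbT.
  - by rewrite h2 ?y1 ?x2 ?andbT ?(ltW x3) ?orbT.
  - by rewrite h4 ?x2 ?y2 ?andbT ?(ltW x3) ?(ltW y3) ?orbT.
have [x Hx] := nested_point i1 i2 l1; have [y Hy] := nested_point i3 i4 l2.
have [K [r r0 H]] := L x y (Hx 0%N) (Hy 0%N).
set W := (b - a) + (d - c).
have [n Hn] : exists n, W / 2 ^+ n < r.
  exists (Num.Def.archi_bound (W / r)).
  by rewrite ltr_pdivrMr ?exprn_gt0 // -ltr_pdivrMl // mulrC upper_nthrootP.
apply: (bn n); exists K => x' y' hx' hy'; apply: H.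
have -> : (x' +i* y') - (x +i* y) = (x' - x)%:C + 'i * (y' - y)%:C by cring.
apply: le_lt_trans (nrmD _ _) _; rewrite nrmM nrm_i mul1r !nrm_real.
apply: le_lt_trans Hn; rewrite /W mulrDl -w1 -w2; apply: lerD; rewrite ler_norml.
  by have := Hx n; lra.
by have := Hy n; lra.
Qed.

Lemma ball_bounded f (c : R[i]) r : (forall z, `|complex.Re (z - c)| <= r ->
    `|complex.Im (z - c)| <= r -> lbdd f z) ->
  exists2 K, 0 <= K & forall z, nrm (z - c) <= r -> nrm (f z) <= K.
Proof.
case: (leP 0 r) => [r0 L|r0 _]; last first.
  by exists 0 => // z /(le_trans (nrm_ge0 _)); rewrite leNgt r0.
have h1 : complex.Re c - r <= complex.Re c + r by lra.
have h2 : complex.Im c - r <= complex.Im c + r by lra.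
have [|K HK] := rect_bounded h1 h2 (f := f).
  move=> x y hx hy; apply: L; rewrite ?ReD ?ImD ?ReN ?ImN /= ler_norml; lra.
exists `|K| => // z zr; apply: le_trans (ler_norm K).
have := le_trans (Re_le_nrm _) zr; have := le_trans (Im_le_nrm _) zr.
rewrite ReD ImD ReN ImN !ler_norml => hx hy.
by rewrite (_ : z = complex.Re z +i* complex.Im z); [apply: HK; lra|case: (z)].
Qed.

(** The maximum principle for [H s * (s - T)^-N] on a disc centred at [T] whose radius [r] exceeds
    [T]: the point 0 is inside, and the bound there is [K * (T / r)^N]. The pole at [T] is harmless
    because [H] vanishes near it. *)
Lemma continuation_uniq (H : R[i] -> R[i]) (sigma tau : R) : sigma < 0 ->
  (forall s, sigma < complex.Re s -> exists k, cdiff H s k) ->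
  (forall s, tau < complex.Re s -> H s = 0) -> H 0 = 0.
Proof.
move=> s0 D Z; pose T : R := Num.max tau 0 + 1; pose r := T - sigma / 2.
have T0 : 1 <= T by rewrite /T lerDr le_max lexx orbT.
have Tm : tau <= Num.max tau 0 by rewrite le_max lexx.
have Tt : tau < T by rewrite /T; lra.
have r0 : 0 < r by rewrite /r; lra.
have dom z : nrm (z - T%:C) <= r -> sigma < complex.Re z.
  move=> zr; have := le_trans (Re_le_nrm _) zr; rewrite ReD ReN /= ler_norml /r; lra.
have [K K0 HK] : exists2 K, 0 <= K & forall z, nrm (z - T%:C) <= r -> nrm (H z) <= K.
  apply: ball_bounded => z; rewrite ReD ReN /= ler_norml /r => h _.
  have [|k Hk] := D z; first lra.
  exact: cdiff_lbdd Hk.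
have key N : nrm (H 0) * (T ^+ N)^-1 <= K * (r ^+ N)^-1.
  have := @max_disc R (fun s => H s * ((s - T%:C)^-1) ^+ N) T%:C r (K * (r ^+ N)^-1) 0 r0.
  rewrite sub0r nrmM nrmX nrmV nrmN nrm_real ger0_norm; last lra.
  rewrite exprVn; apply.
  - move=> z zr; have [k Hk] := D z (dom z zr).
    case: (eqVneq z T%:C) => [->|zT].
      exists 0; apply: (@cdiff_near R (fun=> 0)); last exact: cdiff_cst.
      exists (T - tau); first lra.
      move=> w wT; rewrite Z ?mul0r //.
      by have := le_lt_trans (Re_le_nrm _) wT; rewrite ReD ReN /= ltr_norml; lra.
    eexists; apply: cdiffM; first exact: Hk.
    apply: cdiffX; apply: cdiffV; first by rewrite subr_eq0.
    by apply: cdiffB; [exact: cdiff_id|exact: cdiff_cst].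
  - rewrite /r; lra.
  - move=> z zr; rewrite nrmM nrmX nrmV zr exprVn ler_wpM2r ?HK ?zr //.
    by rewrite invr_ge0 exprn_ge0 // ltW.
apply: nrm_le0 => e e0.
have q1 : T / r < 1 by rewrite ltr_pdivrMr // mul1r /r; lra.
have q0 : 0 <= T / r by rewrite divr_ge0 ?ltW //; lra.
have [N HN] := pow_small q0 q1 (e := e / (K + 1)) ltac:(by rewrite divr_gt0 //; lra).
have TN : 0 < T ^+ N by rewrite exprn_gt0 //; lra.
have := key N; rewrite ler_pdivrMr // => k1; apply: le_trans k1 _.
rewrite -mulrA [X in _ * X]mulrC -expr_div_n.
move: HN; rewrite ltr_pdivlMr; last lra.
have : 0 <= (T / r) ^+ N by rewrite exprn_ge0.
nra.
Qed.

Definition diffq f z0 z := (f z - f z0) / (z - z0).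

Lemma diffq_cdiff f z0 z k : z != z0 -> cdiff f z k -> exists k', cdiff (diffq f z0) z k'.
Proof.
move=> zz D; eexists; apply: cdiffM.
  by apply: cdiffB; [exact: D|exact: cdiff_cst].
apply: cdiffV; first by rewrite subr_eq0.
by apply: cdiffB; [exact: cdiff_id|exact: cdiff_cst].
Qed.

Lemma diffq_lbdd_near f z0 k : cdiff f z0 k -> lbdd (diffq f z0) z0.
Proof.
move=> /cdiff_lip H; exists (nrm k + 1); apply: nbW H => w H; rewrite /diffq.
case: (eqVneq w z0) => [->|wz].
  rewrite subrr mul0r nrm0; have := nrm_ge0 k; lra.
by rewrite nrmM nrmV ler_pdivrMr // nrm_gt0 subr_eq0.
Qed.

Lemma diffq_lbdd f z0 z : z != z0 -> lbdd f z -> lbdd (diffq f z0) z.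
Proof.
move=> zz L; apply: lbddM.
  by apply: lbddD L _; apply: (@cdiff_lbdd _ _ _ 0); exact: cdiff_cst.
have D : cdiff (fun w => w - z0) z (1 - 0).
  by apply: cdiffB; [exact: cdiff_id|exact: cdiff_cst].
by apply: (cdiff_lbdd (cdiffV _ D)); rewrite subr_eq0.
Qed.

(** The difference quotient at [z0] tends to zero on large circles, so [max_disc_exc] makes it zero
    at [z1]. Allowing sublinear growth and locally bounded exceptional points lets the lemma act on
    functions with arbitrary values at their removed poles. *)
Lemma liouville g z0 z1 k0 k1 :
  (forall B, exists E : seq R[i], forall z, nrm z <= B -> z \notin E -> exists k, cdiff g z k) ->
  (forall z, lbdd g z) ->
  (forall e, 0 < e -> exists B, forall z, B <= nrm z -> nrm (g z) <= e * nrm z) ->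
  cdiff g z0 k0 -> cdiff g z1 k1 -> g z0 = g z1.
Proof.
move=> D L G D0 D1; case: (eqVneq z0 z1) => [->//|z01].
have nz : 0 < nrm (z1 - z0) by rewrite nrm_gt0 subr_eq0 eq_sym.
apply/eqP; rewrite eq_sym -subr_eq0; apply/eqP/nrm_le0 => e e0.
pose e' := e / 4 / nrm (z1 - z0); have e'0 : 0 < e' by rewrite !divr_gt0.
have [B HB] := G e' e'0.
pose r := `|B| + 1 + nrm z0 *+ 2 + nrm z1 + nrm (g z0) / e'.
have gz : 0 <= nrm (g z0) / e' by rewrite divr_ge0 ?nrm_ge0 ?ltW.
have nz0 := nrm_ge0 z0; have nz1 := nrm_ge0 z1; have nB := normr_ge0 B.
have r0 : 0 < r by rewrite /r; lra.
have [E HE] := D r.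
pose E' := z0 :: [seq z <- E | z != z1].
have : nrm (diffq g z0 z1) <= 4 * e'.
  apply: (@max_disc_exc R (diffq g z0) 0 r _ z1 E') => //.
  - move=> z; rewrite subr0 inE negb_or mem_filter negb_and negbK => zr /andP[z00].
    case/orP=> [/eqP ->|zE]; first by apply: diffq_cdiff D1; rewrite eq_sym.
    by have [k Hk] := HE z zr zE; apply: diffq_cdiff Hk.
  - move=> a _; case: (eqVneq a z0) => [->|az]; first exact: diffq_lbdd_near D0.
    exact: diffq_lbdd.
  - by rewrite subr0 /r; lra.
  - by rewrite inE negb_or eq_sym z01 mem_filter eqxx.
  - move=> z; rewrite subr0 => zr; rewrite nrmM nrmV.
    have h1 : r - nrm z0 <= nrm (z - z0) by have := nrmB_ge z z0; rewrite zr.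
    have h2 : nrm (g z) <= e' * r.
      by rewrite -zr; apply: HB; rewrite zr /r; have := ler_norm B; lra.
    have h3 : nrm (g z0) <= e' * r.
      rewrite mulrC -ler_pdivrMr //; rewrite /r; lra.
    have h4 : r <= 2 * (r - nrm z0) by rewrite /r; lra.
    have h5 : 0 < nrm (z - z0) by apply: lt_le_trans h1; lra.
    rewrite ler_pdivrMr //; apply: le_trans (nrmB _ _) _.
    have h6 : r <= 2 * nrm (z - z0) by lra.
    have : e' * r <= e' * (2 * nrm (z - z0)) by rewrite ler_pM2l.
    lra.
rewrite nrmM nrmV ler_pdivrMr // /e' (_ : 4 * _ * _ = e) //.
by field; rewrite gt_eqF.
Qed.

(** A substitute for Cauchy's estimates: [2 * M / r] for the difference quotient and [3 * M / r] for
    the derivative, both from the maximum principle. *)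
Lemma diff_quot_bound f z0 r M k z1 : 0 < r ->
  (forall z, nrm (z - z0) <= r -> exists k, cdiff f z k) ->
  (forall z, nrm (z - z0) <= r -> nrm (f z) <= M) -> cdiff f z0 k ->
  nrm (z1 - z0) < r -> nrm (f z1 - f z0 - (z1 - z0) * k) <= 5 * M / r * nrm (z1 - z0).
Proof.
move=> r0 D HM Dk z1r.
have M0 : 0 <= M by apply: le_trans (nrm_ge0 _) (HM z0 _); rewrite subrr nrm0 ltW.
have B w : nrm (w - z0) < r -> nrm (f w - f z0) <= 2 * M / r * nrm (w - z0).
  move=> wr; case: (eqVneq w z0) => [->|wz]; first by rewrite !subrr nrm0 mulr0.
  have : nrm (diffq f z0 w) <= 2 * M / r.
    apply: (@max_disc_exc R (diffq f z0) z0 r _ w [:: z0]) => //.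
    - by move=> z zr; rewrite inE => zz; have [k' Hk'] := D z zr; apply: diffq_cdiff Hk'.
    - by move=> a; rewrite inE => /eqP ->; exact: diffq_lbdd_near Dk.
    - by rewrite inE.
    - move=> z zr; rewrite nrmM nrmV zr ler_wpM2r ?invr_ge0 ?(ltW r0) //.
      apply: le_trans (nrmB _ _) _; have := HM z; rewrite zr lexx => /(_ isT).
      by have := HM z0; rewrite subrr nrm0 (ltW r0) => /(_ isT); lra.
  by rewrite nrmM nrmV ler_pdivrMr // nrm_gt0 subr_eq0.
have Mr : 0 <= M / r by rewrite divr_ge0 ?(ltW r0).
have kb : nrm k <= 3 * M / r.
  apply/ler_addgt0Pr => e e0.
  have [d d0 H] := Dk e e0; pose x := Num.min d r / 2.
  have x0 : 0 < x by rewrite divr_gt0 // lt_min d0.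
  have m0 : 0 < Num.min d r by rewrite lt_min d0.
  have m1 : Num.min d r <= d by rewrite ge_min lexx.
  have m2 : Num.min d r <= r by rewrite ge_min lexx orbT.
  have xd : x < d by rewrite /x; lra.
  have xr : x < r by rewrite /x; lra.
  pose w := z0 + x%:C; have wz : w - z0 = x%:C by rewrite /w addrC addKr.
  have nw : nrm (w - z0) = x by rewrite wz nrm_real gtr0_norm.
  have := H w; rewrite nw => /(_ xd) h1; have := B w; rewrite nw => /(_ xr) h2.
  have : nrm ((w - z0) * k) <= (2 * M / r + e) * x.
    rewrite (_ : (w - z0) * k = (f w - f z0) - (f w - f z0 - (w - z0) * k)); last by ring.
    by apply: le_trans (nrmB _ _) _; lra.
  rewrite nrmM nw mulrC ler_pM2r //; rewrite -!mulrA; lra.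
apply: le_trans (nrmB _ _) _; rewrite nrmM.
have := B z1 z1r; have : nrm k * nrm (z1 - z0) <= 3 * M / r * nrm (z1 - z0).
  by rewrite ler_wpM2r ?nrm_ge0.
rewrite (mulrC (nrm (z1 - z0)) (nrm k)).
rewrite -!mulrA; lra.
Qed.

Lemma deriv_bound f z0 r M k : 0 < r ->
  (forall z, nrm (z - z0) <= r -> exists k, cdiff f z k) ->
  (forall z, nrm (z - z0) <= r -> nrm (f z) <= M) -> cdiff f z0 k ->
  nrm k <= 14 * M / r.
Proof.
move=> r0 D HM Dk; pose w := z0 + (r / 2)%:C.
have wz : w - z0 = (r / 2)%:C by rewrite /w addrC addKr.
have nw : nrm (w - z0) = r / 2 by rewrite wz nrm_real ger0_norm // ltW // divr_gt0.
have := @diff_quot_bound f z0 r M k w r0 D HM Dk; rewrite nw.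
move=> /(_ ltac:(lra)) h.
have h1 := HM w; rewrite nw in h1; have {}h1 := h1 ltac:(lra).
have h2 := HM z0; rewrite subrr nrm0 in h2; have {}h2 := h2 (ltW r0).
have : nrm ((w - z0) * k) <= 2 * M + 5 * M / r * (r / 2).
  rewrite (_ : (w - z0) * k = (f w - f z0) - (f w - f z0 - (w - z0) * k)); last by ring.
  by apply: le_trans (nrmB _ _) _; have := nrmB (f w) (f z0); lra.
rewrite nrmM nw.
have M0 : 0 <= M by apply: le_trans (nrm_ge0 _) h2.
rewrite (_ : 5 * M / r * (r / 2) = 5 / 2 * M); last by field; rewrite gt_eqF.
rewrite ler_pdivlMr //; lra.
Qed.

Section TermwiseDifferentiation.
Variable I : choiceType.
Variables (f : I -> R[i] -> R[i]) (df : I -> R[i]) (z0 : R[i]) (r : R) (M : I -> R).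
Variable s0 : seq I.
Hypothesis r0 : 0 < r.
Hypothesis fD : forall i z, nrm (z - z0) <= r -> exists k, cdiff (f i) z k.
Hypothesis fd : forall i, cdiff (f i) z0 (df i).
Hypothesis fM : forall i z, i \notin s0 -> nrm (z - z0) <= r -> nrm (f i z) <= M i.
Hypothesis Ms : absm (fun i => (M i)%:C).

Lemma absm_exc (g h : I -> R[i]) : (forall i, i \notin s0 -> nrm (g i) <= nrm (h i)) ->
  absm h -> absm g.
Proof.
move=> gh ah.
have a1 : absm (restr (mem s0) g).
  by apply: (@absm_fin _ _ _ s0) => i si; rewrite /restr /= (negbTE si).
have a2 : absm (restr (fun i => i \notin s0) g).
  apply: absm_le ah => i; rewrite /restr; case: ifP => [/gh //|_].
  by rewrite nrm0 nrm_ge0.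
apply: absm_ext (absmD a1 a2) => i; rewrite /restr /=.
by case: (i \in s0); rewrite ?addr0 ?add0r.
Qed.

Lemma termwise_absm z : nrm (z - z0) <= r -> absm (fun i => f i z).
Proof.
move=> zr; apply: absm_exc Ms => i si; rewrite nrm_real.
by apply: le_trans (ler_norm _); apply: fM.
Qed.

Lemma termwise_absm_d : absm df.
Proof.
apply: absm_exc (absmZ (14 / r)%:C Ms) => i si.
rewrite nrmM !nrm_real; have := deriv_bound r0 (fD i) (fun z => @fM i z si) (fd i).
rewrite ger0_norm; last by rewrite divr_ge0 // ltW.
move=> /le_trans; apply; rewrite mulrAC ler_wpM2l ?ler_norm //.
by rewrite divr_ge0 // ltW.
Qed.

(** Weierstrass M-test. The finite head, which includes [s0], is differentiated term by term; by
    [diff_quot_bound] the tail of the difference quotients is dominated by [5 / r] times [M]. *)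
Lemma csum_cdiff : cdiff (fun z => csum (fun i => f i z)) z0 (csum df).
Proof.
move=> e e0.
have [s1 [u1 K1]] := tail_bound (absmZ (5 / r)%:C Ms) (e := e / 2) ltac:(lra).
pose s := undup (s0 ++ s1); have us : uniq s by exact: undup_uniq.
have Ds : cdiff (fun z => \sum_(i <- s) f i z) z0 (\sum_(i <- s) df i).
  by apply: cdiff_sum => i _.
apply: nbW (nb_and (Ds (e / 2) ltac:(lra)) (@nb_near R z0 r r0)) => w [h1 wr].
have aw := termwise_absm (ltW wr).
have a0 := termwise_absm (z := z0) ltac:(by rewrite subrr nrm0 ltW).
have ad := termwise_absm_d.
rewrite (csum_split aw us) (csum_split a0 us) (csum_split ad us).
set P := fun i => i \notin s.
have aw' := absm_restr P aw; have a0' := absm_restr P a0; have ad' := absm_restr P ad.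
rewrite (_ : _ - _ - _ = (\sum_(i <- s) f i w - \sum_(i <- s) f i z0 - (w - z0) * \sum_(i <- s) df i) +
  csum (fun i => restr P (f^~ w) i - restr P (f^~ z0) i - (w - z0) * restr P df i)); last first.
  by rewrite csumB ?csumB ?csumZ //; [ring|exact: absmB|exact: absmZ].
apply: le_trans (nrmD _ _) _; suff : nrm (csum (fun i => restr P (f^~ w) i -
   restr P (f^~ z0) i - (w - z0) * restr P df i)) <= e / 2 * nrm (w - z0) by lra.
case: (eqVneq w z0) => [->|wz].
  rewrite subrr nrm0 mulr0 (@csum_ext _ _ _ (fun=> 0)) ?(csum_eq (@hs0 _ _)) ?nrm0 // => i.
  by rewrite subrr mul0r subr0.
have nz : w - z0 != 0 by rewrite subr_eq0.
set G := fun i => _.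
have -> : csum G = (w - z0) * csum (fun i => (w - z0)^-1 * G i).
  by rewrite csumZ ?mulVKf //; apply: absmB; [exact: absmB|exact: absmZ].
rewrite nrmM mulrC ler_wpM2r ?nrm_ge0 //; apply: csum_nrm_le; apply: K1 => i; last first.
  move=> si; rewrite /G /restr /P mem_undup mem_cat si orbT /=.
  by rewrite subrr mulr0 subr0 mulr0.
rewrite /G /restr; case: ifP => [|_]; last by rewrite subrr mulr0 subr0 mulr0 nrm0 nrm_ge0.
rewrite /P mem_undup mem_cat negb_or => /andP[si _].
rewrite !nrmM nrmV mulrC ler_pdivrMr ?nrm_gt0 //.
have := diff_quot_bound r0 (fD i) (fun z => @fM i z si) (fd i) wr.
move=> /le_trans; apply; rewrite !nrm_real ler_wpM2r ?nrm_ge0 //.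
rewrite (@ger0_norm _ (5 / r)); last by rewrite divr_ge0 // ltW.
rewrite mulrAC ler_wpM2l ?ler_norm //.
by rewrite divr_ge0 // ltW.
Qed.

End TermwiseDifferentiation.

End GlobalTheorems.

(** * A summable weight on pairs of integers *)

Section Weights.
Variable R : realType.
Implicit Types (x y : R) (m n : int).

Definition root4 x : R := Num.sqrt (Num.sqrt x).

Lemma root4X x : 0 <= x -> root4 x ^+ 4 = x.
Proof.
by move=> x0; rewrite /root4 (exprM _ 2 2) !sqr_sqrtr ?sqrtr_ge0.
Qed.

Lemma root4_gt0 x : 0 < x -> 0 < root4 x.
Proof. by move=> x0; rewrite !sqrtr_gt0. Qed.

Lemma root4M x y : 0 <= x -> root4 (x * y) = root4 x * root4 y.
Proof. by move=> x0; rewrite /root4 !sqrtrM ?sqrtr_ge0. Qed.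

Lemma root4_le x y : x <= y -> root4 x <= root4 y.
Proof. by move=> xy; rewrite /root4 !ler_wsqrtr. Qed.

(** This is [(n + 1)^(-5/4)]. The product of two such weights matches [|l|^(-5/2)] on a lattice of
    rank 2, the decay that the continued series have. *)
Definition wnat (n : nat) : R := (root4 n.+1%:R ^+ 5)^-1.

Lemma wnat_gt0 (n : nat) : 0 < wnat n.
Proof. by rewrite invr_gt0 exprn_gt0 // root4_gt0. Qed.

(** Telescoping: with [t], [s] the fourth roots of consecutive integers, [s^4 - t^4 = 1] gives
    [s^-5 <= 4 / t - 4 / s]. *)
Lemma sum_wnat (N : nat) : \sum_(n <- iota 0 N.+1) wnat n <= 5 - 4 / root4 N.+1%:R.
Proof.
elim: N => [|N IH].
  rewrite big_seq1 /wnat /root4 !sqrtr1 expr1n; lra.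
rewrite -addn1 iotaD big_cat /= add0n big_seq1.
have t0 : 0 < root4 N.+1%:R :> R by apply: root4_gt0.
have s0 : 0 < root4 N.+2%:R :> R by apply: root4_gt0.
have ts : root4 N.+1%:R <= root4 N.+2%:R :> R by apply: root4_le; rewrite ler_nat.
have t4 : root4 N.+1%:R ^+ 4 = N.+1%:R :> R by apply: root4X.
have s4 : root4 N.+2%:R ^+ 4 = N.+1%:R + 1 :> R by rewrite root4X // natr1.
move: IH; rewrite addn1 /wnat; move: t0 s0 ts t4 s4.
set t := root4 N.+1%:R; set s := root4 N.+2%:R => t0 s0 ts t4 s4 IH.
suff H : (s ^+ 5)^-1 <= 4 / t - 4 / s by lra.
have E : s ^+ 4 - t ^+ 4 = 1 by rewrite s4 t4; ring.
have E2 : (s - t) * (s ^+ 3 + s ^+ 2 * t + s * t ^+ 2 + t ^+ 3) = 1 by rewrite -E; ring.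
have st : 0 <= s - t by lra.
have B : 1 <= (s - t) * (4 * s ^+ 3).
  rewrite -[leLHS]E2 ler_wpM2l //.
  have h1 : s ^+ 2 * t <= s ^+ 2 * s by rewrite ler_wpM2l // sqr_ge0.
  have h2 : t ^+ 2 <= s ^+ 2 by rewrite ler_pXn2r ?nnegrE ?(ltW t0) ?(ltW s0).
  have h3 : s * t ^+ 2 <= s * s ^+ 2 by rewrite ler_wpM2l // ltW.
  have h4 : t ^+ 3 <= s ^+ 3 by rewrite ler_pXn2r ?nnegrE ?(ltW t0) ?(ltW s0).
  have -> : 4 * s ^+ 3 = s ^+ 3 + s ^+ 2 * s + s * s ^+ 2 + s ^+ 3 by ring.
  lra.
have -> : 4 / t - 4 / s = 4 * (s - t) / (t * s) by field; rewrite !gt_eqF.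
rewrite ler_pdivlMr ?mulr_gt0 // ler_pdivrMl ?exprn_gt0 //.
have h5 : t * s <= s * s by rewrite ler_wpM2r // ltW.
apply: le_trans h5 _.
have -> : s ^+ 5 * (4 * (s - t)) = s * s * ((s - t) * (4 * s ^+ 3)) by ring.
by rewrite ler_peMr // mulr_ge0 // ltW.
Qed.

Lemma absm_wnat : absm (fun n : nat => (wnat n)%:C).
Proof.
exists 5 => s us.
apply: (@le_trans _ _ (\sum_(n <- iota 0 (\max_(i <- s) i).+1) wnat n)).
  have -> : \sum_(n <- s) nrm (wnat n)%:C = \sum_(n <- s) wnat n.
    by apply: eq_bigr => n _; rewrite nrm_real gtr0_norm ?wnat_gt0.
  apply: ler_sum_uniq_sub; rewrite ?iota_uniq //.
    by move=> i; rewrite ltW ?wnat_gt0.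
  move=> i si; rewrite mem_iota leq0n add0n ltnS /=.
  by rewrite (big_rem i) //= leq_max leqnn.
apply: le_trans (sum_wnat _) _; rewrite gerBl divr_ge0 // ltW // root4_gt0 //.
Qed.

Definition wint m : R := wnat `|m|%N.

Lemma absm_wint : absm (fun m => (wint m)%:C).
Proof.
have h1 : absm (restr (fun m : int => 0 <= m) (fun m => (wint m)%:C)).
  apply: (@absm_reindex R _ _ _ Posz); first by move=> a b [].
    move=> i H; rewrite /restr; case: ifP => // i0; case: (H `|i|%N).
    by rewrite gez0_abs.
  by apply: absm_ext absm_wnat => n; rewrite /restr /=.
have h2 : absm (restr (fun m : int => ~~ (0 <= m)) (fun m => (wint m)%:C)).
  apply: (@absm_reindex R _ _ _ Negz); first by move=> a b [].
    move=> i H; rewrite /restr; case: ifP => // i0; case: i H i0 => // n H _.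
    by case: (H n).
  have : absm ((fun n : nat => (wnat n)%:C) \o S) by apply: absm_inj absm_wnat => a b [].
  by apply: absm_ext => n; rewrite /restr /=.
by apply: absm_ext (absmD h1 h2) => m; rewrite /restr; case: ifP; rewrite ?addr0 ?add0r.
Qed.

Definition wpair (p : int * int) : R := wint p.1 * wint p.2.

Lemma wint_ge0 m : 0 <= wint m. Proof. exact: ltW (wnat_gt0 _). Qed.

Lemma wpair_ge0 p : 0 <= wpair p. Proof. by rewrite mulr_ge0 ?wint_ge0. Qed.

Lemma absm_wpair : absm (fun p => (wpair p)%:C).
Proof.
apply: absm_ext (absm_prod absm_wint absm_wint) => p.
by rewrite /wpair rmorphM.
Qed.

End Weights.

(** * Reduced lattices Z + Z tau and comparison with the weight *)

Section Lattice.
Variable R : realType.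
Implicit Types (x y B : R) (m n : int) (p q : int * int) (z w : R[i]).

(** The closed fundamental domain; keeping both sides of the boundary makes it stable under
    [tau -> - tau^*], as [reduced_conj] requires. *)
Definition reduced (tau : R[i]) :=
  [/\ 0 < complex.Im tau, 1 <= nrm tau & `|complex.Re tau| <= 2^-1].

Definition lat (tau : R[i]) p : R[i] := p.1%:~R * tau + p.2%:~R.

Lemma latD tau p q : lat tau (p + q) = lat tau p + lat tau q.
Proof. by rewrite /lat /= !rmorphD /=; ring. Qed.

Lemma latN tau p : lat tau (- p) = - lat tau p.
Proof. by rewrite /lat /= !rmorphN /=; ring. Qed.

Lemma lat0 tau : lat tau 0 = 0.
Proof. by rewrite /lat /= mul0r add0r. Qed.

Lemma latB tau p q : lat tau (p - q) = lat tau p - lat tau q.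
Proof. by rewrite latD latN. Qed.

Variable tau : R[i].
Hypothesis red : reduced tau.
Let L := lat tau.

Lemma nrm_lat_sqr p :
  (p.1%:~R ^+ 2 + p.2%:~R ^+ 2) / 2 <= nrm (L p) ^+ 2.
Proof.
case: red => i0 t1 r2; case: p => m n.
rewrite /L /lat /= nrm_sqr.
have -> : m%:~R = (m%:~R : R)%:C by rewrite rmorph_int.
have -> : n%:~R = (n%:~R : R)%:C by rewrite rmorph_int.
have t2 : 1 <= complex.Re tau ^+ 2 + complex.Im tau ^+ 2.
  by rewrite -nrm_sqr exprn_ege1.
move: r2 t2 {i0 t1}; case: tau => a b /=; rewrite !mul0r !subr0 !addr0.
rewrite ler_norml => /andP[a1 a2] t2.
set x := (m%:~R : R); set y := (n%:~R : R).
have -> : (x * a + y) ^+ 2 + (x * b) ^+ 2 = x ^+ 2 * (a ^+ 2 + b ^+ 2) + 2 * a * (x * y) + y ^+ 2 by ring.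
have h1 : x ^+ 2 <= x ^+ 2 * (a ^+ 2 + b ^+ 2) by rewrite ler_peMr ?sqr_ge0.
have h2 : 0 <= (x + y) ^+ 2 := sqr_ge0 _.
have h3 : 0 <= (x - y) ^+ 2 := sqr_ge0 _.
have : `|2 * a * (x * y)| <= (x ^+ 2 + y ^+ 2) / 2.
  rewrite normrM -[leRHS]mul1r; apply: ler_pM => //; rewrite ler_norml; first lra.
  by move: h2 h3; rewrite sqrrD sqrrB; lra.
rewrite ler_norml => /andP[h4 h5]; lra.
Qed.

Lemma lat_eq0 p : (L p == 0) = (p == 0).
Proof.
apply/eqP/eqP => [E|->]; last by rewrite /L lat0.
have := nrm_lat_sqr p; rewrite E nrm0 expr0n /=; case: p {E} => m n /= H.
have := sqr_ge0 (m%:~R : R); have := sqr_ge0 (n%:~R : R) => hn hm.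
have : (m%:~R : R) ^+ 2 = 0 by lra.
have : (n%:~R : R) ^+ 2 = 0 by lra.
by move=> /eqP; rewrite sqrf_eq0 intr_eq0 => /eqP -> /eqP; rewrite sqrf_eq0 intr_eq0 => /eqP ->.
Qed.

Lemma lat_inj : injective L.
Proof.
move=> p q E; apply/eqP; rewrite -subr_eq0 -lat_eq0 /L latB; by apply/eqP; rewrite -/L E subrr.
Qed.

Lemma nat_int_norm m : `|m%:~R| = (`|m|%N)%:R :> R.
Proof. by rewrite -intr_norm -abszE. Qed.

(** Replaces the norm form by a product in the two coordinates, so that summability over the lattice
    reduces to summability in one index. *)
Lemma lat_weight p : p != 0 ->
  (1 + (`|p.1|%N)%:R) * (1 + (`|p.2|%N)%:R) <= 5 * nrm (L p) ^+ 2.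
Proof.
move=> p0; have H := nrm_lat_sqr p.
have S m : (m%:~R : R) ^+ 2 = (`|m|%N)%:R ^+ 2.
  by rewrite -nat_int_norm real_normK ?num_real.
rewrite !S in H.
have P : (1 : R) <= (`|p.1|%N)%:R ^+ 2 + (`|p.2|%N)%:R ^+ 2.
  rewrite -!natrX -natrD -[1](mulr1n 1) ler_nat addn_gt0 !expn_gt0 !orbF !absz_gt0.
  by move: p0; case: (p) => m n; rewrite -pair_eqE /pair_eq /= negb_and.
have N m : (`|m|%N)%:R <= (`|m|%N)%:R ^+ 2 :> R.
  by rewrite -natrX ler_nat; case: (`|m|%N) => // k; rewrite leq_pmulr.
have := N p.1; have := N p.2; have := sqr_ge0 ((`|p.1|%N)%:R - (`|p.2|%N)%:R : R).
rewrite sqrrB; set a := (`|p.1|%N)%:R in H P *; set b := (`|p.2|%N)%:R in H P *; nra.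
Qed.

Lemma lat_ge1 p : p != 0 -> 1 <= nrm (L p).
Proof.
case: red => i0 t1 r2 p0; rewrite -(@ler_pXn2r _ 2) ?nnegrE ?nrm_ge0 // expr1n.
case: p p0 => m n p0; rewrite /L /lat /= nrm_sqr.
have -> : m%:~R = (m%:~R : R)%:C by rewrite rmorph_int.
have -> : n%:~R = (n%:~R : R)%:C by rewrite rmorph_int.
have t2 : 1 <= complex.Re tau ^+ 2 + complex.Im tau ^+ 2.
  by rewrite -nrm_sqr exprn_ege1.
move: r2 t2 {i0 t1}; case: tau => a b /=; rewrite !mul0r !subr0 !addr0.
rewrite ler_norml => /andP[a1 a2] t2.
have K : (1 : R) <= m%:~R ^+ 2 - `|m%:~R * n%:~R| + n%:~R ^+ 2.
  rewrite -intrM -intr_norm -!rmorphXn /= -rmorphB -rmorphD /= -[1]/(1%:~R) ler_int.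
  case: (eqVneq m 0) p0 => [->|m0].
    rewrite -pair_eqE /pair_eq /= => n0; rewrite mul0r normr0 subr0 expr0n add0r expr2.
    by nia.
  by move=> _; rewrite !expr2; nia.
set x := (m%:~R : R) in K *; set y := (n%:~R : R) in K *.
have -> : (x * a + y) ^+ 2 + (x * b) ^+ 2 = x ^+ 2 * (a ^+ 2 + b ^+ 2) + 2 * a * (x * y) + y ^+ 2 by ring.
have h1 : x ^+ 2 <= x ^+ 2 * (a ^+ 2 + b ^+ 2) by rewrite ler_peMr ?sqr_ge0.
have : `|2 * a * (x * y)| <= `|x * y|.
  rewrite normrM -[leRHS]mul1r; apply: ler_pM => //; rewrite ler_norml; lra.
rewrite ler_norml => /andP[h4 h5]; lra.
Qed.

(** Makes [|l|^(5/2)] the integral power [hroot p ^+ 5]. The half-integral exponent arises as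
    [|l|^-3 * |l|^(1/2)], from a second-order remainder evaluated for [Re s >= -1/2]. *)
Definition hroot p : R := Num.sqrt (nrm (L p)).

Lemma hroot_sqr p : hroot p ^+ 2 = nrm (L p).
Proof. by rewrite sqr_sqrtr ?nrm_ge0. Qed.

Lemma hroot_ge1 p : p != 0 -> 1 <= hroot p.
Proof. by move=> /lat_ge1 h; rewrite -sqrtr1 ler_wsqrtr. Qed.

Lemma hroot_wpair p : p != 0 -> (hroot p ^+ 5)^-1 <= 32 * wpair R p.
Proof.
move=> p0; have h1 := hroot_ge1 p0.
have := lat_weight p0; rewrite -hroot_sqr -exprM /= => H.
rewrite /wpair /wint /wnat; set x := `|p.1|%N in H *; set y := `|p.2|%N in H *.
have x0 : 0 < root4 x.+1%:R :> R by rewrite root4_gt0.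
have y0 : 0 < root4 y.+1%:R :> R by rewrite root4_gt0.
have K : root4 x.+1%:R * root4 y.+1%:R <= 2 * hroot p.
  rewrite -root4M //; apply: (@le_trans _ _ (root4 ((2 * hroot p) ^+ 4))).
    apply: root4_le; rewrite -!nat1r; apply: le_trans H _.
    have h4 : 0 <= hroot p ^+ 4 by rewrite exprn_ge0 // sqrtr_ge0.
    by rewrite exprMn ler_wpM2r // !exprS expr0; lra.
  rewrite /root4 (exprM _ 2 2) !sqrtr_sqr ger0_norm ?sqr_ge0 // sqrtr_sqr ger0_norm //; lra.
have {}K : (root4 x.+1%:R * root4 y.+1%:R) ^+ 5 <= 32 * hroot p ^+ 5.
  have -> : 32 * hroot p ^+ 5 = (2 * hroot p) ^+ 5 by ring.
  by rewrite ler_pXn2r ?nnegrE ?mulr_ge0 ?(ltW x0) ?(ltW y0) //; lra.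
rewrite -invfM -exprMn ler_pdivlMr ?exprn_gt0 ?mulr_gt0 //.
by rewrite mulrC ler_pdivrMr ?exprn_gt0 //; lra.
Qed.

Lemma absm_dom (f : int * int -> R[i]) C :
  (forall p, p != 0 -> nrm (f p) <= C * (hroot p ^+ 5)^-1) -> absm f.
Proof.
move=> H; apply: (@absm_exc _ _ [:: 0] f (fun p => (32 * C)%:C * (wpair R p)%:C)).
  move=> p; rewrite inE => p0; rewrite -rmorphM /= nrm_real; apply: le_trans (H p p0) _.
  have h0 : 0 <= (hroot p ^+ 5)^-1 by rewrite invr_ge0 exprn_ge0 // sqrtr_ge0.
  have := hroot_wpair p0; have := wpair_ge0 R p; have := H p p0; have := nrm_ge0 (f p).
  move=> n0 n1 w0 n2.
  case: (leP 0 C) => C0.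
    by apply: le_trans (ler_norm _); rewrite (mulrC 32) -mulrA ler_wpM2l.
  apply: le_trans (normr_ge0 _); by rewrite nmulr_rle0.
by apply: absmZ; exact: absm_wpair.
Qed.

Lemma lat_finite B : exists s : seq (int * int), forall p, nrm (L p) <= B -> p \in s.
Proof.
pose N := Num.Def.archi_bound (2 * `|B|); pose r : seq int := [seq (i%:Z - N%:Z) | i <- iota 0 (2 * N).+1].
exists [seq (m, n) | m <- r, n <- r] => -[m n] H.
have K (k : int) : (k%:~R : R) ^+ 2 <= (2 * `|B|) ^+ 2 -> k \in r.
  rewrite -[k%:~R ^+ 2]real_normK ?num_real // ler_pXn2r ?nnegrE ?mulr_ge0 // => k1.
  have k2 : `|k%:~R| < N%:R :> R by apply: le_lt_trans k1 (archi_boundP _); rewrite mulr_ge0.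
  rewrite nat_int_norm ltr_nat in k2.
  apply/mapP; exists (absz (k + N%:Z)); last by lia.
  by rewrite mem_iota; lia.
have := nrm_lat_sqr (m, n) => /= h.
have hB : nrm (L (m, n)) ^+ 2 <= `|B| ^+ 2.
  by rewrite ler_pXn2r ?nnegrE ?nrm_ge0 //; apply: le_trans H (ler_norm B).
have := sqr_ge0 (m%:~R : R); have := sqr_ge0 (n%:~R : R); have := sqr_ge0 `|B|.
move=> b0 n0 m0; apply: (@allpairs_f _ _ _ (fun m n : int => (m, n)) r r m n); apply: K => /=.
  by rewrite exprMn expr2; lra.
by rewrite exprMn expr2; lra.
Qed.

End Lattice.

(** * Analytic continuation of the Eisenstein-Kronecker series *)

Section EisensteinValues.
Variable R : realType.
Implicit Types (s z w l u : R[i]) (x B : R).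

(** Two continuations agree on the intersection of their half-planes, hence at 0; so any explicit
    continuation computes [E_]. *)
Lemma E_eq (L : set R[i]) k z F : is_EisKron_continuation L k z F -> E_ k L z = F 0.
Proof.
move=> H; apply: xget_unique; first by exists F.
move=> _ [F' [sg' sg0' [D' [t' S']]] ->].
case: H => [sg sg0 [D [t S]]]; apply/eqP; rewrite -subr_eq0; apply/eqP.
pose sm := Num.max sg sg'; pose tm := Num.max t t'.
apply: (@continuation_uniq R (fun s => F' s - F s) sm tm).
- by rewrite /sm gt_max sg0.
- move=> s; rewrite /sm gt_max => /andP[h1 h2].
  have /derivable_cdiff[k1 K1] := D s h1; have /derivable_cdiff[k2 K2] := D' s h2.
  by exists (k2 - k1); apply: cdiffB.
- move=> s; rewrite /tm gt_max => /andP[h1 h2].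
  have /has_sumE V := S s h1; have /has_sumE V' := S' s h2.
  by rewrite (hs_uniq V V') subrr.
Qed.

Lemma conjcM z w : (z * w)^* = z^* * w^*.
Proof. exact: rmorphM. Qed.

Lemma oppr_self z : - z = z -> z = 0.
Proof.
move=> E; have /eqP : z + z = 0 by rewrite -{1}E addNr.
by rewrite -mulr2n mulrn_eq0 /= => /eqP.
Qed.

Lemma norm_cpowM z w s : z != 0 -> w != 0 ->
  norm_cpow (z * w) s = norm_cpow z s * norm_cpow w s.
Proof.
move=> z0 w0; rewrite /norm_cpow -expCD -mulrDr -rmorphD; congr (expC (s * _%:C)).
by rewrite -/(nrm (z * w)) nrmM lnM ?posrE ?nrm_gt0.
Qed.

Lemma norm_cpow0 z : norm_cpow z 0 = 1.
Proof. by rewrite /norm_cpow mul0r expC0. Qed.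

Lemma norm_cpowN z s : norm_cpow (- z) s = norm_cpow z s.
Proof. by rewrite /norm_cpow -/(nrm (- z)) nrmN. Qed.

Lemma nrm_cpow z s : nrm (norm_cpow z s) = expR (complex.Re s * ln (nrm z)).
Proof.
rewrite /norm_cpow nrm_expC; congr expR.
by rewrite cReM /= mulr0 subr0.
Qed.

Lemma cdiff_cpow z s : exists k, cdiff (fun s => norm_cpow z (- s)) s k.
Proof.
eexists; apply: (@cdiff_comp _ (fun s => - s * (ln (nrm z))%:C) (@expC R)).
  by apply: cdiffM; [apply: cdiffN; exact: cdiff_id|exact: cdiff_cst].
exact: cdiff_expC.
Qed.

(** The summand of weight 1; it is odd and multiplicative in [z], and these two properties carry the
    continuation. *)
Definition phi z s := z^-1 * norm_cpow z (- s).

Lemma phiN z s : phi (- z) s = - phi z s.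
Proof. by rewrite /phi norm_cpowN invrN mulNr. Qed.

Lemma phiM z w s : z != 0 -> w != 0 -> phi (z * w) s = phi z s * phi w s.
Proof. by move=> z0 w0; rewrite /phi norm_cpowM // invfM mulrACA. Qed.

Lemma cdiff_phi z s : exists k, cdiff (phi z) s k.
Proof. by have [k H] := cdiff_cpow z s; eexists; apply: cdiffZ H. Qed.

Lemma ln_bounds x : -1 < x -> x / (1 + x) <= ln (1 + x) <= x.
Proof.
move=> x1; have p : 0 < 1 + x by lra.
have H (v : R) : 0 < v -> ln v <= v - 1.
  by move=> v0; have := expR_ge1Dx (ln v); rewrite lnK ?posrE //; lra.
apply/andP; split; last by have := H _ p; lra.
have := H (1 + x)^-1; rewrite invr_gt0 => /(_ p); rewrite lnV ?posrE //.
have -> : (1 + x)^-1 - 1 = - (x / (1 + x)) by field; rewrite gt_eqF.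
lra.
Qed.

Lemma ln_nrm1 u : nrm u <= 1 / 4 ->
  `|ln (nrm (1 + u)) - complex.Re u| <= 7 * nrm u ^+ 2 /\ `|ln (nrm (1 + u))| <= 3 * nrm u.
Proof.
move=> u4; set U := nrm u in u4 *; have U0 : 0 <= U := nrm_ge0 u.
set r := complex.Re u; have rU : `|r| <= U := Re_le_nrm u.
have U2 : U ^+ 2 = r ^+ 2 + complex.Im u ^+ 2 := nrm_sqr u.
pose x := 2 * r + U ^+ 2.
have U2b : U ^+ 2 <= U / 4 by rewrite expr2; nra.
have U20 : 0 <= U ^+ 2 by rewrite sqr_ge0.
move: rU; rewrite ler_norml => /andP[r1 r2].
have x1 : `|x| <= 9 / 4 * U by rewrite ler_norml /x; lra.
have n2 : nrm (1 + u) ^+ 2 = 1 + x.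
  by rewrite nrm_sqr ReD ImD /= add0r /x U2 -/r; ring.
have x2 : -(9 / 16) <= x by move: x1; rewrite ler_norml; lra.
have n0 : 0 < nrm (1 + u).
  rewrite lt_neqAle nrm_ge0 andbT; apply/eqP => E.
  by move: n2; rewrite -E expr0n /=; lra.
have l2 : ln (1 + x) = 2 * ln (nrm (1 + u)).
  by rewrite -n2 expr2 lnM ?posrE //; ring.
have /andP[b1 b2] := @ln_bounds x ltac:(lra).
have b3 : x - 16 / 7 * x ^+ 2 <= x / (1 + x).
  rewrite ler_pdivlMr; last lra.
  have : 0 <= x ^+ 2 * (16 / 7 * (1 + x) - 1) by apply: mulr_ge0; [exact: sqr_ge0|lra].
  rewrite !expr2; nra.
have x3 : x ^+ 2 <= 81 / 16 * U ^+ 2.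
  have -> : 81 / 16 * U ^+ 2 = (9 / 4 * U) ^+ 2 by rewrite exprMn; congr (_ * _); rewrite expr2; lra.
  by rewrite -(real_normK (num_real x)) ler_pXn2r ?nnegrE //; lra.
rewrite l2 in b1 b2.
have xE : x = 2 * r + U ^+ 2 by [].
clearbody x; have k1 : `|ln (nrm (1 + u)) - r| <= 7 * U ^+ 2.
  by rewrite ler_norml; apply/andP; split; lra.
split=> //; move: k1; rewrite !ler_norml => /andP[k1 k2]; apply/andP; split; lra.
Qed.

(** To first order [ln |1 + u|] is half the sum of [u] and its conjugate, which splits the linear
    part of [phi (1 + u) s] into the coefficients [-(1 + s/2)] of [u] and [-s/2] of its
    conjugate. *)
Lemma phi_taylor B : 0 <= B -> exists2 K, 0 <= K & forall u s, nrm u <= 1 / 4 -> nrm s <= B ->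
  nrm (phi (1 + u) s - 1 + (1 + s / 2) * u + s / 2 * u^*) <= K * nrm u ^+ 2.
Proof.
move=> B0; have e0 := expR_ge0 B.
exists (B + 2 * (expR B * (3 * B) ^+ 2 + 7 * B) + 2 * expR B).
  have := sqr_ge0 (3 * B); nra.
move=> u s u4 sB; have [k1 k2] := ln_nrm1 u4.
set U := nrm u in u4 k1 k2 *; have U0 : 0 <= U := nrm_ge0 u.
set lam := ln (nrm (1 + u)) in k1 k2; set r := complex.Re u in k1.
have rU : `|r| <= U := Re_le_nrm u.
have s0 := nrm_ge0 s.
have n1 : 3 / 4 <= nrm (1 + u) by have := nrmD_ge 1 u; rewrite nrm1 -/U; lra.
have u1 : 1 + u != 0 by rewrite -nrm_gt0; lra.
pose v := - s * lam%:C.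
have nv : nrm v <= B * (3 * U) by rewrite /v nrmM nrmN nrm_real ler_pM.
have nv2 : nrm v <= B by apply: le_trans nv _; rewrite ler_piMr //; lra.
pose a := u ^+ 2 / (1 + u); pose b := expC v - 1 - v; pose c := (lam - r)%:C : R[i].
have -> : phi (1 + u) s - 1 + (1 + s / 2) * u + s / 2 * u^* =
    u * s * r%:C + (1 - u) * (b - s * c) + a * expC v.
  have E1 : (1 + u)^-1 = 1 - u + a by rewrite /a; field.
  have E2 : phi (1 + u) s = (1 + u)^-1 * expC v by [].
  have E3 : expC v = 1 + v + b by rewrite /b; ring.
  have E4 : u^* = r%:C + r%:C - u.
    by rewrite /r; case: (u) => p q; cring.
  rewrite E2 E1 E4 mulrDl; set W := a * expC v; rewrite E3 /v /c; clearbody W.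
  by rewrite rmorphB /=; field.
have h1 : nrm (u * s * r%:C) <= B * U ^+ 2.
  rewrite !nrmM nrm_real -/U expr2 mulrA (mulrC B) ler_pM // ?mulr_ge0 //.
  by rewrite ler_pM.
have h2 : nrm b <= expR B * (3 * B) ^+ 2 * U ^+ 2.
  apply: le_trans (expC_bound2 v) _.
  have -> : expR B * (3 * B) ^+ 2 * U ^+ 2 = expR B * (B * (3 * U)) ^+ 2 by ring.
  rewrite ler_pM ?expR_ge0 ?sqr_ge0 ?ler_expR //.
  by rewrite ler_pXn2r ?nnegrE ?nrm_ge0 ?mulr_ge0.
have h3 : nrm (s * c) <= B * (7 * U ^+ 2).
  by rewrite nrmM nrm_real ler_pM.
have h4 : nrm (1 - u) <= 2 by apply: le_trans (nrmB _ _) _; rewrite nrm1 -/U; lra.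
have h5 : nrm a <= 2 * U ^+ 2.
  rewrite /a nrmM nrmX nrmV -/U mulrC ler_wpM2r ?sqr_ge0 //.
  rewrite -[2]invrK lef_pV2 ?posrE //; lra.
have h6 : nrm (expC v) <= expR B.
  rewrite nrm_expC ler_expR; apply: le_trans (ler_norm _) _.
  exact: le_trans (Re_le_nrm _) nv2.
have h7 : nrm ((1 - u) * (b - s * c)) <= 2 * (expR B * (3 * B) ^+ 2 * U ^+ 2 + B * (7 * U ^+ 2)).
  rewrite nrmM ler_pM ?nrm_ge0 //; apply: le_trans (nrmB _ _) _; exact: lerD.
have h8 : nrm (a * expC v) <= 2 * U ^+ 2 * expR B by rewrite nrmM ler_pM ?nrm_ge0.
have h9 := nrmD (u * s * r%:C + (1 - u) * (b - s * c)) (a * expC v).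
have h10 := nrmD (u * s * r%:C) ((1 - u) * (b - s * c)).
have -> : (B + 2 * (expR B * (3 * B) ^+ 2 + 7 * B) + 2 * expR B) * U ^+ 2 =
  B * U ^+ 2 + 2 * (expR B * (3 * B) ^+ 2 * U ^+ 2 + B * (7 * U ^+ 2)) + 2 * U ^+ 2 * expR B by ring.
lra.
Qed.

Variable tau : R[i].
Hypothesis red : reduced tau.
Let L := lat tau.
Let h p : R := hroot tau p.

Lemma lat_neq0 p : p != 0 -> L p != 0.
Proof. by rewrite lat_eq0. Qed.

Lemma nrm_phi_lat p s x : p != 0 -> x <= complex.Re s ->
  nrm (phi (L p) s) <= (h p ^+ 2)^-1 * expR (- x * ln (h p ^+ 2)).
Proof.
move=> p0 xs; have h1 := hroot_ge1 red p0.
rewrite /phi nrmM nrmV nrm_cpow ReN -hroot_sqr -/(h p).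
have i0 : 0 <= (h p ^+ 2)^-1 by rewrite invr_ge0 sqr_ge0.
rewrite ler_wpM2l // ler_expR ler_wpM2r ?lerN2 //.
by apply: ln_ge0; apply: exprn_ege1.
Qed.

Lemma expR_half_ln p : p != 0 -> expR (- (- 2^-1) * ln (h p ^+ 2)) = h p.
Proof.
move=> p0; have h1 := hroot_ge1 red p0; have h0 : 0 < h p by rewrite /h; lra.
by rewrite expr2 lnM ?posrE // (_ : _ * _ = ln (h p)) ?lnK ?posrE //; field.
Qed.

Lemma expR_m2_ln p : p != 0 -> expR (- 2 * ln (h p ^+ 2)) = (h p ^+ 4)^-1.
Proof.
move=> p0; have h1 := hroot_ge1 red p0; have h0 : 0 < h p by rewrite /h; lra.
have h2 : 0 < h p ^+ 2 by rewrite exprn_gt0.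
rewrite (_ : - 2 * _ = - (ln (h p ^+ 2) + ln (h p ^+ 2))); last by ring.
by rewrite -lnM ?posrE // expRN lnK ?posrE ?mulr_gt0 // -expr2 -exprM.
Qed.

(** The summand at [l = L p] minus its first-order expansion in [z], by [phi_taylor]. What remains
    is summable for [Re s >= -1/2]; at [s = 0] it is the term of the Weierstrass zeta function. *)
Definition Xterm z s p : R[i] := if p == 0 then phi z s else
  phi (L p + z) s - phi (L p) s +
  ((1 + s / 2) * z * ((L p ^+ 2)^-1 * norm_cpow (L p) (- s)) +
   s / 2 * z^* * ((L p * (L p)^*)^-1 * norm_cpow (L p) (- s))).

Definition X z s : R[i] := csum (Xterm z s).

Lemma Xterm_bound z B : 0 <= B -> exists2 K, 0 <= K &
  forall p s, p != 0 -> 4 * nrm z <= nrm (L p) -> - 2^-1 <= complex.Re s -> nrm s <= B ->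
  nrm (Xterm z s p) <= K * (h p ^+ 5)^-1.
Proof.
move=> /phi_taylor[K K0 HK]; exists (K * nrm z ^+ 2).
  by rewrite mulr_ge0 ?sqr_ge0.
move=> p s p0 zl s1 sB; have l0 := lat_neq0 p0; have h1 := hroot_ge1 red p0.
have hp0 : 0 < h p by rewrite /h; lra.
pose u := z / L p.
have nl : nrm (L p) = h p ^+ 2 by rewrite hroot_sqr.
have nl0 : 0 < nrm (L p) by rewrite nrm_gt0.
have u4 : nrm u <= 1 / 4 by rewrite /u nrmM nrmV ler_pdivrMr //; lra.
have u1 : 1 + u != 0.
  by rewrite -nrm_gt0; have := nrmD_ge 1 u; rewrite nrm1; lra.
have cl : (L p)^* != 0 by rewrite conjc_eq0.
have -> : Xterm z s p = phi (L p) s * (phi (1 + u) s - 1 + (1 + s / 2) * u + s / 2 * u^*).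
  rewrite /Xterm (negbTE p0) (_ : L p + z = L p * (1 + u)); last first.
    by rewrite /u mulrDr mulr1 mulrC divfK // addrC.
  have -> : u^* = z^* / (L p)^* by rewrite /u rmorphM /= conjc_inv.
  rewrite phiM //; set q := phi (1 + u) s; clearbody q.
  by rewrite /phi /u; field; rewrite l0 cl.
rewrite nrmM; have := nrm_phi_lat p0 s1; rewrite expR_half_ln // => b1.
apply: le_trans (ler_pM (nrm_ge0 _) (nrm_ge0 _) b1 (HK u s u4 sB)) _.
rewrite /u nrmM nrmV nl.
have -> : (h p ^+ 2)^-1 * h p * (K * (nrm z * (h p ^+ 2)^-1) ^+ 2) =
  K * nrm z ^+ 2 * (h p ^+ 5)^-1 by field; rewrite gt_eqF.
by [].
Qed.

Lemma absm_Xterm z s : - 2^-1 <= complex.Re s -> absm (Xterm z s).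
Proof.
move=> s1; have [K K0 HK] := Xterm_bound z (nrm_ge0 s).
have [s0 Hs] := lat_finite red (4 * nrm z).
apply: (@absm_exc _ _ (0 :: s0) _ (restr (fun p => p != 0) (fun p => (K * (h p ^+ 5)^-1)%:C))).
  move=> p; rewrite inE negb_or => /andP[p0 ps]; rewrite /restr p0 nrm_real.
  apply: le_trans (ler_norm _); apply: HK => //; rewrite leNgt; apply/negP => c.
  by move: ps; rewrite Hs // ltW.
apply: (@absm_dom _ _ red _ K) => p p0; rewrite /restr p0 nrm_real ger0_norm //.
by rewrite mulr_ge0 // invr_ge0 exprn_ge0 // sqrtr_ge0.
Qed.

Lemma cdiff_Xterm z s p : exists k, cdiff (fun s => Xterm z s p) s k.
Proof.
rewrite /Xterm; case: (p == 0); first exact: cdiff_phi.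
have [k1 H1] := cdiff_phi (L p + z) s; have [k2 H2] := cdiff_phi (L p) s.
have [k3 H3] := cdiff_cpow (L p) s.
have H4 : cdiff (fun s => s / 2) s (1 * 2^-1 + s * 0).
  by apply: cdiffM; [exact: cdiff_id|exact: cdiff_cst].
eexists; apply: cdiffD; first exact: cdiffB H1 H2.
apply: cdiffD; apply: cdiffM.
- by apply: cdiffM; [apply: cdiffD; [exact: cdiff_cst|exact: H4]|exact: cdiff_cst].
- by apply: cdiffZ; exact: H3.
- by apply: cdiffM; [exact: H4|exact: cdiff_cst].
- by apply: cdiffZ; exact: H3.
Qed.

Lemma cdiff_X z s : - 2^-1 < complex.Re s -> exists k, cdiff (X z) s k.
Proof.
move=> s1; pose r := complex.Re s + 2^-1; have r0 : 0 < r by rewrite /r; lra.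
pose B := nrm s + r.
have [|K K0 HK] := Xterm_bound z (B := B); first by rewrite addr_ge0 ?nrm_ge0 ?ltW.
have [s0 Hs] := lat_finite red (4 * nrm z).
have [df Hdf] : {df & forall p, cdiff (fun s => Xterm z s p) s (df p)}.
  by apply: (@boolp.choice _ _ (fun p k => cdiff (fun s => Xterm z s p) s k)) => p; exact: cdiff_Xterm.
exists (csum df).
apply: (@csum_cdiff R _ (fun p s => Xterm z s p) df s r
  (fun p => if p == 0 then 0 else K * (h p ^+ 5)^-1) (0 :: s0)) => //.
- by move=> p w _; exact: cdiff_Xterm.
- move=> p w; rewrite inE negb_or => /andP[p0 ps] wr; rewrite (negbTE p0); apply: HK => //.
  + by rewrite leNgt; apply/negP => c; move: ps; rewrite Hs // ltW.
  + by have := le_trans (Re_le_nrm _) wr; rewrite ReD ReN ler_norml /r; lra.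
  + by rewrite /B; have := nrmB_ge w s; lra.
apply: (@absm_dom _ _ red _ K) => p p0; rewrite (negbTE p0) nrm_real ger0_norm //.
by rewrite mulr_ge0 // invr_ge0 exprn_ge0 // sqrtr_ge0.
Qed.

Definition nz (f : int * int -> R[i]) := restr (fun p => p != 0) f.
Definition A2term s p : R[i] := (L p ^+ 2)^-1 * norm_cpow (L p) (- s).
Definition A0term s p : R[i] := (L p * (L p)^*)^-1 * norm_cpow (L p) (- s).

Lemma absm_phi0 s : 2 <= complex.Re s -> absm (nz (fun p => phi (L p) s)).
Proof.
move=> s2; apply: (@absm_dom _ _ red _ 1) => p p0; rewrite /nz /restr p0 mul1r.
have h1 := hroot_ge1 red p0; have hp0 : 0 < h p by rewrite /h; lra.
apply: le_trans (nrm_phi_lat p0 s2) _; rewrite expR_m2_ln // -invfM -exprD.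
by rewrite lef_pV2 ?posrE ?exprn_gt0 // ler_weXn2l.
Qed.

Lemma nrm_A2term s p : p != 0 -> 2 <= complex.Re s ->
  nrm (A2term s p) <= (h p ^+ 5)^-1 /\ nrm (A0term s p) <= (h p ^+ 5)^-1.
Proof.
move=> p0 s2; have h1 := hroot_ge1 red p0; have hp0 : 0 < h p by rewrite /h; lra.
have E : nrm (A0term s p) = nrm (A2term s p).
  by rewrite /A0term /A2term !nrmM !nrmV !nrmM nrm_conj.
rewrite E; have -> : A2term s p = (L p)^-1 * phi (L p) s by rewrite /phi /A2term expr2 invfM mulrA.
suff : nrm ((L p)^-1 * phi (L p) s) <= (h p ^+ 5)^-1 by [].
rewrite nrmM nrmV; have := nrm_phi_lat p0 s2; rewrite expR_m2_ln // -invfM -exprD => b.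
have i1 : (nrm (L p))^-1 <= 1 by rewrite invf_le1 ?(lat_ge1 red) // nrm_gt0 lat_neq0.
have i0 : 0 <= (nrm (L p))^-1 by rewrite invr_ge0 nrm_ge0.
apply: le_trans (ler_pM i0 (nrm_ge0 _) i1 b) _; rewrite mul1r.
by rewrite lef_pV2 ?posrE ?exprn_gt0 // ler_weXn2l.
Qed.

Lemma absm_A2 s : 2 <= complex.Re s -> absm (nz (A2term s)).
Proof.
move=> s2; apply: (@absm_dom _ _ red _ 1) => p p0; rewrite /nz /restr p0 mul1r.
by case: (nrm_A2term p0 s2).
Qed.

Lemma absm_A0 s : 2 <= complex.Re s -> absm (nz (A0term s)).
Proof.
move=> s2; apply: (@absm_dom _ _ red _ 1) => p p0; rewrite /nz /restr p0 mul1r.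
by case: (nrm_A2term p0 s2).
Qed.

Lemma phi_split z s p : phi (L p + z) s = Xterm z s p + nz (fun p => phi (L p) s) p -
  ((1 + s / 2) * z * nz (A2term s) p + s / 2 * z^* * nz (A0term s) p).
Proof.
rewrite /Xterm /nz /restr /A2term /A0term; case: eqVneq => [->|p0] /=.
  by rewrite /L lat0 add0r addr0 !mulr0 addr0 subr0.
by ring.
Qed.

Lemma absm_phi z s : 2 <= complex.Re s -> absm (fun p => phi (L p + z) s).
Proof.
move=> s2.
have a1 := absm_Xterm z (s := s) ltac:(lra).
have H := absmB (absmD a1 (absm_phi0 s2)) (absmD (absmZ ((1 + s / 2) * z) (absm_A2 s2)) (absmZ (s / 2 * z^*) (absm_A0 s2))).
by apply: absm_ext H => p; rewrite phi_split.
Qed.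

Lemma csum_latN (f : int * int -> R[i]) : csum (fun p => f (- p)) = csum f.
Proof. exact: (@csum_bij R _ _ f (fun p => - p) (fun p => - p) opprK opprK). Qed.

Lemma csum_latD (f : int * int -> R[i]) q : csum (fun p => f (p + q)) = csum f.
Proof. exact: (@csum_bij R _ _ f (fun p => p + q) (fun p => p - q) (addrK q) (subrK q)). Qed.

Lemma csum_phi0 s : 2 <= complex.Re s -> csum (nz (fun p => phi (L p) s)) = 0.
Proof.
move=> s2; have E := csum_latN (nz (fun p => phi (L p) s)).
rewrite (@csum_ext _ _ _ (fun p => - nz (fun p => phi (L p) s) p)) in E; last first.
  by move=> p; rewrite /nz /restr oppr_eq0 /L latN phiN; case: ifP; rewrite ?oppr0.
rewrite csumN in E; last exact: absm_phi0.
exact: oppr_self E.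
Qed.

Definition A2 s := csum (nz (A2term s)).
(** The factor [s / 2] compensates the pole at 0 of the sum of [|l|^(-2-s)]; the continuation [cb]
    therefore has a finite value at 0. *)
Definition A0 s := s / 2 * csum (nz (A0term s)).

Lemma csum_phi z s : 2 <= complex.Re s ->
  csum (fun p => phi (L p + z) s) = X z s - ((1 + s / 2) * z * A2 s + z^* * A0 s).
Proof.
move=> s2; have a1 := absm_Xterm z (s := s) ltac:(lra).
have a2 := absm_A2 s2; have a0 := absm_A0 s2; have ap := absm_phi0 s2.
rewrite (csum_ext (phi_split z s)) csumB ?csumD ?csumZ ?csum_phi0 //.
- by rewrite /A2 /A0 addr0 -/(X z s); ring.
- exact: absmZ.
- exact: absmZ.
- exact: absmD.
- by apply: absmD; exact: absmZ.
Qed.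

(** The translate of a lattice by a half period is symmetric about 0, and [phi] is odd. *)
Lemma csum_phi_half q s : 2 <= complex.Re s -> csum (fun p => phi (L p + L q / 2) s) = 0.
Proof.
move=> s2; pose f p := phi (L p + L q / 2) s.
have E : csum (fun p => f (- p - q)) = csum f.
  by rewrite -(csum_latD f (- q)) -(csum_latN (fun p => f (p - q))).
have E2 : csum (fun p => f (- p - q)) = csum (fun p => - f p).
  by apply: csum_ext => p; rewrite /f -phiN; congr phi; rewrite /L latB latN; field.
have a := absm_phi (L q / 2) s2.
rewrite E2 csumN // in E.
exact: oppr_self E.
Qed.

(* By [csum_phi] and [csum_phi_half], 2 X(w/2, s) = (1 + s/2) w A2 + w^* A0 for w = 1, tau;
   Cramer's rule with the analytic left-hand sides continues A2 and A0. *)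
Definition Y1 s := 2 * X (1 / 2) s.
Definition Y2 s := 2 * X (tau / 2) s.
Definition ca s := (Y2 s - tau^* * Y1 s) / (tau - tau^*).
Definition cb s := (Y2 s - tau * Y1 s) / (tau^* - tau).

Lemma tau_conj_neq : tau - tau^* != 0.
Proof.
case: red => i0 _ _; move: i0; case: tau => a b /= b0.
rewrite eq_complex /= negb_and; apply/orP; right; apply/eqP; lra.
Qed.

Lemma ca_cb s : 2 <= complex.Re s -> ca s = (1 + s / 2) * A2 s /\ cb s = A0 s.
Proof.
move=> s2; have H1 := csum_phi_half (0, 1) s2; have H2 := csum_phi_half (1, 0) s2.
rewrite csum_phi // in H1; rewrite csum_phi // in H2.
have e1 : L (0, 1) / 2 = 1 / 2 by rewrite /L /lat /= mul0r add0r.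
have e2 : L (1, 0) / 2 = tau / 2 by rewrite /L /lat /= mul1r addr0.
have c2 : (2^-1 : R[i])^* = 2^-1 by rewrite conjc_inv conjc_nat.
have c1 : (1 / 2 : R[i])^* = 1 / 2 by rewrite mul1r c2.
have c3 : (tau / 2)^* = tau^* / 2 by rewrite conjcM conjc_inv conjc_nat.
rewrite e1 c1 in H1; rewrite e2 c3 in H2.
have t0 := tau_conj_neq.
have t1 : tau^* - tau != 0 by rewrite -opprB oppr_eq0.
have h1 : Y1 s = (1 + s / 2) * A2 s + A0 s.
  by move/eqP: H1; rewrite subr_eq0 /Y1 => /eqP ->; field.
have h2 : Y2 s = (1 + s / 2) * A2 s * tau + tau^* * A0 s.
  by move/eqP: H2; rewrite subr_eq0 /Y2 => /eqP ->; field.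
by rewrite /ca /cb h1 h2; split; field.
Qed.

Lemma cdiff_ca s : - 2^-1 < complex.Re s -> exists k, cdiff ca s k.
Proof.
move=> s1; have [k1 H1] := cdiff_X (1 / 2) s1; have [k2 H2] := cdiff_X (tau / 2) s1.
eexists; apply: cdiffM; last exact: cdiff_cst.
by apply: cdiffB; apply: cdiffZ; [exact: H2|apply: cdiffZ; exact: H1].
Qed.

Lemma cdiff_cb s : - 2^-1 < complex.Re s -> exists k, cdiff cb s k.
Proof.
move=> s1; have [k1 H1] := cdiff_X (1 / 2) s1; have [k2 H2] := cdiff_X (tau / 2) s1.
eexists; apply: cdiffM; last exact: cdiff_cst.
by apply: cdiffB; apply: cdiffZ; [exact: H2|apply: cdiffZ; exact: H1].
Qed.

Lemma has_sum_lat (A : set R[i]) (u : R[i] -> R[i]) (f : int * int -> R[i]) :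
  absm f -> (forall p, (if L p \in A then u (L p) else 0) = f p) ->
  (forall x : R[i], A x -> exists p, x = L p) -> has_sum A u (csum f).
Proof.
move=> af E AL; apply/has_sumE.
rewrite -(hs_reindex _ (lat_inj red)); first by apply: hs_ext (csumP af) => p; rewrite -E.
move=> x H; case: ifP => //; rewrite inE => /AL[p xp]; by case: (H p).
Qed.

Definition L0 : set R[i] := range (lat tau).

(** For large [Re s] the series of weight 2 is [A2 s = ca s / (1 + s / 2)], and the denominator has
    no zero in the half-plane used. *)
Lemma E2_formula : E_ 2 L0 0 = ca 0.
Proof.
rewrite (@E_eq _ 2 _ (fun s => ca s / (1 + s / 2))); first by rewrite mul0r addr0 divr1.
have s20 s : - 2^-1 < complex.Re s -> 1 + s / 2 != 0.
  move=> s1; apply/eqP => E.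
  have : complex.Re (2 * (1 + s / 2)) = 0 by rewrite E mulr0.
  rewrite (_ : 2 * _ = 1 + 1 + s); last by field.
  by rewrite !ReD /=; lra.
exists (- 2^-1); first lra; split.
  move=> s /= s1; apply/derivable_cdiff; have [k H] := cdiff_ca s1.
  eexists; apply: cdiffM; first exact: H.
  apply: cdiffV; first exact: s20.
  by apply: cdiffD; [exact: cdiff_cst|apply: cdiffM; [exact: cdiff_id|exact: cdiff_cst]].
exists 2 => s s2; have [-> _] := ca_cb (ltW s2).
rewrite mulrAC divff ?mul1r; last by apply: s20; lra.
apply: has_sum_lat (absm_A2 (ltW s2)) _ _; last by move=> x [[p _ <-] _]; exists p.
move=> p; rewrite /nz /restr; case: ifP.
  by rewrite inE /= addr0 => -[_]; rewrite lat_eq0 // => ->.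
move=> /negP; rewrite inE /= addr0 => H; case: ifP => // p0; case: H; split.
  by exists p.
exact: lat_neq0.
Qed.

Definition zeta z := X z 0.

Lemma E1_formula z : ~ L0 z -> E_ 1 L0 z = zeta z - z * ca 0 - z^* * cb 0.
Proof.
move=> zL; rewrite (@E_eq _ 1 _ (fun s => X z s - z * ca s - z^* * cb s)) //.
exists (- 2^-1); first lra; split.
  move=> s /= s1; apply/derivable_cdiff; have [k H] := cdiff_ca s1.
  have [k' H'] := cdiff_cb s1; have [k2 H2] := cdiff_X z s1.
  by eexists; apply: cdiffB; [apply: cdiffB; [exact: H2|apply: cdiffZ; exact: H]|apply: cdiffZ; exact: H'].
exists 2 => s s2; have [e1 e2] := ca_cb (ltW s2).
have -> : X z s - z * ca s - z^* * cb s = csum (fun p => phi (L p + z) s).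
  by rewrite csum_phi ?ltW // e1 e2; ring.
apply: has_sum_lat (absm_phi z (ltW s2)) _ _; last by move=> x [[p _ <-] _]; exists p.
move=> p; case: ifP; first by rewrite /phi expr1.
move=> /negP; rewrite inE /= => H; case: H; split; first by exists p.
apply/eqP => E; apply: zL; exists (- p) => //.
by apply/eqP; rewrite latN eq_sym -addr_eq0 addrC E.
Qed.

(** At a lattice point the vanishing term is omitted, so a symmetric sum of an odd function is left;
    the zero function continues it. *)
Lemma E1_lat z : L0 z -> E_ 1 L0 z = 0.
Proof.
move=> [q _ <-]; rewrite (@E_eq _ 1 _ (fun=> 0)) //.
exists (- 1); first lra; split.
  by move=> s /= s1; apply/derivable_cdiff; exists 0; exact: cdiff_cst.
exists 2 => s s2.
have a : absm (fun p => nz (fun p => phi (L p) s) (p + q)).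
  by apply: (@absm_inj _ _ _ _ (fun p => p + q)) (absm_phi0 (ltW s2)); exact: addIr.
have E0 := csum_phi0 (ltW s2); rewrite -(csum_latD _ q) in E0.
suff : has_sum [set l | L0 l /\ l + lat tau q != 0]
  (fun l => (l + lat tau q) ^- 1 * norm_cpow (l + lat tau q) (- s))
  (csum (fun p => nz (fun p => phi (L p) s) (p + q))) by rewrite E0.
apply: has_sum_lat a _ _; last by move=> x [[p _ <-] _]; exists p.
move=> p; rewrite /nz /restr -(lat_eq0 red) -/L; have E : L p + lat tau q = L (p + q) by rewrite /L latD.
case: ifP.
  by rewrite inE /= E => -[_ ->]; rewrite expr1 /phi.
move=> /negP; rewrite inE /= E => H; case: ifP => // p0; case: H; split=> //.
by exists p.
Qed.

End EisensteinValues.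

(** * Limits that ignore the value at the point *)

Section PuncturedLimits.
Variable R : realType.
Implicit Types (a v z w k : R[i]) (f g : R[i] -> R[i]) (e : R).

Definition plim f a v := forall e, 0 < e -> nb a (fun z => z != a -> nrm (f z - v) <= e).

Lemma plim_cont f a : ccont f a -> plim f a (f a).
Proof. by move=> H e /H; apply: nbW. Qed.

Lemma plim_cdiff f a k : cdiff f a k -> plim f a (f a).
Proof. by move=> /cdiff_cont /plim_cont. Qed.

Lemma plimD f g a v w : plim f a v -> plim g a w -> plim (fun z => f z + g z) a (v + w).
Proof.
move=> H K e e0; apply: nbW (nb_and (H (e / 2) ltac:(lra)) (K (e / 2) ltac:(lra))).
move=> z [h k] za; have := h za; have := k za.
by rewrite opprD addrACA; have := nrmD (f z - v) (g z - w); lra.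
Qed.

Lemma plimZ c f a v : plim f a v -> plim (fun z => c * f z) a (c * v).
Proof.
move=> H e e0; have n0 := nrm_ge0 c.
apply: nbW (H (e / (nrm c + 1)) ltac:(by rewrite divr_gt0 //; lra)) => z h /h k.
rewrite -mulrBr nrmM; apply: le_trans (ler_wpM2l n0 k) _.
by rewrite mulrCA ger_pMr // ler_pdivrMr; lra.
Qed.

Lemma plimN f a v : plim f a v -> plim (fun z => - f z) a (- v).
Proof.
move=> /(plimZ (-1)); rewrite mulN1r => H e /H; apply: nbW => z; by rewrite mulN1r.
Qed.

Lemma plimB f g a v w : plim f a v -> plim g a w -> plim (fun z => f z - g z) a (v - w).
Proof. by move=> H /plimN; apply: plimD. Qed.

Lemma plim_ext f g a v : nb a (fun z => z != a -> f z = g z) -> plim f a v -> plim g a v.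
Proof.
move=> E H e e0; apply: nbW (nb_and E (H e e0)) => z [h k] za.
by rewrite -h //; apply: k.
Qed.

Lemma plim_eq f a v w : v = w -> plim f a v -> plim f a w.
Proof. by move=> ->. Qed.

Lemma nb_ex a (P : R[i] -> Prop) : nb a P -> exists2 z, z != a & P z.
Proof.
move=> [d d0 H]; exists (a + (d / 2)%:C).
  rewrite -subr_eq0 addrC addKr eq_complex /= negb_and gt_eqF //; lra.
apply: H; rewrite addrC addKr nrm_real gtr0_norm; lra.
Qed.

Lemma plim_const f a v w : plim f a v -> nb a (fun z => z != a -> f z = w) -> w = v.
Proof.
move=> H K; apply/eqP; rewrite -subr_eq0; apply/eqP/nrm_le0 => e e0.
by have [z za [h k]] := nb_ex (nb_and K (H e e0)); rewrite -(h za); apply: k.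
Qed.

Lemma plim_lbdd f a v : plim f a v -> lbdd f a.
Proof.
move=> /(_ 1 ltr01) H; exists (nrm v + 1 + nrm (f a)); apply: nbW H => z H.
case: (eqVneq z a) => [->|za]; first by have := nrm_ge0 v; lra.
by have := H za; have := nrmB_ge (f z) v; have := nrm_ge0 (f a); lra.
Qed.

Lemma plim_diffq f a k : cdiff f a k -> plim (diffq f a) a k.
Proof.
move=> H e /H; apply: nbW => z h za.
have nz : z - a != 0 by rewrite subr_eq0.
rewrite /diffq (_ : _ - k = (f z - f a - (z - a) * k) / (z - a)); last by field.
by rewrite nrmM nrmV ler_pdivrMr // nrm_gt0.
Qed.

End PuncturedLimits.

(** * Weierstrass functions and the addition formula for E_1 *)

Section EllipticFunctions.
Variable R : realType.
Variable tau : R[i].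
Hypothesis red : reduced tau.
Implicit Types (z w u v k : R[i]) (p q : int * int).
Local Notation L := (lat tau).
Local Notation L0 := (L0 tau).
Local Notation zeta := (zeta tau).
Local Notation s2 := (ca tau 0).
Local Notation c0 := (cb tau 0).
Local Notation E1 := (E_ 1 L0).

Lemma L0D z w : L0 z -> L0 w -> L0 (z + w).
Proof. by move=> [p _ <-] [q _ <-]; exists (p + q); rewrite ?latD. Qed.
Lemma L0N z : L0 z -> L0 (- z).
Proof. by move=> [p _ <-]; exists (- p); rewrite ?latN. Qed.
Lemma L0_0 : L0 0. Proof. by exists 0; rewrite ?lat0. Qed.
Lemma L0B z w : L0 z -> L0 w -> L0 (z - w). Proof. by move=> h /L0N; apply: L0D. Qed.
Lemma L0lat p : L0 (L p). Proof. by exists p. Qed.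
Lemma L0_opp z : L0 (- z) -> L0 z. Proof. by move=> /L0N; rewrite opprK. Qed.
Lemma L0_sub z w : L0 w -> L0 (z + w) -> L0 z.
Proof. by move=> h /L0B /(_ h); rewrite addrK. Qed.

Lemma nb_notL0 z : ~ L0 z -> nb z (fun w => ~ L0 w).
Proof.
move=> zL; have [s Hs] := lat_finite red (nrm z + 1).
have H : nb z (fun w => forall p, p \in s -> w != L p).
  apply: (@nb_all R _ s z (fun p w => w != L p)) => p _; apply: nb_neq.
  by apply/eqP => E; apply: zL; rewrite E; exact: L0lat.
apply: nbW (nb_and H (@nb_near R z 1 ltr01)) => w [h1 h2] [p _ E].
have ps : p \in s by apply: Hs; rewrite E; have := nrmB_ge w z; lra.
by move: (h1 p ps); rewrite E eqxx.
Qed.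

Lemma nb0_notL0 : nb 0 (fun w => w != 0 -> ~ L0 w).
Proof.
exists 1 => // w; rewrite subr0 => w1 w0 [p _ E]; move: w1; rewrite -E ltNge.
by rewrite (lat_ge1 red) //; apply/eqP => p0; move: w0; rewrite -E p0 lat0 eqxx.
Qed.

Lemma L0_small z : nrm z < 1 -> L0 z -> z = 0.
Proof.
by move=> z1 [p _ E]; case: (eqVneq p 0) => [p0|/(lat_ge1 red)]; [rewrite -E p0 lat0|rewrite E leNgt z1].
Qed.

(** Terms of the Weierstrass functions zeta and wp, and of -wp'/2, written with [l + z] for [z - l],
    which is the same by symmetry of the lattice. *)
Definition zterm z p : R[i] := if p == 0 then z^-1 else (L p + z)^-1 - (L p)^-1 + z * (L p ^+ 2)^-1.
Definition wterm z p : R[i] := if p == 0 then (z ^+ 2)^-1 else ((L p + z) ^+ 2)^-1 - (L p ^+ 2)^-1.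
Definition vterm z p : R[i] := ((L p + z) ^+ 3)^-1.

Lemma Xterm0 z p : Xterm tau z 0 p = zterm z p.
Proof.
rewrite /Xterm /zterm /phi oppr0 !norm_cpow0 !mulr1.
by case: (p == 0) => //; rewrite mul0r addr0 mul1r !mul0r addr0.
Qed.

Lemma zetaE z : zeta z = csum (zterm z).
Proof. by apply: csum_ext => p; rewrite Xterm0. Qed.

Definition wp z := csum (wterm z).
Definition zeta0 z := csum (nz (zterm z)).
Definition wp0 z := csum (nz (wterm z)).

Lemma term_bounds B p z : 0 <= B -> nrm z <= B -> 2 * B + 2 <= nrm (L p) -> p != 0 ->
  [/\ nrm (zterm z p) <= 2 * B ^+ 2 * (hroot tau p ^+ 5)^-1,
      nrm (wterm z p) <= 12 * B * (hroot tau p ^+ 5)^-1 &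
      nrm (vterm z p) <= 8 * (hroot tau p ^+ 5)^-1].
Proof.
move=> B0 zB lB p0; have h1 := hroot_ge1 red p0.
set H := (hroot tau p ^+ 5)^-1; set l := L p in lB *.
have l1 : 1 <= nrm l by lra.
have l0 : l != 0 by rewrite -nrm_gt0; lra.
have d1 : nrm l / 2 <= nrm (l + z) by have := nrmD_ge l z; lra.
have lz : l + z != 0 by rewrite -nrm_gt0; lra.
have lH : (nrm l ^+ 3)^-1 <= H.
  rewrite /H lef_pV2 ?posrE ?exprn_gt0 //; [|by rewrite -/l; lra|by lra].
  by rewrite -hroot_sqr -exprM ler_weXn2l.
have H0 : 0 <= H by rewrite /H invr_ge0 exprn_ge0 //; lra.
have nl : 0 < nrm l by lra.
have nlz : 0 < nrm (l + z) by lra.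
have i1 : (nrm (l + z))^-1 <= 2 * (nrm l)^-1.
  rewrite -[2]invrK -invfM lef_pV2 ?posrE //; [lra|by rewrite mulr_gt0 // invr_gt0].
have ia : 0 <= (nrm (l + z))^-1 by rewrite invr_ge0 nrm_ge0.
have ib : 0 <= (nrm l)^-1 by rewrite invr_ge0 nrm_ge0.
have z0 := nrm_ge0 z.
split.
- rewrite /zterm (negbTE p0) -/l.
  have -> : (l + z)^-1 - l^-1 + z * (l ^+ 2)^-1 = z ^+ 2 * ((l ^+ 2)^-1 * (l + z)^-1) by field; rewrite ?l0 ?lz.
  rewrite !nrmM !nrmV !nrmX.
  have -> : 2 * B ^+ 2 * H = B ^+ 2 * (2 * H) by ring.
  apply: ler_pM; [exact: mulr_ge0|by rewrite mulr_ge0 // invr_ge0 sqr_ge0|by rewrite expr2 ler_pM|].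
  apply: le_trans (ler_wpM2l _ i1) _; first by rewrite invr_ge0 sqr_ge0.
  by rewrite mulrCA -invfM -exprSr ler_pM2l.
- rewrite /wterm (negbTE p0) -/l.
  have -> : ((l + z) ^+ 2)^-1 - (l ^+ 2)^-1 = - (z * (2 * l + z)) * ((l ^+ 2)^-1 * ((l + z)^-1 * (l + z)^-1)).
    by field; rewrite ?l0 ?lz.
  rewrite !nrmM nrmN !nrmM !nrmV !nrmX.
  have h3 : nrm (2 * l + z) <= 3 * nrm l.
    by apply: le_trans (nrmD _ _) _; rewrite nrmM nrm_nat; lra.
  have h4 : (nrm (l + z))^-1 * (nrm (l + z))^-1 <= 4 * ((nrm l)^-1 * (nrm l)^-1).
    by apply: le_trans (ler_pM ia ia i1 i1) _; rewrite le_eqVlt; apply/orP; left; apply/eqP; ring.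
  have h5 : nrm z * nrm (2 * l + z) <= B * (3 * nrm l) by rewrite ler_pM ?nrm_ge0.
  have h6 : (nrm l ^+ 2)^-1 * ((nrm (l + z))^-1 * (nrm (l + z))^-1) <= (nrm l ^+ 2)^-1 * (4 * ((nrm l)^-1 * (nrm l)^-1)).
    by rewrite ler_wpM2l // invr_ge0 sqr_ge0.
  have g1 : 0 <= nrm z * nrm (2 * l + z) by rewrite mulr_ge0 ?nrm_ge0.
  have g2 : 0 <= (nrm l ^+ 2)^-1 * ((nrm (l + z))^-1 * (nrm (l + z))^-1).
    by rewrite mulr_ge0 // ?invr_ge0 ?sqr_ge0 // mulr_ge0.
  apply: le_trans (ler_pM g1 g2 h5 h6) _.
  have -> : B * (3 * nrm l) * ((nrm l ^+ 2)^-1 * (4 * ((nrm l)^-1 * (nrm l)^-1))) = 12 * B * (nrm l ^+ 3)^-1.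
    by field; rewrite gt_eqF.
  by rewrite ler_wpM2l // mulr_ge0.
- rewrite /vterm -/l nrmV nrmX.
  apply: (@le_trans _ _ (8 * (nrm l ^+ 3)^-1)); last by rewrite ler_wpM2l.
  have -> : 8 * (nrm l ^+ 3)^-1 = (2 * (nrm l)^-1) ^+ 3 by field; rewrite gt_eqF.
  by rewrite -exprVn ler_pXn2r ?nnegrE // mulr_ge0.
Qed.

Lemma cdiff_shiftX n z w : w + z != 0 ->
  cdiff (fun z => ((w + z) ^+ n)^-1) z (- n%:R * (w + z) ^+ n.-1 / (w + z) ^+ n ^+ 2).
Proof.
move=> wz; apply: cdiff_eq (cdiffV _ (cdiffX n (cdiffD (cdiff_cst w z) (cdiff_id z)))).
  by rewrite add0r mulr1 !mulNr.
by rewrite expf_neq0.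
Qed.

(** Treats together the full series off the lattice ([b = true]) and the series without its polar
    term on the unit disc ([b = false]), where nonzero lattice vectors, having norm at least 1,
    cause no pole. *)
Lemma nz_cdiff (f df : R[i] -> int * int -> R[i]) (g : R -> R) z0 (b : bool) :
  (forall B, 0 <= B -> forall p z, nrm z <= B -> 2 * B + 2 <= nrm (L p) -> p != 0 ->
     nrm (f z p) <= g B * (hroot tau p ^+ 5)^-1) ->
  (forall p z, (p != 0) || b -> L p + z != 0 -> cdiff (fun z => f z p) z (df z p)) ->
  (if b then ~ L0 z0 else nrm z0 < 1) ->
  let P p := (p != 0) || b in
  [/\ absm (restr P (f z0)), absm (restr P (df z0)) &
      cdiff (fun z => csum (restr P (f z))) z0 (csum (restr P (df z0)))].
Proof.
move=> fB fD hb P.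
have [r r0 Hr] : exists2 r, 0 < r & forall z p, nrm (z - z0) <= r -> P p -> L p + z != 0.
  have [d d0 H] : nb z0 (fun z => forall p, P p -> L p + z != 0).
    move: hb; rewrite /P; case: (b) => hb.
      apply: nbW (nb_notL0 hb) => z zL p _; apply/eqP => E; apply: zL.
      by rewrite -[z](addKr (L p)) E addr0; apply: L0N; exact: L0lat.
    exists (1 - nrm z0); first lra.
    move=> z zz p; rewrite orbF => p0; rewrite -nrm_gt0.
    have := lat_ge1 red p0; have := nrmD_ge (L p) z; have := nrmB_ge z z0; lra.
  exists (d / 2); first lra.
  by move=> z p zd; apply: H; lra.
pose B := nrm z0 + r; have B0 : 0 <= B by rewrite addr_ge0 ?nrm_ge0 // ltW.
have [s Hs] := lat_finite red (2 * B + 2).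
pose M p : R := if p == 0 then 0 else `|g B| * (hroot tau p ^+ 5)^-1.
have aM : absm (fun p => (M p)%:C).
  apply: (@absm_dom _ _ red _ `|g B|) => p p0; rewrite /M (negbTE p0) nrm_real ger0_norm //.
  by rewrite mulr_ge0 // invr_ge0 exprn_ge0 // sqrtr_ge0.
have D0 p z : nrm (z - z0) <= r -> cdiff (fun z => restr P (f z) p) z (restr P (df z) p).
  rewrite /restr; case: (boolP (P p)) => Pp zr; last exact: cdiff_cst.
  by apply: fD => //; apply: Hr.
have D1 p z : nrm (z - z0) <= r -> exists k, cdiff (fun z => restr P (f z) p) z k.
  by move=> /(D0 p); eexists; eassumption.
have zz0 : nrm (z0 - z0) <= r by rewrite subrr nrm0 ltW.
have Mb p z : p \notin 0 :: s -> nrm (z - z0) <= r -> nrm (restr P (f z) p) <= M p.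
  rewrite inE negb_or => /andP[p0 ps] zr; rewrite /M (negbTE p0) /restr /P p0 /=.
  have zB : nrm z <= B by rewrite /B; have := nrmB_ge z z0; lra.
  apply: le_trans (fB B B0 p z zB _ p0) _.
    by rewrite leNgt; apply/negP => c; move: ps; rewrite Hs // ltW.
  by rewrite ler_wpM2r ?ler_norm // invr_ge0 exprn_ge0 // sqrtr_ge0.
split.
- exact: (termwise_absm Mb aM zz0).
- exact: (@termwise_absm_d R _ (fun p z => restr P (f z) p) _ z0 r M _ r0 D1 (fun p => D0 p z0 zz0) Mb aM).
- exact: (@csum_cdiff R _ (fun p z => restr P (f z) p) _ z0 r M _ r0 D1 (fun p => D0 p z0 zz0) Mb aM).
Qed.

Lemma restr_true (f : int * int -> R[i]) : restr (fun p => (p != 0) || true) f = f.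
Proof. by apply/funext => p; rewrite /restr orbT. Qed.

Lemma restr_false (f : int * int -> R[i]) : restr (fun p => (p != 0) || false) f = nz f.
Proof. by apply/funext => p; rewrite /restr orbF. Qed.

Lemma zterm_cdiff p z : L p + z != 0 -> cdiff (fun z => zterm z p) z (- wterm z p).
Proof.
move=> lz; rewrite /zterm /wterm; case: (eqVneq p 0) lz => [->|p0] lz.
  by rewrite lat0 add0r in lz; exact: cdiff_inv.
have l0 : L p != 0 by rewrite (lat_eq0 red).
have H1 := cdiff_shiftX 1 lz.
have H2 := cdiffD (cdiffB H1 (cdiff_cst (L p)^-1 z)) (cdiffM (cdiff_id z) (cdiff_cst (L p ^+ 2)^-1 z)).
apply: cdiff_ext (cdiff_eq _ H2) => [w|]; first by rewrite expr1.
by rewrite /= expr0 expr1; field; rewrite l0.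
Qed.

Lemma wterm_cdiff p z : L p + z != 0 -> cdiff (fun z => wterm z p) z (- 2 * vterm z p).
Proof.
move=> lz; rewrite /wterm /vterm; case: (eqVneq p 0) lz => [->|p0] lz.
  have := cdiff_shiftX 2 lz; rewrite lat0 add0r in lz *.
  move=> H; apply: cdiff_ext (cdiff_eq _ H) => [w|]; first by rewrite add0r.
  by field.
have H2 := cdiffB (cdiff_shiftX 2 lz) (cdiff_cst (L p ^+ 2)^-1 z).
by apply: cdiff_eq _ H2; field.
Qed.

Lemma zeta_props z : ~ L0 z ->
  [/\ absm (zterm z), absm (wterm z) & cdiff zeta z (- wp z)].
Proof.
move=> zL; have := @nz_cdiff zterm (fun z p => - wterm z p) (fun B => 2 * B ^+ 2) z true
  (fun B B0 p w h1 h2 h3 => let: And3 a b _ := term_bounds B0 h1 h2 h3 in a)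
  (fun p w _ => @zterm_cdiff p w) zL.
rewrite /= restr_true restr_true => -[a1 a2 D].
have a3 : absm (wterm z) by apply: absm_ext (absmN a2) => p; rewrite opprK.
split=> //; apply: cdiff_ext (cdiff_eq _ D) => [w|]; first by rewrite zetaE restr_true.
by rewrite csumN.
Qed.

Lemma wp_cdiff z : ~ L0 z -> cdiff wp z (- 2 * csum (vterm z)).
Proof.
move=> zL; have := @nz_cdiff wterm (fun z p => - 2 * vterm z p) (fun B => 12 * B) z true
  (fun B B0 p w h1 h2 h3 => let: And3 a b _ := term_bounds B0 h1 h2 h3 in b)
  (fun p w _ => @wterm_cdiff p w) zL.
rewrite /= restr_true restr_true => -[a1 a2 D].
have a3 : absm (vterm z).
  apply: absm_ext (absmZ (- 2^-1) a2) => p; by field.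
apply: cdiff_ext (cdiff_eq _ D) => [w|]; first by rewrite restr_true.
by rewrite csumZ.
Qed.

Lemma zeta0_cdiff z : nrm z < 1 -> cdiff zeta0 z (- wp0 z).
Proof.
move=> z1; have := @nz_cdiff zterm (fun z p => - wterm z p) (fun B => 2 * B ^+ 2) z false
  (fun B B0 p w h1 h2 h3 => let: And3 a b _ := term_bounds B0 h1 h2 h3 in a)
  (fun p w _ => @zterm_cdiff p w) z1.
rewrite /= restr_false restr_false => -[a1 a2 D].
have E : nz (fun p => - wterm z p) = fun p => - nz (wterm z) p.
  by apply/funext => p; rewrite /nz /restr; case: ifP; rewrite ?oppr0.
have a3 : absm (nz (wterm z)) by rewrite E in a2; apply: absm_ext (absmN a2) => p; rewrite opprK.
apply: cdiff_ext (cdiff_eq _ D) => [w|]; first by rewrite restr_false.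
by rewrite E csumN.
Qed.

Lemma wp0_cdiff z : nrm z < 1 -> exists k, cdiff wp0 z k.
Proof.
move=> z1; have := @nz_cdiff wterm (fun z p => - 2 * vterm z p) (fun B => 12 * B) z false
  (fun B B0 p w h1 h2 h3 => let: And3 a b _ := term_bounds B0 h1 h2 h3 in b)
  (fun p w _ => @wterm_cdiff p w) z1.
rewrite /= restr_false restr_false => -[a1 a2 D].
by eexists; apply: cdiff_ext D => w; rewrite restr_false.
Qed.

Lemma wp0_0 : wp0 0 = 0.
Proof.
rewrite /wp0 (@csum_ext _ _ _ (fun=> 0)) ?(csum_eq (@hs0 _ _)) // => p.
by rewrite /nz /restr /wterm; case: eqVneq => //= p0; rewrite addr0 subrr.
Qed.

Lemma zeta0_0 : zeta0 0 = 0.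
Proof.
rewrite /zeta0 (@csum_ext _ _ _ (fun=> 0)) ?(csum_eq (@hs0 _ _)) // => p.
by rewrite /nz /restr /zterm; case: eqVneq => //= p0; rewrite addr0 subrr mul0r addr0.
Qed.

Lemma csum_split0 (f : int * int -> R[i]) : absm f -> csum f = f 0 + csum (nz f).
Proof.
move=> af; rewrite (@csum_split _ _ [:: 0] f af) // big_seq1; congr (_ + csum _).
by apply/funext => p; rewrite /nz /restr inE.
Qed.

Lemma zeta_split z : ~ L0 z -> zeta z = z^-1 + zeta0 z.
Proof.
move=> zL; have [a _ _] := zeta_props zL.
by rewrite zetaE (csum_split0 a) /zterm eqxx.
Qed.

Lemma wp_split z : ~ L0 z -> wp z = (z ^+ 2)^-1 + wp0 z.
Proof.
move=> zL; have [_ a _] := zeta_props zL.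
by rewrite /wp (csum_split0 a) /wterm eqxx.
Qed.

Lemma zetaN z : ~ L0 z -> zeta (- z) = - zeta z.
Proof.
move=> zL; have [a _ _] := zeta_props zL.
rewrite !zetaE -csumN // -csum_latN; apply: csum_ext => p.
rewrite /zterm oppr_eq0 latN; case: eqVneq => [_|p0]; first by rewrite invrN.
by rewrite -opprD !invrN sqrrN; ring.
Qed.

Lemma wpN z : wp (- z) = wp z.
Proof.
rewrite /wp -csum_latN; apply: csum_ext => p.
rewrite /wterm oppr_eq0 latN; case: eqVneq => [_|p0]; first by rewrite sqrrN.
by rewrite -opprD !sqrrN.
Qed.

(** For [Re s > 2] the full series is visibly periodic in [z]; [continuation_uniq] carries this to
    [s = 0] and so yields the quasi-periods in terms of [ca] and [cb]. *)
Lemma zetaD z q : ~ L0 z -> zeta (z + L q) = zeta z + (L q * s2 + (L q)^* * c0).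
Proof.
move=> zL.
pose FF w s := X tau w s - w * ca tau s - w^* * cb tau s.
have H : FF (z + L q) 0 - FF z 0 = 0.
  apply: (@continuation_uniq R (fun s => FF (z + L q) s - FF z s) (- 2^-1) 2); first lra.
    move=> s s1; have [k H] := cdiff_ca red s1; have [k' H'] := cdiff_cb red s1.
    have [k2 H2] := cdiff_X red z s1; have [k3 H3] := cdiff_X red (z + L q) s1.
    eexists; apply: cdiffB; (apply: cdiffB; [apply: cdiffB|apply: cdiffZ; exact: H']).
    + exact: H3. + by apply: cdiffZ; exact: H. + exact: H2. + by apply: cdiffZ; exact: H.
  move=> s s2; have [e1 e2] := ca_cb red (ltW s2).
  have E w : FF w s = csum (fun p => phi (L p + w) s).
    by rewrite (csum_phi red) ?ltW // /FF e1 e2; ring.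
  rewrite !E -(csum_latD (fun p => phi (L p + z) s) q).
  apply/eqP; rewrite subr_eq0; apply/eqP; apply: csum_ext => p; congr (phi _ s).
  by rewrite latD; ring.
move/eqP: H; rewrite subr_eq0 /FF -!/(zeta _) => /eqP H.
have cD : (z + L q)^* = z^* + (L q)^* by exact: rmorphD.
rewrite cD in H.
have -> : zeta (z + L q) = (zeta (z + L q) - (z + L q) * s2 - (z^* + (L q)^*) * c0) +
  ((z + L q) * s2 + (z^* + (L q)^*) * c0) by ring.
by rewrite H; ring.
Qed.

Lemma wpD z q : ~ L0 z -> wp (z + L q) = wp z.
Proof.
move=> zL; have zL' : ~ L0 (z + L q) by move=> /(L0_sub (L0lat q)).
have [_ _ D] := zeta_props zL; have [_ _ D'] := zeta_props zL'.
have D2 := cdiffD D (cdiff_cst (L q * s2 + (L q)^* * c0) z).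
have D3 : cdiff (fun w => zeta (w + L q)) z (- wp z + 0).
  apply: cdiff_near D2; apply: nbW (nb_notL0 zL) => w wL; by rewrite zetaD.
have := cdiff_uniq D3 (cdiff_shift D'); rewrite addr0 => /eqP; rewrite eqr_opp => /eqP ->.
by [].
Qed.

Lemma wp_per z w : ~ L0 z -> L0 w -> wp (z + w) = wp z.
Proof. by move=> zL [q _ <-]; exact: wpD. Qed.

Lemma E1E z : ~ L0 z -> E1 z = zeta z - z * s2 - z^* * c0.
Proof. exact: E1_formula. Qed.

Lemma E1L z : L0 z -> E1 z = 0.
Proof. exact: E1_lat. Qed.

Lemma E1D z w : L0 w -> E1 (z + w) = E1 z.
Proof.
move=> wL; case: (pselect (L0 z)) => zL; first by rewrite !E1L //; exact: L0D.
have zL' : ~ L0 (z + w) by move=> /(L0_sub wL).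
case: wL zL' => q _ <- zL'; rewrite !E1E // zetaD //.
have -> : (z + L q)^* = z^* + (L q)^* by exact: rmorphD.
by ring.
Qed.

Lemma E1N z : E1 (- z) = - E1 z.
Proof.
case: (pselect (L0 z)) => zL; first by rewrite !E1L ?oppr0 //; exact: L0N.
have zL' : ~ L0 (- z) by move=> /L0_opp.
rewrite !E1E // zetaN //.
have -> : (- z)^* = - z^* by exact: rmorphN.
by ring.
Qed.

Lemma lat_round z : exists q, nrm (z - L q) <= nrm tau + 1.
Proof.
have [i0 _ _] := red; set y := complex.Im z / complex.Im tau.
pose x := complex.Re z - y * complex.Re tau.
have zE : z = y%:C * tau + x%:C.
  have ti : complex.Im tau != 0 by rewrite gt_eqF.
  rewrite /x /y; case: (z) => a b; move: ti; case: (tau) => c d /= d0.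
  by apply/eqP; rewrite eq_complex /=; apply/andP; split; apply/eqP; field.
exists (Num.floor y, Num.floor x).
rewrite /lat /= -!(rmorph_int (real_complex R)) {1}zE.
set a := (Num.floor y)%:~R; set b := (Num.floor x)%:~R.
rewrite (_ : _ - _ = (y - a)%:C * tau + (x - b)%:C); last by rewrite !rmorphB /=; ring.
apply: le_trans (nrmD _ _) _; rewrite nrmM !nrm_real.
have fl (t : R) : `|t - (Num.floor t)%:~R| <= 1.
  have /andP[h1 h2] := floor_itv t; rewrite ger0_norm; last by rewrite subr_ge0.
  by move: h2; rewrite rmorphD /=; lra.
apply: lerD; last exact: fl.
by rewrite ler_piMl ?nrm_ge0.
Qed.

Lemma lat_round_disc B : exists s : seq R[i], forall z, nrm z <= B -> L0 z -> z \in s.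
Proof.
have [s Hs] := lat_finite red B; exists (map L s) => z zB [p _ E].
by rewrite -E; apply: map_f; apply: Hs; rewrite E.
Qed.

Lemma periodic_const g z0 z1 k0 k1 : (forall z q, g (z + L q) = g z) ->
  (forall z, lbdd g z) ->
  (forall B, exists E : seq R[i], forall z, nrm z <= B -> z \notin E -> exists k, cdiff g z k) ->
  cdiff g z0 k0 -> cdiff g z1 k1 -> g z0 = g z1.
Proof.
move=> per lb D; apply: liouville => // e e0.
have [K K0 HK] := @ball_bounded R g 0 (nrm tau + 1) (fun z _ _ => lb z).
have HK' z : nrm (g z) <= K.
  have [q Hq] := lat_round z; have := HK (z - L q); rewrite subr0 => /(_ Hq).
  by rewrite -(per _ q) subrK.
exists (K / e) => z; rewrite ler_pdivrMr // mulrC => h.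
exact: le_trans (HK' z) h.
Qed.

(** As a function of [u], the difference of the two sides is periodic, tends to 0 at lattice points,
    and by a reflection also at the points of [- v + L]; Liouville makes it constant. The value 0 is
    assigned at all these points. *)
Lemma addition_thm u v : ~ L0 u -> ~ L0 v -> ~ L0 (u + v) ->
  (zeta u + zeta v - zeta (u + v)) ^+ 2 = wp u + wp v + wp (u + v).
Proof.
move=> uL vL uvL.
pose f u := (zeta u + zeta v - zeta (u + v)) ^+ 2 - (wp u + wp v + wp (u + v)).
pose bad u := L0 u \/ L0 (u + v).
pose g u := if `[< bad u >] then 0 else f u.
have gE w : ~ bad w -> g w = f w by move=> h; rewrite /g asboolF.
have per z q : g (z + L q) = g z.
  have bq : bad (z + L q) <-> bad z.
    rewrite /bad addrAC; split=> -[h|h].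
    - by left; apply: L0_sub h; exact: L0lat.
    - by right; apply: L0_sub h; exact: L0lat.
    - by left; apply: L0D h _; exact: L0lat.
    - by right; apply: L0D h _; exact: L0lat.
  case: (pselect (bad z)) => bz.
    by rewrite /g !asboolT //; apply/bq.
  have bz' : ~ bad (z + L q) by move=> /bq.
  have z1 : ~ L0 z by move=> h; apply: bz; left.
  have z2 : ~ L0 (z + v) by move=> h; apply: bz; right.
  by rewrite !gE // /f (addrAC z) !zetaD // !wpD //; ring.
have Dg z : ~ bad z -> exists k, cdiff g z k.
  move=> bz; have z1 : ~ L0 z by move=> h; apply: bz; left.
  have z2 : ~ L0 (z + v) by move=> h; apply: bz; right.
  have N : nb z (fun w => f w = g w).
    have n2 := nb_notL0 z2; case: n2 => d d0 n2.
    have n3 : nb z (fun w => ~ L0 (w + v)).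
      by exists d => // w wd; apply: n2; rewrite (_ : _ - _ = w - z) //; ring.
    by apply: nbW (nb_and (nb_notL0 z1) n3) => w [h1 h2]; rewrite gE // => -[].
  have [_ _ D1] := zeta_props z1; have [_ _ D2] := zeta_props z2.
  eexists; apply: cdiff_near N _; apply: cdiffB.
    apply: cdiffX; apply: cdiffB; last exact: cdiff_shift D2.
    by apply: cdiffD; [exact: D1|exact: cdiff_cst].
  apply: cdiffD; last exact: cdiff_shift (wp_cdiff z2).
  by apply: cdiffD; [exact: wp_cdiff z1|exact: cdiff_cst].
have vn0 : v != 0 by apply/eqP => v0; apply: vL; rewrite v0; exact: L0_0.
have nbv : nb 0 (fun w => ~ L0 (w + v)).
  by have [d d0 H] := nb_notL0 vL; exists d => // w wd; apply: H; rewrite addrK; rewrite subr0 in wd.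
(* With [A w] the regular part of the bracket, [(1/w + A)^2 - 1/w^2 = 2 A / w + A^2]. Here [A 0 = 0]
   and the derivative of [A] at 0 is [wp v], so the limit is [2 wp v] minus the two remaining values
   [wp v]. *)
have lim0 : plim g 0 0.
  pose A w := zeta0 w + zeta v - zeta (w + v).
  have [_ _ Dv] := zeta_props vL; have v0 : ~ L0 (0 + v) by rewrite add0r.
  have [_ _ Dv'] := zeta_props v0.
  have DA : cdiff A 0 (wp v).
    have := cdiffB (cdiffD (zeta0_cdiff (z := 0) ltac:(by rewrite nrm0 ltr01)) (cdiff_cst (zeta v) 0)) (cdiff_shift Dv').
    by apply: cdiff_eq; rewrite wp0_0 add0r; ring.
  have A0 : A 0 = 0 by rewrite /A zeta0_0 !add0r subrr.
  have [k Dw] := wp0_cdiff (z := 0) ltac:(by rewrite nrm0 ltr01).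
  have P1 := plimZ 2 (plim_diffq DA).
  have P2 := plim_cdiff (cdiffX 2 DA); rewrite A0 expr0n /= in P2.
  have P3 := plim_cdiff Dw; rewrite wp0_0 in P3.
  have P4 := plim_cdiff (cdiff_shift (wp_cdiff v0)); rewrite add0r in P4.
  have P5 := plimB (plimB (plimD P1 P2) P3) (plimD (plim_cdiff (cdiff_cst (wp v) 0)) P4).
  apply: plim_ext (plim_eq _ P5); last by ring.
  apply: nbW (nb_and nb0_notL0 nbv) => w [h1 h2] w0.
  have wL := h1 w0.
  rewrite gE; last by move=> [].
  rewrite /f (zeta_split wL) (wp_split wL) /diffq A0 !subr0 /A.
  by field.
(* Parity makes [g] invariant under this reflection, which exchanges the two classes of poles, so
   one local computation serves both. *)
have refl w : g (- v - w) = g w.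
  have b : bad (- v - w) <-> bad w.
    rewrite /bad (_ : - v - w + v = - w); last by ring.
    split=> -[h|h]; [right|left|right|left].
    - by apply: L0_opp; rewrite opprD addrC.
    - exact: L0_opp.
    - exact: L0N.
    - by rewrite -opprD addrC; exact: L0N.
  case: (pselect (bad w)) => bz.
    by rewrite /g !asboolT //; apply/b.
  have bz' : ~ bad (- v - w) by move=> /b.
  have z1 : ~ L0 w by move=> h; apply: bz; left.
  have z2 : ~ L0 (w + v) by move=> h; apply: bz; right.
  rewrite !gE // /f (_ : - v - w + v = - w); last by ring.
  rewrite (_ : - v - w = - (w + v)); last by ring.
  by rewrite !zetaN // !wpN; ring.
have limL z : L0 z -> plim g z 0.
  move=> [q _ <-] e e0; have [d d0 H] := lim0 e e0; exists d => // w wd wq.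
  rewrite -(subrK (L q) w) per; apply: H; first by rewrite subr0.
  by rewrite subr_eq0.
have lb z : lbdd g z.
  case: (pselect (bad z)) => bz; last by have [k D] := Dg z bz; exact: cdiff_lbdd D.
  case: bz => bz; first exact: plim_lbdd (limL z bz).
  have [K [d d0 H]] := plim_lbdd (limL (- v - z) ltac:(by rewrite -opprD addrC; exact: L0N)).
  exists K, d => // w wd; rewrite -refl; apply: H.
  by rewrite (_ : - v - w - (- v - z) = z - w); [rewrite nrmC|ring].
have fin B : exists E : seq R[i], forall z, nrm z <= B -> z \notin E -> exists k, cdiff g z k.
  have [s1 H1] := lat_round_disc B; have [s2 H2] := lat_round_disc (B + nrm v).
  exists (s1 ++ [seq w - v | w <- s2]) => z zB; rewrite mem_cat negb_or => /andP[h1 h2].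
  apply: Dg => -[h|h]; first by move: h1; rewrite H1.
  move/negP: h2; apply; apply/mapP; exists (z + v); last by rewrite addrK.
  by apply: H2 => //; apply: le_trans (nrmD _ _) _; rewrite lerD2r.
have [k Dk] := Dg u ltac:(by move=> []).
have E : g u = 0.
  apply: (plim_const lim0); apply: nbW (nb_and nb0_notL0 nbv) => w [h1 h2] w0.
  have [k' Dk'] := Dg w ltac:(by move=> []; [exact: h1|exact: h2]).
  exact: (periodic_const per lb fin Dk' Dk).
move: E; rewrite gE; last by move=> [].
by move/eqP; rewrite subr_eq0 => /eqP.
Qed.

Lemma addition_E1 u v : ~ L0 u -> ~ L0 v -> ~ L0 (u + v) ->
  (E1 u + E1 v - E1 (u + v)) ^+ 2 = wp u + wp v + wp (u + v).
Proof.
move=> uL vL uvL; rewrite -addition_thm // !E1E //; congr (_ ^+ 2).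
have -> : (u + v)^* = u^* + v^* by exact: rmorphD.
by ring.
Qed.

End EllipticFunctions.

(** * Liouville's theorem for additive quasi-periods *)

Section QuasiPeriodic.
Variable R : realType.
Variable tau : R[i].
Hypothesis red : reduced tau.
Implicit Types (z w u v k : R[i]) (p q : int * int).
Local Notation L := (lat tau).

Lemma nb_list (s : seq R[i]) z : nb z (fun w => w != z -> w \notin s).
Proof.
have H : nb z (fun w => forall a, a \in s -> w != z -> w != a).
  apply: (@nb_all R _ s z (fun a w => w != z -> w != a)) => a _.
  case: (eqVneq z a) => [->|za]; first exact: nbT.
  by apply: nbW (nb_neq za) => w h _.
apply: nbW H => w h wz; apply/negP => ws; by have := h w ws wz; rewrite eqxx.
Qed.

Definition loc_finite (S : R[i] -> Prop) :=
  forall B, exists s : seq R[i], forall z, nrm z <= B -> S z -> z \in s.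

Lemma nb_loc_finite S z : loc_finite S -> nb z (fun w => w != z -> ~ S w).
Proof.
move=> fS; have [s Hs] := fS (nrm z + 1).
apply: nbW (nb_and (nb_list s z) (@nb_near R z 1 ltr01)) => w [h1 h2] wz Sw.
by have := h1 wz; rewrite Hs //; have := nrmB_ge w z; lra.
Qed.

Lemma nb_loc_finite_compl S z : loc_finite S -> ~ S z -> nb z (fun w => ~ S w).
Proof.
move=> fS Sz; apply: nbW (nb_loc_finite z fS) => w h.
by case: (eqVneq w z) => [->//|]; exact: h.
Qed.

Lemma lat_tau : L (1, 0) = tau.
Proof. by rewrite /lat /= mul1r addr0. Qed.

Lemma lat_1 : L (0, 1) = 1.
Proof. by rewrite /lat /= mul0r add0r. Qed.

(** Such a function grows at most linearly, so its difference quotient is bounded and hence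
    constant, and [f] is affine. An affine function has complex-linear increments, which excludes
    the conjugate-linear part [be]. *)
Lemma quasi_liouville (S : R[i] -> Prop) (f : R[i] -> R[i]) al be :
  loc_finite S -> (forall z q, S (z + L q) <-> S z) ->
  (forall z q, ~ S z -> f (z + L q) = f z + (L q * al + (L q)^* * be)) ->
  (forall z, ~ S z -> exists k, cdiff f z k) ->
  (forall z, S z -> exists K, nb z (fun w => w != z -> nrm (f w) <= K)) ->
  be = 0 /\ exists b, forall z, ~ S z -> f z = al * z + b.
Proof.
move=> fS pS per Df bf.
(* On [S] the default value is chosen to have the same quasi-periods as [f], so that [g] has them
   everywhere. *)
pose g z := if `[< S z >] then z * al + z^* * be else f z.
have gE z : ~ S z -> g z = f z by move=> h; rewrite /g asboolF.
have perg z q : g (z + L q) = g z + (L q * al + (L q)^* * be).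
  case: (pselect (S z)) => Sz.
    rewrite /g !asboolT //; last by apply/pS.
    have -> : (z + L q)^* = z^* + (L q)^* by exact: rmorphD.
    by ring.
  have Sz' : ~ S (z + L q) by move=> /pS.
  by rewrite !gE // per.
have Dg z : ~ S z -> exists k, cdiff g z k.
  move=> Sz; have [k Hk] := Df z Sz; exists k.
  by apply: cdiff_near Hk; apply: nbW (nb_loc_finite_compl fS Sz) => w /gE.
have lb z : lbdd g z.
  case: (pselect (S z)) => Sz; last by have [k D] := Dg z Sz; exact: cdiff_lbdd D.
  have [K HK] := bf z Sz; exists (Num.max K (nrm (g z))).
  apply: nbW (nb_and HK (nb_loc_finite z fS)) => w [h1 h2].
  case: (eqVneq w z) => [->|wz]; first by rewrite le_max lexx orbT.
  by rewrite gE ?le_max ?h1 //; exact: h2.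
have [K K0 HK] := @ball_bounded R g 0 (nrm tau + 1) (fun z _ _ => lb z).
have grow z : nrm (g z) <= K + (nrm z + (nrm tau + 1)) * (nrm al + nrm be).
  have [q Hq] := lat_round red z; rewrite -(subrK (L q) z) perg.
  have lq : nrm (L q) <= nrm (z - L q + L q) + (nrm tau + 1).
    by rewrite subrK (_ : L q = z - (z - L q)); [have := nrmB z (z - L q); lra|ring].
  apply: le_trans (nrmD _ _) _; apply: lerD; first by apply: HK; rewrite subr0.
  apply: le_trans (nrmD _ _) _; rewrite !nrmM nrm_conj -mulrDr ler_wpM2r //.
  by rewrite addr_ge0 ?nrm_ge0.
have [z0 _ Sz0] := nb_ex (nb_loc_finite 0 fS).
have [z0' z00 Sz0'] := nb_ex (nb_loc_finite 0 fS).
have {Sz0'} Sz0' := Sz0' z00; move: z0' z00 Sz0' => {Sz0} {}z0 _ Sz0.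
have [k0 Dk0] := Dg z0 Sz0.
pose h := diffq g z0.
have Dh z : ~ S z -> z != z0 -> exists k, cdiff h z k.
  by move=> Sz zz; have [k Hk] := Dg z Sz; apply: diffq_cdiff Hk.
have lbh z : lbdd h z.
  by case: (eqVneq z z0) => [->|zz]; [exact: diffq_lbdd_near Dk0|exact: diffq_lbdd].
have hfin B : exists E : seq R[i], forall z, nrm z <= B -> z \notin E -> exists k, cdiff h z k.
  have [s Hs] := fS B; exists (z0 :: s) => z zB; rewrite inE negb_or => /andP[zz zs].
  by apply: Dh => // Sz; move: zs; rewrite Hs.
have hgrow e : 0 < e -> exists B, forall z, B <= nrm z -> nrm (h z) <= e * nrm z.
  move=> e0; pose A := nrm al + nrm be; have A0 : 0 <= A by rewrite addr_ge0 ?nrm_ge0.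
  pose D := K + (nrm tau + 1) * A + nrm (g z0).
  have D0 : 0 <= D by rewrite !addr_ge0 ?nrm_ge0 // mulr_ge0 // addr_ge0 ?nrm_ge0.
  have i0 : 0 <= e^-1 by rewrite invr_ge0 ltW.
  exists (2 * nrm z0 + 1 + 2 * (A + D) * e^-1) => z zB.
  have n0 := nrm_ge0 z0; have m0 : 0 <= 2 * (A + D) * e^-1 by rewrite !mulr_ge0 // addr_ge0.
  have h1 : nrm z / 2 <= nrm (z - z0) by have := nrmB_ge z z0; lra.
  have z1 : 1 <= nrm z by lra.
  rewrite nrmM nrmV ler_pdivrMr; last by apply: lt_le_trans h1; lra.
  apply: le_trans (nrmB _ _) _; apply: (@le_trans _ _ (e * nrm z * (nrm z / 2))); last first.
    by rewrite ler_wpM2l // mulr_ge0 ?(ltW e0) // nrm_ge0.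
  have h2 := grow z; rewrite -/A in h2.
  have h3 : nrm (g z) + nrm (g z0) <= (A + D) * nrm z.
    have : D <= D * nrm z by rewrite ler_peMr.
    rewrite /D in D0 *; move=> ?; lra.
  apply: le_trans h3 _; rewrite mulrCA -mulrA mulrC ler_wpM2l ?nrm_ge0 //.
  have : 2 * (A + D) <= e * nrm z; last by lra.
  rewrite -ler_pdivrMl //; lra.
have hc z w : ~ S z -> ~ S w -> z != z0 -> w != z0 -> h z = h w.
  move=> Sz Sw zz wz; have [k Hk] := Dh z Sz zz; have [k' Hk'] := Dh w Sw wz.
  exact: (liouville hfin lbh hgrow Hk Hk').
have [z1 z10 Sz1] := nb_ex (nb_loc_finite z0 fS).
pose a := h z1.
have lin z : ~ S z -> f z = f z0 + a * (z - z0).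
  move=> Sz; case: (eqVneq z z0) => [->|zz]; first by rewrite subrr mulr0 addr0.
  have z10' := Sz1 z10.
  rewrite /a (hc _ _ z10' Sz z10 zz) /h /diffq !gE //.
  by field; rewrite subr_eq0.
have eqn q : a * L q = L q * al + (L q)^* * be.
  have Sq : ~ S (z0 + L q) by move=> /pS.
  have := lin _ Sq; rewrite per // (_ : _ - z0 = L q); last by ring.
  by move/addrI.
have e1 := eqn (0, 1); have e2 := eqn (1, 0).
rewrite lat_1 lat_tau in e1 e2.
have c1 : (1 : R[i])^* = 1 by exact: rmorph1.
rewrite c1 !mul1r mulr1 in e1.
have b0 : be = 0.
  have : be * (tau - tau^*) = 0.
    rewrite e1 in e2; have -> : be * (tau - tau^*) = (al + be) * tau - (tau * al + tau^* * be) by ring.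
    by rewrite e2 subrr.
  by move/eqP; rewrite mulf_eq0 (negbTE (tau_conj_neq red)) orbF => /eqP.
split=> //; exists (f z0 - al * z0) => z Sz.
by rewrite (lin z Sz) e1 b0; ring.
Qed.

End QuasiPeriodic.

(** * The cotangent in terms of exp (2 pi i z) *)

Section CotangentSeries.
Variable R : realType.
Implicit Types (z w u v k : R[i]) (p : int * int) (x : R).

Definition tpi : R[i] := 'i * (2 * pi)%:C.
Definition qe z := expC (tpi * z).

Lemma tpi_neq0 : tpi != 0.
Proof. by rewrite -nrm_gt0 nrmM nrm_i mul1r nrm_real normr_gt0 gt_eqF // mulr_gt0 // pi_gt0. Qed.

Lemma nrm_tpi : nrm tpi = 2 * pi.
Proof. by rewrite nrmM nrm_i mul1r nrm_real ger0_norm // mulr_ge0 // ltW // pi_gt0. Qed.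

Lemma qeD z w : qe (z + w) = qe z * qe w.
Proof. by rewrite /qe mulrDr expCD. Qed.

Lemma qeN z : qe (- z) = (qe z)^-1.
Proof. by rewrite /qe mulrN expCN. Qed.

Lemma qe0 : qe 0 = 1. Proof. by rewrite /qe mulr0 expC0. Qed.

Lemma qe_neq0 z : qe z != 0. Proof. exact: expC_neq0. Qed.

Lemma qe1 : qe 1 = 1. Proof. by rewrite /qe mulr1 expC_2pi. Qed.

Lemma qeM (n : nat) z : qe (n%:R * z) = qe z ^+ n.
Proof. by rewrite /qe mulrCA expCX. Qed.

Lemma qe_int (m : int) : qe m%:~R = 1.
Proof.
case: m => n; first by rewrite -[n%:~R]mulr1 -[(Posz n)%:~R]/(n%:R) qeM qe1 expr1n.
by rewrite NegzE rmorphN /= qeN -[n.+1%:~R]mulr1 -[(Posz n.+1)%:~R]/(n.+1%:R) qeM qe1 expr1n invr1.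
Qed.

Lemma nrm_qe z : nrm (qe z) = expR (- (2 * pi * complex.Im z)).
Proof.
rewrite nrm_expC; congr expR; rewrite /tpi; case: z => a b /=; ring.
Qed.

Lemma qe_real x : qe x%:C = cos (2 * pi * x) +i* sin (2 * pi * x).
Proof.
rewrite -expC_i /qe /tpi; congr expC; rewrite rmorphM /=; ring.
Qed.

Lemma qe_eq1 z : qe z = 1 -> exists m : int, z = m%:~R.
Proof.
move=> E; have p0 := pi_gt0 R.
have I0 : complex.Im z = 0.
  have := nrm_qe z; rewrite E nrm1 -expR0 => /expR_inj/esym/eqP.
  by rewrite oppr_eq0 mulf_eq0 gt_eqF ?mulr_gt0 //= => /eqP.
pose x := complex.Re z; have zx : z = x%:C by rewrite /x; move: I0; case: (z) => a b /= ->.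
pose m := Num.floor x; pose r := x - m%:~R.
have /andP[r1 r2] : 0 <= r < 1.
  by have /andP[h1 h2] := floor_itv x; rewrite /r subr_ge0 h1 /=; move: h2; rewrite rmorphD /=; lra.
have Er : qe r%:C = 1.
  by rewrite /r rmorphB /= qeD -zx E mul1r rmorph_int qeN qe_int invr1.
have r0 : r = 0.
  apply/eqP; rewrite -[_ == _]negbK; apply/negP => rn.
  have rp : 0 < r by rewrite lt_neqAle eq_sym rn.
  have s0 : 0 < sin (pi * r).
    apply: sin_gt0_pi; rewrite mulr_gt0 //= gtr_pMr //.
  have : complex.Re (qe r%:C) = 1 by rewrite Er.
  rewrite qe_real /= (_ : 2 * pi * r = pi * r + pi * r); last by ring.
  rewrite cosD => c; have := cos2Dsin2 (pi * r).
  have : 0 < sin (pi * r) ^+ 2 by rewrite exprn_gt0.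
  rewrite !expr2; lra.
exists m; rewrite zx; have -> : x = m%:~R by move: r0; rewrite /r; lra.
by rewrite rmorph_int.
Qed.

Lemma cdiff_qe z : cdiff qe z (tpi * qe z).
Proof. exact: (cdiff_lin (cdiff_expC (tpi * z))). Qed.

(* [cotC z = pi * cot (pi z)] *)
Definition cotC z := tpi / 2 * ((qe z + 1) / (qe z - 1)).
(** [cotC z] shifted by [tpi / 2] so as to vanish as [Im z] tends to infinity, which makes its
    translates by multiples of tau summable. The function [cscT] below is [pi^2 / sin^2 (pi z)],
    minus its derivative. *)
Definition cotU z := tpi * (qe z / (qe z - 1)).
Definition cscT z := tpi ^+ 2 * (qe z / (qe z - 1) ^+ 2).

Lemma cotU_cotC z : qe z != 1 -> cotU z = cotC z + tpi / 2.
Proof. by move=> q1; rewrite /cotU /cotC; field; rewrite subr_eq0. Qed.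

Lemma cotCN z : cotC (- z) = - cotC z.
Proof.
rewrite /cotC qeN; have q0 := qe_neq0 z; case: (eqVneq (qe z) 1) => [->|q1].
  by rewrite invr1 subrr invr0 !mulr0 oppr0.
have q2 : qe z - 1 != 0 by rewrite subr_eq0.
have q3 : 1 - qe z != 0 by rewrite subr_eq0 eq_sym.
by field; rewrite q0 q2 mulN1r q3.
Qed.

Lemma qe_shift z (m : int) : qe (z + m%:~R) = qe z.
Proof. by rewrite qeD qe_int mulr1. Qed.

Lemma cotU_cdiff z : qe z != 1 -> cdiff cotU z (- cscT z).
Proof.
move=> q1; have q2 : qe z - 1 != 0 by rewrite subr_eq0.
have D := @cdiffV R (fun w => qe w - 1) z _ q2 (cdiffB (cdiff_qe z) (cdiff_cst 1 z)).
have := cdiffZ tpi (cdiffM (cdiff_qe z) D); apply: cdiff_eq.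
by rewrite /cscT; field.
Qed.

Lemma cotC_cdiff z : qe z != 1 -> cdiff cotC z (- cscT z).
Proof.
move=> q1; have q2 : qe z - 1 != 0 by rewrite subr_eq0.
have D := @cdiffV R (fun w => qe w - 1) z _ q2 (cdiffB (cdiff_qe z) (cdiff_cst 1 z)).
have := cdiffZ (tpi / 2) (cdiffM (cdiffD (cdiff_qe z) (cdiff_cst 1 z)) D); apply: cdiff_eq.
by rewrite /cscT; field.
Qed.

Lemma cscT_cdiff z : qe z != 1 -> exists k, cdiff cscT z k.
Proof.
move=> q1; have q2 : qe z - 1 != 0 by rewrite subr_eq0.
have q3 : (qe z - 1) ^+ 2 != 0 by rewrite expf_neq0.
have D := @cdiffV R (fun w => (qe w - 1) ^+ 2) z _ q3 (cdiffX 2 (cdiffB (cdiff_qe z) (cdiff_cst 1 z))).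
by have := cdiffZ (tpi ^+ 2) (cdiffM (cdiff_qe z) D); eexists; eassumption.
Qed.

Lemma csc_cot z : qe z != 1 -> cscT z = cotC z ^+ 2 - (tpi / 2) ^+ 2.
Proof. by move=> q1; rewrite /cscT /cotC; field; rewrite subr_eq0. Qed.

Lemma q_small_bound (q : R[i]) : nrm q <= 2^-1 -> 2^-1 <= nrm (q - 1).
Proof. by move=> h; have := nrmB_ge 1 q; rewrite nrm1 nrmC; lra. Qed.

Lemma cotU_bound z : nrm (qe z) <= 2^-1 -> nrm (cotU z) <= 4 * pi * nrm (qe z).
Proof.
move=> h; have d := q_small_bound h; rewrite /cotU nrmM nrm_tpi nrmM nrmV.
have p0 := pi_gt0 R; have i0 : (nrm (qe z - 1))^-1 <= 2.
  by rewrite -[2]invrK lef_pV2 ?posrE //; lra.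
have -> : 4 * pi * nrm (qe z) = 2 * pi * (nrm (qe z) * 2) by ring.
by rewrite ler_wpM2l ?ler_wpM2l ?nrm_ge0 // mulr_ge0 // ltW.
Qed.

Lemma cscT_bound z : nrm (qe z) <= 2^-1 -> nrm (cscT z) <= 16 * pi ^+ 2 * nrm (qe z).
Proof.
move=> h; have d := q_small_bound h; rewrite /cscT nrmM nrmX nrm_tpi nrmM nrmV nrmX.
have p0 := pi_gt0 R; have i0 : (nrm (qe z - 1) ^+ 2)^-1 <= 4.
  rewrite -[4]invrK lef_pV2 ?posrE //; last by rewrite exprn_gt0 //; lra.
  by rewrite (_ : 4^-1 = 2^-1 ^+ 2 :> R); [rewrite ler_pXn2r ?nnegrE //; lra|field].
have -> : 16 * pi ^+ 2 * nrm (qe z) = (2 * pi) ^+ 2 * (nrm (qe z) * 4) by ring.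
by rewrite ler_wpM2l ?ler_wpM2l ?nrm_ge0 // sqr_ge0.
Qed.

Lemma absb_geo (rho : R) : 0 <= rho -> rho < 1 -> absb (fun n : nat => (rho ^+ n)%:C) (1 - rho)^-1.
Proof.
move=> r0 r1; have d : 0 < 1 - rho by lra.
move=> s us.
have -> : \sum_(i <- s) nrm (rho ^+ i)%:C = \sum_(i <- s) rho ^+ i.
  by apply: eq_bigr => i _; rewrite nrm_real ger0_norm // exprn_ge0.
pose N := (\max_(i <- s) i).+1.
have sub : {subset s <= iota 0 N}.
  by move=> i si; rewrite mem_iota /= add0n ltnS; apply: leq_bigmax_seq.
apply: le_trans (ler_sum_uniq_sub (fun i => exprn_ge0 i r0) us (iota_uniq 0 N) sub) _.
have E n : (\sum_(i <- iota 0 n) rho ^+ i) * (1 - rho) = 1 - rho ^+ n.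
  elim: n => [|n IH]; first by rewrite big_nil mul0r expr0 subrr.
  by rewrite -addn1 iotaD big_cat /= big_seq1 add0n mulrDl IH addn1 exprS; ring.
rewrite -div1r ler_pdivlMr // E; have := exprn_ge0 N r0; lra.
Qed.

Lemma absm_geo (rho : R) : 0 <= rho -> rho < 1 -> absm (fun n : nat => (rho ^+ n)%:C).
Proof. by move=> r0 r1; exists (1 - rho)^-1; exact: absb_geo. Qed.

(* (e^w + 1)/(e^w - 1) = 2/w + O(1) *)
Lemma cotC_pole : exists K, nb 0 (fun z => z != 0 -> nrm (cotC z - z^-1) <= K).
Proof.
pose K := expR (1 : R); have K1 : 1 <= K by rewrite -(@expR0 R) ler_expR.
have p0 := pi_gt0 R.
exists (2 * pi * (3 * K)), (4 * pi * K)^-1; first by rewrite invr_gt0 !mulr_gt0 //; lra.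
move=> z; rewrite subr0 => zd z0; pose w := tpi * z.
have w0 : w != 0 by rewrite mulf_neq0 // tpi_neq0.
have wn : nrm w <= (2 * K)^-1.
  rewrite /w nrmM nrm_tpi; apply: (@le_trans _ _ (2 * pi * (4 * pi * K)^-1)).
    by rewrite ler_wpM2l ?(ltW zd) // mulr_ge0 // ltW.
  rewrite le_eqVlt; apply/orP; left; apply/eqP; field; rewrite !gt_eqF //; lra.
have wK : K * nrm w <= 2^-1.
  apply: le_trans (ler_wpM2l _ wn) _; first lra.
  rewrite le_eqVlt; apply/orP; left; apply/eqP; field; rewrite !gt_eqF //; lra.
have nw := nrm_ge0 w.
have w1 : nrm w <= 1 by (have h : nrm w <= K * nrm w by rewrite ler_peMl); lra.
have KE : expR (nrm w) <= K by rewrite ler_expR.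
have b1 := expC_bound1 w; have b2 := expC_bound2 w.
have {}b1 : nrm (expC w - 1) <= K * nrm w by apply: le_trans b1 _; rewrite ler_wpM2r.
have {}b2 : nrm (expC w - 1 - w) <= K * nrm w ^+ 2 by apply: le_trans b2 _; rewrite ler_wpM2r ?sqr_ge0.
have kw2 : K * nrm w ^+ 2 <= nrm w / 2 by rewrite expr2 mulrA mulrC ler_wpM2l.
have lo : nrm w / 2 <= nrm (expC w - 1).
  have := nrmB_ge w (w - (expC w - 1)); rewrite (nrmC w (expC w - 1)).
  rewrite (_ : w - (w - _) = expC w - 1); last by ring.
  lra.
have wp : 0 < nrm w by rewrite nrm_gt0.
have e0 : expC w - 1 != 0 by rewrite -nrm_gt0; lra.
have -> : cotC z - z^-1 = tpi * ((w * (expC w - 1) - 2 * (expC w - 1 - w)) / (2 * w * (expC w - 1))).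
  by rewrite /cotC /qe -/w /w in e0 *; field; rewrite z0 e0 tpi_neq0.
rewrite nrmM nrm_tpi ler_wpM2l //; first by rewrite mulr_ge0 // ltW.
clearbody w; rewrite nrmM nrmV ler_pdivrMr; last by rewrite !nrmM nrm_nat !mulr_gt0 //; lra.
apply: le_trans (nrmB _ _) _; rewrite !nrmM nrm_nat.
have h1 : nrm w * nrm (expC w - 1) <= nrm w * (K * nrm w) by rewrite ler_wpM2l.
have h2 : 3 * K * nrm w ^+ 2 <= 3 * K * (2 * nrm w * nrm (expC w - 1)).
  rewrite expr2 ler_wpM2l ?mulr_ge0 //; first lra.
  have : nrm w * (nrm w / 2) <= nrm w * nrm (expC w - 1) by rewrite ler_wpM2l.
  by lra.
apply: le_trans h2; move: b2 h1; rewrite !expr2; lra.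
Qed.

End CotangentSeries.

(** * The Lambert expansion of zeta *)

Section LambertSeries.
Variable R : realType.
Variable tau : R[i].
Hypothesis red : reduced tau.
Implicit Types (z w u k : R[i]) (p q : int * int) (v dv : R[i] -> R[i]).
Local Notation L := (lat tau).
Local Notation L0 := (L0 tau).
Local Notation zeta := (zeta tau).
Local Notation s2 := (ca tau 0).
Local Notation c0 := (cb tau 0).
Local Notation tpi := (tpi R).

Lemma nrm_qe_tau : nrm (qe tau) < 1.
Proof.
have [i0 _ _] := red; rewrite nrm_qe expR_lt1 oppr_lt0 !mulr_gt0 //; exact: pi_gt0.
Qed.

Lemma nrm_qe_le z B : nrm z <= B -> nrm (qe z) <= expR (2 * pi * B).
Proof.
move=> zB; rewrite nrm_qe ler_expR -mulrN ler_wpM2l ?mulr_ge0 ?pi_ge0 //.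
by have := le_trans (Im_le_nrm z) zB; rewrite ler_norml => /andP[]; lra.
Qed.

(** Rows start at [z + tau]: the row of [z] itself is carried by [cotC] in [lambF]. *)
Definition trow (n : nat) z := z + n.+1%:R * tau.
Definition useries v z := csum (fun n : nat => v (trow n z)).
(** The condition that no row [trow n z] meets an integer, a pole of [cotU]. Unlike [~ L0 z] it
    holds at [z = 0], where expansions are taken. *)
Definition above z := forall p, 0 < p.1 -> L p + z != 0.

Lemma nrm_qe_row n z : nrm (qe (trow n z)) = nrm (qe z) * nrm (qe tau) ^+ n.+1.
Proof. by rewrite /trow qeD qeM nrmM nrmX. Qed.

Lemma qe_trow_neq1 n z : above z -> qe (trow n z) != 1.
Proof.
move=> az; apply/eqP => /qe_eq1[m E].
have := az (n.+1%:Z, - m) isT; rewrite /lat /= rmorphN /= => /eqP; apply.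
move: E; rewrite /trow => E; rewrite -E -[(n.+1%:Z)%:~R]/(n.+1%:R); ring.
Qed.

Lemma above_notL0 z : ~ L0 z -> above z.
Proof.
move=> zL p _; apply/eqP => E; apply: zL.
by rewrite -[z](addKr (L p)) E addr0; exact: L0N (L0lat _ p).
Qed.

Lemma above_im z : - complex.Im tau < complex.Im z -> above z.
Proof.
have [i0 _ _] := red; move=> zi [m n] /= m0; apply/eqP => /(congr1 (@complex.Im R)) /=.
have -> : complex.Im (m%:~R * tau + n%:~R + z) = m%:~R * complex.Im tau + complex.Im z.
  by rewrite -!(rmorph_int (real_complex R)) !ImD cImM /=; ring.
have m1 : 1 <= m%:~R :> R by rewrite ler1z.
have : 1 * complex.Im tau <= m%:~R * complex.Im tau by rewrite ler_pM2r.
move=> h E; lra.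
Qed.

Lemma nb_above z : above z -> nb z above.
Proof.
move=> az; have [s Hs] := lat_finite red (nrm z + 1).
have H : nb z (fun w => forall p, p \in s -> 0 < p.1 -> w != - L p).
  apply: (@nb_all R _ s z (fun p w => 0 < p.1 -> w != - L p)) => p _.
  case: (boolP (0 < p.1)) => p1; last exact: nbT.
  apply: nbW (@nb_neq R z (- L p) _) => //; apply/eqP => E.
  by have := az p p1; rewrite E subrr eqxx.
apply: nbW (nb_and H (@nb_near R z 1 ltr01)) => w [h1 h2] p p1.
apply/eqP => E; have Ew : w = - L p by rewrite -[w](addKr (L p)) E addr0.
have ps : p \in s by apply: Hs; rewrite -nrmN -Ew; have := nrmB_ge w z; lra.
by have := h1 p ps p1; rewrite Ew eqxx.
Qed.

Lemma useries_cdiff v dv K z0 : 0 <= K ->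
  (forall z, qe z != 1 -> cdiff v z (dv z)) ->
  (forall z, nrm (qe z) <= 2^-1 -> nrm (v z) <= K * nrm (qe z)) -> above z0 ->
  [/\ absm (fun n => v (trow n z0)), absm (fun n => dv (trow n z0)) &
      cdiff (useries v) z0 (useries dv z0)].
Proof.
move=> K0 Dv Bv az; have [d d0 Hd] := nb_above az.
pose r := Num.min (d / 2) 1.
have r0 : 0 < r by rewrite lt_min ltr01 divr_gt0.
have rd : r <= d / 2 by rewrite ge_min lexx.
have r1 : r <= 1 by rewrite ge_min lexx orbT.
pose W := expR (2 * pi * (nrm z0 + 1)); have W0 : 0 < W by exact: expR_gt0.
pose rho := nrm (qe tau); have rho1 : rho < 1 := nrm_qe_tau; have rho0 : 0 <= rho := nrm_ge0 _.
have [N HN] := pow_small rho0 rho1 (e := (2 * W)^-1) ltac:(by rewrite invr_gt0 mulr_gt0).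
pose M n : R := K * W * rho ^+ n.+1.
have Dn n z : nrm (z - z0) <= r -> cdiff (fun z => v (trow n z)) z (dv (trow n z)).
  move=> zr; apply: cdiff_shift; apply: Dv; apply: qe_trow_neq1; apply: Hd; lra.
have Dn' n z : nrm (z - z0) <= r -> exists k, cdiff (fun z => v (trow n z)) z k.
  by move=> /(Dn n); eexists; eassumption.
have Mb n z : n \notin iota 0 N -> nrm (z - z0) <= r -> nrm (v (trow n z)) <= M n.
  rewrite mem_iota /= add0n -leqNgt => nN zr.
  have qW : nrm (qe z) <= W by apply: nrm_qe_le; have := nrmB_ge z z0; lra.
  have b : nrm (qe (trow n z)) <= W * rho ^+ n.+1.
    by rewrite nrm_qe_row ler_wpM2r // exprn_ge0.
  have b2 : W * rho ^+ n.+1 <= 2^-1.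
    have : rho ^+ n.+1 <= (2 * W)^-1.
      by apply: le_trans (ltW HN); apply: ler_wiXn2l; rewrite ?(ltW rho1) // ltnW.
    move=> /(ler_wpM2l (ltW W0)) /le_trans; apply.
    by rewrite le_eqVlt; apply/orP; left; apply/eqP; field; rewrite gt_eqF.
  apply: le_trans (Bv _ (le_trans b b2)) _.
  by rewrite /M -mulrA ler_wpM2l.
have aM : absm (fun n => (M n)%:C).
  apply: absm_ext (absmZ (K * W * rho)%:C (absm_geo rho0 rho1)) => n.
  by rewrite -rmorphM /M exprS mulrA.
have zz0 : nrm (z0 - z0) <= r by rewrite subrr nrm0 ltW.
split.
- exact: (termwise_absm Mb aM zz0).
- exact: (@termwise_absm_d R _ (fun n z => v (trow n z)) _ z0 r M _ r0 Dn' (fun n => Dn n z0 zz0) Mb aM).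
- exact: (@csum_cdiff R _ (fun n z => v (trow n z)) _ z0 r M _ r0 Dn' (fun n => Dn n z0 zz0) Mb aM).
Qed.

Local Notation U := (useries (@cotU R)).
Local Notation T := (useries (@cscT R)).

Lemma U_cdiff z : above z -> [/\ absm (fun n => cotU (trow n z)), absm (fun n => cscT (trow n z)) &
  cdiff U z (- T z)].
Proof.
move=> az; have [|||a1 a2 a3] := @useries_cdiff (@cotU R) (fun z => - cscT z) (4 * pi) z _ _ _ az.
- by rewrite mulr_ge0 // pi_ge0.
- exact: cotU_cdiff.
- exact: cotU_bound.
have a4 : absm (fun n => cscT (trow n z)) by apply: absm_ext (absmN a2) => n; rewrite opprK.
by split=> //; apply: cdiff_eq a3; rewrite /useries csumN.
Qed.

Lemma T_cdiff z : above z -> exists k, cdiff T z k.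
Proof.
move=> az.
have [dT HdT] : exists dT : R[i] -> R[i], forall z, qe z != 1 -> cdiff (@cscT R) z (dT z).
  pose Q z k := qe z != 1 -> cdiff (@cscT R) z k.
  have H z' : exists k, Q z' k.
    case: (boolP (qe z' != 1)) => h; last by exists 0 => h'; rewrite h' in h.
    by have [k Hk] := cscT_cdiff h; exists k.
  have [dT HdT] := boolp.choice H; exists dT; exact: HdT.
have [||_ _ a3] := @useries_cdiff (@cscT R) dT (16 * pi ^+ 2) z _ HdT _ az.
- by rewrite mulr_ge0 // sqr_ge0.
- exact: cscT_bound.
by eexists; exact: a3.
Qed.

Lemma row_tau n z : trow n (z + tau) = trow n.+1 z.
Proof. by rewrite /trow -(natr1 n.+1); ring. Qed.

(** Translation by tau drops the first row of the sum. *)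
Lemma U_tau z : above z -> above (z + tau) -> U (z + tau) = U z - cotU (z + tau).
Proof.
move=> az az'; have [a _ _] := U_cdiff az; have [a' _ _] := U_cdiff az'.
have -> : cotU (z + tau) = cotU (trow 0 z) by rewrite /trow mul1r.
rewrite /useries (@csum_split _ _ [:: 0] _ a) // big_seq1 [RHS]addrC addKr.
rewrite -(@csum_reindex _ _ _ (restr _ _) S); last first.
- by move=> [|n] h; [rewrite /restr inE|have := h n].
- by move=> m n [].
by apply: csum_ext => n; rewrite row_tau.
Qed.

Lemma U_shift1 z : U (z + 1) = U z.
Proof.
apply: csum_ext => n; rewrite /cotU /trow (_ : z + 1 + _ = z + n.+1%:R * tau + 1%:~R); last by ring.
by rewrite qe_shift.
Qed.

(** The cotangent summed over all rows; oddness turns the rows below into [U (- z)]. The shift from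
    [cotC] to [cotU] in each row accounts for the period [- tpi] along tau. *)
Definition lambF z := cotC z + U z - U (- z).

Lemma L0_tau : L0 tau. Proof. by rewrite -{2}(lat_tau tau); exact: L0lat. Qed.
Lemma L0_1 : L0 1. Proof. by rewrite -(lat_1 tau); exact: L0lat. Qed.
Lemma L0_int (m : int) : L0 m%:~R. Proof. by exists (0, m) => //; rewrite /lat /= mul0r add0r. Qed.

Lemma notL0_qe z : ~ L0 z -> qe z != 1.
Proof. by move=> zL; apply/eqP => /qe_eq1[m E]; apply: zL; rewrite E; exact: L0_int. Qed.

Lemma lambF_1 z : lambF (z + 1) = lambF z.
Proof.
rewrite /lambF U_shift1 -[U (- z)](congr1 U (subrK 1 (- z))) U_shift1 -opprD /cotC.
by rewrite -[1]/(1%:~R) qe_shift.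
Qed.

Lemma lambF_tau z : ~ L0 z -> lambF (z + tau) = lambF z - tpi.
Proof.
move=> zL.
have z1 : ~ L0 (z + tau) by move=> /(L0_sub L0_tau).
have z2 : ~ L0 (- z) by move=> /L0_opp.
have z3 : ~ L0 (- (z + tau)) by move=> /L0_opp.
have e1 := U_tau (above_notL0 zL) (above_notL0 z1).
have e2 := U_tau (above_notL0 z3); rewrite opprD subrK in e2.
have {}e2 := e2 (above_notL0 z2).
rewrite /lambF e1 opprD.
have -> : U (- z - tau) = U (- z) + cotU (- z) by rewrite e2; ring.
rewrite !cotU_cotC ?notL0_qe // cotCN.
by field.
Qed.

Lemma lambF_cdiff z : ~ L0 z -> cdiff lambF z (- cscT z - T z - T (- z)).
Proof.
move=> zL; have z2 : ~ L0 (- z) by move=> /L0_opp.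
have [_ _ D1] := U_cdiff (above_notL0 zL); have [_ _ D2] := U_cdiff (above_notL0 z2).
rewrite -mulN1r in D2; have := cdiff_lin D2 => D3.
have := cdiffB (cdiffD (cotC_cdiff (notL0_qe zL)) D1) D3.
move=> H; apply: cdiff_ext (cdiff_eq _ H) => [w|]; first by rewrite /lambF mulN1r.
by rewrite mulN1r; ring.
Qed.

Lemma above0 : above 0.
Proof. by apply: above_im; have [i0 _ _] := red; rewrite /= oppr_lt0. Qed.

Lemma lambFN z : lambF (- z) = - lambF z.
Proof. by rewrite /lambF cotCN opprK; ring. Qed.

Lemma L0_per z p : L0 (z + L p) <-> L0 z.
Proof. by split=> [|h]; [apply: L0_sub; exact: L0lat|apply: L0D h (L0lat _ _)]. Qed.

Lemma L0_loc_finite : loc_finite L0.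
Proof. by move=> B; have [s Hs] := lat_round_disc red B; exists s. Qed.

Lemma lambF_lat z p : ~ L0 z -> lambF (z + L p) = lambF z - p.1%:~R * tpi.
Proof.
have per1 w (m : int) : lambF (w + m%:~R) = lambF w.
  have H (n : nat) u : lambF (u + n%:R) = lambF u.
    by elim: n u => [|n IH] u; rewrite ?addr0 // -natr1 addrA lambF_1.
  case: m => n; first exact: H.
  by rewrite NegzE rmorphN /= -(H n.+1 (w - _)) subrK.
have nat_case (n : nat) u : ~ L0 u -> lambF (u + n%:R * tau) = lambF u - n%:R * tpi.
  elim: n => [|n IH] uL; first by rewrite !mul0r addr0 subr0.
  rewrite -natr1 mulrDl mul1r addrA lambF_tau ?IH //; first by ring.
  by rewrite (_ : n%:R * tau = L (n%:Z, 0)) ?L0_per // /lat /= addr0.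
case: p => m n zL; rewrite /lat /= addrA per1; case: m => m; first exact: nat_case.
rewrite NegzE !rmorphN /=; set z' := z + _.
have z'L : ~ L0 z'.
  by rewrite /z' (_ : - _ * tau = L (- m.+1%:Z, 0)) ?L0_per // /lat /= addr0 rmorphN.
have := nat_case m.+1 z' z'L; rewrite /z' mulNr subrK => ->; ring.
Qed.

Lemma zeta_lamb : c0 = (pi / complex.Im tau)%:C /\
  forall z, ~ L0 z -> zeta z = (s2 + c0) * z + lambF z.
Proof.
have [i0 _ _] := red; have it : complex.Im tau != 0 by rewrite gt_eqF.
pose b : R[i] := (pi / complex.Im tau)%:C.
have tb : (tau - tau^*) * b = tpi.
  by rewrite /b /Defs.E_ /tpi; move: it; case: (tau) => x y /= y0; apply/eqP;
    rewrite eq_complex /=; apply/andP; split; apply/eqP; field.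
pose f z := zeta z - lambF z.
have bpole : exists K, nb 0 (fun w => w != 0 -> nrm (f w) <= K).
  have [K HK] := cotC_pole R.
  have D0 := zeta0_cdiff red (z := 0) ltac:(by rewrite nrm0 ltr01).
  have [_ _ D1] := U_cdiff above0.
  have D2 : cdiff (fun w => U (-1 * w)) 0 (-1 * (- T 0)) by apply: cdiff_lin; rewrite mulr0.
  have B := ccont_bnd (cdiff_cont (cdiffB (cdiffB D0 D1) (cdiffN D2))).
  eexists; apply: nbW (nb_and (nb_and HK B) (nb0_notL0 red)) => w [[h1 h2] h3] w0.
  rewrite /f (zeta_split red (h3 w0)) /lambF.
  have -> : w^-1 + zeta0 tau w - (cotC w + U w - U (- w)) =
     (zeta0 tau w - U w - - U (-1 * w)) - (cotC w - w^-1) by rewrite mulN1r; ring.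
  by apply: le_trans (nrmB _ _) _; apply: lerD; [exact: h2|exact: h1].
have [] := @quasi_liouville R tau red L0 f (s2 + b) (c0 - b).
- exact: L0_loc_finite.
- exact: L0_per.
- move=> z q zL; rewrite /f zetaD // lambF_lat // -tb /lat.
  have -> : (q.1%:~R * tau + q.2%:~R)^* = q.1%:~R * tau^* + q.2%:~R.
    by rewrite rmorphD rmorphM /= !rmorph_int.
  ring.
- move=> z zL; have [_ _ D1] := zeta_props red zL.
  by eexists; apply: cdiffB D1 (lambF_cdiff zL).
- move=> _ [p _ <-]; have [K HK] := bpole.
  have [d d0 H] := HK; have [d1 d10 H1] := nb0_notL0 red.
  exists (K + nrm (L p * (s2 + b) + (L p)^* * (c0 - b))), (Num.min d d1); first by rewrite lt_min d0.
  move=> w; rewrite lt_min => /andP[wd wd1] wp.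
  have w0 : w - L p != 0 by rewrite subr_eq0.
  have wL : ~ L0 (w - L p) by apply: H1; rewrite ?subr0.
  have -> : f w = f (w - L p) + (L p * (s2 + b) + (L p)^* * (c0 - b)).
    rewrite -{1}(subrK (L p) w) /f zetaD // lambF_lat // -tb.
    have -> : (L p)^* = p.1%:~R * tau^* + p.2%:~R by rewrite rmorphD rmorphM /= !rmorph_int.
    rewrite /lat; ring.
  by apply: le_trans (nrmD _ _) _; rewrite lerD2r; apply: H; rewrite ?subr0.
move=> cb [k Hk]; have cE : c0 = b by apply/eqP; rewrite -subr_eq0 cb.
split=> // z zL.
have fN w : ~ L0 w -> f (- w) = - f w by move=> wL; rewrite /f zetaN // lambFN; ring.
have k0 : k = 0.
  have z2 : ~ L0 (- z) by move=> /L0_opp.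
  have := fN z zL; rewrite (Hk _ zL) (Hk _ z2) => E.
  have : 2 * k = 0 by transitivity ((s2 + b) * - z + k - (- ((s2 + b) * z + k))); [ring|rewrite E subrr].
  by move/eqP; rewrite mulf_eq0 (negbTE (_ : 2 != 0)) ?pnatr_eq0 //= => /eqP.
by have := Hk z zL; rewrite k0 addr0 /f -cE => <-; ring.
Qed.

End LambertSeries.

(** * The q-expansion of E_2 *)

Section QuasiPeriod.
Variable R : realType.
Variable tau : R[i].
Hypothesis red : reduced tau.
Implicit Types (z w : R[i]).
Local Notation T := (useries tau (@cscT R)).

(** Write [cotC w = 1/w + r w]. The differential equation for the cotangent, [csc_cot], gives
    [3 r'(0) = tpi^2 / 4] as [w] tends to 0, and [r'(0) = - a + 2 T 0]. This supplies the constant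
    [tpi^2 / 12] without summing a series. *)
Lemma quasi_period_series :
  ca tau 0 + cb tau 0 = 2 * T 0 - tpi R ^+ 2 / 12.
Proof.
have [_ zl] := zeta_lamb red; set a := ca tau 0 + cb tau 0 in zl *.
pose U := useries tau (@cotU R).
pose r z := zeta0 tau z - a * z - U z + U (-1 * z).
pose r' z := - wp0 tau z - a + T z + T (-1 * z).
have a0 := above0 red.
have a0' : above tau (-1 * 0) by rewrite mulr0.
have Dr z : nrm z < 1 -> above tau z -> above tau (-1 * z) -> cdiff r z (r' z).
  move=> z1 az az'; have [_ _ D1] := U_cdiff red az; have [_ _ D2] := U_cdiff red az'.
  have D := cdiffD (cdiffB (cdiffB (zeta0_cdiff red z1) (cdiffZ a (cdiff_id z))) D1) (cdiff_lin D2).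
  by apply: cdiff_eq D; rewrite /r'; ring.
have N : nb 0 (fun z => [/\ nrm z < 1, above tau z & above tau (-1 * z)]).
  have [d d0 H] := nb_above red a0; exists (Num.min d 1); first by rewrite lt_min d0 ltr01.
  move=> w; rewrite subr0 lt_min => /andP[w1 w2]; split=> //; apply: H; rewrite subr0 //.
  by rewrite mulN1r nrmN.
have n0 : nrm (0 : R[i]) < 1 by rewrite nrm0 ltr01.
have D0 := Dr 0 n0 a0 a0'.
have r0 : r 0 = 0 by rewrite /r zeta0_0 !mulr0 !subr0; ring.
have Pr' : plim r' 0 (r' 0).
  have [k1 H1] := wp0_cdiff red n0; have [k2 H2] := T_cdiff red a0; have [k3 H3] := T_cdiff red a0'.
  apply: (@plim_cdiff R r' 0 (- k1 - 0 + k2 + -1 * k3)).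
  by apply: cdiffD (cdiffD (cdiffB (cdiffN H1) (cdiff_cst a 0)) H2) (cdiff_lin H3).
have P1 := plimD (plimD Pr' (plimZ 2 (plim_diffq D0))) (plim_cdiff (cdiffX 2 D0)).
have E : tpi R ^+ 2 / 4 = r' 0 + 2 * r' 0 + r 0 ^+ 2.
  apply: (plim_const P1); have [d d0 H] := nb_and (nb0_notL0 red) (nb_nb N).
  apply: nbW (nb_and (nb_and (nb0_notL0 red) (nb_nb N)) N) => z [[h1 h2] h3] z0.
  have zL := h1 z0; have q1 := notL0_qe zL.
  have Cr : nb z (fun w => cotC w = w^-1 + r w).
    apply: nbW (nb_notL0 red zL) => w wL.
    by have := zl w wL; rewrite (zeta_split red wL) /lambF => E; rewrite /r mulN1r;
      rewrite (_ : zeta0 tau w = a * w + (cotC w + useries tau (@cotU R) w - useries tau (@cotU R) (- w)) - w^-1);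
      [rewrite /U; ring|rewrite -E; ring].
  have [z1 az az'] := h3.
  have D1 := cdiff_near Cr (cotC_cdiff q1).
  have := cdiff_uniq D1 (cdiffD (cdiff_inv z0) (Dr z z1 az az')).
  rewrite (csc_cot q1) (nb_self Cr) => E.
  have -> : r' z = (z ^+ 2)^-1 - ((z^-1 + r z) ^+ 2 - (tpi R / 2) ^+ 2) by rewrite E; ring.
  by rewrite /diffq r0 !subr0; field.
move: E; rewrite r0 /r' wp0_0 mulr0 => E.
have -> : 2 * T 0 - tpi R ^+ 2 / 12 = 2 * T 0 - tpi R ^+ 2 / 4 / 3 by field.
by rewrite E; field.
Qed.

End QuasiPeriod.

(** * Torsion points, distribution relations and sums of wp *)

Section Torsion.
Variable R : realType.
Variable tau : R[i].
Hypothesis red : reduced tau.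
Implicit Types (z w u v k h t : R[i]) (p q : int * int) (S : R[i] -> Prop) (T : seq R[i]).
Local Notation L := (lat tau).
Local Notation L0 := (L0 tau).
Local Notation zeta := (zeta tau).
Local Notation s2 := (ca tau 0).
Local Notation c0 := (cb tau 0).
Local Notation E1 := (E_ 1 L0).

Definition latperiodic (g : R[i] -> R[i]) := forall z w, L0 w -> g (z + w) = g z.

(** Lists of representatives modulo the lattice stand in for finite quotients; by [reps_sum], sums
    of periodic functions do not depend on the list. *)
Record reps S T : Prop := Reps {
  reps_sub : forall t, t \in T -> S t;
  reps_uniq : uniq T;
  reps_inj : forall t t', t \in T -> t' \in T -> L0 (t - t') -> t = t';
  reps_surj : forall z, S z -> exists2 t, t \in T & L0 (z - t) }.

Lemma periodic_eq g z w : latperiodic g -> L0 (z - w) -> g z = g w.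
Proof. by move=> pg h; rewrite -(pg w _ h) addrC subrK. Qed.

Lemma L0_subC z w : L0 (z - w) -> L0 (w - z).
Proof. by move=> /L0N; rewrite opprB. Qed.

Lemma L0_trans z w u : L0 (z - w) -> L0 (w - u) -> L0 (z - u).
Proof. by move=> a /(L0D a); rewrite addrA subrK. Qed.

Lemma reps_map S (S' : R[i] -> Prop) T (phi : R[i] -> R[i]) : reps S T ->
  (forall t, S t -> S' (phi t)) ->
  (forall t t', S t -> S t' -> L0 (phi t - phi t') -> L0 (t - t')) ->
  (forall t t', L0 (t - t') -> L0 (phi t - phi t')) ->
  (forall z, S' z -> exists2 t, S t & L0 (z - phi t)) ->
  reps S' (map phi T).
Proof.
move=> [h1 h2 h3 h4] m1 m2 m3 m4; split.
- by move=> _ /mapP[t tT ->]; apply: m1; apply: h1.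
- rewrite map_inj_in_uniq // => t t' tT tT' E; apply: h3 => //.
  by apply: m2; rewrite ?E ?subrr; [exact: h1|exact: h1|exact: L0_0].
- move=> _ _ /mapP[t tT ->] /mapP[t' tT' ->] h; congr phi; apply: h3 => //.
  by apply: m2 => //; exact: h1.
- move=> z /m4[t St zt]; have [t' tT tt] := h4 t St.
  exists (phi t'); first exact: map_f.
  exact: L0_trans zt (m3 _ _ tt).
Qed.

Lemma reps_sum S T T' g : reps S T -> reps S T' -> latperiodic g ->
  \sum_(t <- T) g t = \sum_(t <- T') g t.
Proof.
move=> [h1 h2 h3 h4] [k1 k2 k3 k4] pg.
pose c z := xget 0 [set t | t \in T' /\ L0 (z - t)].
have cP z : S z -> c z \in T' /\ L0 (z - c z).
  move=> /k4[t tT zt]; rewrite /c; case: xgetP => [t' -> //|/(_ t)]; case=> //.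
have -> : \sum_(t <- T) g t = \sum_(t <- map c T) g t.
  rewrite big_map big_seq [RHS]big_seq; apply: eq_bigr => t tT.
  by apply: periodic_eq pg _; case: (cP t (h1 t tT)).
apply: perm_big; apply: uniq_perm => //.
  rewrite map_inj_in_uniq // => t t' tT tT' E; apply: h3 => //.
  have [_ a] := cP t (h1 t tT); have [_ b] := cP t' (h1 t' tT').
  by apply: L0_trans a _; rewrite E; exact: L0_subC.
move=> t; apply/mapP/idP => [[t' tT ->]|tT]; first by case: (cP t' (h1 t' tT)).
have [t' tT' tt] := h4 t (k1 t tT); exists t' => //.
have [a b] := cP t' (h1 t' tT'); apply: k3 => //.
exact: L0_trans tt b.
Qed.

Lemma reps_seq (s : seq R[i]) : exists T, [/\ uniq T, {subset T <= s},
  forall t t', t \in T -> t' \in T -> L0 (t - t') -> t = t' &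
  forall z, z \in s -> exists2 t, t \in T & L0 (z - t)].
Proof.
elim: s => [|a s [T [h1 h2 h3 h4]]]; first by exists [::].
case: (pselect (exists2 t, t \in T & L0 (a - t))) => [H|H].
  exists T; split=> // [t /h2|z]; first by rewrite inE orbC => ->.
  by rewrite inE => /orP[/eqP -> //|/h4].
have aT : a \notin T by apply/negP => aT; apply: H; exists a; rewrite ?subrr //; exact: L0_0.
exists (a :: T); split=> /=; first by rewrite aT.
- by move=> t; rewrite !inE => /orP[->//|/h2 ->]; rewrite orbT.
- move=> t t'; rewrite !inE => /orP[/eqP ->|tT] /orP[/eqP ->|tT'] // h.
  + by case: H; exists t'.
  + by case: H; exists t => //; exact: L0_subC.
  + exact: h3.
- move=> z; rewrite inE => /orP[/eqP ->|/h4[t tT zt]].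
    by exists a; rewrite ?mem_head ?subrr //; exact: L0_0.
  by exists t; rewrite ?inE ?tT ?orbT.
Qed.

Definition tors k z := L0 (k * z).
Definition mult k := forall z, L0 z -> L0 (k * z).

Lemma multM h k : mult h -> mult k -> mult (h * k).
Proof. by move=> a b z /b /a; rewrite mulrA. Qed.

Lemma mult_tors k z w : mult k -> L0 w -> tors k (z + w) <-> tors k z.
Proof.
move=> mk wL; rewrite /tors mulrDr; split=> [|h]; first by apply: L0_sub; exact: mk.
by apply: L0D h (mk _ wL).
Qed.

Lemma tors_loc_finite k : k != 0 -> loc_finite (tors k).
Proof.
move=> k0 B; have [s Hs] := lat_round_disc red (nrm k * B).
exists (map (fun w => k^-1 * w) s) => z zB kz.
apply/mapP; exists (k * z); last by rewrite mulKf.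
by apply: Hs => //; rewrite nrmM ler_wpM2l ?nrm_ge0.
Qed.

Lemma tors_reps k : k != 0 -> mult k -> exists T, reps (tors k) T.
Proof.
move=> k0 mk; have [s Hs] := tors_loc_finite k0 (nrm tau + 1).
have [T [h1 h2 h3 h4]] := reps_seq [seq z <- s | `[< tors k z >]].
exists T; split=> //.
  by move=> t /h2; rewrite mem_filter => /andP[/asboolP].
move=> z kz; have [q Hq] := lat_round red z.
have kz' : tors k (z - L q) by apply/mult_tors => //; exact: L0N (L0lat _ q).
have [|t tT zt] := h4 (z - L q).
  by rewrite mem_filter (Hs _ Hq kz') andbT; apply/asboolP.
exists t => //; apply: L0_trans zt; rewrite opprB addrC subrK; exact: L0lat.
Qed.

Lemma torsD k z w : tors k z -> tors k w -> tors k (z + w).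
Proof. by rewrite /tors mulrDr; exact: L0D. Qed.

Lemma torsN k z : tors k z -> tors k (- z).
Proof. by rewrite /tors mulrN; exact: L0N. Qed.

Lemma E1_periodic : latperiodic E1.
Proof. by move=> z w; exact: E1D. Qed.

Lemma reps_tors_shift k T s : reps (tors k) T -> tors k s -> reps (tors k) (map (fun t => s + t) T).
Proof.
move=> rT sk; apply: reps_map rT _ _ _ _.
- by move=> t kt; apply: torsD.
- by move=> t t' _ _; rewrite opprD addrACA subrr add0r.
- by move=> t t'; rewrite opprD addrACA subrr add0r.
- move=> z kz; exists (z - s); first exact: torsD kz (torsN sk).
  by rewrite (_ : z - _ = 0); [exact: L0_0|ring].
Qed.

Lemma reps_tors_opp k T : reps (tors k) T -> reps (tors k) (map -%R T).
Proof.
move=> rT; apply: reps_map rT _ _ _ _.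
- by move=> t; exact: torsN.
- by move=> t t' _ _; rewrite -opprD => /L0_opp.
- by move=> t t' h; rewrite -opprD; exact: L0N.
- by move=> z kz; exists (- z); [exact: torsN|rewrite opprK subrr; exact: L0_0].
Qed.

Lemma sum_shift k T s g : reps (tors k) T -> tors k s -> latperiodic g ->
  \sum_(t <- T) g (s + t) = \sum_(t <- T) g t.
Proof.
move=> rT sk pg; rewrite -(big_map (fun t => s + t) xpredT g).
exact: reps_sum (reps_tors_shift rT sk) rT pg.
Qed.

Lemma sum_opp k T g : reps (tors k) T -> latperiodic g ->
  \sum_(t <- T) g (- t) = \sum_(t <- T) g t.
Proof.
move=> rT pg; rewrite -(big_map -%R xpredT g).
exact: reps_sum (reps_tors_opp rT) rT pg.
Qed.

Lemma sum_E1 k T : reps (tors k) T -> \sum_(t <- T) E1 t = 0.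
Proof.
move=> rT; have := sum_opp rT E1_periodic.
under eq_bigr => t _ do rewrite (E1N red).
rewrite sumrN => E; set x := \sum_(t <- T) _ in E *.
have : 2 * x = 0 by rewrite mulr_natl mulr2n -{1}E addNr.
by move/eqP; rewrite mulf_eq0 (negbTE (_ : 2 != 0)) ?pnatr_eq0 //= => /eqP.
Qed.

Definition pbd (f : R[i] -> R[i]) z := exists K, nb z (fun w => w != z -> nrm (f w) <= K).

Lemma pbdD f g z : pbd f z -> pbd g z -> pbd (fun w => f w + g w) z.
Proof.
move=> [K HK] [K' HK']; exists (K + K'); apply: nbW (nb_and HK HK') => w [a b] wz.
by apply: le_trans (nrmD _ _) _; apply: lerD; [exact: a|exact: b].
Qed.

Lemma pbd_cdiff f z k : cdiff f z k -> pbd f z.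
Proof.
by move=> /cdiff_cont/ccont_bnd h; eexists; apply: nbW h => w h _; exact: h.
Qed.

Lemma pbd_ext f g z : nb z (fun w => w != z -> f w = g w) -> pbd f z -> pbd g z.
Proof.
move=> H [K HK]; exists K; apply: nbW (nb_and H HK) => w [a b] wz.
by rewrite -a //; exact: b.
Qed.

Lemma pbd_sum (I : eqType) (s : seq I) (f : I -> R[i] -> R[i]) z :
  (forall i, i \in s -> pbd (f i) z) -> pbd (fun w => \sum_(i <- s) f i w) z.
Proof.
elim: s => [|a s IH] H.
  by exists 0; apply: nbT => w _; rewrite big_nil nrm0.
apply: pbd_ext (pbdD (H a (mem_head _ _)) (IH _)).
  by apply: nbT => w _; rewrite big_cons.
by move=> i si; apply: H; rewrite inE si orbT.
Qed.

Lemma zeta_shift_L0 z w : ~ L0 z -> L0 w ->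
  zeta (z + w) = zeta z + (w * s2 + w^* * c0).
Proof. by move=> zL [q _ <-]; exact: zetaD. Qed.

Lemma big_reps1 T t0 (f : R[i] -> R[i]) : uniq T -> t0 \in T ->
  \sum_(t <- T) f t = f t0 + \sum_(t <- rem t0 T) f t.
Proof. by move=> uT tT; rewrite (big_rem t0 tT). Qed.

Definition zsum k T z := \sum_(t <- T) zeta (z + t) - k * zeta (k * z).

(** [zsum] has the quasi-period data [(n - k^2) s2] and [(n - k k') c0], with [n] the size of [T]
    and [k'] the conjugate of [k]. By [quasi_liouville] the second vanishes, and [c0] is nonzero:
    this counts the torsion points without determinants. *)
Lemma zsum_linear k T : k != 0 -> mult k -> reps (tors k) T ->
  (size T)%:R = k * k^* /\ exists b, forall z, ~ tors k z ->
   zsum k T z = (k * k^* - k ^+ 2) * s2 * z + b.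
Proof.
move=> k0 mk rT.
have zt z t : ~ tors k z -> t \in T -> ~ L0 (z + t).
  move=> kz /(reps_sub rT) kt /mk h; apply: kz; move: h; rewrite mulrDr; exact: L0_sub.
pose n : R[i] := (size T)%:R.
have [] := @quasi_liouville R tau red (tors k) (zsum k T) ((n - k ^+ 2) * s2) ((n - k * k^*) * c0).
- exact: tors_loc_finite.
- by move=> z q; apply: mult_tors => //; exact: L0lat.
- move=> z q kz; rewrite /zsum.
  have -> : \sum_(t <- T) zeta (z + L q + t) = \sum_(t <- T) zeta (z + t) + n * (L q * s2 + (L q)^* * c0).
    rewrite big_seq (eq_bigr (fun t => zeta (z + t) + (L q * s2 + (L q)^* * c0))); last first.
      by move=> t tT; rewrite addrAC zetaD //; exact: zt.
    rewrite -big_seq big_split /= (big_const_seq); congr (_ + _).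
    by rewrite count_predT iter_addr_0 /n mulr_natl.
  rewrite (mulrDr k z) zeta_shift_L0 //; last by apply: mk; exact: L0lat.
  have -> : (k * L q)^* = k^* * (L q)^* by exact: rmorphM.
  ring.
- move=> z kz; have kz' : ~ L0 (k * z) by [].
  have [_ _ D] := zeta_props red kz'.
  exists (\sum_(t <- T) - wp tau (z + t) - k * (k * - wp tau (k * z))).
  apply: cdiffB; last by apply: cdiffZ; exact: cdiff_lin D.
  apply: cdiff_sum => t tT; apply: cdiff_shift.
  by have [_ _] := zeta_props red (zt z t kz tT).
(* Only the representative [t1] of [- s] gives a pole, of residue 1, and [k * zeta (k * z)] has
   residue 1 there too; the difference is bounded. *)
- move=> s ks; have [t1 t1T h1] := reps_surj rT (torsN ks).
  pose g w := \sum_(t <- rem t1 T) zeta (w + t) + (zeta0 tau (w - s) - k * zeta0 tau (k * (w - s))).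
  have n0 : nrm (0 : R[i]) < 1 by rewrite nrm0 ltr01.
  have bg : pbd g s.
    apply: pbdD.
      apply: pbd_sum => t tT.
      have tT' : t \in T by exact: mem_rem tT.
      have stL : ~ L0 (s + t).
        move=> h; have := reps_inj rT tT' t1T; rewrite (_ : t - t1 = (s + t) + (- s - t1)); last by ring.
        move=> /(_ (L0D h h1)) E; move: tT; rewrite E mem_rem_uniqF //; exact: reps_uniq rT.
      have [_ _ D] := zeta_props red stL.
      exact: pbd_cdiff (cdiff_shift D).
    have D0 : cdiff (zeta0 tau) (s - s) (- wp0 tau (s - s)) by apply: zeta0_cdiff; rewrite ?subrr.
    have D1 : cdiff (zeta0 tau) (k * (s - s)) (- wp0 tau (k * (s - s))).
      by apply: zeta0_cdiff; rewrite ?subrr ?mulr0.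
    have D2 := cdiff_lin D1.
    exact: pbd_cdiff (cdiffB (cdiff_shift D0) (cdiffZ k (cdiff_shift D2))).
  pose c := (s + t1) * s2 + (s + t1)^* * c0 - k * (k * s * s2 + (k * s)^* * c0).
  apply: pbd_ext (pbdD bg (pbd_cdiff (cdiff_cst c s))).
  apply: nbW (nb_loc_finite s (tors_loc_finite k0)) => w H ws; have kw := H ws.
  have kw0 : ~ L0 (k * (w - s)) by move=> h; apply: kw; rewrite -(subrK s w); exact: torsD h ks.
  have w0 : ~ L0 (w - s) by move=> /mk.
  have ws0 : w - s != 0 by rewrite subr_eq0.
  rewrite /zsum (@big_reps1 _ t1 _ (reps_uniq rT)) // /g /c.
  have -> : zeta (w + t1) = zeta (w - s) + ((s + t1) * s2 + (s + t1)^* * c0).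
    rewrite -zeta_shift_L0 //; last by apply: L0_opp; rewrite opprD.
    by congr zeta; ring.
  have -> : zeta (k * w) = zeta (k * (w - s)) + (k * s * s2 + (k * s)^* * c0).
    by rewrite -zeta_shift_L0 //; congr zeta; ring.
  rewrite (zeta_split red w0) (zeta_split red kw0); field; by rewrite ws0 k0.
move=> nk [b Hb].
have c00 : c0 != 0.
  have [-> _] := zeta_lamb red; have [i0 _ _] := red.
  by rewrite -nrm_gt0 nrm_real normr_gt0 gt_eqF // divr_gt0 // pi_gt0.
have nE : n = k * k^*.
  by move/eqP: nk; rewrite mulf_eq0 (negbTE c00) orbF subr_eq0 => /eqP.
by split=> //; exists b => z kz; rewrite Hb // nE.
Qed.

Lemma size_reps k T : k != 0 -> mult k -> reps (tors k) T -> (size T)%:R = k * k^*.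
Proof. by move=> k0 mk rT; case: (zsum_linear k0 mk rT). Qed.

(** Off the torsion points the defect is constant by [zsum_linear] and odd, hence zero. At torsion
    points both sides vanish. *)
Lemma E1_distribution k T z : k != 0 -> mult k -> reps (tors k) T ->
  \sum_(t <- T) E1 (z + t) = k * E1 (k * z).
Proof.
move=> k0 mk rT; case: (pselect (tors k z)) => kz.
  by rewrite (E1L red kz) mulr0 (sum_shift rT kz E1_periodic) (sum_E1 rT).
have [nT [b Hb]] := zsum_linear k0 mk rT.
pose h w := \sum_(t <- T) E1 (w + t) - k * E1 (k * w).
pose c := b - s2 * \sum_(t <- T) t - c0 * \sum_(t <- T) t^*.
have hc w : ~ tors k w -> h w = c.
  move=> kw; rewrite /h (E1E red (kw : ~ L0 (k * w))).
  have -> : \sum_(t <- T) E1 (w + t) = \sum_(t <- T) zeta (w + t) - (size T)%:R * (w * s2 + w^* * c0)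
     - s2 * \sum_(t <- T) t - c0 * \sum_(t <- T) t^*.
    rewrite !mulr_sumr -[(size T)%:R]/(size T)%:R mulr_natl -iter_addr_0 -count_predT -big_const_seq -!sumrB.
    rewrite big_seq [RHS]big_seq; apply: eq_bigr => t tT.
    rewrite E1E //; last first.
      by move=> /mk h'; apply: kw; move: h'; rewrite mulrDr; apply: L0_sub; exact: reps_sub rT _ tT.
    have -> : (w + t)^* = w^* + t^* by exact: rmorphD.
    ring.
  have := Hb w kw; rewrite /zsum => E.
  have -> : \sum_(t <- T) zeta (w + t) = (k * k^* - k ^+ 2) * s2 * w + b + k * zeta (k * w) by rewrite -E; ring.
  have -> : (k * w)^* = k^* * w^* by exact: rmorphM.
  by rewrite nT /c; ring.
have kz' : ~ tors k (- z) by move=> /torsN; rewrite opprK.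
have hN : h (- z) = - h z.
  rewrite /h mulrN (E1N red) mulrN opprD opprK; congr (_ + _).
  have pg : latperiodic (fun t => E1 (- z + t)) by move=> u w wL; rewrite addrA E1D.
  rewrite -(sum_opp rT pg) -sumrN; apply: eq_bigr => t _.
  by rewrite -opprD E1N.
have c1 : c = 0.
  have : 2 * c = 0 by rewrite mulr_natl mulr2n -{1}(hc _ kz') hN (hc _ kz) addNr.
  by move/eqP; rewrite mulf_eq0 (negbTE (_ : 2 != 0)) ?pnatr_eq0 //= => /eqP.
by have := hc _ kz; rewrite c1 /h => /eqP; rewrite subr_eq0 => /eqP.
Qed.

(* The added junk value 0 at lattice points, with the correction [delta], makes the addition
   formula [addition_all] valid for all arguments. *)
Definition wpx z := if `[< L0 z >] then 0 else wp tau z.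
Definition delta z : R[i] := if `[< L0 z >] then 1 else 0.

Lemma wpx_periodic : latperiodic wpx.
Proof.
move=> z w wL; rewrite /wpx; case: (pselect (L0 z)) => zL.
  by rewrite !asboolT //; exact: L0D.
have zL' : ~ L0 (z + w) by move=> /(L0_sub wL).
by rewrite !asboolF // (wp_per red).
Qed.

Lemma delta_periodic : latperiodic delta.
Proof.
move=> z w wL; rewrite /delta; case: (pselect (L0 z)) => zL.
  by rewrite !asboolT //; exact: L0D.
have zL' : ~ L0 (z + w) by move=> /(L0_sub wL).
by rewrite !asboolF.
Qed.

Lemma reps_zero k T : reps (tors k) T -> exists2 t0, t0 \in T & L0 t0.
Proof.
move=> rT; have [|t tT h] := reps_surj rT (z := 0); first by rewrite /tors mulr0; exact: L0_0.
by exists t => //; apply: L0_opp; rewrite -sub0r.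
Qed.

Lemma reps_rem k T t0 t : reps (tors k) T -> t0 \in T -> L0 t0 -> t \in rem t0 T -> ~ L0 t.
Proof.
move=> rT t0T h0 tT h; have := reps_inj rT (mem_rem tT) t0T (L0B h h0).
by move=> E; move: tT; rewrite E mem_rem_uniqF //; exact: reps_uniq rT.
Qed.

Lemma sum_delta k T s (g : R[i] -> R[i]) : reps (tors k) T -> tors k s -> latperiodic g ->
  \sum_(t <- T) delta (s + t) * g t = g (- s).
Proof.
move=> rT sk pg.
have pg' : latperiodic (fun t => delta t * g (t - s)).
  by move=> z w wL /=; rewrite delta_periodic // (addrAC z w) (pg (z - s) w wL).
transitivity (\sum_(t <- T) delta (s + t) * g (s + t - s)).
  by apply: eq_bigr => t _; rewrite (addrC s t) addrK.
rewrite (sum_shift rT sk pg').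
have [t0 t0T h0] := reps_zero rT; rewrite (big_reps1 _ (reps_uniq rT) t0T).
rewrite big_seq big1 ?addr0 => [|t tT]; last by rewrite /delta asboolF ?mul0r //; exact: (reps_rem rT t0T h0 tT).
by rewrite /delta asboolT // mul1r addrC pg.
Qed.

(** Comparison of derivatives at 0 in the affine identity of [zsum_linear], once the polar terms
    have cancelled. *)
Lemma wpx_sum k T : k != 0 -> mult k -> reps (tors k) T ->
  \sum_(t <- T) wpx t = (k ^+ 2 - k * k^*) * s2.
Proof.
move=> k0 mk rT; have [nT [b Hb]] := zsum_linear k0 mk rT.
have [t0 t0T h0] := reps_zero rT; rewrite (big_reps1 _ (reps_uniq rT) t0T).
rewrite /wpx asboolT // add0r.
have -> : \sum_(t <- rem t0 T) (if `[< L0 t >] then 0 else wp tau t) = \sum_(t <- rem t0 T) wp tau t.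
  by rewrite big_seq [RHS]big_seq; apply: eq_bigr => t tT; rewrite asboolF //; exact: (reps_rem rT t0T h0 tT).
pose g z := \sum_(t <- rem t0 T) zeta (z + t) + (zeta0 tau z - k * zeta0 tau (k * z)).
have n0 : nrm (0 : R[i]) < 1 by rewrite nrm0 ltr01.
have Dg : cdiff g 0 (- \sum_(t <- rem t0 T) wp tau t).
  have D1 : cdiff (zeta0 tau) (k * 0) (- wp0 tau (k * 0)) by apply: zeta0_cdiff; rewrite ?mulr0.
  have D2 := cdiffB (zeta0_cdiff red n0) (cdiffZ k (cdiff_lin D1)).
  rewrite mulr0 wp0_0 oppr0 !mulr0 subr0 in D2.
  rewrite -[- _]addr0 -sumrN; apply: cdiffD D2; apply: cdiff_sum => t tT.
  apply: cdiff_shift; rewrite add0r.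
  by have [_ _] := zeta_props red (reps_rem rT t0T h0 tT).
pose c := t0 * s2 + t0^* * c0.
have gE : nb 0 (fun z => z != 0 -> g z = (k * k^* - k ^+ 2) * s2 * z + (b - c)).
  apply: nbW (nb_and (nb0_notL0 red) (nb_loc_finite 0 (tors_loc_finite k0))) => z [h1 h2] z0.
  have zL := h1 z0; have kz := h2 z0.
  have := Hb z kz; rewrite /zsum (big_reps1 _ (reps_uniq rT) t0T) zeta_shift_L0 // => E.
  have E' : (k * k^* - k ^+ 2) * s2 * z + b = (k * k^* - k ^+ 2) * s2 * z + b by [].
  rewrite addrA /g -E (zeta_split red zL) (zeta_split red (kz : ~ L0 (k * z))) /c.
  by field; rewrite z0 k0.
have Dl : cdiff (fun z => (k * k^* - k ^+ 2) * s2 * z + (b - c)) 0 ((k * k^* - k ^+ 2) * s2).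
  apply: cdiff_eq (cdiffD (cdiffZ _ (cdiff_id 0)) (cdiff_cst _ _)); by rewrite mulr1 addr0.
have P0 := plimB (plim_cdiff Dg) (plim_cdiff Dl).
have E0 : g 0 = (k * k^* - k ^+ 2) * s2 * 0 + (b - c).
  apply/eqP; rewrite -subr_eq0; apply/eqP/esym; apply: (plim_const P0).
  by apply: nbW gE => z h z0; rewrite h // subrr.
have Dg' : cdiff g 0 ((k * k^* - k ^+ 2) * s2).
  apply: cdiff_near Dl; apply: nbW gE => z h; case: (eqVneq z 0) => [->//|z0]; by rewrite h.
have := cdiff_uniq Dg Dg' => E.
by rewrite -[LHS]opprK E; ring.
Qed.

Lemma addition_all u v : (E1 u + E1 v - E1 (u + v)) ^+ 2 =
  wpx u + wpx v + wpx (u + v) - 2 * delta u * wpx v - 2 * delta v * wpx u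
  - 2 * delta (u + v) * wpx u.
Proof.
case: (pselect (L0 u)) => uL.
  have e : wpx (u + v) = wpx v by rewrite addrC wpx_periodic.
  have e' : E1 (u + v) = E1 v by rewrite addrC E1D.
  rewrite e e' (E1L red uL) /wpx (asboolT uL) /delta (asboolT uL); ring.
case: (pselect (L0 v)) => vL.
  have e : wpx (u + v) = wpx u by rewrite wpx_periodic.
  have e' : E1 (u + v) = E1 u by rewrite E1D.
  have d : delta (u + v) = delta u by rewrite delta_periodic.
  rewrite e d e' (E1L red vL) /wpx (asboolT vL) /delta (asboolT vL) (asboolF uL); ring.
case: (pselect (L0 (u + v))) => uvL.
  have e : wpx v = wpx u.
    have uL' : ~ L0 (- u) by move=> /L0_opp.
    by rewrite {1}(_ : v = - u + (u + v)); [rewrite wpx_periodic // /wpx !asboolF // wpN|ring].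
  have e' : E1 v = - E1 u.
    by rewrite {1}(_ : v = - u + (u + v)); [rewrite E1D // E1N|ring].
  rewrite e e' (E1L red uvL) /delta (asboolF uL) (asboolF vL) (asboolT uvL) /wpx (asboolT uvL).
  by ring.
by rewrite addition_E1 // /delta /wpx !asboolF //; ring.
Qed.

End Torsion.

(** * Lambert expansion at torsion points and its finite Fourier transform *)

Section SelfDuality.
Variable R : realType.
Variable tau : R[i].
Hypothesis red : reduced tau.
Variable n : nat.
Hypothesis n0 : (0 < n)%N.
Implicit Types (z w : R[i]) (a b c : nat).
Local Notation L := (lat tau).
Local Notation L0 := (L0 tau).
Local Notation E1 := (E_ 1 L0).
Local Notation tpi := (tpi R).
Local Notation U := (useries tau (@cotU R)).

Let nR : n%:R != 0 :> R[i]. Proof. by rewrite pnatr_eq0 -lt0n. Qed.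

Let om : R[i] := qe n%:R^-1.
Let Q : R[i] := qe (tau / n%:R).

Lemma om_n : om ^+ n = 1.
Proof. by rewrite -qeM divff // qe1. Qed.

Lemma om_mod c : om ^+ (c %% n) = om ^+ c.
Proof. by rewrite {2}(divn_eq c n) exprD mulnC exprM om_n expr1n mul1r. Qed.

Lemma om_eq c d : c = d %[mod n] -> om ^+ c = om ^+ d.
Proof. by move=> h; rewrite -om_mod h om_mod. Qed.

Lemma om_eq1 c : om ^+ c = 1 -> (n %| c)%N.
Proof.
rewrite -qeM => /qe_eq1[m E].
have {}E : c%:R = m%:~R * n%:R :> R[i] by rewrite -E mulfVK.
have E2 : (c%:Z = m * n%:Z)%R.
  by apply/eqP; rewrite -(eqr_int R[i]) rmorphM /=; apply/eqP; exact: E.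
by apply/dvdnP; exists `|m|%N; rewrite -[c]absz_nat E2 abszM.
Qed.

Lemma om_sum c : \sum_(b < n) om ^+ (b * c) = if (n %| c)%N then n%:R else 0.
Proof.
case: ifP => h.
  rewrite (eq_bigr (fun=> 1)) => [|b _]; last first.
    by rewrite mulnC -(@om_eq 0) ?expr0 // mod0n; apply/esym/eqP; exact: dvdn_mulr.
  by rewrite sumr_const card_ord.
have x1 : om ^+ c - 1 != 0 by rewrite subr_eq0; apply/eqP => /om_eq1; rewrite h.
apply: (mulfI x1); rewrite mulr0.
under eq_bigr => b _ do rewrite mulnC exprM.
by rewrite -subrX1 -exprM mulnC exprM om_n expr1n subrr.
Qed.

Lemma sum_flip (V : zmodType) (f : nat -> V) : f n = f 0%N ->
  \sum_(a < n) f (n - a)%N = \sum_(a < n) f a.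
Proof.
move=> fn; rewrite (reindex_inj rev_ord_inj) /=.
have -> : \sum_(i < n) f (n - (n - i.+1))%N = \sum_(i < n) f i.+1.
  by apply: eq_bigr => i _; rewrite subKn.
have e1 : \sum_(i < n.+1) f i = f 0%N + \sum_(i < n) f i.+1.
  by rewrite big_ord_recl; congr (_ + _); apply: eq_bigr => i _; rewrite /bump /= add1n.
have e2 : \sum_(i < n.+1) f i = \sum_(i < n) f i + f n by rewrite big_ord_recr.
by move: e1; rewrite e2 fn addrC => /addrI ->.
Qed.

(** The sawtooth [((a / n))], with value 0 at multiples of [n]. Its finite Fourier transform [sawh]
    is a cotangent value by [sawh_cot]. *)
Definition sawt a : R[i] := if (n %| a)%N then 0 else (a %% n)%:R / n%:R - 2^-1.
Definition sawh b : R[i] := \sum_(a < n) om ^+ (a * b) * sawt a.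

Lemma sawt_opp a : (a <= n)%N -> sawt (n - a) = - sawt a.
Proof.
move=> an; rewrite /sawt; have E : (n %| n - a)%N = (n %| a)%N by rewrite dvdn_subr.
rewrite E; case: ifP => h; first by rewrite oppr0.
have a0 : (0 < a)%N by case: (a) h => //; rewrite dvdn0.
have an' : (a < n)%N by rewrite ltn_neqAle an andbT; apply: contraFneq h => ->; exact: dvdnn.
rewrite !modn_small //; last by rewrite ltn_subrL a0 n0.
by rewrite natrB //; field.
Qed.

Lemma sawh0 : sawh 0 = 0.
Proof.
have E : sawh 0 = \sum_(a < n) sawt a by apply: eq_bigr => a _; rewrite muln0 expr0 mul1r.
have F : \sum_(a < n) sawt a = - \sum_(a < n) sawt a.
  rewrite -{1}(@sum_flip _ sawt); last by rewrite /sawt dvdnn dvdn0.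
  by rewrite -sumrN; apply: eq_bigr => a _; rewrite sawt_opp // ltnW.
have : 2 * sawh 0 = 0 by rewrite mulr_natl mulr2n E {1}F addNr.
by move/eqP; rewrite mulf_eq0 (negbTE (_ : 2 != 0)) ?pnatr_eq0 //= => /eqP.
Qed.

Lemma sum_mulX (x : R[i]) N :
  (x - 1) * \sum_(a < N) a%:R * x ^+ a = N%:R * x ^+ N - x * \sum_(a < N) x ^+ a.
Proof.
elim: N => [|N IH]; first by rewrite !big_ord0; ring.
by rewrite !big_ord_recr /= !mulrDr IH -natr1 exprS; ring.
Qed.

Lemma sawh_cot b : ~~ (n %| b)%N -> tpi * sawh b = cotC (b%:R / n%:R).
Proof.
move=> nb.
have qb : qe (b%:R / n%:R) = om ^+ b by rewrite -qeM.
have x1 : om ^+ b - 1 != 0 by rewrite subr_eq0; apply/eqP => /om_eq1; exact/negP.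
set x := om ^+ b in qb x1.
have xn : x ^+ n = 1 by rewrite /x -exprM mulnC exprM om_n expr1n.
have s0 : \sum_(a < n) x ^+ a = 0.
  by apply: (mulfI x1); rewrite mulr0 -subrX1 xn subrr.
have s1 : \sum_(a < n) a%:R * x ^+ a = n%:R / (x - 1).
  by apply: (mulfI x1); rewrite sum_mulX s0 xn mulr1 mulr0 subr0; field.
have -> : sawh b = n%:R^-1 * \sum_(a < n) a%:R * x ^+ a - 2^-1 * \sum_(a < n) x ^+ a + 2^-1.
  have s2 : \sum_(a < n) (if a == 0%N :> nat then 2^-1 else 0) = 2^-1 :> R[i].
    rewrite (bigD1 (Ordinal n0)) //= big1 ?addr0 // => i; rewrite -val_eqE /=.
    by move/negbTE ->.
  rewrite !mulr_sumr -sumrB -[X in _ + X]s2 -big_split /=; apply: eq_bigr => i _.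
  rewrite mulnC exprM -/x /sawt; case: (posnP i) => [->|i0].
    by rewrite dvdn0 expr0; ring.
  by rewrite gtnNdvd // modn_small //; ring.
by rewrite s0 s1 /cotC qb; field; rewrite x1 nR.
Qed.

(** With [M], [N] the two indices counted from 1, the sum runs over [M = a mod n] and all [N], with
    terms [om^(N b) Q^(M N)]: one index carries a congruence, the other a character. *)
Definition gterm a b (p : nat * nat) : R[i] :=
  (if p.1.+1 == a %[mod n] then om ^+ (p.2.+1 * b) else 0) * Q ^+ (p.1.+1 * p.2.+1).
Definition gsum a b := csum (gterm a b).

Lemma nrm_om : nrm om = 1.
Proof.
by rewrite nrm_qe -(rmorph_nat (real_complex R)) -fmorphV /= mulr0 oppr0 expR0.
Qed.

Lemma nrm_Q : nrm Q < 1.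
Proof.
have [i0 _ _] := red; rewrite nrm_qe expR_lt1 oppr_lt0 !mulr_gt0 ?pi_gt0 //.
rewrite mulrC -(rmorph_nat (real_complex R)) -fmorphV cImM /= mul0r addr0.
by rewrite mulr_gt0 // invr_gt0 ltr0n.
Qed.

Lemma absm_Q : absm (fun p : nat * nat => Q ^+ (p.1.+1 * p.2.+1)).
Proof.
have g := absm_geo (nrm_ge0 Q) nrm_Q; apply: absm_le (absm_prod g g) => -[i j] /=.
rewrite nrmX nrmM !nrm_real !ger0_norm ?exprn_ge0 ?nrm_ge0 // -exprD.
by apply: ler_wiXn2l; rewrite ?nrm_ge0 ?(ltW nrm_Q) //; nia.
Qed.

Lemma absm_gterm a b : absm (gterm a b).
Proof.
apply: absm_le absm_Q => p; rewrite /gterm nrmM ler_piMl ?nrm_ge0 //.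
by case: ifP => _; rewrite ?nrmX ?nrm_om ?expr1n ?nrm0.
Qed.

Lemma gsum_mod a a' b b' : a = a' %[mod n] -> b = b' %[mod n] -> gsum a b = gsum a' b'.
Proof.
move=> ha hb; apply: csum_ext => p; rewrite /gterm ha; congr (_ * _); case: ifP => // _.
by apply: om_eq; rewrite -modnMmr hb modnMmr.
Qed.

(** The finite transform turns the congruence on one index into a character and the character on the
    other into a congruence. Since [Q^(M N)] is symmetric, exchanging the indices restores the
    original sum. The exponent [n - a] encodes [- a]. *)
Lemma gsum_fourier a b : (a <= n)%N ->
  \sum_(i < n) \sum_(j < n) om ^+ (i * b + j * (n - a)) * gsum i j = n%:R * gsum a b.
Proof.
move=> an.
pose F (p : nat * nat) : R[i] := \sum_(ij : 'I_n * 'I_n) om ^+ (ij.1 * b + ij.2 * (n - a)) * gterm ij.1 ij.2 p.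
have -> : \sum_(i < n) \sum_(j < n) om ^+ (i * b + j * (n - a)) * gsum i j = csum F.
  rewrite pair_big /=; apply/esym/csum_eq; apply: hs_sum => ij.
  by apply: hsZ; apply: csumP; exact: absm_gterm.
rewrite -csumZ; last exact: absm_gterm.
rewrite -csum_swap; apply: csum_ext => -[k m]; rewrite /F /gterm /=.
rewrite -(pair_big xpredT xpredT (fun i j : 'I_n => om ^+ (i * b + j * (n - a)) *
  ((if m.+1 == i %[mod n] then om ^+ (k.+1 * j) else 0) * Q ^+ (m.+1 * k.+1)))) /=.
have i0 : (m.+1 %% n < n)%N by rewrite ltn_mod.
rewrite (bigD1 (Ordinal i0)) //= [X in _ + X]big1 ?addr0; last first.
  move=> i ii; apply: big1 => j _; case: ifP => [/eqP h|_]; last by rewrite mul0r mulr0.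
  by case/negP: ii; apply/eqP/val_inj; rewrite /= h modn_small.
have -> : \sum_(j < n) om ^+ (m.+1 %% n * b + j * (n - a)) *
    ((if m.+1 == m.+1 %% n %[mod n] then om ^+ (k.+1 * j) else 0) * Q ^+ (m.+1 * k.+1)) =
   om ^+ (m.+1 * b) * Q ^+ (m.+1 * k.+1) * \sum_(j < n) om ^+ (j * (k.+1 + (n - a))).
  rewrite mulr_sumr; apply: eq_bigr => j _; rewrite modn_mod eqxx.
  rewrite exprD (@om_eq (m.+1 %% n * b) (m.+1 * b)) ?modnMml //.
  by rewrite mulnDr exprD (mulnC k.+1 j); ring.
rewrite om_sum.
have -> : (n %| k.+1 + (n - a))%N = (k.+1 == a %[mod n]).
  rewrite -(eqn_modDr (n - a)) subnKC // modnn; exact/idP/idP.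
by rewrite (mulnC m.+1 k.+1); case: ifP => _; ring.
Qed.

Lemma gsum_fourier_opp a b : (a <= n)%N -> (b <= n)%N ->
  \sum_(i < n) \sum_(j < n) om ^+ (i * b + j * (n - a)) * gsum (n - i) (n - j) =
  n%:R * gsum (n - a) (n - b).
Proof.
move=> an bn; rewrite -gsum_fourier ?leq_subr //.
have flip c d : (c <= n)%N -> (d <= n)%N -> om ^+ ((n - c) * d) = om ^+ (c * (n - d)).
  move=> cn dn; have o0 : om ^+ (c * d) != 0 by rewrite expf_neq0 // qe_neq0.
  apply: (mulIf o0); rewrite -!exprD -mulnDl -mulnDr !subnK //.
  by apply: om_eq; rewrite modnMr modnMl.
pose f (i : nat) := \sum_(j < n) om ^+ ((n - i) * b + j * (n - a)) * gsum i (n - j).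
rewrite [LHS](_ : _ = \sum_(i < n) f (n - i)%N); last first.
  by apply: eq_bigr => i _; apply: eq_bigr => j _; rewrite subKn // ltnW.
rewrite sum_flip; last first.
  apply: eq_bigr => j _; rewrite subnn subn0 mul0n add0n.
  by congr (_ * _); [apply: om_eq; rewrite (mulnC n) modnMDl|apply: gsum_mod; rewrite ?modnn ?mod0n].
apply: eq_bigr => i _.
pose g (j : nat) := om ^+ ((n - i) * b + (n - j) * (n - a)) * gsum i j.
rewrite /f [LHS](_ : _ = \sum_(j < n) g (n - j)%N); last first.
  by apply: eq_bigr => j _; rewrite /g subKn // ltnW.
rewrite sum_flip; last first.
  rewrite /g subnn subn0 mul0n addn0.
  by congr (_ * _); [apply: om_eq; rewrite (mulnC n) addnC modnMDl|apply: gsum_mod; rewrite ?modnn ?mod0n].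
apply: eq_bigr => j _; rewrite /g !exprD !flip ?leq_subr // ltnW //.
Qed.

(** Each [cotU] is expanded as a geometric series in its exponential; the rows are the indices
    congruent to [c]. *)
Lemma gsum_row c (b : int) : (0 < c <= n)%N -> forall b', (b'%:Z = b %[mod n%:Z])%Z ->
  - tpi * gsum c b' = csum (fun m : nat => cotU ((c%:R * tau + b%:~R) / n%:R + m%:R * tau)).
Proof.
move=> /andP[c0 cn] b' bb.
have omb : qe (b%:~R / n%:R) = om ^+ b'.
  have -> : b = b'%:Z + (b - b'%:Z) by rewrite addrC subrK.
  have /dvdzP[q E] : (n%:Z %| b - b'%:Z)%Z by rewrite -eqz_mod_dvd bb.
  rewrite E rmorphD rmorphM /= mulrDl mulfK // qe_shift -qeM; congr qe.
pose qt (m : nat) := om ^+ b' * Q ^+ (n * m + c).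
have qE m : qe ((c%:R * tau + b%:~R) / n%:R + m%:R * tau) = qt m.
  rewrite (_ : _ + _ = b%:~R / n%:R + (n * m + c)%:R * (tau / n%:R)); last first.
    by rewrite natrD natrM; field.
  by rewrite qeD omb qeM.
have qt1 m : nrm (qt m) < 1.
  rewrite nrmM !nrmX nrm_om expr1n mul1r exprn_ilt1 ?nrm_ge0 ?nrm_Q //.
  by rewrite -lt0n addn_gt0 c0 orbT.
have uE m : cotU ((c%:R * tau + b%:~R) / n%:R + m%:R * tau) = - tpi * csum (fun k : nat => qt m ^+ k.+1).
  have ag : absm (fun k => qt m ^+ k).
    by apply: absm_ext (absm_le _ (absm_geo (nrm_ge0 (qt m)) (qt1 m))) => // k;
      rewrite nrmX nrm_real ger0_norm // exprn_ge0 // nrm_ge0.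
  have q1 : qt m - 1 != 0.
    by rewrite subr_eq0; apply/eqP => E; have := qt1 m; rewrite E nrm1 ltxx.
  have E : csum (fun k => qt m ^+ k) = 1 + csum (fun k => qt m ^+ k.+1).
    rewrite (@csum_split _ _ [:: 0%N] _ ag) // big_seq1 expr0; congr (_ + _).
    rewrite -(@csum_reindex _ _ _ (restr _ _) S); last first.
    - by move=> [|k] h; [rewrite /restr inE|have := h k].
    - by move=> k l [].
    by apply: csum_ext.
  have E2 : csum (fun k => qt m ^+ k.+1) = qt m * csum (fun k => qt m ^+ k).
    by rewrite -csumZ //; apply: csum_ext => k; rewrite exprS.
  have E3 : csum (fun k => qt m ^+ k) = (1 - qt m)^-1.
    have q2 : 1 - qt m != 0 by rewrite -opprB oppr_eq0.
    by apply: (mulfI q2); rewrite divff // mulrBl mul1r -E2 {1}E addrK.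
  rewrite /cotU qE E2 E3 (_ : 1 - qt m = - (qt m - 1)); last by ring.
  by rewrite invrN; field.
have ah : absm (fun p : nat * nat => qt p.1 ^+ p.2.+1).
  (* Row [m] has index [n * m + c], stored as its predecessor because [gterm] counts from 1. *)
  pose hh (p : nat * nat) := ((n * p.1 + c).-1, p.2).
  have ih : injective hh.
    move=> [m k] [m' k'] [] /(congr1 S); rewrite !prednK ?addn_gt0 ?c0 ?orbT //.
    by move/addIn/eqP; rewrite eqn_pmul2l // => /eqP -> ->.
  apply: absm_le (absm_inj ih absm_Q) => -[m k] /=.
  rewrite prednK ?addn_gt0 ?c0 ?orbT // !nrmX nrmM !nrmX nrm_om expr1n mul1r.
  by rewrite -exprM.
rewrite (csum_ext uE) csumZ; last exact: (absm_rows ah).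
rewrite -(csum_fubini ah); congr (_ * _).
pose hh (p : nat * nat) := ((n * p.1 + c).-1, p.2).
have hS m k : (hh (m, k)).1.+1 = (n * m + c)%N by rewrite /hh /= prednK ?addn_gt0 ?c0 ?orbT.
have ih : injective hh.
  move=> [m k] [m' k'] E; have E1 : (n * m + c = n * m' + c)%N by rewrite -(hS m k) E hS.
  have := congr1 snd E; rewrite /= => ->; congr (_, _); apply/eqP.
  by rewrite -(eqn_pmul2l n0); apply/eqP; move/addIn: E1.
rewrite /gsum -(csum_reindex ih).
  apply: csum_ext => -[m k]; rewrite /= /gterm hS /= mulnC modnMDl eqxx.
  have -> : qt m ^+ k.+1 = om ^+ (b' * k.+1) * Q ^+ ((n * m + c) * k.+1).
    by rewrite /qt exprMn !exprM.
  by rewrite (mulnC b') (mulnC m n).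
move=> [M k] H; rewrite /gterm /=; case: ifP => [/eqP h|_]; last by rewrite mul0r.
have cM : (c <= M.+1)%N.
  rewrite leqNgt; apply/negP => Mc; move: h; rewrite modn_small; last exact: leq_trans cn.
  case: (ltnP c n) => cn'; first by rewrite modn_small // => E; rewrite E ltnn in Mc.
  have -> : c = n by apply/eqP; rewrite eqn_leq cn cn'.
  by rewrite modnn.
have : (n %| M.+1 - c)%N by rewrite -eqn_mod_dvd //; apply/eqP.
move=> /dvdnP[m E]; case: (H (m, k)); rewrite /hh /=; congr (_, _).
by rewrite mulnC -E subnK.
Qed.

(** The two [gsum] terms are the rows above and below. For [a = 0] the row of the point is real,
    where the geometric expansion fails, and its cotangent is kept as [sawh b]. *)
Lemma E1_lambert a b : (a < n)%N -> (b < n)%N ->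
  E1 ((a%:R * tau + b%:R) / n%:R) =
  tpi * (sawt a + (if a == 0%N then sawh b else 0) - gsum a b + gsum (n - a) (n - b)).
Proof.
move=> an bn; set z := _ / _.
have [cE zl] := zeta_lamb red; have [i0 _ _] := red.
have rowU w : U w = csum (fun m : nat => cotU (w + tau + m%:R * tau)).
  by apply: csum_ext => m; rewrite /trow -natr1; congr cotU; ring.
have rN : - tpi * gsum (n - a) (n - b) = U (- z).
  rewrite (@gsum_row _ (- b%:Z)).
  - rewrite (rowU (- z)); apply: csum_ext => m; congr cotU; congr (_ + _).
    by rewrite /z natrB ?(ltnW an) // rmorphN /=; field.
  - by rewrite subn_gt0 an leq_subr.
  - by rewrite -subzn ?(ltnW bn) // modzDl.
case: (posnP a) => [a0|a0].
  have sa : sawt a = 0 by rewrite /sawt a0 dvdn0.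
  have zE : z = b%:R / n%:R by rewrite /z a0 mul0r add0r.
  have rP : - tpi * gsum a b = U z.
    (* The class of 0 has its first positive index at [n], which yields the starting row [z + tau]
       of [U]. *)
    rewrite (_ : gsum a b = gsum n b); last by apply: gsum_mod => //; rewrite a0 modnn mod0n.
    rewrite (@gsum_row _ b%:Z) ?n0 ?leqnn // (rowU z); apply: csum_ext => m; congr cotU; congr (_ + _).
    by rewrite zE -[(b%:Z)%:~R]/(b%:R); field.
  case: (posnP b) => [b0|b0].
    rewrite zE sa a0 b0 /= mul0r E1L //; last exact: L0_0.
    rewrite sawh0 !subn0 (_ : gsum n n = gsum 0 0); first by ring.
    by apply: gsum_mod; rewrite modnn mod0n.
  have nb : ~~ (n %| b)%N by rewrite gtnNdvd.
  have zL : ~ L0 z.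
    have b1 : nrm z < 1.
      by rewrite zE nrmM nrmV !nrm_nat ltr_pdivrMr ?ltr0n // mul1r ltr_nat.
    move=> /(L0_small red b1) /eqP; rewrite zE mulf_eq0 invr_eq0 (negbTE nR) orbF.
    by rewrite pnatr_eq0 gtn_eqF.
  rewrite (E1E red zL) zl //.
  have -> : z^* = z.
    by rewrite zE -!(rmorph_nat (real_complex R)) -fmorphV -rmorphM conjc_real.
  rewrite sa add0r mulrDr mulrBr (sawh_cot nb) -zE /lambF -rN -rP; ring.
have rP : - tpi * gsum a b = cotU z + U z.
  rewrite (@gsum_row _ b%:Z) ?a0 ?(ltnW an) //.
  have zL : above tau (z - tau).
    apply: above_im => //; rewrite ImD ImN /z.
    rewrite -!(rmorph_nat (real_complex R)) -fmorphV cImM ImD cImM /= !mul0r !addr0 mulr0 add0r.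
    have : 0 < a%:R * complex.Im tau * n%:R^-1.
      by rewrite !mulr_gt0 ?ltr0n // invr_gt0 ltr0n.
    by lra.
  have [ab _ _] := U_cdiff red zL.
  have {}ab : absm (fun m : nat => cotU (z + m%:R * tau)).
    apply: absm_ext ab => m; congr cotU; rewrite /trow -natr1; ring.
  rewrite -[(b%:Z)%:~R]/(b%:R) -/z (@csum_split _ _ [:: 0%N] _ ab) // big_seq1 mul0r addr0; congr (_ + _).
  rewrite -(@csum_reindex _ _ _ (restr _ _) S); last first.
  - by move=> [|k] h; [rewrite /restr inE|have := h k].
  - by move=> k l [].
  by apply: csum_ext.
have imz : complex.Im z = a%:R / n%:R * complex.Im tau.
  rewrite /z -!(rmorph_nat (real_complex R)) -fmorphV cImM ImD cImM /=; ring.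
pose x : R := a%:R / n%:R.
have xp : 0 < x by rewrite divr_gt0 ?ltr0n.
have x1 : x < 1 by rewrite ltr_pdivrMr ?ltr0n // mul1r ltr_nat.
have zL : ~ L0 z.
  move=> [[m k] _ /(congr1 (@complex.Im R))]; rewrite imz /lat /=.
  rewrite -!(rmorph_int (real_complex R)) ImD cImM /= mul0r !addr0 => /eqP.
  have it : complex.Im tau != 0 by rewrite gt_eqF.
  rewrite (inj_eq (mulIf it)) => /eqP E; move: x1 xp; rewrite /x -E ltr0z ltrz1.
  by move=> h2 h1; move: h1; rewrite -[0 < m]/(1 <= m) leNgt h2.
rewrite (E1E red zL) zl // /lambF -rN.
have -> : (ca tau 0 + cb tau 0) * z + (cotC z + U z - - tpi * gsum (n - a) (n - b)) - z * ca tau 0 - z^* * cb tau 0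
  = cb tau 0 * (z - z^*) + (cotU z + U z) + (cotC z - cotU z) + tpi * gsum (n - a) (n - b) by ring.
rewrite -rP (cotU_cotC (notL0_qe zL)).
(* The nonholomorphic part of E_1 enters here: [cb tau 0 = pi / Im tau] makes it the linear part
   [a / n] of the sawtooth. *)
have -> : cb tau 0 * (z - z^*) = tpi * (a%:R / n%:R).
  have -> : z - z^* = 'i * (2 * complex.Im z)%:C.
    by case: (z) => u v; apply/eqP; rewrite eq_complex /=; apply/andP; split; apply/eqP; ring.
  rewrite imz cE /tpi !rmorphM /= fmorphV !rmorph_nat.
  have it : (complex.Im tau)%:C != 0 :> R[i] by rewrite eq_complex /= eqxx andbT gt_eqF.
  by field; rewrite it nR.
rewrite /sawt gtnNdvd // modn_small //; by field.
Qed.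

End SelfDuality.

Lemma opp_self0 (K : numFieldType) (x : K) : x = - x -> x = 0.
Proof.
move=> E; have : 2 * x = 0 by rewrite mulr_natl mulr2n {1}E addNr.
by move/eqP; rewrite mulf_eq0 (negbTE (_ : 2 != 0)) ?pnatr_eq0 //= => /eqP.
Qed.

(** * Summing the addition formula over finite families *)

Section AdditionSums.
Variables (G : zmodType) (K : fieldType) (e w d : G -> K).
Implicit Types (u v x y : G) (T : seq G).
Hypothesis add_e : forall u v, (e u + e v - e (u + v)) ^+ 2 =
  w u + w v + w (u + v) - 2 * d u * w v - 2 * d v * w u - 2 * d (u + v) * w u.

Lemma sum_const_seq T (c : K) : \sum_(t <- T) c = (size T)%:R * c.
Proof. by rewrite big_const_seq count_predT iter_addr_0 mulr_natl. Qed.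

(** Summed over all pairs, the mixed products vanish because translates of [e] sum to zero. The left
    side becomes [3 N Q] and the right side [3 (N - 2) P], whence the condition on 3. *)
Lemma addition_square_sum T : (3 != 0 :> K) -> \sum_(v <- T) e v = 0 -> \sum_(v <- T) d v = 1 ->
  (forall u, u \in T -> \sum_(v <- T) e (u + v) = 0) ->
  (forall u, u \in T -> \sum_(v <- T) e (u + v) ^+ 2 = \sum_(v <- T) e v ^+ 2) ->
  (forall u, u \in T -> \sum_(v <- T) w (u + v) = \sum_(v <- T) w v) ->
  (forall u, u \in T -> \sum_(v <- T) d (u + v) = 1) ->
  (size T)%:R * \sum_(t <- T) e t ^+ 2 = ((size T)%:R - 2) * \sum_(t <- T) w t.
Proof.
move=> three e0 d0 eT e2T wT dT.
set Q := \sum_(t <- T) e t ^+ 2; set P := \sum_(t <- T) w t; set N : K := (size T)%:R.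
have row u : u \in T -> N * e u ^+ 2 + Q + Q - 2 * \sum_(v <- T) e v * e (u + v) =
    N * w u + P + P - 2 * d u * P - 4 * w u.
  move=> uT.
  transitivity (\sum_(v <- T) (e u + e v - e (u + v)) ^+ 2).
    transitivity (\sum_(v <- T) (e u ^+ 2 + e v ^+ 2 + e (u + v) ^+ 2 + 2 * e u * e v
       - 2 * e u * e (u + v) - 2 * (e v * e (u + v)))); last by apply: eq_bigr => v _; ring.
    rewrite !sumrB !big_split /= sum_const_seq -!mulr_sumr eT // e0 e2T // -/Q -/N; ring.
  transitivity (\sum_(v <- T) (w u + w v + w (u + v) - 2 * d u * w v
     - 2 * w u * d v - 2 * w u * d (u + v))).
    by apply: eq_bigr => v _; rewrite add_e; ring.
  rewrite !sumrB !big_split /= sum_const_seq -!mulr_sumr wT // dT // d0 -/P -/N; ring.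
have : \sum_(u <- T) (N * e u ^+ 2 + Q + Q - 2 * \sum_(v <- T) e v * e (u + v)) =
  \sum_(u <- T) (N * w u + P + P - 2 * P * d u - 4 * w u).
  by rewrite big_seq [RHS]big_seq; apply: eq_bigr => u uT; rewrite row //; ring.
rewrite !sumrB !big_split /= !sum_const_seq -!mulr_sumr d0 -/Q -/P -/N.
have -> : \sum_(u <- T) \sum_(v <- T) e v * e (u + v) = 0.
  rewrite exchange_big big_seq big1 // => v vT; rewrite -mulr_sumr.
  by under eq_bigr => u _ do rewrite addrC; rewrite eT // mulr0.
move=> E; apply: (mulfI three).
have -> : 3 * (N * Q) = N * Q + N * Q + N * Q - 2 * 0 by ring.
by rewrite E; ring.
Qed.

(** The abstract form of reciprocity: in the sum over [Th] and [Tk], the distribution relation turns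
    the cross terms [e x * e (x + y)] and [e y * e (x + y)] into the two Dedekind sums. *)
Lemma addition_double_sum (Th Tk : seq G) (a b : K) (eh ek : G -> K) :
  \sum_(y <- Tk) e y = 0 -> \sum_(x <- Th) d x = 1 -> \sum_(y <- Tk) d y = 1 ->
  (forall x, \sum_(y <- Tk) e (x + y) = b * ek x) ->
  (forall y, \sum_(x <- Th) e (y + x) = a * eh y) ->
  (forall x y, x \in Th -> y \in Tk -> d (x + y) * w x = 0) ->
  2 * b * (\sum_(x <- Th) ek x * e x) + 2 * a * (\sum_(y <- Tk) eh y * e y) =
  (size Tk)%:R * \sum_(t <- Th) e t ^+ 2 + (size Th)%:R * \sum_(t <- Tk) e t ^+ 2
  + \sum_(x <- Th) \sum_(y <- Tk) e (x + y) ^+ 2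
  - (((size Tk)%:R - 2) * \sum_(t <- Th) w t + ((size Th)%:R - 2) * \sum_(t <- Tk) w t
     + \sum_(x <- Th) \sum_(y <- Tk) w (x + y)).
Proof.
move=> e0 dh dk ekE ehE dw.
set M : K := (size Tk)%:R; set N : K := (size Th)%:R.
set Qh := \sum_(t <- Th) e t ^+ 2; set Qk := \sum_(t <- Tk) e t ^+ 2.
set Ph := \sum_(t <- Th) w t; set Pk := \sum_(t <- Tk) w t.
set Q := \sum_(x <- Th) \sum_(y <- Tk) e (x + y) ^+ 2.
set P := \sum_(x <- Th) \sum_(y <- Tk) w (x + y).
set Sh := \sum_(x <- Th) ek x * e x; set Sk := \sum_(y <- Tk) eh y * e y.
have lhs : \sum_(x <- Th) \sum_(y <- Tk) (e x + e y - e (x + y)) ^+ 2 =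
   M * Qh + N * Qk + Q - 2 * b * Sh - 2 * a * Sk.
  transitivity (\sum_(x <- Th) (M * e x ^+ 2 + Qk + \sum_(y <- Tk) e (x + y) ^+ 2
     - 2 * b * (ek x * e x) - 2 * \sum_(y <- Tk) e y * e (x + y))).
    apply: eq_bigr => x _.
    transitivity (\sum_(y <- Tk) (e x ^+ 2 + e y ^+ 2 + e (x + y) ^+ 2 + 2 * e x * e y
       - 2 * e x * e (x + y) - 2 * (e y * e (x + y)))); first by apply: eq_bigr => y _; ring.
    rewrite !sumrB !big_split /= sum_const_seq -!mulr_sumr e0 ekE -/Qk -/M; ring.
  rewrite !sumrB !big_split /= sum_const_seq -!mulr_sumr -/Qh -/Q -/N -/Sh.
  have -> : \sum_(x <- Th) \sum_(y <- Tk) e y * e (x + y) = a * Sk.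
    rewrite exchange_big /Sk mulr_sumr; apply: eq_bigr => y _; rewrite -mulr_sumr.
    by under eq_bigr => x _ do rewrite addrC; rewrite ehE; ring.
  ring.
have rhs : \sum_(x <- Th) \sum_(y <- Tk) (e x + e y - e (x + y)) ^+ 2 =
   (M - 2) * Ph + (N - 2) * Pk + P.
  transitivity (\sum_(x <- Th) (M * w x + Pk + \sum_(y <- Tk) w (x + y) - 2 * Pk * d x
      - 2 * w x)).
    rewrite big_seq [RHS]big_seq; apply: eq_bigr => x xT.
    transitivity (\sum_(y <- Tk) (w x + w y + w (x + y) - 2 * d x * w y - 2 * w x * d y)).
      rewrite big_seq [RHS]big_seq; apply: eq_bigr => y yT; rewrite add_e.
      have -> : 2 * d (x + y) * w x = 2 * (d (x + y) * w x) by ring.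
      by rewrite dw //; ring.
    rewrite !sumrB !big_split /= sum_const_seq -!mulr_sumr dk -/Pk -/M; ring.
  rewrite !sumrB !big_split /= sum_const_seq -!mulr_sumr dh -/Ph -/P -/N; ring.
have -> : 2 * b * Sh + 2 * a * Sk = M * Qh + N * Qk + Q -
  (M * Qh + N * Qk + Q - 2 * b * Sh - 2 * a * Sk) by ring.
by rewrite -lhs rhs; ring.
Qed.

End AdditionSums.

(** * Antisymmetry, reciprocity and explicit Dedekind sums *)

Section DedekindSums.
Variable R : realType.
Variable tau : R[i].
Hypothesis red : reduced tau.
Implicit Types (z w u v h k : R[i]) (T : seq R[i]) (n : nat).
Local Notation L := (lat tau).
Local Notation L0 := (L0 tau).
Local Notation E1 := (E_ 1 L0).
Local Notation s2 := (ca tau 0).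
Local Notation tors := (tors tau).
Local Notation mult := (mult tau).
Local Notation reps := (reps tau).
Local Notation wpx := (wpx tau).
Local Notation delta := (delta tau).
Local Notation tpi := (tpi R).

(** In [E1_lambert] the transform exchanges the sawtooth with [sawh] and preserves each of the two
    [gsum] parts. *)
Lemma E1_fourier n al be : (al < n)%N -> (be < n)%N ->
  \sum_(a < n) \sum_(b < n) qe (n%:R^-1) ^+ (a * be + b * (n - al)) * E1 ((a%:R * tau + b%:R) / n%:R)
  = n%:R * E1 ((al%:R * tau + be%:R) / n%:R).
Proof.
move=> an bn; have n0 : (0 < n)%N by exact: leq_ltn_trans an.
set om := qe _.
pose B a b : R[i] := sawt R n a + (if a == 0%N then sawh R n b else 0).
pose k a b : R[i] := om ^+ (a * be + b * (n - al)).
transitivity (tpi * (\sum_(a < n) \sum_(b < n) k a b * B a b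
   - \sum_(a < n) \sum_(b < n) k a b * gsum tau n a b
   + \sum_(a < n) \sum_(b < n) k a b * gsum tau n (n - a) (n - b))).
  rewrite -sumrB -big_split /= mulr_sumr; apply: eq_bigr => a _.
  rewrite -sumrB -big_split /= mulr_sumr; apply: eq_bigr => b _.
  by rewrite (E1_lambert red n0) // -/(B a b) /k; ring.
rewrite (gsum_fourier red n0) ?(ltnW an) // (gsum_fourier_opp red n0) ?(ltnW an) ?(ltnW bn) //.
rewrite (E1_lambert red n0) // -/(B al be).
suff -> : \sum_(a < n) \sum_(b < n) k a b * B a b = n%:R * B al be by ring.
have -> : \sum_(a < n) \sum_(b < n) k a b * B a b =
   \sum_(a < n) \sum_(b < n) k a b * sawt R n a + \sum_(b < n) om ^+ (b * (n - al)) * sawh R n b.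
  transitivity (\sum_(a < n) \sum_(b < n) k a b * sawt R n a +
     \sum_(a < n) \sum_(b < n) k a b * (if a == 0%N :> nat then sawh R n b else 0)).
    rewrite -big_split /=; apply: eq_bigr => a _; rewrite -big_split /=; apply: eq_bigr => b _.
    by rewrite -mulrDr.
  congr (_ + _).
  rewrite (bigD1 (Ordinal n0)) //= [X in _ + X]big1 ?addr0.
    by apply: eq_bigr => b _; rewrite /k mul0n add0n.
  by move=> a; rewrite -val_eqE /= => /negbTE ->; rewrite big1 // => b _; rewrite mulr0.
have -> : \sum_(a < n) \sum_(b < n) k a b * sawt R n a = (if al == 0%N then n%:R else 0) * sawh R n be.
  have -> : (if al == 0%N then n%:R else 0) = \sum_(b < n) om ^+ (b * (n - al)) :> R[i].
    rewrite (om_sum R n0) dvdn_subr ?(ltnW an) //; congr (if _ then _ else _).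
    by case: (posnP al) => [->|a0]; rewrite ?dvdn0 // gtnNdvd // gtn_eqF.
  rewrite /sawh mulrC mulr_suml; apply: eq_bigr => a _; rewrite mulr_sumr; apply: eq_bigr => b _.
  by rewrite /k exprD; ring.
have -> : \sum_(b < n) om ^+ (b * (n - al)) * sawh R n b = n%:R * sawt R n al.
  transitivity (\sum_(b < n) \sum_(a < n) sawt R n a * om ^+ (b * (a + (n - al)))).
    apply: eq_bigr => b _; rewrite /sawh mulr_sumr; apply: eq_bigr => a _.
    by rewrite mulnDr exprD (mulnC b a); ring.
  rewrite exchange_big /= (bigD1 (Ordinal an)) //= [X in _ + X]big1 ?addr0.
    by rewrite -mulr_sumr subnKC ?(ltnW an) // (om_sum R n0) dvdnn mulrC.
  move=> a aal; rewrite -mulr_sumr (om_sum R n0).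
  have -> : (n %| a + (n - al))%N = false; last by rewrite mulr0.
  apply: contraNF aal => d; rewrite -val_eqE /=.
  have : (a == al %[mod n])%N by rewrite -(eqn_modDr (n - al)) subnKC ?(ltnW an) // modnn; exact: d.
  by rewrite !modn_small.
by rewrite /B; case: ifP => _; ring.
Qed.

(** The alternating form that is integral on the lattice ([omega_lat]). Multiplication by [h] and by
    its conjugate are adjoint for it, and [psi n] is the resulting pairing on n-torsion, of Weil
    type. *)
Definition omega z w : R[i] := (z * w^* - z^* * w) / (tau - tau^*).
Definition psi n z w := qe (n%:R * omega z w).

Lemma omegaDl z w u : omega (z + w) u = omega z u + omega w u.
Proof.
have t0 := tau_conj_neq red.
rewrite /omega; have -> : (z + w)^* = z^* + w^* by exact: rmorphD.
by field.
Qed.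

Lemma omegaN z w : omega z w = omega w (- z).
Proof.
rewrite /omega; have -> : (- z)^* = - z^* by exact: rmorphN.
by rewrite -mulrN; congr (_ / _); ring.
Qed.

Lemma omega_adj h z w : omega z (h * w) = omega (h^* * z) w.
Proof.
rewrite /omega; have -> : (h * w)^* = h^* * w^* by exact: rmorphM.
have -> : (h^* * z)^* = h * z^* by rewrite rmorphM /= conjcK.
by congr (_ / _); ring.
Qed.

Lemma lat_conj p : (L p)^* = p.1%:~R * tau^* + p.2%:~R.
Proof. by rewrite rmorphD rmorphM /= !rmorph_int. Qed.

Lemma omega_lat p q : omega (L p) (L q) = (p.1 * q.2 - p.2 * q.1)%:~R.
Proof.
have t0 := tau_conj_neq red.
by rewrite /omega !lat_conj /lat rmorphB /= !rmorphM /=; field.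
Qed.

Lemma psi_nat n a b c d : (0 < n)%N -> (c <= n)%N ->
  psi n ((a%:R * tau + b%:R) / n%:R) ((c%:R * tau + d%:R) / n%:R) = qe (n%:R^-1) ^+ (a * d + b * (n - c)).
Proof.
move=> n0 cn; have nR : n%:R != 0 :> R[i] by rewrite pnatr_eq0 -lt0n.
have t0 := tau_conj_neq red.
have cE (x y : nat) : ((x%:R * tau + y%:R) / n%:R)^* = (x%:R * tau^* + y%:R) / n%:R.
  by rewrite rmorphM rmorphD rmorphM /= fmorphV !rmorph_nat.
rewrite -qeM /psi /omega !cE natrD !natrM natrB //.
rewrite -[RHS](qe_shift _ (- b%:Z)); congr qe; rewrite rmorphN /=.
rewrite -[(b%:Z)%:~R]/(b%:R); by field; rewrite nR t0.
Qed.

Lemma psi_shift n z w l : tors n%:R w -> L0 l -> psi n (z + l) w = psi n z w.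
Proof.
move=> kw [p _ <-]; rewrite /psi omegaDl mulrDr.
have -> : n%:R * omega (L p) w = omega (L p) (n%:R * w).
  have t0 := tau_conj_neq red.
  rewrite /omega; have -> : (n%:R * w)^* = n%:R * w^* by rewrite rmorphM /= rmorph_nat.
  by field.
by case: kw => q _ <-; rewrite omega_lat qe_shift.
Qed.

Lemma psi_sym n z w : psi n z w = psi n w (- z).
Proof. by rewrite /psi omegaN. Qed.

Lemma nat_reps n : (0 < n)%N ->
  reps (tors n%:R) [seq (a%:R * tau + b%:R) / n%:R | a <- iota 0 n, b <- iota 0 n].
Proof.
move=> n0; have nR : n%:R != 0 :> R[i] by rewrite pnatr_eq0 -lt0n.
have nE (a b : nat) : n%:R * ((a%:R * tau + b%:R) / n%:R) = L (a%:Z, b%:Z).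
  by rewrite mulrC mulfVK.
have key a b c d : (a < n)%N -> (b < n)%N -> (c < n)%N -> (d < n)%N ->
    L0 ((a%:R * tau + b%:R) / n%:R - (c%:R * tau + d%:R) / n%:R) -> a = c /\ b = d.
  move=> an bn cn dn [p _ E].
  have : L (a%:Z - c%:Z - n%:Z * p.1, b%:Z - d%:Z - n%:Z * p.2) = 0.
    rewrite /lat /= !rmorphB !rmorphM /=.
    have -> : (a%:~R - c%:~R - n%:~R * p.1%:~R) * tau + (b%:~R - d%:~R - n%:~R * p.2%:~R) =
      n%:R * (((a%:R * tau + b%:R) / n%:R - (c%:R * tau + d%:R) / n%:R) - L p).
      by rewrite /lat -![(Posz _)%:~R]/(_%:R); field.
    by rewrite E subrr mulr0.
  move/eqP; rewrite (lat_eq0 red) => /eqP[e1 e2].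
  have aux (x y : nat) (q : int) : (x < n)%N -> (y < n)%N -> x%:Z - y%:Z - n%:Z * q = 0 -> x = y.
    move=> xn yn e; have q0 : q = 0 by nia.
    by move: e; rewrite q0; lia.
  by split; [apply: aux e1|apply: aux e2].
split.
- move=> t /allpairsP[[a b] /= [_ _ ->]]; rewrite /tors nE; exact: L0lat.
- apply: allpairs_uniq; rewrite ?iota_uniq // => -[a b] [c d] /=.
  move=> /allpairsP[[a' b'] /= [ha hb [-> ->]]] /allpairsP[[c' d'] /= [hc hd [-> ->]]] E.
  rewrite !mem_iota /= !add0n in ha hb hc hd.
  have [|-> -> //] := key a' b' c' d' ha hb hc hd.
  by rewrite E subrr; exact: L0_0.
- move=> _ _ /allpairsP[[a b] /= [ha hb ->]] /allpairsP[[c d] /= [hc hd ->]] h.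
  rewrite !mem_iota /= !add0n in ha hb hc hd.
  by have [-> ->] := key a b c d ha hb hc hd h.
- move=> z [[x y] _ E].
  have zE : z = (x%:~R * tau + y%:~R) / n%:R by rewrite -[RHS]/(L (x, y) / n%:R) E mulrC mulKf.
  have md (m : int) : exists2 r : nat, (r < n)%N & exists q : int, m = r%:Z + q * n%:Z.
    exists `|(m %% n%:Z)%Z|%N.
      have := modz_ge0 m (_ : n%:Z != 0); have := ltz_pmod m (_ : 0 < n%:Z).
      have nn : n%:Z != 0 by lia. 
      have nn' : 0 < n%:Z by lia.
      by move=> /(_ nn') h1 /(_ nn) h2; lia.
    have nn : n%:Z != 0 by lia.
    exists (m %/ n%:Z)%Z; have := modz_ge0 m nn; have := divz_eq m n%:Z; lia.
  have [a an [q qE]] := md x; have [b bn [r rE]] := md y.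
  exists ((a%:R * tau + b%:R) / n%:R).
    by apply/allpairsP; exists (a, b); rewrite /= !mem_iota /= !add0n.
  exists (q, r) => //; rewrite zE qE rE /lat /= !rmorphD !rmorphM /= -![(Posz _)%:~R]/(_%:R).
  by field.
Qed.

(** [E1_fourier] without coordinates: the choice of representatives is removed by periodicity of
    both factors. *)
Lemma self_dual n T w : (0 < n)%N -> reps (tors n%:R) T -> tors n%:R w ->
  \sum_(z <- T) psi n z w * E1 z = n%:R * E1 w.
Proof.
move=> n0 rT wn.
have pg u : tors n%:R u -> latperiodic tau (fun z => psi n z u * E1 z).
  by move=> un x y yL; rewrite (psi_shift _ un yL) (E1D red _ yL).
rewrite (reps_sum rT (nat_reps n0) (pg w wn)).
have [w0 w0T ww] := reps_surj (nat_reps n0) wn.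
have wn0 : tors n%:R w0 by exact: reps_sub (nat_reps n0) _ w0T.
have -> : E1 w = E1 w0 by apply: periodic_eq ww; exact: E1_periodic.
transitivity (\sum_(z <- [seq (a%:R * tau + b%:R) / n%:R | a <- iota 0 n, b <- iota 0 n]) psi n z w0 * E1 z).
  rewrite big_seq [RHS]big_seq; apply: eq_bigr => z zT; congr (_ * _).
  have zn := reps_sub (nat_reps n0) zT.
  rewrite !(psi_sym n z); rewrite -(subrK w0 w) addrC psi_shift //; exact: torsN.
case/allpairsP: w0T => -[c d] /= [hc hd ->]; rewrite !mem_iota /= !add0n in hc hd.
rewrite -E1_fourier // big_allpairs_dep /= -[in LHS](subn0 n) -/(index_iota 0 n) big_mkord.
apply: eq_bigr => a _; rewrite -/(index_iota 0 n) big_mkord subn0; apply: eq_bigr => b _.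
by rewrite psi_nat // ltnW.
Qed.

Definition dsum h T := \sum_(t <- T) E1 (h * t) * E1 t.

Lemma E1_mult_periodic h : mult h -> latperiodic tau (fun z => E1 (h * z)).
Proof. by move=> mh x y yL; rewrite mulrDr E1D //; exact: mh. Qed.

(** Expand [E1 (h * t)] by [self_dual] and exchange the sums; [h] crosses the pairing as its
    conjugate, and the sign comes from antisymmetry of the pairing and oddness of E_1. *)
Lemma dsum_adj n T h : (0 < n)%N -> reps (tors n%:R) T -> mult h -> mult h^* ->
  dsum h T = - dsum h^* T.
Proof.
move=> n0 rT mh mh'.
have nR : n%:R != 0 :> R[i] by rewrite pnatr_eq0 -lt0n.
have mt k t : mult k -> tors n%:R t -> tors n%:R (k * t).
  by move=> mk kt; rewrite /tors mulrCA; exact: mk.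
apply: (mulfI nR); rewrite /dsum mulrN !mulr_sumr -sumrN.
transitivity (\sum_(t <- T) \sum_(z <- T) psi n z (h * t) * E1 z * E1 t).
  rewrite big_seq [RHS]big_seq; apply: eq_bigr => t tT.
  rewrite mulrA -(self_dual n0 rT) ?mulr_suml //.
  by apply: mt => //; exact: reps_sub rT _ tT.
rewrite exchange_big /= big_seq [RHS]big_seq; apply: eq_bigr => z zT.
have zn := reps_sub rT zT.
transitivity (E1 z * \sum_(t <- T) psi n t (- (h^* * z)) * E1 t).
  rewrite mulr_sumr; apply: eq_bigr => t _.
  by rewrite -psi_sym /psi omega_adj; ring.
rewrite (self_dual n0 rT); last by apply: torsN; apply: mt.
by rewrite (E1N red); ring.
Qed.

Lemma sum_delta1 k T s : reps (tors k) T -> tors k s -> \sum_(t <- T) delta (s + t) = 1.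
Proof.
move=> rT sk; have := @sum_delta R tau k T s (fun=> 1) rT sk (fun _ _ _ => erefl).
by under eq_bigr => t _ do rewrite mulr1.
Qed.

Lemma tors0 k : tors k 0. Proof. by rewrite /tors mulr0; exact: L0_0. Qed.

Lemma sum_delta0 k T : reps (tors k) T -> \sum_(t <- T) delta t = 1.
Proof.
move=> rT; rewrite -(sum_delta1 rT (tors0 k)).
by apply: eq_bigr => t _; rewrite add0r.
Qed.

Lemma E1_sqr_periodic : latperiodic tau (fun z => E1 z ^+ 2).
Proof. by move=> z w wL; rewrite (E1D red). Qed.

Lemma E1_square_sum k T : k != 0 -> mult k -> reps (tors k) T ->
  (size T)%:R * \sum_(t <- T) E1 t ^+ 2 = ((size T)%:R - 2) * \sum_(t <- T) wpx t.
Proof.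
move=> k0 mk rT.
apply: (@addition_square_sum _ _ E1 wpx delta (addition_all red)).
- by rewrite pnatr_eq0.
- exact: (sum_E1 red rT).
- exact: sum_delta0 rT.
- by move=> u uT; rewrite (sum_shift rT (reps_sub rT uT) (E1_periodic red)) (sum_E1 red rT).
- by move=> u uT; exact: (sum_shift rT (reps_sub rT uT) E1_sqr_periodic).
- by move=> u uT; exact: (sum_shift rT (reps_sub rT uT) (wpx_periodic red)).
- by move=> u uT; exact: (sum_delta1 rT (reps_sub rT uT)).
Qed.

Lemma reps_add h k Th Tk : mult h -> mult k -> reps (tors h) Th -> reps (tors k) Tk ->
  (forall z, tors h z -> tors k z -> L0 z) ->
  (forall z, tors (h * k) z -> exists x y, [/\ tors h x, tors k y & z = x + y]) ->
  reps (tors (h * k)) [seq x + y | x <- Th, y <- Tk].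
Proof.
move=> mh mk rh rk cop dec.
have key a b c d : a \in Th -> b \in Tk -> c \in Th -> d \in Tk -> L0 (a + b - (c + d)) -> a = c /\ b = d.
  move=> aT bT cT dT h0.
  have ac : tors h (a - c) by apply: torsD (reps_sub rh aT) (torsN (reps_sub rh cT)).
  have db : tors k (d - b) by apply: torsD (reps_sub rk dT) (torsN (reps_sub rk bT)).
  have e : a - c = (a + b - (c + d)) + (d - b) by ring.
  have ac' : tors k (a - c) by rewrite e addrC; apply/mult_tors.
  have acL := cop _ ac ac'; split; first exact: reps_inj rh _ _ aT cT acL.
  apply: reps_inj rk _ _ bT dT _.
  rewrite (_ : b - d = (a + b - (c + d)) - (a - c)); [exact: L0B|ring].
split.
- move=> t /allpairsP[[a b] /= [aT bT ->]].
  have ah := reps_sub rh aT; have bk := reps_sub rk bT.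
  rewrite /tors mulrDr; apply: L0D; first by rewrite mulrAC mulrC; exact: mk.
  by rewrite -mulrA; exact: mh.
- apply: allpairs_uniq; [exact: reps_uniq rh|exact: reps_uniq rk|].
  move=> [a b] [c d] /= /allpairsP[[a' b'] /= [ha hb [-> ->]]] /allpairsP[[c' d'] /= [hc hd [-> ->]]] E.
  have [|-> -> //] := key a' b' c' d' ha hb hc hd.
  by rewrite E subrr; exact: L0_0.
- move=> _ _ /allpairsP[[a b] /= [ha hb ->]] /allpairsP[[c d] /= [hc hd ->]] h0.
  by have [-> ->] := key a b c d ha hb hc hd h0.
- move=> z /dec[x [y [xh yk ->]]].
  have [a aT xa] := reps_surj rh xh; have [b bT yb] := reps_surj rk yk.
  exists (a + b); first by apply/allpairsP; exists (a, b).
  by rewrite opprD addrACA; exact: L0D.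
Qed.

Lemma sum_add (Th Tk : seq R[i]) (g : R[i] -> R[i]) :
  \sum_(z <- [seq x + y | x <- Th, y <- Tk]) g z = \sum_(x <- Th) \sum_(y <- Tk) g (x + y).
Proof. by rewrite big_allpairs_dep. Qed.

(** Coprimality of [h] and [k] is expressed by the direct decomposition of the torsion of [h * k],
    which permits [addition_double_sum] over all sums [x + y]. *)
Lemma reciprocity h k Th Tk Thk : h != 0 -> k != 0 -> mult h -> mult k ->
  reps (tors h) Th -> reps (tors k) Tk -> reps (tors (h * k)) Thk ->
  (forall z, tors h z -> tors k z -> L0 z) ->
  (forall z, tors (h * k) z -> exists x y, [/\ tors h x, tors k y & z = x + y]) ->
  2 * k * dsum k Th + 2 * h * dsum h Tk =
  (size Tk)%:R * \sum_(t <- Th) E1 t ^+ 2 + (size Th)%:R * \sum_(t <- Tk) E1 t ^+ 2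
  + \sum_(t <- Thk) E1 t ^+ 2
  - (((size Tk)%:R - 2) * \sum_(t <- Th) wpx t + ((size Th)%:R - 2) * \sum_(t <- Tk) wpx t
     + \sum_(t <- Thk) wpx t).
Proof.
move=> h0 k0 mh mk rh rk rhk cop dec; have rA := reps_add mh mk rh rk cop dec.
rewrite (reps_sum rhk rA E1_sqr_periodic) (reps_sum rhk rA (wpx_periodic red)) !sum_add.
apply: (@addition_double_sum _ _ E1 wpx delta (addition_all red) Th Tk h k (fun x => E1 (h * x)) (fun x => E1 (k * x))).
- exact: (sum_E1 red rk).
- exact: sum_delta0 rh.
- exact: sum_delta0 rk.
- by move=> x; exact: (E1_distribution red _ k0 mk rk).
- by move=> x; exact: (E1_distribution red _ h0 mh rh).
- move=> x y xT yT; case: (pselect (L0 (x + y))) => xyL; last by rewrite /delta asboolF // mul0r.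
  have xk : tors k x.
    by rewrite -(addrK y x); apply: torsD (torsN (reps_sub rk yT)); exact: mk.
  by rewrite /wpx asboolT ?mulr0 //; apply: cop xk; exact: reps_sub rh _ xT.
Qed.

(** Raises the modulus from [k] to its norm: the fibres of multiplication by the conjugate of [k]
    are translates of a torsion group, along which E_1 sums by the distribution relation. *)
Lemma dsum_transfer h k T T' TN : k != 0 -> mult h -> mult k -> mult k^* ->
  reps (tors k) T -> reps (tors k^*) T' -> reps (tors (k * k^*)) TN ->
  dsum (h * k^*) TN = k^* * dsum h T.
Proof.
move=> k0 mh mk mk' rT rT' rN.
have k0' : k^* != 0 by rewrite fmorph_eq0.
have key a b c d : a \in T -> b \in T' -> c \in T -> d \in T' ->
    L0 (a / k^* + b - (c / k^* + d)) -> a = c /\ b = d.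
  move=> aT bT cT dT h0.
  have bd : tors k^* (b - d) by apply: torsD (reps_sub rT' bT) (torsN (reps_sub rT' dT)).
  have ac : L0 (a - c).
    rewrite (_ : a - c = k^* * (a / k^* + b - (c / k^* + d)) - k^* * (b - d)); last by field.
    by apply: L0B => //; exact: mk'.
  have e := reps_inj rT aT cT ac; split=> //.
  by apply: reps_inj rT' _ _ bT dT _; move: h0; rewrite e opprD addrACA subrr add0r.
have rA : reps (tors (k * k^*)) [seq x / k^* + y | x <- T, y <- T'].
  split.
  - move=> t /allpairsP[[a b] /= [aT bT ->]].
    rewrite /tors (_ : _ * _ = k * a + k * (k^* * b)); last by field.
    by apply: L0D; [exact: reps_sub rT _ aT|apply: mk; exact: reps_sub rT' _ bT].
  - apply: allpairs_uniq; [exact: reps_uniq rT|exact: reps_uniq rT'|].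
    move=> [a b] [c d] /= /allpairsP[[a1 b1] /= [ha hb [-> ->]]] /allpairsP[[c1 d1] /= [hc hd [-> ->]]] E.
    have [|-> -> //] := key a1 b1 c1 d1 ha hb hc hd.
    by rewrite E subrr; exact: L0_0.
  - move=> _ _ /allpairsP[[a b] /= [ha hb ->]] /allpairsP[[c d] /= [hc hd ->]] h0.
    by have [-> ->] := key a b c d ha hb hc hd h0.
  - move=> z kz.
    have [|a aT za] := reps_surj rT (z := k^* * z); first by rewrite /tors mulrA.
    have [|b bT zb] := reps_surj rT' (z := z - a / k^*).
      by rewrite /tors (_ : _ * _ = k^* * z - a) //; field.
    exists (a / k^* + b); first by apply/allpairsP; exists (a, b).
    by rewrite opprD addrA.
have pg : latperiodic tau (fun z => E1 (h * k^* * z) * E1 z).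
  by move=> x y yL; rewrite (E1D red x yL) (E1_mult_periodic (multM mh mk') x yL).
rewrite /dsum (reps_sum rN rA pg) big_allpairs_dep mulr_sumr; apply: eq_bigr => x _.
transitivity (\sum_(y <- T') E1 (h * x) * E1 (x / k^* + y)).
  rewrite big_seq [RHS]big_seq; apply: eq_bigr => y yT.
  have yL : L0 (h * (k^* * y)) by apply: mh; exact: reps_sub rT' _ yT.
  rewrite -(E1D red (h * x) yL); congr (E1 _ * _); by field.
rewrite -mulr_sumr (E1_distribution red _ k0' mk' rT') mulrCA; congr (_ * (_ * E1 _)).
by field.
Qed.

(** Both sides are transferred to the common modulus [k * k^*], where the duality for integers
    applies. *)
Lemma dsum_conj h k T T' : k != 0 -> mult h -> mult k -> mult h^* -> mult k^* ->
  reps (tors k) T -> reps (tors k^*) T' ->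
  k^* * dsum h T = - (k * dsum h^* T').
Proof.
move=> k0 mh mk mh' mk' rT rT'.
have k0' : k^* != 0 by rewrite fmorph_eq0.
have nE := size_reps red k0 mk rT.
have mN : mult (k * k^*) by exact: multM.
have N0 : k * k^* != 0 by rewrite mulf_neq0.
have [TN rN] := tors_reps red N0 mN.
have n0 : (0 < size T)%N by rewrite lt0n -(pnatr_eq0 R[i]) nE.
(* By [size_reps] the norm of [k] is the natural number [size T], so [dsum_adj] is available for
   it. *)
have rn : reps (tors (size T)%:R) TN by rewrite nE.
have cE : (h * k^*)^* = h^* * k by rewrite rmorphM /= conjcK.
have m1 : mult (h * k^*) by exact: multM.
have m2 : mult (h * k^*)^* by rewrite cE; exact: multM.
rewrite -(dsum_transfer k0 mh mk mk' rT rT' rN) (dsum_adj n0 rn m1 m2) cE; congr (- _).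
have rN' : reps (tors (k^* * k^*^*)) TN by rewrite conjcK mulrC.
have mkk : mult k^*^* by rewrite conjcK.
have rT2 : reps (tors k^*^*) T by rewrite conjcK.
by have := dsum_transfer k0' mh' mk' mkk rT' rT2 rN'; rewrite !conjcK.
Qed.

(** Substitute [t -> h' * t], a permutation of the n-torsion; the two factors then exchange their
    roles. *)
Lemma dsum_inverse n T h h' : (0 < n)%N -> reps (tors n%:R) T -> mult h -> mult h' ->
  (forall z, tors n%:R z -> L0 (h * (h' * z) - z)) -> dsum h T = dsum h' T.
Proof.
move=> n0 rT mh mh' inv.
have mt k t : mult k -> tors n%:R t -> tors n%:R (k * t).
  by move=> mk kt; rewrite /tors mulrCA; exact: mk.
have rM : reps (tors n%:R) (map (fun t => h' * t) T).
  apply: reps_map rT _ _ _ _.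
  - by move=> t; exact: mt.
  - move=> t t' tn tn' D; have := inv (t - t') (torsD tn (torsN tn')).
    have hD : L0 (h * (h' * (t - t'))) by apply: mh; rewrite mulrBr.
    by move=> /(L0B hD); rewrite opprB addrCA subrr addr0.
  - by move=> t t' D; rewrite -mulrBr; exact: mh'.
  - move=> z zn; exists (h * z); first exact: mt.
    by apply: L0_subC; have := inv z zn; rewrite mulrCA.
have pg : latperiodic tau (fun z => E1 (h * z) * E1 z).
  by move=> x y yL; rewrite (E1D red x yL) (E1_mult_periodic mh x yL).
rewrite /dsum (reps_sum rT rM pg) big_map big_seq [RHS]big_seq; apply: eq_bigr => t tT.
rewrite mulrC; congr (_ * _); apply: periodic_eq (E1_periodic red) _.
exact: inv (reps_sub rT tT).
Qed.

Lemma dsum_zero n T h u : (0 < n)%N -> reps (tors n%:R) T -> mult h -> mult h^* -> mult u ->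
  h * h^* = 1 + u * n%:R -> dsum h T = 0.
Proof.
move=> n0 rT mh mh' mu E.
have E1 : dsum h T = dsum h^* T.
  apply: (dsum_inverse n0 rT mh mh') => z zn.
  by rewrite mulrA E mulrDl mul1r addrC addKr -mulrA; exact: mu.
by apply: opp_self0; rewrite {1}(dsum_adj n0 rT mh mh') -E1.
Qed.

Lemma nat_mult n : mult n%:R.
Proof.
move=> z [[x y] _ <-]; exists (n%:Z * x, n%:Z * y) => //.
by rewrite /lat /= !rmorphM /= -![(Posz _)%:~R]/(_%:R); ring.
Qed.

(** The relation [h * h^* = 1 + u * n%:R] serves twice: as a Bezout identity for the decomposition
    in [reciprocity], and through [dsum_zero] to cancel one of its two Dedekind sums. The square
    sums left over are explicit by [E1_square_sum] and [wpx_sum]. *)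
Lemma dsum_value n h u Th : (0 < n)%N -> h != 0 -> mult h -> mult h^* -> mult u ->
  h * h^* = 1 + u * n%:R -> reps (tors h) Th ->
  n%:R * dsum n%:R Th = s2 * h * (h - h^*) * (1 - (n%:R ^+ 2 + 1) / (h * h^*)).
Proof.
move=> n0 h0 mh mh' mu E rh.
have nR : n%:R != 0 :> R[i] by rewrite pnatr_eq0 -lt0n.
have h0' : h^* != 0 by rewrite fmorph_eq0.
have mn := @nat_mult n.
have [Tn rn] := tors_reps red nR mn.
have mhn : mult (h * n%:R) by exact: multM.
have hn0 : h * n%:R != 0 by rewrite mulf_neq0.
have [Thn rhn] := tors_reps red hn0 mhn.
have cop z : tors h z -> tors n%:R z -> L0 z.
  move=> hz nz; rewrite (_ : z = h^* * (h * z) - u * (n%:R * z)).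
    by apply: L0B; [exact: mh'|exact: mu].
  by rewrite !mulrA -mulrBl (mulrC h^*) E addrK mul1r.
have dec z : tors (h * n%:R) z -> exists x y, [/\ tors h x, tors n%:R y & z = x + y].
  move=> hz; exists (- (u * n%:R * z)), (h * h^* * z); split.
  - apply: torsN; rewrite /tors (_ : _ * _ = u * (h * n%:R * z)); [exact: mu|ring].
  - rewrite /tors (_ : _ * _ = h^* * (h * n%:R * z)); [exact: mh'|ring].
  - by rewrite E; ring.
have rec := reciprocity h0 nR mh mn rh rn rhn cop dec.
rewrite (dsum_zero n0 rn mh mh' mu E) mulr0 addr0 in rec.
have q1 := E1_square_sum h0 mh rh; have q2 := E1_square_sum nR mn rn; have q3 := E1_square_sum hn0 mhn rhn.
have p1 := wpx_sum red h0 mh rh; have p2 := wpx_sum red nR mn rn; have p3 := wpx_sum red hn0 mhn rhn.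
have c1 := size_reps red h0 mh rh; have c2 := size_reps red nR mn rn; have c3 := size_reps red hn0 mhn rhn.
have nc : (n%:R : R[i])^* = n%:R by exact: rmorph_nat.
have hnc : (h * n%:R)^* = h^* * n%:R by rewrite rmorphM /= nc.
rewrite nc in c2 p2; rewrite hnc in c3 p3.
rewrite c1 c2 in rec; rewrite c1 p1 in q1; rewrite c2 p2 in q2; rewrite c3 p3 in q3.
rewrite p1 p2 p3 in rec.
move: rec q1 q2 q3.
set Q1 := \sum_(t <- Th) E1 t ^+ 2; set Q2 := \sum_(t <- Tn) E1 t ^+ 2; set Q3 := \sum_(t <- Thn) E1 t ^+ 2.
move=> rec q1 q2 q3.
have N0 : h * h^* != 0 by rewrite mulf_neq0.
have e1 : Q1 = (h * h^* - 2) * ((h ^+ 2 - h * h^*) * s2) / (h * h^*) by rewrite -q1; field; rewrite h0 h0'.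
(* A real modulus equals its conjugate, so the sum of [wpx] over the n-torsion is zero. *)
have e2 : Q2 = 0.
  have : n%:R * n%:R * Q2 = 0 by rewrite q2; ring.
  by move/eqP; rewrite !mulf_eq0 (negbTE nR) /= => /eqP.
have e3 : Q3 = (h * n%:R * (h^* * n%:R) - 2) * (((h * n%:R) ^+ 2 - h * n%:R * (h^* * n%:R)) * s2) / (h * n%:R * (h^* * n%:R)).
  by rewrite -q3; field; rewrite h0 h0' nR.
rewrite e1 e2 e3 in rec.
have two : 2 != 0 :> R[i] by rewrite pnatr_eq0.
apply: (mulfI two); rewrite mulrA rec; field; by rewrite h0 h0' nR.
Qed.

End DedekindSums.

(** * A recursion for Eisenstein sums from a polynomial identity *)

Section EisensteinRecursion.
Variable K : numFieldType.
Variable m : nat.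
Implicit Types (x y z : K) (a b i : nat) (g : nat -> K).

(** The geometric series truncated at order [m], so that for [i <= m] the number [kap a i] is the
    coefficient of [X^i] in [(1 - X)^(-a)]. *)
Definition geo (t : {poly K}) := \sum_(i < m.+1) t ^+ i.
Definition kap a i : K := (geo 'X ^+ a)`_i.

Lemma geoE : geo 'X = \poly_(i < m.+1) 1.
Proof. by rewrite poly_def; apply: eq_bigr => i _; rewrite scale1r. Qed.

Lemma coef_comp_scale (p : {poly K}) c i : (p \Po (c *: 'X))`_i = c ^+ i * p`_i.
Proof.
rewrite comp_polyE coef_sum.
under eq_bigr => j _ do rewrite exprZn coefZ coefZ coefXn.
case: (ltnP i (size p)) => h; last first.
  rewrite (nth_default _ h) mulr0 big1 // => j _.
  by rewrite gtn_eqF ?mulr0 // (leq_trans (ltn_ord j)).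
rewrite (bigD1 (Ordinal h)) //= eqxx big1 ?addr0; first by rewrite mulr1 mulrC.
move=> j; rewrite -val_eqE /= eq_sym => /negbTE ->; by rewrite !mulr0.
Qed.

Lemma geo_comp c : geo (c *: 'X) = geo 'X \Po (c *: 'X).
Proof. by rewrite /geo raddf_sum; apply: eq_bigr => i _; rewrite -comp_Xn_poly. Qed.

Lemma coef_geoX c a i : (geo (c *: 'X) ^+ a)`_i = c ^+ i * kap a i.
Proof. by rewrite geo_comp -(rmorphXn (comp_poly _)) /= coef_comp_scale. Qed.

Lemma kap_ge0 a i : 0 <= kap a i.
Proof.
rewrite /kap; elim: a i => [|a IH] i; first by rewrite expr0 coef1 ler0n.
rewrite exprS coefM sumr_ge0 // => j _; rewrite mulr_ge0 // geoE coef_poly.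
by case: ifP.
Qed.

Lemma kap_0 a : kap a 0 = 1.
Proof.
rewrite /kap -horner_coef0 horner_exp horner_coef0 geoE coef_poly /= expr1n //.
Qed.

Lemma kap_gt0 a : (0 < a)%N -> 0 < kap a m.
Proof.
case: a => // a _; rewrite /kap exprS coefM (bigD1 ord_max) //= geoE coef_poly ltnSn subnn -geoE.
rewrite -[X in 1 * X]/(kap a 0) kap_0 mul1r ltr_wpDr // sumr_ge0 // => j _.
by apply: mulr_ge0; [rewrite -[geo _]expr1; exact: (kap_ge0 1)|exact: kap_ge0].
Qed.

Lemma kapD a b : \sum_(i < m.+1) kap a i * kap b (m - i) = kap (a + b) m.
Proof. by rewrite /kap exprD coefM. Qed.

Lemma coef_geo_pow x a i : ((x%:P * geo ((- x) *: 'X)) ^+ a)`_i = (-1) ^+ i * kap a i * x ^+ (a + i).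
Proof. by rewrite exprMn -polyC_exp coefCM coef_geoX (exprNn x) (exprD x); ring. Qed.

Lemma coef_geo_powZ y a i : ((y%:P * geo (y *: 'X)) ^+ a)`_i = kap a i * y ^+ (a + i).
Proof. by rewrite exprMn -polyC_exp coefCM coef_geoX (exprD y); ring. Qed.

(** The relation of [eisrel_point] after summation: [w a b] replaces the sum of [x^a y^b], and the
    pairs with [z] contribute twice by symmetry. *)
Definition eisrel (w : nat -> nat -> K) : K :=
  3 * (\sum_(i < m.+1) (-1) ^+ i * kap 4 i * kap 4 (m - i) * w (4 + i)%N (4 + (m - i))%N
      + 2 * kap 4 m * w (4 + m)%N 4)
  - 2 * (\sum_(i < m.+1) (-1) ^+ i * kap 5 i * kap 3 (m - i) * w (5 + i)%N (3 + (m - i))%N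
      + \sum_(i < m.+1) (-1) ^+ i * kap 3 i * kap 5 (m - i) * w (3 + i)%N (5 + (m - i))%N
      + 2 * kap 5 m * w (5 + m)%N 3 + 2 * kap 3 m * w (3 + m)%N 5).

(* With [xy + yz + zx = 0] one has [3 sum x^4 y^4 = 2 sum x^5 y^3]; the relation is the
   coefficient of [eps^m] after replacing [1/x], [1/y] by [1/x + eps], [1/y - eps]. *)
Lemma eisrel_point x y z : ~~ odd m -> x != 0 -> y != 0 -> z != 0 -> x^-1 + y^-1 + z^-1 = 0 ->
  3 * (\sum_(i < m.+1) (-1) ^+ i * kap 4 i * kap 4 (m - i) * (x ^+ (4 + i) * y ^+ (4 + (m - i)))
      + kap 4 m * (x ^+ (4 + m) * z ^+ 4) + kap 4 m * (y ^+ (4 + m) * z ^+ 4))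
  - 2 * (\sum_(i < m.+1) (-1) ^+ i * kap 5 i * kap 3 (m - i) * (x ^+ (5 + i) * y ^+ (3 + (m - i)))
      + \sum_(i < m.+1) (-1) ^+ i * kap 3 i * kap 5 (m - i) * (x ^+ (3 + i) * y ^+ (5 + (m - i)))
      + (kap 5 m * (x ^+ (5 + m) * z ^+ 3) + kap 5 m * (y ^+ (5 + m) * z ^+ 3))
      + (kap 3 m * (x ^+ (3 + m) * z ^+ 5) + kap 3 m * (y ^+ (3 + m) * z ^+ 5))) = 0.
Proof.
move=> me x0 y0 z0 E.
pose px : {poly K} := x%:P * geo ((- x) *: 'X); pose py : {poly K} := y%:P * geo (y *: 'X).
pose pz : {poly K} := z%:P.
have geo1 (t : {poly K}) : (1 - t) * geo t = 1 - t ^+ m.+1.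
  by rewrite /geo -opprB mulNr -subrX1 opprB.
pose A := ((- x) ^+ m.+1)%:P; pose B := (y ^+ m.+1)%:P.
have hx : (x^-1%:P + 'X) * px = 1 - A * 'X^(m.+1).
  rewrite /A polyC_exp -exprMn mul_polyC -geo1 /px mulrA; congr (_ * _).
  by rewrite mulrDl -polyCM mulVf // scaleNr opprK -mul_polyC mulrC.
have hy : (y^-1%:P - 'X) * py = 1 - B * 'X^(m.+1).
  rewrite /B polyC_exp -exprMn mul_polyC -geo1 /py mulrA; congr (_ * _).
  by rewrite mulrBl -polyCM mulVf // -mul_polyC mulrC.
have hz : z^-1%:P * pz = 1 by rewrite -polyCM mulVf.
have e0 : x^-1%:P + y^-1%:P + z^-1%:P = 0 :> {poly K} by rewrite -!polyCD E.
pose e2 := px * py + py * pz + pz * px.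
have he2 : e2 = pz * (py * A + px * B) * 'X^(m.+1).
  have -> : e2 = (z^-1%:P * pz) * (px * py) + pz * py * ((x^-1%:P + 'X) * px + A * 'X^(m.+1))
     + pz * px * ((y^-1%:P - 'X) * py + B * 'X^(m.+1)).
    by rewrite hz hx hy /e2; ring.
  have -> : (z^-1%:P * pz) * (px * py) + pz * py * ((x^-1%:P + 'X) * px + A * 'X^(m.+1))
     + pz * px * ((y^-1%:P - 'X) * py + B * 'X^(m.+1)) =
     pz * px * py * (x^-1%:P + y^-1%:P + z^-1%:P) + pz * (py * A + px * B) * 'X^(m.+1) by ring.
  by rewrite e0 mulr0 add0r.
pose e1 := px + py + pz; pose e3 := px * py * pz.
pose F := 3 * (px ^+ 4 * py ^+ 4 + px ^+ 4 * pz ^+ 4 + py ^+ 4 * pz ^+ 4)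
  - 2 * (px ^+ 5 * py ^+ 3 + px ^+ 3 * py ^+ 5 + (px ^+ 5 * pz ^+ 3 + py ^+ 5 * pz ^+ 3)
     + (px ^+ 3 * pz ^+ 5 + py ^+ 3 * pz ^+ 5)).
(* The symmetric polynomial is a multiple of [e2], and [e2] is divisible by [X^(m+1)]; so the
   coefficient of order [m] vanishes. *)
have FE : F = e2 * (7 * e2 ^+ 3 - 24 * e2 * e1 * e3 + 26 * e3 ^+ 2 - 2 * e1 ^+ 2 * e2 ^+ 2
   + 6 * e1 ^+ 3 * e3) by rewrite /F /e1 /e2 /e3; ring.
have F0 : F`_m = 0 by rewrite FE he2 mulrAC coefMXn ltnSn.
transitivity (F`_m); last exact: F0.
rewrite /F.
have nC (k : nat) (p : {poly K}) : (k%:R * p)`_m = k%:R * p`_m.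
  by rewrite -polyC_natr coefCM.
have zC a (p : {poly K}) : (p * pz ^+ a)`_m = p`_m * z ^+ a by rewrite /pz -polyC_exp coefMC.
have sgm : (-1) ^+ m = 1 :> K by rewrite -signr_odd (negbTE me).
have prod a b : (px ^+ a * py ^+ b)`_m = \sum_(i < m.+1) (-1) ^+ i * kap a i * kap b (m - i) *
    (x ^+ (a + i) * y ^+ (b + (m - i))).
  rewrite coefM; apply: eq_bigr => i _; rewrite coef_geo_pow coef_geo_powZ; ring.
rewrite coefB !nC !coefD !zC !prod !coef_geo_pow !coef_geo_powZ sgm.
ring.
Qed.

(** In the relation the products involve only indices below [8 + m], and the top value occurs
    linearly; it is determined as soon as its coefficient is nonzero. *)
Lemma eisrel_det g g' : ~~ odd m ->
  (forall n, (3 <= n)%N -> (n < 8 + m)%N -> g n = g' n) ->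
  eisrel (fun a b => g a * g b - (-1) ^+ b * g (a + b)%N) = 0 ->
  eisrel (fun a b => g' a * g' b - (-1) ^+ b * g' (a + b)%N) = 0 ->
  g (8 + m)%N = g' (8 + m)%N.
Proof.
move=> me H E E'; pose d := g (8 + m)%N - g' (8 + m)%N.
suff : d = 0 by move/eqP; rewrite subr_eq0 => /eqP.
have sgm : (-1) ^+ m = 1 :> K by rewrite -signr_odd (negbTE me).
have wd a b : (3 <= a)%N -> (3 <= b)%N -> (a + b = 8 + m)%N ->
   g a * g b - (-1) ^+ b * g (a + b)%N - (g' a * g' b - (-1) ^+ b * g' (a + b)%N) = - (-1) ^+ b * d.
  move=> a3 b3 ab; rewrite ab (H a) ?(H b) //; [rewrite /d; ring|lia|lia].
have s1 a b : (3 <= a)%N -> (3 <= b)%N -> (a + b = 8)%N ->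
  \sum_(i < m.+1) (-1) ^+ i * kap a i * kap b (m - i) * (g (a + i)%N * g (b + (m - i))%N
     - (-1) ^+ (b + (m - i)) * g (a + i + (b + (m - i)))%N)
  - \sum_(i < m.+1) (-1) ^+ i * kap a i * kap b (m - i) * (g' (a + i)%N * g' (b + (m - i))%N
     - (-1) ^+ (b + (m - i)) * g' (a + i + (b + (m - i)))%N) = - (-1) ^+ b * d * kap 8 m.
  move=> a3 b3 ab; rewrite -sumrB -ab -kapD mulr_sumr; apply: eq_bigr => i _.
  have im : (i <= m)%N by rewrite -ltnS ltn_ord.
  rewrite -mulrBr wd; [|lia|lia|lia].
  have -> : (-1) ^+ (b + (m - i)) = (-1) ^+ b * (-1) ^+ i :> K.
    by rewrite -signr_odd oddD oddB // (negbTE me) /= -oddD signr_odd exprD.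
  have ii : (-1) ^+ i * (-1) ^+ i = 1 :> K by rewrite -exprD addnn -mul2n exprM sqrrN expr1n expr1n.
  move: ii; set t := (-1) ^+ i; set u := (-1) ^+ b; set k1 := kap a i; set k2 := kap b _ => ii.
  have -> : t * k1 * k2 * (- (u * t) * d) = t * t * (- u * d * (k1 * k2)) by ring.
  by rewrite ii mul1r.
(* Collecting the coefficient of [d] by [kapD] leaves terms [kap] of one sign, so it cannot
   vanish. *)
have : 0 = - (3 * (kap 8 m + 2 * kap 4 m) + 2 * (2 * kap 8 m + 2 * kap 5 m + 2 * kap 3 m)) * d.
  have t44 := s1 4%N 4%N isT isT erefl; have t53 := s1 5%N 3%N isT isT erefl.
  have t35 := s1 3%N 5%N isT isT erefl.
  have w4 := wd (4 + m)%N 4%N ltac:(lia) ltac:(lia) ltac:(lia).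
  have w5 := wd (5 + m)%N 3%N ltac:(lia) ltac:(lia) ltac:(lia).
  have w3 := wd (3 + m)%N 5%N ltac:(lia) ltac:(lia) ltac:(lia).
  have -> : 0 = eisrel (fun a b => g a * g b - (-1) ^+ b * g (a + b)%N) -
     eisrel (fun a b => g' a * g' b - (-1) ^+ b * g' (a + b)%N) by rewrite E E' subrr.
  rewrite /eisrel.
  set A1 := \sum_(i < m.+1) _ in t44 *; set A2 := \sum_(i < m.+1) _ in t44 *.
  set B1 := \sum_(i < m.+1) _ in t53 *; set B2 := \sum_(i < m.+1) _ in t53 *.
  set C1 := \sum_(i < m.+1) _ in t35 *; set C2 := \sum_(i < m.+1) _ in t35 *.
  transitivity (3 * ((A1 - A2) + 2 * kap 4 m * (- (-1) ^+ 4 * d))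
     - 2 * ((B1 - B2) + (C1 - C2) + 2 * kap 5 m * (- (-1) ^+ 3 * d) + 2 * kap 3 m * (- (-1) ^+ 5 * d))).
    by rewrite -w4 -w5 -w3; ring.
  by rewrite t44 t53 t35; ring.
move/esym/eqP; rewrite mulf_eq0 => /orP[|/eqP //].
rewrite oppr_eq0 gt_eqF // addr_gt0 // mulr_gt0 // ?addr_gt0 ?mulr_gt0 ?kap_gt0 //.
Qed.

End EisensteinRecursion.

(** * Double sums over the lattice and the recursion for G_n *)

Section LatticeSums.
Variable R : realType.
Variable tau : R[i].
Hypothesis red : reduced tau.
Implicit Types (p q : int * int) (n a b m : nat).
Local Notation L := (lat tau).
Local Notation L0 := (L0 tau).

Definition lattice_term n p : R[i] := if p == 0 then 0 else (L p)^-1 ^+ n.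
Definition gsm n := csum (lattice_term n).

Lemma absm_lattice_term n : (3 <= n)%N -> absm (lattice_term n).
Proof.
move=> n3; apply: (absm_dom red (C := 1)) => p p0; rewrite /lattice_term (negbTE p0) mul1r nrmX nrmV.
have l1 := lat_ge1 red p0; have h1 := hroot_ge1 red p0.
have i1 : (nrm (L p))^-1 <= 1 by rewrite invf_le1 //; lra.
apply: (@le_trans _ _ ((nrm (L p))^-1 ^+ 3)).
  by rewrite ler_wiXn2l // invr_ge0 nrm_ge0.
rewrite exprVn lef_pV2 ?posrE ?exprn_gt0 //; [|lra|lra].
by rewrite -hroot_sqr -exprM ler_weXn2l.
Qed.

Lemma gsm_odd n : odd n -> (3 <= n)%N -> gsm n = 0.
Proof.
move=> no n3; have a := absm_lattice_term n3.
have E : gsm n = - gsm n.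
  rewrite /gsm -csumN // -[LHS]csum_latN; apply: csum_ext => p.
  rewrite /lattice_term oppr_eq0 latN; case: ifP; rewrite ?oppr0 // invrN exprNn -signr_odd no.
  by rewrite expr1 mulN1r.
have : 2 * gsm n = 0 by rewrite mulr_natl mulr2n {1}E addNr.
by move/eqP; rewrite mulf_eq0 (negbTE (_ : 2 != 0)) ?pnatr_eq0 //= => /eqP.
Qed.

Lemma lattice_termN n p : lattice_term n (- p) = (-1) ^+ n * lattice_term n p.
Proof. by rewrite /lattice_term oppr_eq0; case: ifP => _; rewrite ?mulr0 // latN invrN (exprNn (L p)^-1). Qed.

(** Pairs with zero sum are excluded so that the third vector [- s.1 - s.2] is invertible as
    well. *)
Definition dterm a b (s : (int * int) * (int * int)) : R[i] :=
  if s.1 + s.2 == 0 then 0 else lattice_term a s.1 * lattice_term b s.2.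
Definition dsm a b := csum (dterm a b).

Lemma absm_dterm a b : (3 <= a)%N -> (3 <= b)%N -> absm (dterm a b).
Proof.
move=> a3 b3; apply: absm_le (absm_prod (absm_lattice_term a3) (absm_lattice_term b3)) => s.
by rewrite /dterm; case: ifP => // _; rewrite nrm0 nrm_ge0.
Qed.

Lemma dsm_eq a b : (3 <= a)%N -> (3 <= b)%N ->
  dsm a b = gsm a * gsm b - (-1) ^+ b * gsm (a + b)%N.
Proof.
move=> a3 b3; have ab3 : (3 <= a + b)%N by lia.
rewrite /gsm -(csum_prod (absm_lattice_term a3) (absm_lattice_term b3)).
pose h p := (p, - p); have ih : injective h by move=> p q [].
pose f (s : (int * int) * (int * int)) : R[i] := if s.1 + s.2 == 0 then lattice_term a s.1 * lattice_term b s.2 else 0.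
have fh p : f (h p) = (-1) ^+ b * lattice_term (a + b)%N p.
  rewrite /f /h /= subrr eqxx lattice_termN mulrCA; congr (_ * _); rewrite /lattice_term.
  by case: ifP => _; rewrite ?mulr0 // exprD.
have f0 s : (forall p, s <> h p) -> f s = 0.
  case: s => p q H; rewrite /f /=; case: ifP => // /eqP E; case: (H p).
  by rewrite /h -[q](addKr p) E addr0.
rewrite -csumZ; last exact: absm_lattice_term.
have -> : csum (fun p => (-1) ^+ b * lattice_term (a + b)%N p) = csum f.
  by rewrite -(csum_reindex ih f0); apply: csum_ext => p; rewrite /= fh.
have af : absm f.
  apply: absm_le (absm_prod (absm_lattice_term a3) (absm_lattice_term b3)) => s.
  by rewrite /f; case: ifP => // _; rewrite nrm0 nrm_ge0.
rewrite -csumB //; last exact: absm_prod (absm_lattice_term a3) (absm_lattice_term b3).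
by apply: csum_ext => s; rewrite /dterm /f; case: ifP => _; rewrite ?subr0 ?subrr.
Qed.

Lemma dsm_hs a b : (3 <= a)%N -> (3 <= b)%N -> hs (dterm a b) (dsm a b).
Proof. by move=> a3 b3; apply: csumP; exact: absm_dterm. Qed.

Lemma dsm_hs13 a b : (3 <= a)%N -> (3 <= b)%N ->
  hs (fun s => dterm a b (s.1, - s.1 - s.2)) (dsm a b).
Proof.
move=> a3 b3; pose h (s : (int * int) * (int * int)) := (s.1, - s.1 - s.2).
have hK : cancel h h by move=> [p q]; rewrite /h /= opprB addrC subrK.
apply/(@hs_reindex R _ _ (dterm a b) _ h (can_inj hK)); last exact: dsm_hs.
by move=> s H; case: (H (h s)); rewrite hK.
Qed.

Lemma dsm_hs23 a b : (3 <= a)%N -> (3 <= b)%N ->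
  hs (fun s => dterm a b (s.2, - s.1 - s.2)) (dsm a b).
Proof.
move=> a3 b3; pose h (s : (int * int) * (int * int)) := (s.2, - s.1 - s.2).
pose h' (s : (int * int) * (int * int)) := (- s.1 - s.2, s.1).
have hK : cancel h h' by move=> [p q]; rewrite /h /h' /= opprB addKr opprK.
have hK' : cancel h' h by move=> [p q]; rewrite /h /h' /= opprB opprK addrK.
apply/(@hs_reindex R _ _ (dterm a b) _ h (can_inj hK)); last exact: dsm_hs.
by move=> s H; case: (H (h' s)); rewrite hK'.
Qed.

(** Applies [eisrel_point] to the inverses of three nonzero lattice vectors with zero sum and adds
    up; permuting the three vectors identifies the double sums. *)
Lemma gsm_eisrel m : ~~ odd m ->
  eisrel m (fun a b => gsm a * gsm b - (-1) ^+ b * gsm (a + b)%N) = 0.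
Proof.
move=> me.
have sumr (c : nat -> R[i]) a b : (3 <= a)%N -> (3 <= b)%N ->
   hs (fun s => \sum_(i < m.+1) c i * dterm (a + i) (b + (m - i)) s)
      (\sum_(i < m.+1) c i * dsm (a + i) (b + (m - i))).
  by move=> a3 b3; apply: hs_sum => i; apply: hsZ; apply: dsm_hs; lia.
have h13 (c : R[i]) a b : (3 <= a)%N -> (3 <= b)%N ->
   hs (fun s => c * dterm a b (s.1, - s.1 - s.2) + c * dterm a b (s.2, - s.1 - s.2)) (2 * c * dsm a b).
  move=> a3 b3; rewrite (_ : 2 * c * _ = c * dsm a b + c * dsm a b); last by ring.
  by apply: hsD; apply: hsZ; [exact: dsm_hs13|exact: dsm_hs23].
pose k a i := kap R[i] m a i.
have H := hsB (hsZ 3 (hsD (sumr (fun i => (-1) ^+ i * k 4%N i * k 4%N (m - i)%N) 4%N 4%N isT isT)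
    (h13 (k 4%N m) (4 + m)%N 4%N isT isT)))
  (hsZ 2 (hsD (hsD (hsD (sumr (fun i => (-1) ^+ i * k 5%N i * k 3%N (m - i)%N) 5%N 3%N isT isT)
    (sumr (fun i => (-1) ^+ i * k 3%N i * k 5%N (m - i)%N) 3%N 5%N isT isT))
    (h13 (k 5%N m) (5 + m)%N 3%N isT isT)) (h13 (k 3%N m) (3 + m)%N 5%N isT isT))).
transitivity (eisrel m dsm).
  rewrite /eisrel -!dsm_eq ?leq_addr //; congr (_ * (_ + _) - _ * (_ + _ + _ + _));
  by apply: eq_bigr => i _; rewrite -dsm_eq //; lia.
apply: (hs_uniq H); apply: hs_ext (@hs0 R _) => -[p q] /=.
rewrite /dterm /=.
have e1 : p + (- p - q) = - q by rewrite addrA subrr sub0r.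
have e2 : q + (- p - q) = - p by rewrite addrCA subrr addr0.
rewrite e1 e2 !oppr_eq0.
case: (eqVneq p 0) => [->|p0].
  rewrite /lattice_term eqxx; rewrite !big1 => [|i _|i _|i _];
  by rewrite !(mul0r, mulr0, if_same, addr0, subr0, subrr).
case: (eqVneq q 0) => [->|q0].
  rewrite /lattice_term eqxx; rewrite !big1 => [|i _|i _|i _];
  by rewrite !(mul0r, mulr0, if_same, addr0, subr0, subrr).
case: (eqVneq (p + q) 0) => [pq|pq].
  have -> : lattice_term 4 (- p - q) = 0 by rewrite /lattice_term -opprD pq oppr0 eqxx.
  have -> : lattice_term 3 (- p - q) = 0 by rewrite /lattice_term -opprD pq oppr0 eqxx.
  have -> : lattice_term 5 (- p - q) = 0 by rewrite /lattice_term -opprD pq oppr0 eqxx.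
  rewrite !big1 => [|i _|i _|i _]; by rewrite /= !(mul0r, mulr0, if_same, addr0, subr0, subrr).
have r0 : - p - q != 0 by rewrite -opprD oppr_eq0.
have g n u : u != 0 -> lattice_term n u = (L u)^-1 ^+ n by move=> u0; rewrite /lattice_term (negbTE u0).
have lu u : u != 0 -> (L u)^-1 != 0 by move=> u0; rewrite invr_eq0 (lat_eq0 red).
have E : (L p)^-1^-1 + (L q)^-1^-1 + (L (- p - q))^-1^-1 = 0.
  by rewrite !invrK latB latN; ring.
have S (c : nat -> R[i]) a b : \sum_(i < m.+1) c i * (lattice_term (a + i) p * lattice_term (b + (m - i)) q) =
    \sum_(i < m.+1) c i * ((L p)^-1 ^+ (a + i) * (L q)^-1 ^+ (b + (m - i))).
  by apply: eq_bigr => i _; rewrite !g.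
have s1 := S (fun i => (-1) ^+ i * k 4%N i * k 4%N (m - i)%N) 4%N 4%N.
have s2 := S (fun i => (-1) ^+ i * k 5%N i * k 3%N (m - i)%N) 5%N 3%N.
have s3 := S (fun i => (-1) ^+ i * k 3%N i * k 5%N (m - i)%N) 3%N 5%N.
rewrite /= in s1 s2 s3; rewrite s1 s2 s3 !(g _ p) // !(g _ q) // !(g _ (- p - q)) //.
rewrite /k; apply: (etrans (esym (@eisrel_point R[i] m _ _ _ me (lu p p0) (lu q q0) (lu _ r0) E))).
set S1 := \sum_(i < m.+1) _; set S2 := \sum_(i < m.+1) _; set S3 := \sum_(i < m.+1) _.
ring.
Qed.

End LatticeSums.

(** * G_4 and G_6 determine the lattice *)

Section Determination.
Variable R : realType.
Implicit Types (x y z c tau : R[i]) (n : nat).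

(** Strong induction: odd weights vanish, weights 4 and 6 are given, and from 8 on the recursion,
    homogeneous under scaling, determines each weight from smaller ones. *)
Lemma gsm_det tau tau' c c' : reduced tau -> reduced tau' ->
  c ^+ 4 * gsm tau 4 = c' ^+ 4 * gsm tau' 4 -> c ^+ 6 * gsm tau 6 = c' ^+ 6 * gsm tau' 6 ->
  forall n, (3 <= n)%N -> c ^+ n * gsm tau n = c' ^+ n * gsm tau' n.
Proof.
move=> red red' h4 h6.
have sc m u t : ~~ odd m -> reduced t ->
    eisrel m (fun a b => u ^+ a * gsm t a * (u ^+ b * gsm t b) - (-1) ^+ b * (u ^+ (a + b) * gsm t (a + b)%N)) = 0.
  move=> me rt; have := gsm_eisrel rt me; set w := fun a b => _ => H.
  have -> : (fun a b => u ^+ a * gsm t a * (u ^+ b * gsm t b) - (-1) ^+ b * (u ^+ (a + b) * gsm t (a + b)%N))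
    = fun a b => u ^+ (a + b) * w a b.
    by apply/funext => a; apply/funext => b; rewrite /w exprD; ring.
  transitivity (u ^+ (8 + m) * eisrel m w); last by rewrite H mulr0.
  rewrite /eisrel.
  have S a b k : (a + b = 8)%N -> \sum_(i < m.+1) k i * (u ^+ (a + i + (b + (m - i))) * w (a + i)%N (b + (m - i))%N)
     = u ^+ (8 + m) * \sum_(i < m.+1) k i * w (a + i)%N (b + (m - i))%N.
    move=> ab; rewrite mulr_sumr; apply: eq_bigr => i _.
    have -> : (a + i + (b + (m - i)) = 8 + m)%N by have := ltn_ord i; lia.
    ring.
  rewrite !(S _ _ (fun i => (-1) ^+ i * _ * _)) //.
  have -> : (4 + m + 4 = 8 + m)%N by lia.
  have -> : (5 + m + 3 = 8 + m)%N by lia.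
  have -> : (3 + m + 5 = 8 + m)%N by lia.
  set U := u ^+ (8 + m); ring.
elim/ltn_ind => n IH n3.
case: (boolP (odd n)) => no; first by rewrite !gsm_odd // !mulr0.
case: (ltnP n 8) => n8.
  have : (n == 4) || (n == 6) by move: n3 n8 no; clear; move: n; do 8! (case=> //).
  by case/orP => /eqP ->.
have nE : n = (8 + (n - 8))%N by rewrite subnKC.
have me : ~~ odd (n - 8) by move: no; rewrite {1}nE oddD.
rewrite nE; apply: (@eisrel_det R[i] (n - 8) (fun k => c ^+ k * gsm tau k) (fun k => c' ^+ k * gsm tau' k) me).
- by move=> k k3 kn; apply: IH => //; rewrite nE.
- exact: sc me red.
- exact: sc me red'.
Qed.

Lemma argmin_seq (T : eqType) (f : T -> R) (s : seq T) (x : T) : x \in s ->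
  exists2 y : T, y \in s & forall z : T, z \in s -> f y <= f z.
Proof.
elim: s x => // a s IH x _; case: s IH => [_|b s IH].
  by exists a; rewrite ?mem_head // => z; rewrite inE => /eqP ->.
have [y ys Hy] := IH b (mem_head _ _).
case: (leP (f a) (f y)) => h.
  by exists a; rewrite ?mem_head // => z; rewrite inE => /orP[/eqP ->//|/Hy]; exact: le_trans.
exists y; first by rewrite inE ys orbT.
by move=> z; rewrite inE => /orP[/eqP ->|/Hy //]; exact: ltW.
Qed.

(** The geometric sums are bounded by [2 / |rho - 1|], and the division by [n + 1] sends them to
    zero. *)
Lemma average_pow (rho : R[i]) : nrm rho <= 1 -> rho != 1 -> forall e, 0 < e -> exists N,
  forall n, (N <= n)%N -> nrm (n.+1%:R^-1 * \sum_(i < n.+1) rho ^+ i) <= e.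
Proof.
move=> r1 rn e e0; have d0 : 0 < nrm (rho - 1) by rewrite nrm_gt0 subr_eq0.
exists (Num.Def.archi_bound (2 / (e * nrm (rho - 1)))) => n Nn.
have sE : \sum_(i < n.+1) rho ^+ i = (rho ^+ n.+1 - 1) / (rho - 1).
  by rewrite subrX1 mulrAC divff ?mul1r // subr_eq0.
rewrite sE nrmM nrmV nrm_nat nrmM nrmV.
have b : nrm (rho ^+ n.+1 - 1) <= 2.
  apply: le_trans (nrmB _ _) _; rewrite nrm1 nrmX.
  by have := exprn_ile1 n.+1 (nrm_ge0 rho) r1; lra.
have n1 : 2 / (e * nrm (rho - 1)) <= n.+1%:R.
  have := archi_boundP (x := 2 / (e * nrm (rho - 1))) ltac:(by rewrite divr_ge0 // mulr_ge0 // ltW).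
  move=> /ltW /le_trans; apply; rewrite ler_nat; exact: leqW.
rewrite mulrC ler_pdivrMr ?ltr0n // ler_pdivrMr //; apply: le_trans b _.
by move: n1; rewrite ler_pdivrMr ?mulr_gt0 //; lra.
Qed.

Section Peeling.
Variables (tau tau' c c' : R[i]).
Hypotheses (red : reduced tau) (red' : reduced tau') (cn0 : c != 0) (cn0' : c' != 0).
Hypothesis eqs : forall n, (3 <= n)%N -> c^-1 ^+ n * gsm tau n = c'^-1 ^+ n * gsm tau' n.

Let A (u t x : R[i]) := `[< exists2 p, p != 0 & x = u * lat t p >].
(** Difference of the indicator functions of the nonzero vectors of the two scaled lattices;
    equality of the lattices means that it vanishes. *)
Let eps x : R[i] := (A c tau x)%:R - (A c' tau' x)%:R.

Lemma scaled_sum u t n : reduced t -> u != 0 -> (3 <= n)%N ->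
  absm (fun x => (A u t x)%:R * x^-1 ^+ n) /\
  csum (fun x => (A u t x)%:R * x^-1 ^+ n) = u^-1 ^+ n * gsm t n.
Proof.
move=> rt u0 n3; pose h p := u * lat t p.
have ih : injective h by move=> p q /(mulfI u0) /(lat_inj rt).
have f0 x : (forall p, x <> h p) -> (A u t x)%:R * x^-1 ^+ n = 0 :> R[i].
  move=> H; rewrite /A asboolF ?mul0r // => -[p _ E]; exact: H p E.
have fh p : (A u t (h p))%:R * (h p)^-1 ^+ n = u^-1 ^+ n * lattice_term t n p.
  rewrite /lattice_term; case: eqVneq => [->|p0]; rewrite /A.
    rewrite asboolF ?mul0r ?mulr0 // => -[q q0 E]; have /esym/eqP := ih _ _ E.
    by rewrite (negbTE q0).
  by rewrite asboolT; [rewrite mul1r /h invfM exprMn|exists p].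
have a := absmZ (u^-1 ^+ n) (absm_lattice_term rt n3).
have a2 : absm ((fun x => (A u t x)%:R * x^-1 ^+ n) \o h) by apply: absm_ext a => p; rewrite /= fh.
split; first exact: absm_reindex a2.
by rewrite -(csum_reindex ih f0) -csumZ; [apply: csum_ext => p; rewrite /= fh|exact: absm_lattice_term].
Qed.

Lemma eps_sum n : (3 <= n)%N -> absm (fun x => eps x * x^-1 ^+ n) /\ csum (fun x => eps x * x^-1 ^+ n) = 0.
Proof.
move=> n3; have [a e] := scaled_sum red cn0 n3; have [a' e'] := scaled_sum red' cn0' n3.
have E x : eps x * x^-1 ^+ n = (A c tau x)%:R * x^-1 ^+ n - (A c' tau' x)%:R * x^-1 ^+ n by rewrite mulrBl.
split; first by apply: absm_ext (absmB a a') => x; rewrite E.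
by rewrite (csum_ext E) csumB // e e' eqs // subrr.
Qed.

Lemma A_fin u t B : reduced t -> u != 0 -> exists s : seq R[i], forall x, nrm x <= B -> A u t x -> x \in s.
Proof.
move=> rt u0; have [s Hs] := lat_finite rt (nrm u^-1 * B).
exists (map (fun p => u * lat t p) s) => x xB /asboolP[p _ E].
apply/mapP; exists p => //; apply: Hs.
have -> : lat t p = u^-1 * x by rewrite E mulKf.
by rewrite nrmM ler_wpM2l ?nrm_ge0.
Qed.

Lemma A_neq0 u t x : reduced t -> u != 0 -> A u t x -> x != 0.
Proof. by move=> rt u0 /asboolP[p p0 ->]; rewrite mulf_neq0 // (lat_eq0 rt). Qed.

(* Multiply the identities [eps_sum] by x0^n for a shortest x0 with eps x0 <> 0 and average
   over n: by [average_pow] only eps x0 survives. *)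
Lemma eps_eq0 x : eps x = 0.
Proof.
apply/eqP; rewrite -[_ == _]negbK; apply/negP => xn.
have epsA y : eps y != 0 -> A c tau y \/ A c' tau' y.
  by rewrite /eps; case: (A c tau y); case: (A c' tau' y); auto; rewrite subrr eqxx.
have [s Hs] := A_fin (nrm x) red cn0; have [s' Hs'] := A_fin (nrm x) red' cn0'.
have fin y : nrm y <= nrm x -> eps y != 0 -> y \in s ++ s'.
  by move=> yx /epsA[h|h]; rewrite mem_cat ?(Hs _ yx h) // (Hs' _ yx h) orbT.
have [|x0 x0s Hmin] := @argmin_seq _ (@nrm R) [seq y <- s ++ s' | eps y != 0] x.
  by rewrite mem_filter xn fin.
move: x0s; rewrite mem_filter => /andP[x0n _].
have min y : eps y != 0 -> nrm x0 <= nrm y.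
  move=> yn; case: (leP (nrm y) (nrm x)) => yx; first by apply: Hmin; rewrite mem_filter yn fin.
  apply: le_trans (ltW yx); apply: Hmin; by rewrite mem_filter xn fin.
have epsn0 y : eps y != 0 -> y != 0 by move=> /epsA[]; exact: A_neq0.
have x00 := epsn0 _ x0n.
have [a3 _] := @eps_sum 3 isT.
pose f y := x0 ^+ 3 * (eps y * y^-1 ^+ 3).
have af : absm f by exact: absmZ.
pose F n y := f y * (n.+1%:R^-1 * \sum_(i < n.+1) (x0 / y) ^+ i).
pose G y := if y == x0 then eps x0 else 0.
have ratio y : eps y != 0 -> nrm (x0 / y) <= 1.
  move=> yn; rewrite nrmM nrmV ler_pdivrMr ?mul1r; [exact: min|by rewrite nrm_gt0 epsn0].
have Fb n y : nrm (F n y) <= nrm (f y).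
  case: (eqVneq (eps y) 0) => [E|yn]; first by rewrite /F /f E mul0r mulr0 mul0r.
  rewrite /F nrmM ler_piMr ?nrm_ge0 // nrmM nrmV nrm_nat mulrC ler_pdivrMr ?ltr0n // mul1r.
  apply: le_trans (nrm_sum _ _ _) _.
  apply: (@le_trans _ _ (\sum_(i < n.+1) 1)); last by rewrite sumr_const card_ord.
  by apply: ler_sum => i _; rewrite nrmX exprn_ile1 ?nrm_ge0 // ratio.
have FG y e : 0 < e -> exists N, forall n, (N <= n)%N -> nrm (F n y - G y) <= e.
  move=> e0; case: (eqVneq (eps y) 0) => [E|yn].
    exists 0%N => n _; rewrite /F /f /G E mul0r mulr0 mul0r.
    by case: eqP => [yx|_]; [rewrite -yx E|]; rewrite subrr nrm0 ltW.
  case: (eqVneq y x0) => [->|yx].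
    exists 0%N => n _; rewrite /F /f /G eqxx divff //.
    under eq_bigr => i _ do rewrite expr1n.
    rewrite sumr_const card_ord mulVf ?pnatr_eq0 // mulr1.
    by rewrite exprVn mulrCA divff ?expf_neq0 // mulr1 subrr nrm0 ltW.
  have rn : x0 / y != 1.
    apply: contra_neq yx => E.
    by rewrite -(mulfVK (epsn0 y yn) x0) E mul1r.
  have fn := nrm_ge0 (f y).
  have [N HN] := average_pow (ratio y yn) rn (e := e / (nrm (f y) + 1)) ltac:(by rewrite divr_gt0 //; lra).
  exists N => n /HN h; rewrite /F /G (negbTE yx) subr0 nrmM.
  apply: le_trans (ler_wpM2l fn h) _; rewrite mulrCA ger_pMr // ler_pdivrMr; lra.
have F0 n : csum (F n) = 0.
  apply: csum_eq; pose cst i : R[i] := n.+1%:R^-1 * x0 ^+ (3 + i).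
  have : hs (fun y => \sum_(i < n.+1) cst i * (eps y * y^-1 ^+ (3 + i))) (\sum_(i < n.+1) cst i * 0).
    apply: hs_sum => i; apply: hsZ; have [a e] := @eps_sum (3 + i) isT.
    by rewrite -e; exact: csumP.
  rewrite big1 => [|i _]; last by rewrite mulr0.
  apply: hs_ext => y; rewrite /F /f !mulr_sumr; apply: eq_bigr => i _.
  by rewrite /cst exprMn !exprD; ring.
have G0 : csum G = eps x0.
  rewrite (@csum_fin _ _ G [:: x0]) // ?big_seq1 /G ?eqxx // => y; rewrite inE => /negbTE -> //.
have : eps x0 = 0.
  apply: nrm_le0 => e e0; have [N HN] := csum_dominated af Fb FG e0.
  by have := HN N (leqnn N); rewrite F0 G0 sub0r nrmN.
by move/eqP; rewrite (negbTE x0n).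
Qed.

Lemma scaled_lattice_eq : [set c * x | x in L0 tau] = [set c' * x | x in L0 tau'].
Proof.
have key x : A c tau x = A c' tau' x.
  have := eps_eq0 x; rewrite /eps; case: (A c tau x); case: (A c' tau' x) => // /eqP.
    by rewrite subr0 oner_eq0.
  by rewrite sub0r oppr_eq0 oner_eq0.
have AE u t x : u != 0 -> reduced t -> [set u * y | y in L0 t] x <-> x = 0 \/ A u t x.
  move=> u0 rt; split=> [[_ [p _ <-] <-]|[->|/asboolP[p _ ->]]].
  - case: (eqVneq p 0) => [->|p0]; first by left; rewrite lat0 mulr0.
    by right; apply/asboolP; exists p.
  - by exists 0; rewrite ?mulr0 //; exact: L0_0.
  - by exists (lat t p) => //; exact: L0lat.
by apply/seteqP; split=> x /AE h; apply/AE => //; [rewrite -key|rewrite key]; exact: h.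
Qed.

End Peeling.

Lemma gsm_determines tau tau' c c' : reduced tau -> reduced tau' -> c != 0 -> c' != 0 ->
  c^-1 ^+ 4 * gsm tau 4 = c'^-1 ^+ 4 * gsm tau' 4 -> c^-1 ^+ 6 * gsm tau 6 = c'^-1 ^+ 6 * gsm tau' 6 ->
  [set c * x | x in L0 tau] = [set c' * x | x in L0 tau'].
Proof.
move=> red red' c0 c0' h4 h6; apply: scaled_lattice_eq => //.
exact: gsm_det.
Qed.

End Determination.

(** * Behaviour under homothety and complex conjugation *)

Section Transport.
Variable R : realType.
Implicit Types (z s w c h k : R[i]) (n : nat).

(** The condition in the reverse direction handles the default value: if one side has no
    continuation, neither has the other, and both values are 0. *)
Lemma E_transport (L L' : set R[i]) n z z' (phi : R[i] -> R[i]) : phi 0 = 0 ->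
  (forall F, is_EisKron_continuation L n z F ->
     exists2 F', is_EisKron_continuation L' n z' F' & F' 0 = phi (F 0)) ->
  (forall F', is_EisKron_continuation L' n z' F' -> exists F, is_EisKron_continuation L n z F) ->
  E_ n L' z' = phi (E_ n L z).
Proof.
move=> p0 H H'; case: (pselect (exists F, is_EisKron_continuation L n z F)) => [[F HF]|N].
  by have [F' HF' E] := H F HF; rewrite (E_eq HF) (E_eq HF') E.
have xg (M : set R[i]) u : ~ (exists F, is_EisKron_continuation M n u F) -> E_ n M u = 0.
  by move=> K; rewrite /E_; case: xgetP => // e _ [F HF _]; case: K; exists F.
by rewrite !xg ?p0 // => -[F' /H'].
Qed.

Lemma scale_continuation (L : set R[i]) n z F c : c != 0 -> is_EisKron_continuation L n z F ->
  is_EisKron_continuation [set c * l | l in L] n (c * z)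
    (fun s => c^-1 ^+ n * (norm_cpow c (- s) * F s)).
Proof.
move=> c0 [sg sg0 [D [t S]]]; exists sg; [exact: sg0|split].
  move=> s /D /derivable_cdiff[k Hk]; apply/derivable_cdiff.
  have [k' Hk'] := cdiff_cpow c s.
  by eexists; apply: cdiffZ; apply: cdiffM; [exact: Hk'|exact: Hk].
exists t => s st; apply/has_sumE; have /has_sumE H := S s st.
have ih : injective (fun x => c * x) by exact: (mulfI c0).
apply/(hs_reindex _ ih).
  by move=> x K; case: (K (c^-1 * x)); rewrite mulVKf.
apply: hs_ext (hsZ (c^-1 ^+ n) (hsZ (norm_cpow c (- s)) H)) => l /=.
case: ifP => /asboolP; rewrite ?inE /=.
  move=> [lL lz]; rewrite ifT.
    by rewrite -mulrDr norm_cpowM // -!exprVn invfM exprMn; ring.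
  by rewrite inE /=; split; [exists l|rewrite -mulrDr mulf_neq0].
move=> N; rewrite ifF ?mulr0 //; apply/negP; rewrite inE /= => -[[l' l'L /ih E]].
by rewrite -mulrDr mulf_eq0 (negbTE c0) /= => lz; apply: N; rewrite -E in lz *.
Qed.

Lemma E_scale (L : set R[i]) n z c : c != 0 ->
  E_ n [set c * l | l in L] (c * z) = c^-1 ^+ n * E_ n L z.
Proof.
move=> c0; apply: (E_transport (mulr0 _)).
  by move=> F HF; eexists; [exact: scale_continuation HF|rewrite /= oppr0 norm_cpow0 mul1r].
move=> F' HF'; have c1 : c^-1 != 0 by rewrite invr_eq0.
have := scale_continuation c1 HF'; rewrite mulKf //.
have -> : [set c^-1 * l | l in [set c * l | l in L]] = L.
  apply/seteqP; split=> [_ [_ [l lL <-] <-]|l lL]; first by rewrite mulKf.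
  by exists (c * l); [exists l|rewrite mulKf].
by move=> H; eexists; exact: H.
Qed.

Lemma conjc_real_eq (x : R) : x%:C^* = x%:C.
Proof. by rewrite /= oppr0. Qed.

Lemma cdiff_conj F s k : cdiff F s^* k -> cdiff (fun s => (F s^*)^*) s k^*.
Proof.
move=> H e e0; have [d d0 K] := H e e0; exists d => // w wd.
have cB (x y : R[i]) : (x - y)^* = x^* - y^* by exact: rmorphB.
have := K w^*; rewrite -cB nrm_conj => /(_ wd) {}K.
have -> : (F w^*)^* - (F s^*)^* - (w - s) * k^* = (F w^* - F s^* - (w - s)^* * k)^*.
  by rewrite [RHS]cB [in RHS]cB; congr (_ - _); rewrite rmorphM /= conjcK.
by rewrite nrm_conj.
Qed.

Lemma norm_cpow_conj z s : norm_cpow z^* s^* = (norm_cpow z s)^*.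
Proof.
rewrite /norm_cpow -/(nrm z^*) nrm_conj expC_conj; congr expC.
have -> : (s * (ln (nrm z))%:C)^* = s^* * (ln (nrm z))%:C^* by exact: rmorphM.
by rewrite conjc_real_eq.
Qed.

Lemma conj_continuation (L : set R[i]) n z F : is_EisKron_continuation L n z F ->
  is_EisKron_continuation [set l^* | l in L] n z^* (fun s => (F s^*)^*).
Proof.
have cRe (s : R[i]) : complex.Re s^* = complex.Re s by case: s.
move=> [sg sg0 [D [t S]]]; exists sg; [exact: sg0|split].
  move=> s s1; have /derivable_cdiff[k Hk] := D s^* ltac:(by rewrite /= cRe).
  by apply/derivable_cdiff; exists k^*; exact: cdiff_conj.
exists t => s st; apply/has_sumE; have /has_sumE H := S s^* ltac:(by rewrite /= cRe).
have ih : injective (fun x : R[i] => x^*) by exact: (can_inj (@conjcK R)).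
apply/(hs_reindex _ ih).
  by move=> x K; case: (K x^*); rewrite conjcK.
move=> e e0; have [s0 Hs0] := H e e0; exists s0 => u uu su.
have := Hs0 u uu su; rewrite -[X in X <= _]nrm_conj rmorphB /= rmorph_sum /=.
set A := \sum_(i <- u) _; set B := \sum_(i <- u) _; suff -> : A = B by [].
apply: eq_bigr => l _.
have cD : l^* + z^* = (l + z)^* by rewrite rmorphD.
case: ifP => /asboolP; rewrite ?inE /=.
  move=> [lL lz]; rewrite ifT.
    rewrite cD; have -> : ((l + z) ^- n * norm_cpow (l + z) (- s^*))^* =
       ((l + z) ^- n)^* * (norm_cpow (l + z) (- s^*))^* by exact: rmorphM.
    rewrite -norm_cpow_conj; have -> : (- s^*)^* = - s by rewrite rmorphN /= conjcK.
    by congr (_ * _); rewrite fmorphV rmorphXn.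
  by rewrite inE /=; split; [exists l|rewrite cD fmorph_eq0].
move=> N; rewrite ifF; first exact: (@conjc0 R).
apply/negP; rewrite inE /= => -[[l' l'L /ih E]].
by rewrite cD fmorph_eq0 => lz; apply: N; rewrite -E in lz *.
Qed.

Lemma E_conj (L : set R[i]) n z : E_ n [set l^* | l in L] z^* = (E_ n L z)^*.
Proof.
apply: (@E_transport _ _ _ _ _ (fun x => x^*)); first exact: conjc0.
  move=> F HF; eexists; first exact: conj_continuation HF.
  by congr (F _)^*; exact: conjc0.
move=> F' /conj_continuation; rewrite conjcK.
have -> : [set l^* | l in [set l^* | l in L]] = L.
  apply/seteqP; split=> [_ [_ [l lL <-] <-]|l lL]; first by rewrite conjcK.
  by exists l^*; [exists l|rewrite conjcK].
by move=> H; eexists; exact: H.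
Qed.

Section Scaled.
Variables (tau w : R[i]).
Hypotheses (red : reduced tau) (w0 : w != 0).
Local Notation L := [set w * x | x in L0 tau].

Lemma multiplier_scale : multiplier_ring L = [set m | mult tau m].
Proof.
apply/seteqP; split=> m /= H.
  move=> z zL; have [|x xL E] := H (w * z); first by exists z.
  by rewrite (_ : m * z = x) //; apply: (mulfI w0); rewrite E; ring.
by move=> _ [z zL <-]; exists (m * z); [exact: H|ring].
Qed.

(** The coset of [mu] corresponds to the torsion point [mu / (k w)]. The representative chosen by
    [xget] differs from it by a lattice vector, which periodicity absorbs; each factor E_1
    contributes [w^-1]. *)
Lemma dedekind_sum_scale h k T : k != 0 -> mult tau h -> mult tau k -> reps tau (tors tau k) T ->
  dedekind_sum L h k = w^-1 ^+ 2 * k^-1 * dsum tau h T.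
Proof.
move=> k0 mh mk rT.
pose psi t := coset L k (k * (w * t)).
have tL t : t \in T -> L (k * (w * t)).
  by move=> /(reps_sub rT) kt; exists (k * t) => //; ring.
have cosE t t' : psi t = psi t' -> L0 tau (t - t').
  move=> E; have : psi t (k * (w * t)) by exists 0; [exists 0; rewrite ?mulr0 //; exact: L0_0|ring].
  rewrite E => -[_ [x xL <-] H]; apply: L0_subC.
  rewrite (_ : t' - t = - x); first exact: L0N.
  apply: (mulfI w0); apply: (mulfI k0); rewrite mulrBr mulrBr -H; ring.
have ipsi : {in T &, injective psi}.
  by move=> t t' tT tT' /cosE; exact: reps_inj rT _ _ tT tT'.
have uT : uniq (map psi T) by rewrite map_inj_in_uniq //; exact: reps_uniq rT.
have setE : [set coset L k mu | mu in L] = [set` map psi T].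
  apply/seteqP; split=> [_ [_ [x xL <-] <-]|X /= /mapP[t tT ->]]; last by exists (k * (w * t)) => //; exact: tL.
  have [|t tT xt] := reps_surj rT (z := x / k).
    by rewrite /tors mulrC mulfVK.
  have xE : w * x = k * (w * t) + k * (w * (x / k - t)) by field.
  apply/mapP; exists t => //; apply/seteqP; split=> _ [_ [y yL <-] <-].
    rewrite xE -addrA -mulrDr -mulrDr; exists (w * (x / k - t + y)) => //.
    by exists (x / k - t + y) => //; exact: L0D.
  have -> : k * (w * t) + k * (w * y) = w * x + k * (w * (y - (x / k - t))) by rewrite xE; ring.
  exists (w * (y - (x / k - t))) => //; exists (y - (x / k - t)) => //; exact: L0B.
rewrite /dedekind_sum setE -fsbig_seq // big_map /dsum.
rewrite -mulrA [RHS]mulrCA; congr (_ * _); rewrite mulr_sumr big_seq [RHS]big_seq.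
apply: eq_bigr => t tT.
have [x xL xE] : exists2 x, L0 tau x & xget 0 (psi t) = k * (w * (t + x)).
  case: xgetP => [_ -> [_ [x xL <-] <-]|/(_ (k * (w * t)))]; first by exists x => //; ring.
  by case; exists 0; [exists 0; rewrite ?mulr0 //; exact: L0_0|ring].
rewrite xE.
have -> : h * (k * (w * (t + x))) / k = w * (h * t + h * x) by field.
have -> : k * (w * (t + x)) / k = w * (t + x) by field.
rewrite (E_scale _ _ _ w0) (E_scale _ _ _ w0) (E1D red t xL) (E1D red (h * t) (mh x xL)).
by set a := E_ 1 _ (h * t); set b := E_ 1 _ t; ring.
Qed.

(** [E_2(0)] and the Dedekind sum both scale by [w^-2], so the normalized sum sees only the reduced
    lattice. *)
Lemma normalized_scale h k T : k != 0 -> mult tau h -> mult tau k -> reps tau (tors tau k) T ->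
  normalized_dedekind_sum L h k =
  dsum tau h T / (k * ('i * sqrtC `|(lattice_disc L)%:~R| * ca tau 0)).
Proof.
move=> k0 mh mk rT; rewrite /normalized_dedekind_sum (dedekind_sum_scale k0 mh mk rT).
have -> : E_ 2 L 0 = w^-1 ^+ 2 * ca tau 0.
  by have := E_scale (L0 tau) 2 0 w0; rewrite mulr0 => ->; rewrite E2_formula.
set S := dsum _ _ _; set c := 'i * _; set d := ca tau 0.
have -> : (c * (w^-1 ^+ 2 * d))^-1 = w ^+ 2 * (c * d)^-1.
  by rewrite !invfM !invrK; ring.
rewrite (invfM k); set e := (c * d)^-1; field; by rewrite w0 k0.
Qed.

End Scaled.

End Transport.

(** * Numerical estimates for the series in the expansion of E_2 *)

Section LambertEstimates.
Variable R : realType.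
Implicit Types (q w z : R[i]) (rho r t x : R).

(** The Koebe function; [lambert q] is the power series whose coefficients are the divisor sums
    sigma_1(n). *)
Definition koebe w : R[i] := w / (1 - w) ^+ 2.
Definition lambert q := csum (fun n : nat => koebe (q ^+ n.+1)).

Lemma koebe_diff w w' : 1 - w != 0 -> 1 - w' != 0 ->
  koebe w - koebe w' = (w - w') * ((1 - w * w') / ((1 - w) ^+ 2 * (1 - w') ^+ 2)).
Proof. by move=> h h'; rewrite /koebe; field; rewrite h h'. Qed.

Lemma one_sub_lower w rho : nrm w <= rho -> 1 - rho <= nrm (1 - w).
Proof. by move=> h; have := nrmB_ge 1 w; rewrite nrm1; lra. Qed.

(** The factor between [koebe w - koebe w'] and [w - w']. Its upper bound controls the tail of
    [lambert], its lower bound expresses injectivity of [koebe]. *)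
Lemma koebe_factor w w' rho : rho <= 40^-1 -> nrm w <= rho -> nrm w' <= rho ->
  [/\ 1 - w != 0, 1 - w' != 0, nrm ((1 - w * w') / ((1 - w) ^+ 2 * (1 - w') ^+ 2)) <= 2 &
   85 / 100 <= nrm ((1 - w * w') / ((1 - w) ^+ 2 * (1 - w') ^+ 2))].
Proof.
move=> r1 h h'; have r0 : 0 <= rho by apply: le_trans h; exact: nrm_ge0.
have l := one_sub_lower h; have l' := one_sub_lower h'.
have a0 : 0 < nrm (1 - w) by lra. have b0 : 0 < nrm (1 - w') by lra.
have u : nrm (1 - w) <= 41 / 40 by have := nrmB 1 w; rewrite nrm1; lra.
have u' : nrm (1 - w') <= 41 / 40 by have := nrmB 1 w'; rewrite nrm1; lra.
have p : nrm (w * w') <= 1600^-1.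
  rewrite nrmM; apply: le_trans (ler_pM (nrm_ge0 _) (nrm_ge0 _) (le_trans h r1) (le_trans h' r1)) _; lra.
have n1 : nrm (1 - w * w') <= 1 + 1600^-1 by have := nrmB 1 (w * w'); rewrite nrm1; lra.
have n2 : 1 - 1600^-1 <= nrm (1 - w * w') by have := nrmB_ge 1 (w * w'); rewrite nrm1; lra.
have d1 : 39 / 40 <= nrm (1 - w) by lra.
have d2 : 39 / 40 <= nrm (1 - w') by lra.
split; rewrite -?nrm_gt0 //.
  rewrite nrmM nrmV nrmM !nrmX ler_pdivrMr ?mulr_gt0 ?exprn_gt0 //.
  have e1 : (39 / 40) ^+ 2 <= nrm (1 - w) ^+ 2 by rewrite ler_pXn2r ?nnegrE //; lra.
  have e2 : (39 / 40) ^+ 2 <= nrm (1 - w') ^+ 2 by rewrite ler_pXn2r ?nnegrE //; lra.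
  have := ler_pM (sqr_ge0 _) (sqr_ge0 _) e1 e2; rewrite !expr2; lra.
rewrite nrmM nrmV nrmM !nrmX ler_pdivlMr ?mulr_gt0 ?exprn_gt0 //.
have e1 : nrm (1 - w) ^+ 2 <= (41 / 40) ^+ 2 by rewrite ler_pXn2r ?nnegrE //; lra.
have e2 : nrm (1 - w') ^+ 2 <= (41 / 40) ^+ 2 by rewrite ler_pXn2r ?nnegrE //; lra.
have := ler_pM (sqr_ge0 _) (sqr_ge0 _) e1 e2; rewrite !expr2; lra.
Qed.

Lemma koebe_lip w w' rho : rho <= 40^-1 -> nrm w <= rho -> nrm w' <= rho ->
  nrm (koebe w - koebe w') <= 2 * nrm (w - w').
Proof.
move=> r1 h h'; have [a b u _] := koebe_factor r1 h h'.
by rewrite koebe_diff // nrmM mulrC ler_wpM2r ?nrm_ge0.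
Qed.

Lemma pow_diff q q' rho n : 0 <= rho -> nrm q <= rho -> nrm q' <= rho ->
  nrm (q ^+ n.+1 - q' ^+ n.+1) <= (2 * rho) ^+ n * nrm (q - q').
Proof.
move=> r0 h h'; elim: n => [|n IH]; first by rewrite !expr1 expr0 mul1r.
rewrite (_ : q ^+ n.+2 - q' ^+ n.+2 = q * (q ^+ n.+1 - q' ^+ n.+1) + (q - q') * q' ^+ n.+1); last first.
  by rewrite !(exprS _ n.+1); ring.
apply: le_trans (nrmD _ _) _; rewrite !nrmM nrmX.
have d0 := nrm_ge0 (q - q').
have h1 : nrm q * nrm (q ^+ n.+1 - q' ^+ n.+1) <= rho * ((2 * rho) ^+ n * nrm (q - q')).
  by rewrite ler_pM ?nrm_ge0.
have h2 : nrm (q - q') * nrm q' ^+ n.+1 <= nrm (q - q') * (rho * (2 * rho) ^+ n).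
  rewrite ler_wpM2l // exprS ler_pM ?nrm_ge0 ?exprn_ge0 ?nrm_ge0 //.
  rewrite lerXn2r ?nnegrE ?nrm_ge0 //; lra.
move: h1 h2; rewrite (exprS (2 * rho)); set T := (2 * rho) ^+ n; lra.
Qed.

Lemma pow_le_small q rho n : rho <= 40^-1 -> nrm q <= rho -> nrm (q ^+ n.+1) <= rho.
Proof.
move=> r1 h; have q0 := nrm_ge0 q; rewrite nrmX exprS; apply: (le_trans _ h).
by rewrite ler_piMr // exprn_ile1 //; lra.
Qed.

Lemma koebe0 : koebe 0 = 0. Proof. by rewrite /koebe mul0r. Qed.

Lemma absm_lambert q rho : rho <= 40^-1 -> nrm q <= rho -> absm (fun n : nat => koebe (q ^+ n.+1)).
Proof.
move=> r1 h; have q0 := nrm_ge0 q; have r0 : 0 <= rho by lra.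
have r2 : 0 <= 2 * rho by lra. have r3 : 2 * rho < 1 by lra.
apply: absm_le (absmZ (2 * nrm q)%:C (absm_geo r2 r3)) => n.
have z0 : nrm (0 : R[i]) <= rho by rewrite nrm0.
have := koebe_lip r1 (pow_le_small n r1 h) z0; rewrite koebe0 !subr0 => /le_trans; apply.
have := pow_diff n r0 h z0; rewrite expr0n /= !subr0 => h2.
rewrite -rmorphM nrm_real ger0_norm; last by rewrite !mulr_ge0 // exprn_ge0.
by rewrite -mulrA ler_wpM2l // mulrC.
Qed.

(** The terms after the first vary by a small multiple of [q - q'], so [lambert] inherits
    injectivity and monotonicity from [koebe]. *)
Lemma lambert_diff q q' rho : rho <= 40^-1 -> nrm q <= rho -> nrm q' <= rho ->
  nrm (lambert q - lambert q' - (koebe q - koebe q')) <= 5 * rho * nrm (q - q').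
Proof.
move=> r1 h h'; have r0 : 0 <= rho by apply: le_trans h; exact: nrm_ge0.
have r2 : 0 <= 2 * rho by lra. have r3 : 2 * rho < 1 by lra.
have a := absm_lambert r1 h; have a' := absm_lambert r1 h'.
rewrite /lambert -csumB //; have ad := absmB a a'.
rewrite (@csum_split _ _ [:: 0%N] _ ad) // big_seq1 !expr1 addrC addKr.
rewrite -(@csum_reindex _ _ _ (restr _ _) S); last first.
- by move=> [|n] k; [rewrite /restr inE|have := k n].
- by move=> k n [].
have d0 := nrm_ge0 (q - q').
apply: (@le_trans _ _ ((4 * rho * nrm (q - q')) * (1 - 2 * rho)^-1)); last first.
  rewrite ler_pdivrMr; last lra.
  have : 0 <= rho * nrm (q - q') * (1 - 10 * rho) by rewrite !mulr_ge0 //; lra.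
  lra.
have gb := absb_geo r2 r3; apply: csum_nrm_le => s us.
apply: (@le_trans _ _ (\sum_(i <- s) 4 * rho * nrm (q - q') * nrm ((2 * rho) ^+ i)%:C)).
  apply: ler_sum => n _; rewrite /restr /=.
  apply: le_trans (koebe_lip r1 (pow_le_small _ r1 h) (pow_le_small _ r1 h')) _.
  rewrite nrm_real ger0_norm ?exprn_ge0 //.
  have := pow_diff n.+1 r0 h h'; rewrite (exprS (2 * rho)); set T := (2 * rho) ^+ n; lra.
rewrite -mulr_sumr ler_wpM2l ?mulr_ge0 //; exact: gb.
Qed.

Lemma lambert0 : lambert 0 = 0.
Proof.
rewrite /lambert (@csum_ext _ _ _ (fun=> 0)) ?(csum_eq (@hs0 _ _)) // => n.
by rewrite expr0n /koebe mul0r.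
Qed.

Lemma koebe_real x : koebe x%:C = (x / (1 - x) ^+ 2)%:C.
Proof. by rewrite /koebe -[1]/(1%:C) -rmorphB -rmorphXn -fmorphV -rmorphM. Qed.

Lemma lambert_real_diff x y rho : rho <= 40^-1 -> `|x| <= rho -> `|y| <= rho ->
  `|complex.Re (lambert x%:C) - complex.Re (lambert y%:C) - (x / (1 - x) ^+ 2 - y / (1 - y) ^+ 2)|
  <= 5 * rho * `|x - y|.
Proof.
move=> r1 hx hy.
have := @lambert_diff x%:C y%:C rho r1; rewrite !nrm_real => /(_ hx hy).
rewrite -rmorphB nrm_real; apply: le_trans.
apply: le_trans (Re_le_nrm _); rewrite !koebe_real !ReD !ReN !ReD !ReN /=.
by rewrite le_eqVlt eqxx.
Qed.

Lemma expR_pow128 x : 0 <= x -> (1 + x / 128) ^+ 128 <= expR x.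
Proof.
move=> x0; have -> : expR x = expR (x / 128) ^+ 128 by rewrite -expRM_natl; congr expR; field.
rewrite lerXn2r ?nnegrE ?expR_ge0 ?expR_ge1Dx //; lra.
Qed.

Lemma square_chain (a b : R) n : 0 <= a -> 0 <= b -> b <= a * a -> forall c, (c <= b ^+ n -> c <= a ^+ (2 * n)).
Proof.
move=> a0 b0 ab c cb; apply: le_trans cb _; rewrite exprM lerXn2r ?nnegrE ?sqr_ge0 //.
Qed.

Lemma expR4_ge : 40 <= expR (4 : R).
Proof.
apply: le_trans (expR_pow128 _); last lra.
(* [1063 / 1000] is [(1 + 4 / 128)^2] rounded down, which keeps the rational power small. *)
apply: (@square_chain _ (1063 / 1000) 64); try lra.
Qed.

Lemma expR519_ge : 160 <= expR (519 / 100 : R).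
Proof.
apply: le_trans (expR_pow128 _); last lra.
(* [10826 / 10000] is [(1 + 5.19 / 128)^2] rounded down. *)
apply: (@square_chain _ (10826 / 10000) 64); try lra.
Qed.

End LambertEstimates.

(** * Zeros of E_2 at i and rho6, and bounds on pi *)

Section E2Nonvanishing.
Variable R : realType.
Implicit Types (tau q : R[i]) (t x : R).

Lemma tpi_sqr : tpi R ^+ 2 = (- (4 * pi ^+ 2))%:C.
Proof. by rewrite /tpi; cring. Qed.

Lemma s2_lambert tau : reduced tau ->
  ca tau 0 = (pi ^+ 2 / 3 - pi / complex.Im tau)%:C - (8 * pi ^+ 2)%:C * lambert (qe tau).
Proof.
move=> red; have [c0E _] := zeta_lamb red; have := quasi_period_series red.
have -> : useries tau (@cscT R) 0 = tpi R ^+ 2 * lambert (qe tau).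
  have [_ a _] := U_cdiff red (above0 red).
  have E n : cscT (trow tau n 0) = tpi R ^+ 2 * koebe (qe tau ^+ n.+1).
    by rewrite /cscT /koebe /trow add0r qeM; congr (_ * (_ / _)); ring.
  have t0 : tpi R ^+ 2 != 0 by rewrite expf_neq0 // tpi_neq0.
  transitivity (csum (fun n : nat => tpi R ^+ 2 * koebe (qe tau ^+ n.+1))); first exact: csum_ext E.
  rewrite csumZ //.
  by apply: absm_ext (absmZ (tpi R ^+ 2)^-1 a) => n; rewrite E mulKf.
rewrite c0E tpi_sqr => E.
have -> : ca tau 0 = (ca tau 0 + (pi / complex.Im tau)%:C) - (pi / complex.Im tau)%:C by ring.
rewrite E !rmorphB !rmorphM /= !rmorphN /= !rmorphM /= !fmorphV !rmorph_nat /=.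
by field; rewrite eq_complex /= eqxx andbT gt_eqF //; have [] := red.
Qed.

Lemma Re_s2 tau : reduced tau -> complex.Re (ca tau 0) =
  pi ^+ 2 / 3 - pi / complex.Im tau - 8 * pi ^+ 2 * complex.Re (lambert (qe tau)).
Proof. by move=> /s2_lambert ->; rewrite ReD ReN cReM /=; ring. Qed.

(** E_2 has weight 2, so a symmetry [u] of the lattice multiplies it by [u^-2], which differs from
    1. *)
Lemma ca_symmetric tau u : reduced tau -> u != 0 -> u ^+ 2 != 1 ->
  [set u * x | x in L0 tau] = L0 tau -> ca tau 0 = 0.
Proof.
move=> red u0 u2 uL; rewrite -(E2_formula red).
have := E_scale (L0 tau) 2 0 u0; rewrite uL mulr0 => E; apply/eqP.
have : (1 - u^-1 ^+ 2) * E_ 2 (L0 tau) 0 = 0 by rewrite mulrBl mul1r -E subrr.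
move/eqP; rewrite mulf_eq0 => /orP[|//]; rewrite subr_eq0 eq_sym exprVn invr_eq1.
by rewrite (negbTE u2).
Qed.

Lemma mul_lat_set tau u u' : u * u' = 1 -> (forall z, L0 tau z -> L0 tau (u * z)) ->
  (forall z, L0 tau z -> L0 tau (u' * z)) -> [set u * x | x in L0 tau] = L0 tau.
Proof.
move=> uu H H'; apply/seteqP; split=> [_ [x xL <-]|x xL]; first exact: H.
by exists (u' * x); [exact: H'|rewrite mulrA uu mul1r].
Qed.

(** The sixth root of unity with positive imaginary part, the right-hand corner of the fundamental
    domain. *)
Definition rho6 : R[i] := 2^-1 +i* (Num.sqrt 3 / 2).

Lemma sqrt3_sqr : Num.sqrt 3 * Num.sqrt 3 = 3 :> R.
Proof. by rewrite -expr2 sqr_sqrtr. Qed.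

Lemma rho6_sqr : rho6 * rho6 = rho6 - 1.
Proof. by apply/eqP; rewrite eq_complex /=; have := sqrt3_sqr => s; apply/andP; split; apply/eqP; lra. Qed.

Lemma sqrt3_bounds : 173 / 100 <= Num.sqrt 3 :> R /\ Num.sqrt 3 <= 17322 / 10000 :> R.
Proof.
have s := sqrt3_sqr; have s0 : 0 <= Num.sqrt 3 :> R by exact: sqrtr_ge0.
split; rewrite leNgt; apply/negP => c.
  by have := ltr_pM s0 s0 c c; rewrite s; lra.
have c0 : 0 <= 17322 / 10000 :> R by lra.
by have := ltr_pM c0 c0 c c; rewrite s; lra.
Qed.

Definition iu : R[i] := 0 +i* 1.

Lemma iu_sqr : iu * iu = -1. Proof. by rewrite /iu; cring. Qed.

Lemma nrm_iu : nrm iu = 1.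
Proof.
have : nrm iu ^+ 2 = 1 by rewrite nrm_sqr /= expr0n add0r expr1n.
by move/eqP; rewrite sqrf_eq1 => /orP[/eqP->//|/eqP h]; have := nrm_ge0 iu; lra.
Qed.

Lemma reduced_i : reduced iu.
Proof. by split; rewrite ?nrm_iu /= ?normr0 //; lra. Qed.

Lemma reduced_rho6 : reduced rho6.
Proof.
have [b1 b2] := sqrt3_bounds; split=> /=; [lra| |by rewrite ger0_norm].
have : nrm rho6 ^+ 2 = 1 by rewrite nrm_sqr /=; have := sqrt3_sqr => s; rewrite !expr2; lra.
by move/eqP; rewrite sqrf_eq1 => /orP[/eqP->//|/eqP h]; have := nrm_ge0 rho6; lra.
Qed.

Lemma ca_i : ca iu 0 = 0.
Proof.
apply: (@ca_symmetric _ iu reduced_i); first by rewrite -nrm_gt0 nrm_iu.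
  by rewrite expr2 iu_sqr eq_complex /= negb_and; apply/orP; left; apply/eqP; lra.
have H (z : R[i]) : L0 iu z -> L0 iu (iu * z).
  move=> [[m n] _ <-]; exists (n, - m) => //; rewrite /lat /= rmorphN /=.
  have -> : iu * (m%:~R * iu + n%:~R) = m%:~R * (iu * iu) + n%:~R * iu by ring.
  by rewrite iu_sqr; ring.
apply: (@mul_lat_set _ iu (- iu)) => //; first by rewrite mulrN iu_sqr opprK.
by move=> z /H /L0N; rewrite mulNr.
Qed.

Lemma ca_rho6 : ca rho6 0 = 0.
Proof.
have [b1 b2] := sqrt3_bounds.
have r0 : rho6 != 0 by rewrite eq_complex /= negb_and; apply/orP; left; apply/eqP; lra.
apply: (@ca_symmetric _ rho6 reduced_rho6) => //.
  rewrite expr2 rho6_sqr eq_complex /= negb_and; apply/orP; left; apply/eqP; lra.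
have H (z : R[i]) : L0 rho6 z -> L0 rho6 (rho6 * z).
  move=> [[m n] _ <-]; exists (m + n, - m) => //.
  rewrite /lat /= rmorphD rmorphN /=.
  have -> : rho6 * (m%:~R * rho6 + n%:~R) = m%:~R * (rho6 * rho6) + n%:~R * rho6 by ring.
  by rewrite rho6_sqr; ring.
apply: (@mul_lat_set _ rho6 (1 - rho6)) => //.
  by rewrite mulrBr mulr1 rho6_sqr; ring.
by move=> z zL; rewrite mulrBl mul1r; apply: L0B => //; exact: H.
Qed.

Lemma qe_half : qe (2^-1 : R[i]) = -1.
Proof.
have h2 : (2^-1 : R)%:C = 2^-1 :> R[i] by rewrite fmorphV rmorph_nat.
have h3 : 2 * pi * 2^-1 = pi :> R by field.
by rewrite -h2 qe_real h3 cospi sinpi; apply/eqP; rewrite eq_complex /= oppr0 !eqxx.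
Qed.

Lemma qe_im t : qe ('i * t%:C) = (expR (- (2 * pi * t)))%:C :> R[i].
Proof. by rewrite -expC_real /qe; congr expC; rewrite /tpi; cring. Qed.

Lemma lambert_q tau : complex.Re tau = 0 -> qe tau = (expR (- (2 * pi * complex.Im tau)))%:C.
Proof. by move=> h; rewrite -qe_im; congr qe; rewrite [LHS]complex_ReIm h add0r. Qed.

Lemma lambert_q_half tau : `|complex.Re tau| = 2^-1 ->
  qe tau = (- expR (- (2 * pi * complex.Im tau)))%:C.
Proof.
move=> h; rewrite rmorphN /= -qe_im [in LHS](complex_ReIm tau) qeD.
rewrite -mulN1r; congr (_ * _).
have h2 : (2^-1 : R)%:C = 2^-1 :> R[i] by rewrite fmorphV rmorph_nat.
move: h; case: (leP 0 (complex.Re tau)) => c; first by rewrite ger0_norm // => ->; rewrite h2 qe_half.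
rewrite ltr0_norm // => /eqP; rewrite eqr_oppLR => /eqP ->.
by rewrite rmorphN /= h2 qeN qe_half invrN invr1.
Qed.

(* E_2 vanishes at tau = i, and its q-expansion there turns this into bounds on pi. *)
Lemma pi_i : exists2 x : R, 0 < x & x = expR (- (2 * pi)) /\
  pi = 3 + 24 * (pi * complex.Re (lambert x%:C)) :> R.
Proof.
exists (expR (- (2 * pi))); first exact: expR_gt0.
split=> //; have := Re_s2 reduced_i; rewrite ca_i lambert_q //= mulr1 divr1.
have p0 := pi_gt0 R; set S := complex.Re _ => E.
have E2 : pi * (pi / 3 - 1 - 8 * pi * S) = 0 by rewrite [RHS]E; ring.
move/eqP: E2; rewrite mulf_eq0 gt_eqF //= => /eqP; lra.
Qed.

(** A bootstrap on [pi_i]: from [pi_ge2] one gets [x <= 1/40], so the series is positive and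
    [pi > 3]; this improves the bound to [x <= 1/160], and then the series is small enough for the
    upper bound. *)
Lemma pi_bounds : 3 < pi :> R /\ pi <= 363 / 100 :> R.
Proof.
have p2 := pi_ge2 R; have [x x0 [xE pE]] := pi_i.
have l0 : lambert (0 : R)%:C = 0 by exact: lambert0.
have lo (y rho : R) : 0 < y -> y <= rho -> rho <= 40^-1 ->
    `|complex.Re (lambert y%:C) - y / (1 - y) ^+ 2| <= 5 * rho * y.
  move=> y0 yr r1; have := @lambert_real_diff R y 0 rho r1.
  rewrite (gtr0_norm y0) normr0 => /(_ yr ltac:(lra)).
  by rewrite l0 /= mul0r !subr0 (gtr0_norm y0).
have xb (a : R) : a <= 2 * pi -> x <= (expR a)^-1.
  by move=> h; rewrite xE expRN lef_pV2 ?posrE ?expR_gt0 // ler_expR.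
have x40 : x <= 40^-1.
  apply: le_trans (xb 4 ltac:(lra)) _; rewrite lef_pV2 ?posrE ?expR_gt0 //; exact: expR4_ge.
have sq (y : R) : 0 < y -> y <= 40^-1 -> y <= y / (1 - y) ^+ 2.
  move=> y0 y1; rewrite ler_pdivlMr ?exprn_gt0 //; last lra.
  by rewrite ger_pMr // expr_le1 //; lra.
have p3 : 3 < pi :> R.
  have := lo x 40^-1 x0 x40 (lexx _); rewrite ler_norml => /andP[h _].
  have := sq x x0 x40 => h2.
  have S0 : 0 < complex.Re (lambert x%:C) by lra.
  have : 0 < pi * complex.Re (lambert x%:C) by rewrite mulr_gt0 // pi_gt0.
  by move: pE; set A := pi * _; lra.
split=> //.
have x160 : x <= 160^-1.
  apply: le_trans (xb (519 / 100) ltac:(lra)) _; rewrite lef_pV2 ?posrE ?expR_gt0 //; exact: expR519_ge.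
have := lo x 160^-1 x0 x160 ltac:(lra); rewrite ler_norml => /andP[_ h].
have h2 : x / (1 - x) ^+ 2 <= 102 / 100 * x.
  rewrite ler_pdivrMr ?exprn_gt0 //; last lra.
  rewrite mulrAC ler_peMl ?(ltW x0) //.
  have : (159 / 160) ^+ 2 <= (1 - x) ^+ 2 by rewrite lerXn2r ?nnegrE //; lra.
  by rewrite !expr2; lra.
have S1 : complex.Re (lambert x%:C) <= 66 / 10000 by lra.
have : pi * complex.Re (lambert x%:C) <= pi * (66 / 10000) by rewrite ler_wpM2l //; lra.
lra.
Qed.

(** [173 / 200] lies just below [sqrt 3 / 2], the least height in the fundamental domain, and
    [519 / 100] is [2 * 3 * (173 / 200)]. *)
Lemma expq_le t : 173 / 200 <= t -> expR (- (2 * pi * t)) <= 160^-1 :> R.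
Proof.
move=> h; have [p3 _] := pi_bounds; rewrite expRN lef_pV2 ?posrE ?expR_gt0 //.
apply: le_trans (expR519_ge R) _; rewrite ler_expR.
have : 3 * (173 / 200) <= pi * t by rewrite ler_pM //; lra.
lra.
Qed.

End E2Nonvanishing.

(** * E_2 on the boundary and on the symmetry axis of the fundamental domain *)

Section E2NonvanishingCases.
Variable R : realType.
Implicit Types (tau q : R[i]) (t x : R).
Local Notation rho6 := (rho6 R).
Local Notation iu := (iu R).

Lemma koebe_incr (q q0 : R) : 0 < q -> q <= q0 -> q0 <= 160^-1 ->
  q / (1 - q) ^+ 2 - q0 / (1 - q0) ^+ 2 <= - (q0 - q) * (99 / 100).
Proof.
move=> qp qq b0.
have -> : q / (1 - q) ^+ 2 - q0 / (1 - q0) ^+ 2 = - ((q0 - q) * ((1 - q * q0) / ((1 - q) ^+ 2 * (1 - q0) ^+ 2))).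
  by field; rewrite !subr_eq0 !gt_eqF //; lra.
rewrite mulNr lerN2 ler_wpM2l ?subr_ge0 //.
have d : 0 < (1 - q) ^+ 2 * (1 - q0) ^+ 2 by rewrite mulr_gt0 // exprn_gt0 //; lra.
rewrite ler_pdivlMr //.
have d1 : (1 - q) ^+ 2 * (1 - q0) ^+ 2 <= 1.
  by rewrite mulr_ile1 ?sqr_ge0 // exprn_ile1 //; lra.
have : q * q0 <= 160^-1 * 160^-1 by rewrite ler_pM //; lra.
clear -d1; lra.
Qed.

(** [koebe] increases at a rate of at least 99/100, while the remaining terms vary at a rate of at
    most 5/160. *)
Lemma lambert_incr (q q0 : R) : 0 < q -> q <= q0 -> q0 <= 160^-1 ->
  complex.Re (lambert q%:C) <= complex.Re (lambert q0%:C).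
Proof.
move=> qp qq b0; have q0p : 0 < q0 by apply: lt_le_trans qq.
have k := koebe_incr qp qq b0.
have r1 : (160^-1 : R) <= 40^-1 by lra.
have := @lambert_real_diff R q q0 160^-1 r1.
rewrite (gtr0_norm qp) (gtr0_norm q0p) => /(_ (le_trans qq b0) b0).
rewrite ler_norml ler0_norm; last by rewrite subr_le0.
move=> /andP[_ h].
have aux : forall A A0 B B0 : R, A - A0 - (B - B0) <= 5 / 160 * - (q - q0) ->
    B - B0 <= - (q0 - q) * (99 / 100) -> A <= A0 by clear -qq => A A0 B B0; lra.
exact: aux h k.
Qed.

Lemma lambert_neg_le0 (r : R) : 0 < r -> r <= 160^-1 -> complex.Re (lambert (- r)%:C) <= 0.
Proof.
move=> rp b0; have r1 : (160^-1 : R) <= 40^-1 by lra.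
have := @lambert_real_diff R (- r) 0 160^-1 r1.
rewrite (lambert0 R : lambert (0 : R)%:C = 0) /= mul0r !subr0 !normrN (gtr0_norm rp) normr0.
move=> /(_ b0 ltac:(lra)); rewrite ler_norml => /andP[_].
have k0 : - r / (1 - - r) ^+ 2 <= - r * (98 / 100).
  rewrite !mulNr lerN2 ler_wpM2l ?(ltW rp) //.
  have -> : 98 / 100 = (100 / 98)^-1 :> R by field.
  rewrite lef_pV2 ?posrE ?exprn_gt0 //; [|lra..].
  have : (1 - - r) ^+ 2 <= (161 / 160) ^+ 2 by rewrite lerXn2r ?nnegrE //; lra.
  by clear; rewrite !expr2; lra.
by move: k0; set A := complex.Re _; set B := - r / (1 - - r) ^+ 2; clear -rp; lra.
Qed.

Lemma lambert_neg_diff (r r0 : R) : 0 < r -> r <= r0 -> r0 <= 160^-1 ->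
  complex.Re (lambert (- r)%:C) - complex.Re (lambert (- r0)%:C) <= 33 / 32 * (r0 - r).
Proof.
move=> rp rr b0; have r0p : 0 < r0 by apply: lt_le_trans rr.
have r1 : (160^-1 : R) <= 40^-1 by lra.
have := @lambert_real_diff R (- r) (- r0) 160^-1 r1.
rewrite (_ : - r - - r0 = r0 - r); last by ring.
rewrite !normrN (gtr0_norm rp) (gtr0_norm r0p) => /(_ (le_trans rr b0) b0).
rewrite ler_norml => /andP[_]; rewrite ger0_norm ?subr_ge0 //.
have k1 : - r / (1 - - r) ^+ 2 - - r0 / (1 - - r0) ^+ 2 <= r0 - r.
  have -> : - r / (1 - - r) ^+ 2 - - r0 / (1 - - r0) ^+ 2 = (r0 - r) * ((1 - r * r0) / ((1 + r) ^+ 2 * (1 + r0) ^+ 2)).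
    by field; rewrite !gt_eqF //; lra.
  have g : 1 <= (1 + r) ^+ 2 * (1 + r0) ^+ 2 by rewrite mulr_ege1 // exprn_ege1 //; lra.
  have rr0 : 0 <= r * r0 by rewrite mulr_ge0 // ltW.
  rewrite ler_piMr ?subr_ge0 // ler_pdivrMr ?mul1r; last by apply: lt_le_trans g.
  by clear -g rr0; lra.
have aux : forall A A0 B B0 : R, B - B0 <= r0 - r -> A - A0 - (B - B0) <= 5 / 160 * (r0 - r) ->
    A - A0 <= 33 / 32 * (r0 - r) by clear => A A0 B B0; lra.
exact: aux k1.
Qed.

(** Upwards from the zero at i, [- pi / Im tau] strictly increases and the subtracted series
    decreases, so E_2 becomes positive. *)
Lemma s2_neq0_im tau : reduced tau -> complex.Re tau = 0 -> 1 < complex.Im tau -> ca tau 0 != 0.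
Proof.
move=> red x0 t1; apply/eqP => c0.
have p0 := pi_gt0 R.
have b0 := @expq_le R 1 ltac:(lra).
have x1 : complex.Re iu = 0 by [].
have t01 : complex.Im iu = 1 by [].
have E := Re_s2 red; have E0 := Re_s2 (reduced_i R).
rewrite c0 (lambert_q x0) in E; rewrite ca_i (lambert_q x1) in E0.
move: (complex.Im tau) (complex.Im iu) t1 t01 E E0 => t t0 t1 t01 E E0; clear -p0 t1 t01 E E0 b0.
subst t0; have tp : 0 < t by apply: lt_trans t1.
have q0q : expR (- (2 * pi * t)) <= expR (- (2 * pi * 1)) :> R.
  by rewrite ler_expR lerN2 mulr1 ler_peMr ?(ltW t1) // mulr_ge0 // ltW.
have S := lambert_incr (expR_gt0 _) q0q b0.
have c : pi / t < pi / 1 by rewrite divr1 ltr_pdivrMr // ltr_pMr.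
have s0 : 0 <= 8 * pi ^+ 2 :> R by rewrite mulr_ge0 // sqr_ge0.
have aux : forall X Y Z V W : R, X <= Y -> Z < W -> 0 = V - Z - X -> 0 = V - W - Y -> False.
  by clear => X Y Z V W; lra.
exact: aux (ler_wpM2l s0 S) c E E0.
Qed.

(** The competing term is at most [8 * (41 / 1000) = 0.328] times [t - t0], just below the main term
    [(t - t0) / 3]. This small margin dictates the accuracy of the bounds on pi, [sqrt 3] and
    [r0]. *)
Lemma half_arith (p t t0 r0 A A0 : R) : p <= 363 / 100 -> 3 < p -> 0 < t0 -> t0 <= 8661 / 10000 ->
  0 < r0 -> r0 <= 160^-1 -> t0 < t -> A <= 0 -> A - A0 <= 33 / 32 * (r0 * (2 * p * (t - t0))) ->
  (t - t0) / 3 - 8 * ((t - t0) * A + t0 * (A - A0)) <> 0.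
Proof.
move=> p1 p3 t0p t0u r0p b0 tt A0' AA key.
have dt : 0 < t - t0 by rewrite subr_gt0.
have u1 : (t - t0) * A <= 0 by rewrite mulr_ge0_le0 // ltW.
have u2 : t0 * (A - A0) <= t0 * (33 / 32 * (r0 * (2 * p * (t - t0)))) by rewrite ler_wpM2l // ltW.
have a1 : r0 * p <= 160^-1 * (363 / 100) by rewrite ler_pM //; clear -p1 p3 b0 r0p; lra.
have a2 : t0 * (r0 * p) <= 8661 / 10000 * (160^-1 * (363 / 100)).
  by rewrite ler_pM // ?(ltW t0p) // mulr_ge0 //; clear -p3 r0p; lra.
have u3 : t0 * (33 / 32 * (r0 * (2 * p * (t - t0)))) <= 41 / 1000 * (t - t0).
  have -> : t0 * (33 / 32 * (r0 * (2 * p * (t - t0)))) = (33 / 16) * (t0 * (r0 * p)) * (t - t0) by field.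
  rewrite ler_pM2r //; clear -a2; lra.
have aux : forall X Y Z W : R, W / 3 - 8 * (Z + X) = 0 -> Z <= 0 -> X <= Y -> Y <= 41 / 1000 * W -> 0 < W -> False.
  by clear => X Y Z W; lra.
exact: aux key u1 u2 u3 dt.
Qed.

Lemma expR_lin (c t t0 : R) :
  expR (- (c * t0)) - expR (- (c * t)) <= expR (- (c * t0)) * (c * (t - t0)).
Proof.
have -> : expR (- (c * t)) = expR (- (c * t0)) * expR (- (c * (t - t0))).
  by rewrite -expRD; congr expR; ring.
have := ler_wpM2l (expR_ge0 (- (c * t0))) (expR_ge1Dx (- (c * (t - t0)))).
move: (expR _) (expR _) => X Y; lra.
Qed.

(** Here q is negative and the two variations compete. Multiplying each formula for E_2 by the
    height and subtracting removes the terms [pi / t] and leaves [pi^2] times the expression of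
    [half_arith]. *)
Lemma s2_neq0_half_of tau tau0 : reduced tau -> reduced tau0 -> `|complex.Re tau| = 2^-1 ->
  `|complex.Re tau0| = 2^-1 -> ca tau0 0 = 0 -> 173 / 200 <= complex.Im tau0 ->
  complex.Im tau0 <= 8661 / 10000 -> complex.Im tau0 < complex.Im tau -> ca tau 0 != 0.
Proof.
move=> red red0 xh xh0 c0' t0l t0u t1; apply/eqP => c0.
have [p3 p4] := pi_bounds R.
have E := Re_s2 red; have E0 := Re_s2 red0.
rewrite c0 (lambert_q_half xh) in E; rewrite c0' (lambert_q_half xh0) in E0.
have b0 := expq_le t0l.
move: (complex.Im tau) (complex.Im tau0) t0l t0u t1 b0 E E0 => t t0 t0l t0u t1 b0 E E0.
have t0p : 0 < t0 by clear -t0l; lra.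
have tp : 0 < t by apply: lt_trans t1.
have p0 := pi_gt0 R.
have rr : expR (- (2 * pi * t)) <= expR (- (2 * pi * t0)) :> R.
  by rewrite ler_expR lerN2 ler_pM2l ?(ltW t1) // mulr_gt0.
have rp : 0 < expR (- (2 * pi * t)) :> R by exact: expR_gt0.
have r0p : 0 < expR (- (2 * pi * t0)) :> R by exact: expR_gt0.
have dr := expR_lin (2 * pi) t t0.
have An := lambert_neg_le0 rp (le_trans rr b0).
have AA := lambert_neg_diff rp rr b0.
have h33 : 0 <= 33 / 32 :> R by clear; lra.
have AA' := le_trans AA (ler_wpM2l h33 dr).
have aux : forall A A0 r0 : R, 0 = pi ^+ 2 / 3 - pi / t - 8 * pi ^+ 2 * A ->
   0 = pi ^+ 2 / 3 - pi / t0 - 8 * pi ^+ 2 * A0 -> 0 < r0 -> r0 <= 160^-1 -> A <= 0 ->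
   A - A0 <= 33 / 32 * (r0 * (2 * pi * (t - t0))) -> False; last exact: aux E E0 r0p b0 An AA'.
clear -t1 t0u t0p tp p0 p3 p4; move=> A A0 r0 E E0 r0p b0 An AA'.
apply: (half_arith p4 p3 t0p t0u r0p b0 t1 An AA').
have tE : t * (pi ^+ 2 / 3) - pi - 8 * pi ^+ 2 * t * A = 0.
  have : t * (pi ^+ 2 / 3 - pi / t - 8 * pi ^+ 2 * A) = 0 by rewrite -E mulr0.
  by move=> <-; field; rewrite gt_eqF.
have tE0 : t0 * (pi ^+ 2 / 3) - pi - 8 * pi ^+ 2 * t0 * A0 = 0.
  have : t0 * (pi ^+ 2 / 3 - pi / t0 - 8 * pi ^+ 2 * A0) = 0 by rewrite -E0 mulr0.
  by move=> <-; field; rewrite gt_eqF.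
have key : pi ^+ 2 * ((t - t0) / 3 - 8 * ((t - t0) * A + t0 * (A - A0))) = 0.
  rewrite (_ : pi ^+ 2 * _ = (t * (pi ^+ 2 / 3) - pi - 8 * pi ^+ 2 * t * A) -
     (t0 * (pi ^+ 2 / 3) - pi - 8 * pi ^+ 2 * t0 * A0)); last by ring.
  by rewrite tE tE0 subrr.
by move/eqP: key; rewrite mulf_eq0 expf_eq0 /= (gt_eqF p0) /= => /eqP.
Qed.

Lemma s2_neq0_half tau : reduced tau -> `|complex.Re tau| = 2^-1 -> Num.sqrt 3 / 2 < complex.Im tau ->
  ca tau 0 != 0.
Proof.
move=> red xh t1; have [b1 b2] := sqrt3_bounds R.
have h1 : `|complex.Re rho6| = 2^-1 by rewrite /= ger0_norm // invr_ge0.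
have h2 : 173 / 200 <= complex.Im rho6 by rewrite [leRHS]/=; clear -b1; lra.
have h3 : complex.Im rho6 <= 8661 / 10000 by rewrite [leLHS]/=; clear -b2; lra.
exact: (s2_neq0_half_of red (reduced_rho6 R) xh h1 (ca_rho6 R) h2 h3 t1).
Qed.

(** If E_2 vanished at tau, it would vanish at the mirror point [- tau^*] of the same height, so
    both would have the same [lambert] value. Near-injectivity makes their q equal, and then
    [2 * Re tau] is an integer. *)
Lemma s2_neq0_circle tau : reduced tau -> nrm tau = 1 -> complex.Re tau != 0 ->
  `|complex.Re tau| < 2^-1 -> ca tau 0 != 0.
Proof.
move=> red n1 x0 xh; apply/eqP => c0.
have [i0 _ _] := red.
have red' : reduced (- tau^*).
  have [h1 h2 h3] := red; split.
  - by rewrite ImN; case: (tau) h1 => a b /=; rewrite opprK.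
  - by rewrite nrmN nrm_conj.
  - by rewrite ReN normrN; case: (tau) h3.
have LE : L0 (- tau^*) = [set l^* | l in L0 tau].
  have cint (m : int) : (m%:~R : R[i])^* = m%:~R by exact: rmorph_int.
  have lc p : (lat tau p)^* = p.1%:~R * tau^* + p.2%:~R.
    by rewrite rmorphD rmorphM /= !cint.
  apply/seteqP; split=> [_ [p _ <-]|_ [_ [p _ <-] <-]].
    exists (lat tau (- p.1, p.2)); first exact: L0lat.
    by rewrite lc /lat /= rmorphN /=; ring.
  exists (- p.1, p.2) => //; rewrite lc /lat /= rmorphN /=; ring.
have c0' : ca (- tau^*) 0 = 0.
  rewrite -(E2_formula red') LE.
  transitivity (E_ 2 [set l^* | l in L0 tau] (0 : R[i])^*); first by congr (E_ 2 _ _); apply/esym; exact: conjc0.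
  by rewrite E_conj (E2_formula red) c0; exact: conjc0.
have ImE : complex.Im (- tau^*) = complex.Im tau by rewrite ImN; case: (tau) => a b /=; rewrite opprK.
have eqL : lambert (qe tau) = lambert (qe (- tau^*)).
  have e := s2_lambert red; have e' := s2_lambert red'; rewrite c0 in e; rewrite c0' ImE in e'.
  have k0 : (8 * pi ^+ 2)%:C != 0 :> R[i].
    by rewrite eq_complex /= eqxx andbT gt_eqF // mulr_gt0 // exprn_gt0 // pi_gt0.
  have aux : forall K k X Y : R[i], k != 0 -> 0 = K - k * X -> 0 = K - k * Y -> X = Y.
    by move=> K k X Y kn -> /addrI/oppr_inj/(mulfI kn).
  exact: aux k0 e e'.
have th : 173 / 200 <= complex.Im tau.
  have := nrm_sqr tau; rewrite n1 expr1n => E.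
  clear eqL c0 c0'; have x2 : complex.Re tau ^+ 2 <= 2^-1 ^+ 2.
    by rewrite -[X in X <= _]real_normK ?num_real // lerXn2r ?nnegrE // ltW.
  rewrite leNgt; apply/negP => c; have := ltr_pM (ltW i0) (ltW i0) c c.
  by move: E x2; rewrite !expr2; lra.
have nq : nrm (qe tau) <= 160^-1 by rewrite nrm_qe; exact: expq_le.
have nq' : nrm (qe (- tau^*)) <= 160^-1 by rewrite nrm_qe ImE; exact: expq_le.
have b : (160^-1 : R) <= 40^-1 by clear; lra.
have := lambert_diff b nq nq'; rewrite eqL subrr sub0r nrmN.
have [a1 a2 _ lo] := koebe_factor b nq nq'; rewrite (koebe_diff a1 a2) nrmM => h.
have d0 := nrm_ge0 (qe tau - qe (- tau^*)).
have h2 : nrm (qe tau - qe (- tau^*)) * (85 / 100) <= 5 * 160^-1 * nrm (qe tau - qe (- tau^*)).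
  by apply: le_trans h; rewrite ler_wpM2l.
have d1 : nrm (qe tau - qe (- tau^*)) = 0.
  by move: d0 h2; clear; move: (nrm _) => X; lra.
move/eqP: d1; rewrite nrm_eq0 subr_eq0 => /eqP E.
have : qe (tau + tau^*) = 1.
  by rewrite qeD E -qeD addNr qe0.
move=> /qe_eq1[m] /(congr1 (@complex.Re R)).
rewrite ReD -(rmorph_int (real_complex R)) /= => mE.
have mE2 : 2 * complex.Re tau = m%:~R by rewrite -mE; case: (tau) => a c /=; ring.
clear -mE2 xh x0; have : `|m%:~R| < 1 :> R by rewrite -mE2 normrM ger0_norm //; lra.
rewrite -intr_norm ltrz1 => m1; have m0 : m = 0 by lia.
by move: mE2; rewrite m0 => /eqP; rewrite mulf_eq0 (negbTE x0) orbF pnatr_eq0.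
Qed.

End E2NonvanishingCases.

(** * Orders in imaginary quadratic fields and their discriminants *)

Section Quadratic.
Variable R : realType.
Implicit Types (x y z w : R[i]) (m n a b d : int).

Lemma conjc_int m : (m%:~R : R[i])^* = m%:~R.
Proof. exact: rmorph_int. Qed.

Definition zspan w1 w2 : set R[i] := [set x | exists m n, x = m%:~R * w1 + n%:~R * w2].

Lemma conjc_lin m n w w' : (m%:~R * w + n%:~R * w')^* = m%:~R * w^* + n%:~R * w'^* :> R[i].
Proof.
have cM (u v : R[i]) : (u * v)^* = u^* * v^* by exact: rmorphM.
have cD (u v : R[i]) : (u + v)^* = u^* + v^* by exact: rmorphD.
by rewrite cD !cM !conjc_int.
Qed.

Lemma zspan_l w1 w2 : zspan w1 w2 w1.
Proof. by exists 1, 0; rewrite mul1r mul0r addr0. Qed.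

Lemma zspan_r w1 w2 : zspan w1 w2 w2.
Proof. by exists 0, 1; rewrite mul1r mul0r add0r. Qed.

Lemma zspan_disc_mul w1 w2 v1 v2 : zspan v1 v2 `<=` zspan w1 w2 ->
  exists n, v1 * v2^* - v2 * v1^* = n%:~R * (w1 * w2^* - w2 * w1^*).
Proof.
move=> H; have [a [b e1]] := H _ (zspan_l v1 v2); have [c [d e2]] := H _ (zspan_r v1 v2).
exists (a * d - b * c); rewrite e1 e2 !conjc_lin rmorphB !rmorphM /=; ring.
Qed.

(** Each determinant is an integral multiple of the other, so they agree up to sign. *)
Lemma zspan_disc w1 w2 v1 v2 : zspan w1 w2 = zspan v1 v2 ->
  (w1 * w2^* - w2 * w1^*) ^+ 2 = (v1 * v2^* - v2 * v1^*) ^+ 2.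
Proof.
move=> E; have [n e] : exists n, v1 * v2^* - v2 * v1^* = n%:~R * (w1 * w2^* - w2 * w1^*).
  by apply: zspan_disc_mul; rewrite E.
have [n' e'] : exists n, w1 * w2^* - w2 * w1^* = n%:~R * (v1 * v2^* - v2 * v1^*).
  by apply: zspan_disc_mul; rewrite E.
rewrite e; move: e'; rewrite e; move: (w1 * w2^* - w2 * w1^*) => X.
have [->|X0] := eqVneq X 0; first by rewrite mulr0.
rewrite mulrA => /esym/eqP; rewrite -[X in _ == X]mul1r (inj_eq (mulIf X0)) -rmorphM /= -[X in _ == X](rmorph1 intr).
move=> /eqP/intr_inj /(congr1 absz); rewrite abszM /= => /eqP; rewrite muln_eq1 => /andP[_ /eqP nn].
have : n = 1 \/ n = -1 by move: nn; clear; lia.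
by case=> ->; rewrite ?rmorphN rmorph1 ?mulN1r ?mul1r ?sqrrN.
Qed.

Lemma Zadjoin_quad w a b : w ^+ 2 = a%:~R * w + b%:~R -> Zadjoin w = zspan 1 w.
Proof.
move=> E; apply/seteqP; split=> [x [p ->]|x [m [n ->]]]; last first.
  exists (m%:P + n%:P * 'X).
  by rewrite rmorphD rmorphM /= !map_polyC map_polyX hornerD hornerM !hornerC hornerX mulr1.
elim/poly_ind: p => [|p c [m [n IH]]].
  by exists 0, 0; rewrite rmorph0 horner0 !mul0r addr0.
exists (n * b + c), (m + n * a).
rewrite rmorphD rmorphM /= map_polyC map_polyX hornerD hornerM hornerC hornerX IH.
rewrite !rmorphD !rmorphM /=.
transitivity (m%:~R * w + n%:~R * w ^+ 2 + c%:~R); first by ring.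
by rewrite E; ring.
Qed.

Lemma zspan_shift (s k : int) w : s * s = 1 -> zspan 1 (s%:~R * w + k%:~R) = zspan 1 w.
Proof.
move=> ss; have ss' : s%:~R * s%:~R = 1 :> R[i] by rewrite -rmorphM ss.
apply/seteqP; split=> x [m [n ->]].
  exists (m + n * k), (n * s); rewrite !rmorphD !rmorphM /=; ring.
exists (m - n * s * k), (n * s); rewrite !rmorphB !rmorphM /=.
transitivity (m%:~R * 1 + (s%:~R * s%:~R) * (n%:~R * w)); last by ring.
by rewrite ss' mul1r.
Qed.

Lemma sqrtC_im_gt0 z : 0 < complex.Im z -> sqrtC (z ^+ 2) = z.
Proof.
move=> z0; apply/sqrCK_P; apply/andP; split.
  by rewrite -complexIm lecE /= eqxx ltW.
by apply/negP; rewrite ltcE /= => /andP[/eqP E _]; move: z0; rewrite -E ltxx.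
Qed.

Section RationalIntegral.
Import algC algnum.

(** The rational number is carried over to [algC], where rational algebraic integers are known to be
    integers. *)
Lemma rational_integral y a b : b != 0 -> y * b%:~R = a%:~R ->
  integralOver (intr : int -> R[i]) y -> exists c : int, y = c%:~R.
Proof.
move=> b0 E [p mp rp]; pose r : rat := a%:~R / b%:~R.
have yE : y = ratr r.
  rewrite fmorph_div /= !ratr_int -E mulfK //.
  by rewrite intr_eq0.
have mE (F : numFieldType) : map_poly (intr : int -> F) p = map_poly ratr (map_poly (intr : int -> rat) p).
  by rewrite -map_poly_comp; apply: eq_map_poly => x; rewrite /= ratr_int.
move: rp; rewrite yE mE fmorph_root => rq.
have : root (map_poly (intr : int -> algC) p) (ratr r) by rewrite mE fmorph_root.
move=> /root_monic_Aint h.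
have /h : map_poly (intr : int -> algC) p \is monic by exact: monic_map.
have /[swap]/[apply] : map_poly (intr : int -> algC) p \is a polyOver Num.int.
  by apply/polyOverP => i; rewrite coef_map /= intr_int.
move=> /Cint_rat_Aint -/(_ (Crat_rat r)) /intrP[c] /eqP.
rewrite -(ratr_int algC) (inj_eq (fmorph_inj _)) => /eqP ->.
by exists c; rewrite ratr_int.
Qed.

End RationalIntegral.

Lemma int_parity n : exists k, n = 2 * k \/ n = 2 * k + 1.
Proof. by exists (n %/ 2)%Z; lia. Qed.

Lemma conjc_half : (2^-1 : R[i])^* = 2^-1.
Proof.
have -> : (2^-1 : R[i])^* = (2%:R^*)^-1 by exact: fmorphV.
by congr (_^-1); exact: rmorph_nat.
Qed.

(** The congruence that characterizes discriminants of monic integral quadratic polynomials. *)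
Definition mod4 d := exists t, d = 4 * t \/ d = 4 * t + 1.

Lemma mod4_sqr_sub n b : mod4 (n ^+ 2 - 4 * b).
Proof.
have [k [->|->]] := int_parity n.
  by exists (k * k - b); left; ring.
by exists (k * k + k - b); right; ring.
Qed.

Lemma int_lowest (c N : int) : N != 0 -> exists p q : int, [/\ 0 < q, coprimez p q & c * q = p * N].
Proof.
move=> N0; pose r : rat := c%:~R / N%:~R; exists (numq r), (denq r); split.
- exact: denq_gt0.
- by rewrite coprimezE; exact: coprime_num_den.
have h : (numq r)%:~R / (denq r)%:~R = c%:~R / N%:~R :> rat by rewrite divq_num_den.
have Nn : N%:~R != 0 :> rat by rewrite intr_eq0.
have dn : (denq r)%:~R != 0 :> rat by rewrite intr_eq0 denq_neq0.
move/eqP: h; rewrite eqr_div // -!rmorphM => /eqP/intr_inj h.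
by rewrite -h.
Qed.

(* f is the conductor: the largest f such that D / f^2 is still 0 or 1 mod 4. *)
Lemma max_square (D B M : int) : D = B ^+ 2 - 4 * M -> D != 0 ->
  exists (f : nat) d, [/\ (0 < f)%N, D = f%:Z ^+ 2 * d, mod4 d &
    forall q d1 : int, 0 < q -> d = d1 * q ^+ 2 -> mod4 d1 -> q = 1].
Proof.
move=> DE D0; pose P (f : nat) := `[< (0 < f)%N /\ exists2 d, D = f%:Z ^+ 2 * d & mod4 d >].
have P1 : exists f, P f.
  exists 1%N; apply/asboolP; split=> //; exists D; first by rewrite expr1n mul1r.
  by rewrite DE; exact: mod4_sqr_sub.
have Pb f : P f -> (f <= `|D|)%N.
  move=> /asboolP[f0 [d E _]]; have d0 : d != 0.
    by apply: contra_neq D0 => d0; rewrite E d0 mulr0.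
  rewrite E abszM abszX /=; have : (0 < `|d|)%N by rewrite absz_gt0.
  move: (`|d|)%N => k k0; rewrite expnS expn1 -mulnA; apply: leq_pmulr; rewrite muln_gt0 f0 //.
case: (ex_maxnP P1 Pb) => f /asboolP[f0 [d E md]] mx; exists f, d; split=> // q d1 q0 dE m1.
have : P (f * `|q|)%N.
  apply/asboolP; split; first by rewrite muln_gt0 f0 absz_gt0; lia.
  exists d1 => //; rewrite E dE PoszM abszE gtr0_norm //; ring.
move=> /mx; rewrite -[X in (_ <= X)%N]muln1 leq_pmul2l //; lia.
Qed.

Section Order.
Variables (om : R[i]) (B M : int).
Hypothesis om_quad : om * om = - (B%:~R * om) - M%:~R.
Hypothesis om_im : 0 < complex.Im om.

Let D := B ^+ 2 - 4 * M.
Let sD := om - om^*.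

Lemma conj_om : om^* = - B%:~R - om.
Proof.
have q : om^* * om^* = - (B%:~R * om^*) - M%:~R.
  have := congr1 (@conjc R) om_quad.
  have -> : (om * om)^* = om^* * om^* by exact: rmorphM.
  have -> : (- (B%:~R * om) - M%:~R)^* = - (B%:~R^* * om^*) - M%:~R^*.
    by rewrite -rmorphM -!rmorphN -rmorphD.
  by rewrite !conjc_int.
have n0 : om - om^* != 0.
  move: om_im; case: (om) => a b /= b0; rewrite eq_complex /= negb_and; apply/orP; right.
  by apply/eqP; lra.
apply: (mulfI n0); transitivity (om * om^* - om^* * om^*); first by ring.
rewrite q; transitivity (om * om^* + B%:~R * om^* - B%:~R * om - om * om); first by rewrite om_quad; ring.
ring.
Qed.

Lemma norm_om : om * om^* = M%:~R.
Proof. by rewrite conj_om mulrBr om_quad; ring. Qed.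

Lemma sD_sqr : sD ^+ 2 = D%:~R.
Proof.
rewrite /sD conj_om /D rmorphB rmorphXn rmorphM /=.
transitivity (4 * (om * om) + 4 * B%:~R * om + B%:~R ^+ 2); first by ring.
rewrite om_quad; ring.
Qed.

Lemma sD_im : 0 < complex.Im sD.
Proof. by rewrite /sD; move: om_im; case: (om) => a b /= b0; lra. Qed.

Lemma sD_neq0 : sD != 0.
Proof. by apply/eqP => e; move: sD_im; rewrite e ltxx. Qed.

Lemma sD_conj : sD^* = - sD.
Proof. by rewrite /sD; case: (om) => a b; apply/eqP; rewrite eq_complex /=; apply/andP; split; apply/eqP; ring. Qed.

Lemma D_neq0 : D != 0.
Proof. by rewrite -(intr_eq0 R[i]) -sD_sqr expf_eq0 /= sD_neq0. Qed.

(** Identifies the normalizing factor with the square root of [D] in the upper half-plane, a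
    difference of conjugates. *)
Lemma sqrt_norm_disc : 'i * sqrtC `|D%:~R| = sD :> R[i].
Proof.
have e : sD = 'i * (complex.Im sD)%:C.
  by rewrite {1}(complex_ReIm sD) /sD; case: (om) => a b /=; rewrite subrr add0r.
have -> : D%:~R = - ((complex.Im sD)%:C ^+ 2) :> R[i].
  by rewrite -sD_sqr {1}e exprMn sqrCi mulN1r.
rewrite normrN normrX sqrCK ?normr_ge0 // {2}e; congr (_ * _).
by rewrite ger0_norm // lecE /= eqxx ltW ?sD_im.
Qed.

Section Fundamental.
Variables (f : nat) (d : int).
Hypotheses (f0 : (0 < f)%N) (DE : D = f%:Z ^+ 2 * d) (md : mod4 d)
  (maxf : forall q d1 : int, 0 < q -> d = d1 * q ^+ 2 -> mod4 d1 -> q = 1).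

Let s := sD / f%:R.
Let th := (d%:~R + s) / 2.

Lemma f_neq0 : f%:R != 0 :> R[i].
Proof. by rewrite pnatr_eq0 -lt0n. Qed.

Lemma s_sqr : s ^+ 2 = d%:~R.
Proof.
rewrite /s expr_div_n sD_sqr DE rmorphM rmorphXn /= -[(f%:Z)%:~R]/(f%:R) mulrC mulKf //.
by rewrite expf_neq0 // f_neq0.
Qed.

Lemma sqrt_d : sqrtC d%:~R = s.
Proof.
rewrite -s_sqr sqrtC_im_gt0 //.
have -> : s = (f%:R^-1 : R)%:C * sD + 0.
  by rewrite /s addr0 mulrC fmorphV /= rmorph_nat.
by rewrite ImD cImM /= mul0r addr0 addr0 mulr_gt0 ?sD_im // invr_gt0 ltr0n.
Qed.

Lemma s_conj : s^* = - s.
Proof.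
rewrite /s; have -> : (sD / f%:R)^* = sD^* / f%:R^* by exact: fmorph_div.
have -> : (f%:R : R[i])^* = f%:R by exact: rmorph_nat.
by rewrite sD_conj mulNr.
Qed.

Lemma th_quad : exists e, th ^+ 2 = d%:~R * th + e%:~R.
Proof.
have [t dt] := md; have [e eE] : exists e, d - d ^+ 2 = 4 * e.
  by case: dt => ->; [exists (t - 4 * t ^+ 2)|exists (- t - 4 * t ^+ 2)]; ring.
exists e; have -> : e%:~R = (d%:~R - d%:~R ^+ 2) / 4 :> R[i].
  by rewrite -rmorphXn -rmorphB eE rmorphM /= mulrC mulKf // pnatr_eq0.
rewrite /th; transitivity ((d%:~R ^+ 2 + 2 * d%:~R * s + s ^+ 2) / 4 : R[i]); first by field.
by rewrite s_sqr; field.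
Qed.

Lemma th_conj : th^* = (d%:~R - s) / 2.
Proof.
have e : th = d%:~R * 2^-1 + 1%:~R * (s / 2) by rewrite /th; field.
rewrite e conjc_lin.
rewrite conjc_half.
have -> : (s / 2)^* = - s / 2.
  have -> : (s / 2)^* = s^* * 2^-1^* by exact: rmorphM.
  by rewrite s_conj conjc_half.
by field.
Qed.

Lemma disc_mul_th (g : nat) : (1 * (g%:R * th)^* - g%:R * th * 1^*) ^+ 2 = (g%:Z ^+ 2 * d)%:~R.
Proof.
have -> : (g%:R * th)^* = g%:R * th^*.
  have -> : (g%:R * th)^* = g%:R^* * th^* by exact: rmorphM.
  by congr (_ * _); exact: rmorph_nat.
rewrite conjc1 th_conj !rmorphM /= -[(g%:Z)%:~R]/(g%:R) /th -s_sqr; move: (s) => t; by field.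
Qed.

Lemma Zadjoin_mul_th (g : nat) : Zadjoin (g%:R * th) = zspan 1 (g%:R * th).
Proof.
have [e eE] := th_quad; apply: (@Zadjoin_quad _ (g%:Z * d) (g%:Z ^+ 2 * e)).
rewrite exprMn eE !rmorphM /= -[(g%:Z)%:~R]/(g%:R); ring.
Qed.

Lemma order_th : zspan 1 om = zspan 1 (f%:R * th).
Proof.
(* Equality of [f^2 d] and [B^2 - 4 M], with [d] congruent to 0 or 1 mod 4, gives [f d] and [B] the
   same parity. *)
have [k kE] : exists k, f%:Z * d + B = 2 * k.
  have [k [|kE]] := int_parity (f%:Z * d + B); first by exists k.
  have [b bE] := int_parity B; have [g gE] := int_parity f%:Z.
  move: DE kE; rewrite /D; have [t dt] := md.
  by case: bE => ->; case: gE => ->; case: dt => ->; lia.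
have -> : f%:R * th = 1%:~R * om + k%:~R.
  have -> : k%:~R = (f%:R * d%:~R + B%:~R) / 2 :> R[i].
    have := congr1 (fun x : int => x%:~R : R[i]) kE.
    by rewrite rmorphD !rmorphM /= -[(f%:Z)%:~R]/(f%:R) => ->; field.
  rewrite /th /s /sD conj_om; field; exact: f_neq0.
by rewrite zspan_shift.
Qed.

Lemma th_im : 0 < complex.Im s -> forall m n, m%:~R * 1 + n%:~R * th = 0 -> m = 0 /\ n = 0.
Proof.
move=> si m n E; have E' : (m%:~R * 1 + n%:~R * th)^* = 0 by rewrite E conjc0.
move: E'; rewrite conjc_lin conjc1 th_conj => E'.
have n0 : n%:~R * s = 0.
  transitivity ((m%:~R * 1 + n%:~R * th) - (m%:~R * 1 + n%:~R * ((d%:~R - s) / 2))).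
    by rewrite /th; field.
  by rewrite E E' subrr.
have s0 : s != 0 by apply/eqP => e; move: si; rewrite e ltxx.
move/eqP: n0; rewrite mulf_eq0 (negbTE s0) orbF intr_eq0 => /eqP n0.
by move: E; rewrite n0 mul0r addr0 mulr1 => /eqP; rewrite intr_eq0 => /eqP.
Qed.

Lemma th_integral : integralOver (intr : int -> R[i]) th.
Proof.
have [e eE] := th_quad.
exists ('X^2 - (d%:P * 'X + e%:P)).
  rewrite monicE lead_coefDl ?lead_coefXn // size_polyXn size_polyN.
  apply: leq_ltn_trans (size_polyD _ _) _; rewrite gtn_max mul_polyC.
  by rewrite (leq_ltn_trans (size_scale_leq _ _)) ?size_polyX //= (leq_ltn_trans (size_polyC_leq1 _)).
rewrite rootE rmorphB rmorphD !rmorphM /= !map_polyC !map_polyX.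
by rewrite !(hornerD, hornerN, hornerM, hornerC, hornerX) -expr2 eE subrr.
Qed.

(** An integral element [x] has integral trace [a] and norm [b], and [x - x^* = (p / q) s] in lowest
    terms. Then [(a^2 - 4 b) q^2 = p^2 d], so [q^2] divides [d], the quotient is again 0 or 1 mod 4,
    and maximality of [f] gives [q = 1]. *)
Lemma integers_fraction : ring_of_integers (fraction_field (zspan 1 om)) = zspan 1 th.
Proof.
apply/seteqP; split=> [x [[N1 [N2 [[m1 [n1 E1]] [m2 [n2 E2]] N20 xE]]] xint]|x [m [n ->]]]; last first.
  split.
    exists (m%:~R * f%:R + n%:~R * (f%:R * th)), f%:R; split.
    - rewrite order_th; exists (m * f%:Z), n; rewrite rmorphM /= -[(f%:Z)%:~R]/(f%:R); ring.
    - by exists f%:Z, 0; rewrite mul0r addr0 mulr1.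
    - exact: f_neq0.
    - by field; exact: f_neq0.
  apply: integral_add; first by rewrite mulr1; exact: integral_id.
  by apply: integral_mul; [exact: integral_id|exact: th_integral].
pose N := m2 ^+ 2 - B * m2 * n2 + M * n2 ^+ 2.
have trE : om^* = - B%:~R - om := conj_om.
have N2c : N2^* = m2%:~R * 1 + n2%:~R * om^* by rewrite E2 conjc_lin conjc1.
have N1c : N1^* = m1%:~R * 1 + n1%:~R * om^* by rewrite E1 conjc_lin conjc1.
have NE : N2 * N2^* = N%:~R.
  rewrite N2c E2 /N rmorphD rmorphB !rmorphM /= -norm_om.
  transitivity (m2%:~R ^+ 2 + m2%:~R * n2%:~R * (om + om^*) + n2%:~R ^+ 2 * (om * om^*)); first by ring.
  have -> : om + om^* = - B%:~R by rewrite trE; ring.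
  ring.
have N20' : N2^* != 0 by rewrite fmorph_eq0.
have N0 : N != 0 by rewrite -(intr_eq0 R[i]) -NE mulf_neq0.
have xc : x^* = N1^* / N2^* by rewrite xE; exact: fmorph_div.
have xN : x * N%:~R = N1 * N2^* by rewrite -NE xE; field.
have xcN : x^* * N%:~R = N1^* * N2 by rewrite -NE xc; field.
have cint : integralOver (intr : int -> R[i]) x^*.
  have [p mp rp] := xint; exists p => //.
  have -> : map_poly (intr : int -> R[i]) p = map_poly (@conjc R) (map_poly intr p).
    by rewrite -map_poly_comp; apply: eq_map_poly => y; rewrite /= conjc_int.
  by rewrite fmorph_root.
have [a aE] : exists c : int, x + x^* = c%:~R.
  apply: (@rational_integral _ (2 * m1 * m2 - B * (m1 * n2 + n1 * m2) + 2 * M * (n1 * n2)) N) => //.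
    rewrite mulrDl xN xcN N1c N2c E1 E2 !(rmorphD, rmorphB, rmorphM) /= -norm_om.
    transitivity (2 * m1%:~R * m2%:~R + (m1%:~R * n2%:~R + n1%:~R * m2%:~R) * (om + om^*) + 2 * (om * om^*) * (n1%:~R * n2%:~R)); first by ring.
    have -> : om + om^* = - B%:~R by rewrite trE; ring.
    ring.
  exact: integral_add.
have [b bE] : exists c : int, x * x^* = c%:~R.
  apply: (@rational_integral _ (m1 ^+ 2 - B * m1 * n1 + M * n1 ^+ 2) N) => //.
    transitivity (N1 * N1^*).
      by rewrite -NE xc xE; field; rewrite N20 N20'.
    rewrite N1c E1 rmorphD rmorphB !rmorphM /= -norm_om.
    transitivity (m1%:~R ^+ 2 + m1%:~R * n1%:~R * (om + om^*) + n1%:~R ^+ 2 * (om * om^*)); first by ring.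
    have -> : om + om^* = - B%:~R by rewrite trE; ring.
    ring.
  exact: integral_mul.
have dE : (x - x^*) * N%:~R = ((n1 * m2 - m1 * n2) * f%:Z)%:~R * s.
  rewrite mulrBl xN xcN N1c N2c E1 E2 /s /sD !rmorphM rmorphB !rmorphM /= -[(f%:Z)%:~R]/(f%:R).
  by field; exact: f_neq0.
have [p [q [q0 cpq pqE]]] := int_lowest ((n1 * m2 - m1 * n2) * f%:Z) N0.
have NR : N%:~R != 0 :> R[i] by rewrite intr_eq0.
have dE' : (x - x^*) * q%:~R = p%:~R * s.
  apply: (mulIf NR); rewrite mulrAC dE mulrAC -rmorphM pqE rmorphM /=; ring.
have eE : (a ^+ 2 - 4 * b) * q ^+ 2 = p ^+ 2 * d.
  apply: (@intr_inj R[i]); rewrite !rmorphM rmorphB !rmorphM /= -aE -bE -s_sqr.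
  transitivity (((x - x^*) * q%:~R) ^+ 2); first by ring.
  by rewrite dE'; ring.
have /dvdzP[d1 d1E] : (q ^+ 2 %| d)%Z.
  rewrite -(Gauss_dvdzr (m := q ^+ 2) (n := p ^+ 2)); last by rewrite coprimezXl // coprimezXr // coprimez_sym.
  by rewrite -eE dvdz_mull.
have e1 : a ^+ 2 - 4 * b = p ^+ 2 * d1.
  have q2 : q ^+ 2 != 0 by rewrite expf_neq0 // gt_eqF.
  by apply: (mulIf q2); rewrite eE d1E; ring.
have q1 : q = 1.
  apply: (maxf q0 d1E).
  (* For even [p] the coprime [q] is odd, so [d] and [d1] agree mod 4; for odd [p] the equation [e1]
     gives [d1] the residue of a discriminant. *)
  have [k [pk|pk]] := int_parity p.
    have [l [ql|ql]] := int_parity q.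
      by move/coprimezP: cpq => -[[u v]] /=; rewrite pk ql; lia.
    have [t [dt|dt]] := md; move: d1E; rewrite ql dt => E.
      by exists (t - (l ^+ 2 + l) * d1); left; move: E; clear; lia.
    by exists (t - (l ^+ 2 + l) * d1); right; move: E; clear; lia.
  have [t at_] := mod4_sqr_sub a b; move: e1; rewrite pk => E.
  by exists (t - (k ^+ 2 + k) * d1); case: at_ => at_; [left|right]; move: E; rewrite at_; clear; lia.
move: dE' eE; rewrite q1 mulr1 expr1n mulr1 => dE' eE.
have [k kE] : exists k, a - p * d = 2 * k.
  have [k [|kE]] := int_parity (a - p * d); first by exists k.
  move: eE kE; have [a' aE'] := int_parity a; have [p' pE'] := int_parity p; have [t dt] := md.
  by case: aE' => ->; case: pE' => ->; case: dt => ->; clear; lia.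
exists k, p.
have -> : k%:~R = (a%:~R - p%:~R * d%:~R) / 2 :> R[i].
  have := congr1 (fun x : int => x%:~R : R[i]) kE.
  by rewrite rmorphB !rmorphM /= => ->; field.
rewrite -aE /th; transitivity ((x + x^* + (x - x^*)) / 2); first by field.
by rewrite dE'; field.
Qed.

End Fundamental.

(** [lattice_disc] is a choice, so every admissible pair must give [D]: the field discriminant is
    unique by [zspan_disc], and the discriminant of the order then fixes the product. *)
Lemma lattice_disc_order (L : set R[i]) : multiplier_ring L = zspan 1 om -> lattice_disc L = D.
Proof.
move=> mL; have [f [d [f0 DE md maxf]]] := max_square (erefl D) D_neq0.
have key := integers_fraction f0 DE md maxf.
have si : 0 < complex.Im (sD / f%:R).
  have -> : sD / f%:R = (f%:R^-1 : R)%:C * sD + 0 by rewrite addr0 mulrC fmorphV /= rmorph_nat.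
  by rewrite ImD cImM /= mul0r addr0 addr0 mulr_gt0 ?sD_im // invr_gt0 ltr0n.
have rE g : g%:R * ((d%:~R + sqrtC d%:~R) / 2) = g%:R * ((d%:~R + sD / f%:R) / 2) :> R[i].
  by rewrite (sqrt_d f0 DE).
have dK : has_discriminant (ring_of_integers (fraction_field (multiplier_ring L))) d.
  exists 1, ((d%:~R + sD / f%:R) / 2); split.
    by split; [rewrite mL; exact: key|exact: th_im].
  transitivity ((1%N%:Z ^+ 2 * d)%:~R : R[i]); first by rewrite expr1n mul1r.
  by rewrite -(disc_mul_th f0 DE 1%N) !mul1r.
rewrite /lattice_disc; apply: xget_unique => [|d' [dK' [g [[w1 [w2 [[wE _] w12]]] g0 gE ->]]]].
  exists d, f; split=> //.
  by rewrite rE (Zadjoin_mul_th f0 DE md) mL; exact: order_th.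
have dd : dK' = d.
  have [v1 [v2 [[vE _] v12]]] := dK.
  apply: (@intr_inj R[i]); rewrite w12 v12; apply: zspan_disc.
  by rewrite /zspan -wE -vE.
rewrite dd in gE *; move: gE; rewrite rE (Zadjoin_mul_th f0 DE md) mL => /zspan_disc gE.
apply: (@intr_inj R[i]); rewrite -(disc_mul_th f0 DE) -gE conjc1 mul1r mulr1.
by rewrite -sD_sqr /sD -sqrrN opprB.
Qed.

End Order.
End Quadratic.

(** * Complex multiplication of reduced lattices *)

Section QuadraticTau.
Variable R : realType.
Local Notation iu := (iu R).
Local Notation rho6 := (rho6 R).

Section Tau.
Variable tau : R[i].
Hypothesis red : reduced tau.

(** A multiplier that is not an integer gives a quadratic equation for tau; dividing by the content
    and keeping Bezout coefficients prepares [mult_zspan]. *)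
Lemma cm_quadratic k : mult tau k -> (forall n : int, k <> n%:~R) ->
  exists A B C : int, [/\ 0 < A, A%:~R * (tau * tau) + B%:~R * tau + C%:~R = 0 &
    exists u v w, u * A + v * B + w * C = 1].
Proof.
move=> mk nk; have [[a b] _ e1] := mk 1 (L0_1 tau); have [[c d] _ e2] := mk tau (L0_tau tau).
rewrite /lat /= in e1 e2; rewrite mulr1 in e1.
have a0 : a != 0 by apply/eqP => a0; apply: (nk b); rewrite -e1 a0 mul0r add0r.
have E : a%:~R * (tau * tau) + (b - c)%:~R * tau + (- d)%:~R = 0 :> R[i].
  rewrite rmorphB rmorphN /=; transitivity ((a%:~R * tau + b%:~R) * tau - (c%:~R * tau + d%:~R)); first by ring.
  by rewrite e2 e1 subrr.
pose g := gcdz (gcdz a (b - c)) (- d).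
have g0 : g != 0 by rewrite !gcdz_eq0 (negbTE a0).
have /dvdzP[A AE] : (g %| a)%Z by apply: dvdz_trans (dvdz_gcdl _ _) (dvdz_gcdl _ _).
have /dvdzP[B BE] : (g %| b - c)%Z by apply: dvdz_trans (dvdz_gcdl _ _) (dvdz_gcdr _ _).
have /dvdzP[C CE] : (g %| - d)%Z by apply: dvdz_gcdr.
have [u' [w h1]] := Bezoutz (gcdz a (b - c)) (- d).
have [u [v h2]] := Bezoutz a (b - c).
have bz : u' * u * A + u' * v * B + w * C = 1.
  apply: (mulIf g0); rewrite mul1r {2}/g -h1 -h2.
  transitivity (u' * u * (A * g) + u' * v * (B * g) + w * (C * g)); first by ring.
  by rewrite -AE -BE -CE; ring.
have gR : g%:~R != 0 :> R[i] by rewrite intr_eq0.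
have E' : A%:~R * (tau * tau) + B%:~R * tau + C%:~R = 0.
  apply: (mulIf gR); rewrite mul0r -E AE BE CE !rmorphM /=; ring.
case: (ltP 0 A) => Ap.
  by exists A, B, C; split=> //; exists (u' * u), (u' * v), w.
exists (- A), (- B), (- C); split.
- rewrite lt_neqAle eq_sym oppr_eq0 oppr_ge0 Ap andbT.
  by apply: contra_neq a0 => A0; rewrite AE A0 mul0r.
- rewrite !rmorphN /=; transitivity (- (A%:~R * (tau * tau) + B%:~R * tau + C%:~R)); first by ring.
  by rewrite E' oppr0.
by exists (- (u' * u)), (- (u' * v)), (- w); rewrite !mulrNN.
Qed.

(** Comparing coordinates of [k] and [k * tau] shows that [A] divides both [a B] and [a C], where
    [k = a tau + b]; primitivity then gives that [A] divides [a]. *)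
Lemma mult_zspan (A B C : int) : 0 < A -> A%:~R * (tau * tau) + B%:~R * tau + C%:~R = 0 ->
  (exists u v w, u * A + v * B + w * C = 1) -> [set m | mult tau m] = zspan 1 (A%:~R * tau).
Proof.
move=> A0 E [u [v [w bz]]].
have E' : A%:~R * (tau * tau) = - (B%:~R * tau) - C%:~R.
  by apply/eqP; rewrite -subr_eq0 -E; apply/eqP; ring.
apply/seteqP; split=> [k /= mk|_ [m [n ->]] /= _ [[x y] _ <-]]; last first.
  exists (m * x + n * (A * y - B * x), m * y - n * (C * x)) => //.
  rewrite /lat /= !(rmorphD, rmorphB, rmorphM) /=.
  transitivity (m%:~R * (x%:~R * tau + y%:~R) + n%:~R * (x%:~R * (A%:~R * (tau * tau)) + A%:~R * y%:~R * tau)).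
    by rewrite E'; ring.
  ring.
have [[a b] _ e1] := mk 1 (L0_1 tau); have [[c d] _ e2] := mk tau (L0_tau tau).
rewrite /lat /= in e1 e2; rewrite mulr1 in e1.
have : lat tau (- a * B + A * b, - a * C) = lat tau (A * c, A * d).
  rewrite /lat /= !(rmorphD, rmorphN, rmorphM) /=.
  transitivity (A%:~R * (c%:~R * tau + d%:~R)); last by ring.
  rewrite e2 -e1; transitivity (a%:~R * (A%:~R * (tau * tau)) + A%:~R * b%:~R * tau); last by ring.
  by rewrite E'; ring.
(* The second witness is the quotient of [a] by [A], computed from the Bezout coefficients. *)
move=> /(lat_inj red)[h1 h2]; exists b, (u * a + v * (b - c) - w * d).
have -> : k = b%:~R * 1 + a%:~R * tau by rewrite -e1; ring.
congr (_ + _); rewrite mulrA -rmorphM; congr (_%:~R * _).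
transitivity (a * (u * A + v * B + w * C)); first by rewrite bz mulr1.
transitivity (u * a * A + v * (A * b - A * c) - w * (A * d)); last by ring.
by rewrite -h1 -h2; ring.
Qed.

Lemma mult_zspan_tau (b : int) : tau * tau = b%:~R * tau - 1 ->
  [set m | mult tau m] = zspan 1 tau.
Proof.
move=> E; rewrite (@mult_zspan 1 (- b) 1) ?mul1r // ?E ?rmorphN //=; first by ring.
by exists 1, 0, 0; rewrite mul0r mulr1 !addr0.
Qed.

(** Minimality of the vector 1 in both lattices gives [lam] norm 1. If [|tau| > 1], the vectors of
    norm 1 are only 1 and -1, so the lattice is stable under conjugation and [2 * Re tau] is an
    integer. *)
Lemma conj_cases lam : lam != 0 -> [set lam * x | x in L0 tau] = [set x^* | x in L0 tau] ->
  complex.Re tau = 0 \/ `|complex.Re tau| = 2^-1 \/ nrm tau = 1.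
Proof.
move=> l0 E; have [i0 n1 xh] := red.
have [e|tn] := eqVneq (nrm tau) 1; first by right; right.
have {}n1 : 1 < nrm tau by rewrite lt_neqAle eq_sym tn.
have ge1 z : L0 tau z -> z != 0 -> 1 <= nrm z.
  by move=> zL z0; rewrite leNgt; apply/negP => /(L0_small red)/(_ zL) e; rewrite e eqxx in z0.
have lc : L0 tau lam^*.
  have : [set lam * x | x in L0 tau] lam by exists 1; rewrite ?mulr1 //; exact: L0_1.
  by rewrite E => -[x xL <-]; rewrite conjcK.
have nl : nrm lam = 1.
  have : [set x^* | x in L0 tau] 1 by exists 1; rewrite ?conjc1 //; exact: L0_1.
  rewrite -E => -[y yL ye].
  have y0 : y != 0 by apply/eqP => y0; move: ye; rewrite y0 mulr0 => /eqP; rewrite eq_sym oner_eq0.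
  have h1 := ge1 _ yL y0.
  have h2 : 1 <= nrm lam by rewrite -nrm_conj; apply: ge1 => //; rewrite fmorph_eq0.
  have := congr1 (@nrm R) ye; rewrite nrmM nrm1 => h3.
  by apply/eqP; rewrite eq_le h2 andbT; move: h1 h2 h3; clear; nra.
have [[m n] _ lE] := lc; rewrite /lat /= in lE.
have reE : complex.Re lam^* = m%:~R * complex.Re tau + n%:~R.
  by rewrite -lE -!(rmorph_int (real_complex R)) ReD cReM /= mul0r subr0.
have imE : complex.Im lam^* = m%:~R * complex.Im tau.
  by rewrite -lE -!(rmorph_int (real_complex R)) ImD cImM /= mul0r addr0 addr0.
have := nrm_sqr lam^*; rewrite nrm_conj nl expr1n reE imE => q1.
have t2 : 1 < complex.Re tau ^+ 2 + complex.Im tau ^+ 2.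
  by rewrite -nrm_sqr expr_gt1 ?nrm_ge0.
(* For [m != 0], [|tau| > 1] and [|Re tau| <= 1/2] make [|m tau + n|^2] exceed [m^2 - |m n| + n^2],
   which is at least 1. *)
have m0 : m = 0.
  apply/eqP/negP => /negP mn0.
  have k1 : 1 <= m * m - `|m * n| + n * n.
    by move: mn0; clear; case: (ger0P (m * n)) => _ h; nia.
  have k2 : 1 <= (m%:~R * m%:~R - `|m%:~R * n%:~R| + n%:~R * n%:~R : R).
    by rewrite -!rmorphM -intr_norm -rmorphB -rmorphD ler1z.
  have k3 : - `|m%:~R * n%:~R| <= 2 * (m%:~R * n%:~R) * complex.Re tau :> R.
    have : `|2 * (m%:~R * n%:~R) * complex.Re tau| <= `|m%:~R * n%:~R : R|.
      rewrite !normrM; have := ler_wpM2l (mulr_ge0 (normr_ge0 (m%:~R : R)) (normr_ge0 (n%:~R : R))) xh.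
      by rewrite (ger0_norm (ler0n _ 2)); clear; lra.
    by rewrite ler_norml => /andP[].
  have k4 : 0 < (m%:~R : R) ^+ 2 by rewrite exprn_even_gt0 // intr_eq0.
  have := mulr_gt0 k4 (ltac:(by rewrite subr_gt0; exact: t2) : 0 < complex.Re tau ^+ 2 + complex.Im tau ^+ 2 - 1).
  move: k2 k3 q1; move: `|_| => Z; clear; rewrite !expr2; move: (complex.Re tau) (complex.Im tau) => X Y; nra.
have n1' : n = 1 \/ n = -1.
  move: q1; rewrite m0 !mul0r add0r expr0n addr0 /= => /esym/eqP; rewrite -rmorphXn -[X in _ == X](rmorph1 intr) (inj_eq (@intr_inj R)).
  by move=> /eqP; clear; nia.
have lE' : lam = n%:~R.
  by rewrite -(conjcK lam) -lE m0 mul0r add0r conjc_int.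
have : [set x^* | x in L0 tau] tau^* by exists tau => //; exact: L0_tau.
rewrite -E => -[_ [[a b] _ <-]]; rewrite lE' /lat /= => tE.
have imT : - complex.Im tau = (n * a)%:~R * complex.Im tau.
  have -> : - complex.Im tau = complex.Im tau^* by case: (tau).
  rewrite -tE rmorphM -!(rmorph_int (real_complex R)) cImM ImD ReD cImM cReM /=; ring.
have reT : complex.Re tau = (n * a)%:~R * complex.Re tau + (n * b)%:~R.
  have {1}-> : complex.Re tau = complex.Re tau^* by case: (tau).
  rewrite -tE !rmorphM -!(rmorph_int (real_complex R)) cReM ImD ReD cImM cReM /=; ring.
have na : n * a = -1.
  have i00 : complex.Im tau != 0 by rewrite gt_eqF.
  apply: (@intr_inj R); rewrite rmorphN /=; apply: (mulIf i00).
  by rewrite -imT rmorph1 mulN1r.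
rewrite na rmorphN /= rmorph1 in reT.
have b2 : 2 * complex.Re tau = (n * b)%:~R by move: reT; clear; lra.
have : `|(n * b)%:~R| <= 1 :> R by rewrite -b2 normrM ger0_norm //; move: xh; clear; lra.
rewrite -intr_norm lerz1 => b1.
have [z|z] : n * b = 0 \/ `|n * b| = 1 by move: b1; clear; move: (n * b) => z; lia.
  by left; move: b2; rewrite z; clear; lra.
right; left; have : `|2 * complex.Re tau| = 1 by rewrite b2 -intr_norm z.
by rewrite normrM ger0_norm //; clear; lra.
Qed.

Lemma Zadjoin_i : Zadjoin 'i = zspan 1 iu.
Proof.
have -> : 'i = iu by [].
apply: (@Zadjoin_quad _ _ 0 (-1)).
by rewrite expr2 iu_sqr rmorphN rmorph1 mul0r add0r.
Qed.

Lemma sqrt_neg3 : (1 - sqrtC (- 3%:R)) / 2%:R = 1 - rho6 :> R[i].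
Proof.
have h : (2 * rho6 - 1) ^+ 2 = - 3%:R.
  transitivity (4 * (rho6 * rho6) - 4 * rho6 + 1); first by ring.
  by rewrite rho6_sqr; ring.
rewrite -h sqrtC_im_gt0; first by field.
have [s3 _] := sqrt3_bounds R.
have -> : 2 * rho6 - 1 = (2 : R)%:C * rho6 + (-1) by rewrite rmorph_nat.
by rewrite ImD cImM /= mul0r addr0 oppr0 addr0 mulr_gt0 // divr_gt0 //; move: s3; clear; lra.
Qed.

Lemma Zadjoin_neg3 : Zadjoin ((1 - sqrtC (- 3%:R)) / 2%:R) = zspan 1 rho6.
Proof.
rewrite sqrt_neg3 (@Zadjoin_quad _ _ 1 (-1)); last first.
  transitivity (1 - 2 * rho6 + rho6 * rho6); first by ring.
  by rewrite rho6_sqr rmorphN rmorph1; ring.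
have -> : 1 - rho6 = (-1)%:~R * rho6 + 1%:~R by rewrite rmorphN rmorph1; ring.
exact: zspan_shift.
Qed.

Lemma s2_neq0 : complex.Re tau = 0 \/ `|complex.Re tau| = 2^-1 \/ nrm tau = 1 ->
  [set m | mult tau m] <> Zadjoin 'i -> [set m | mult tau m] <> Zadjoin ((1 - sqrtC (- 3%:R)) / 2%:R) ->
  ca tau 0 != 0.
Proof.
rewrite Zadjoin_i Zadjoin_neg3 => cases ni n3; have [i0 n1 xh] := red.
have nq := nrm_sqr tau.
have n2 : 1 <= nrm tau ^+ 2 by rewrite expr_ge1 ?nrm_ge0.
have [x0|x0] := eqVneq (complex.Re tau) 0.
  have t1 : 1 <= complex.Im tau.
    by move: n2; rewrite nq x0 expr0n add0r expr_ge1 // ltW.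
  have [t1'|t1'] := eqVneq (complex.Im tau) 1; last first.
    by apply: s2_neq0_im => //; rewrite lt_neqAle eq_sym t1'.
  have tE : tau = iu by rewrite /iu; move: x0 t1'; case: (tau) => a b /= -> ->.
  case: ni; rewrite (@mult_zspan_tau 0) ?tE // mul0r sub0r; exact: iu_sqr.
have [xe|xe] := eqVneq `|complex.Re tau| 2^-1.
  have x2 : complex.Re tau ^+ 2 = 4^-1 by rewrite -real_normK ?num_real // xe; field.
  have [t1'|t1'] := eqVneq (complex.Im tau) (Num.sqrt 3 / 2); last first.
    apply: s2_neq0_half => //; rewrite lt_neqAle eq_sym t1' /= leNgt; apply/negP => c.
    have e : (Num.sqrt 3 / 2) * (Num.sqrt 3 / 2) = 3 / 4 :> R.
      by transitivity (Num.sqrt 3 * Num.sqrt 3 / 4 : R); [field|rewrite sqrt3_sqr].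
    have := ltr_pM (ltW i0) (ltW i0) c c; rewrite e => h3.
    rewrite nq x2 expr2 in n2; move: n2 h3; clear; lra.
  have [tE|tE] : tau = rho6 \/ tau = rho6 - 1.
    have [xv|xv] : complex.Re tau = 2^-1 \/ complex.Re tau = - 2^-1.
      by case: (ger0P (complex.Re tau)) xe => _ h; [left|right]; rewrite -?h ?opprK.
      by left; rewrite /rho6; move: xv t1'; case: (tau) => a b /= -> ->.
    right; rewrite /rho6; move: xv t1'; case: (tau) => a b /= -> ->.
    by apply/eqP; rewrite eq_complex /=; apply/andP; split; apply/eqP; field.
    case: n3; rewrite (@mult_zspan_tau 1) ?tE // mul1r; exact: rho6_sqr.
  case: n3; rewrite (@mult_zspan_tau (-1)) ?tE //; last first.
    by transitivity (rho6 * rho6 - 2 * rho6 + 1); [ring|rewrite rho6_sqr rmorphN rmorph1; ring].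
  have -> : rho6 - 1 = 1%:~R * rho6 + (-1)%:~R by rewrite rmorphN rmorph1 mul1r.
  exact: zspan_shift.
case: cases => [/eqP|[/eqP|ne]]; [by rewrite (negbTE x0)|by rewrite (negbTE xe)|].
by apply: s2_neq0_circle => //; rewrite lt_neqAle xe.
Qed.

End Tau.
End QuadraticTau.

(** * Reduction of a lattice to the fundamental domain *)

Section Reduction.
Variable R : realType.
Implicit Types (x y z w l : R[i]) (L : set R[i]).

Lemma zspan_bounded_finite (tau : R[i]) B : 0 < complex.Im tau -> exists s : seq (int * int),
  forall p, nrm (lat tau p) <= B -> p \in s.
Proof.
move=> t0; pose C : R := B / complex.Im tau; pose N := (Num.Def.archi_bound `|C|).
pose K : R := B + `|N%:R| * nrm tau; pose N' := (Num.Def.archi_bound `|K|).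
pose rng (n : nat) := [seq (k%:Z - n%:Z) | k <- iota 0 (n + n).+1].
have inr (m : int) (n : nat) : `|m%:~R : R| <= n%:R -> m \in rng n.
  rewrite -intr_norm -[n%:R]/((n%:Z)%:~R) ler_int => h; apply/mapP; exists (absz (m + n%:Z)); last by lia.
  by rewrite mem_iota; lia.
exists [seq (a, b) | a <- rng N, b <- rng N'] => -[a b] h; apply/allpairsP; exists (a, b) => /=.
have ha : `|a%:~R : R| <= N%:R.
  have := le_trans (Im_le_nrm _) h; rewrite /lat /= -!(rmorph_int (real_complex R)) ImD cImM /= mul0r !addr0.
  rewrite normrM (gtr0_norm t0) -ler_pdivlMr // => hh; apply: le_trans hh _; apply: le_trans (ler_norm C) _.
  by apply/ltW/archi_boundP.
split=> //; first exact: inr.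
apply: inr; apply: (@le_trans _ _ `|K|); last by apply/ltW/archi_boundP.
apply: le_trans (ler_norm K); rewrite /K -nrm_int.
have -> : b%:~R = lat tau (a, b) - a%:~R * tau by rewrite /lat /=; ring.
apply: le_trans (nrmB _ _) _; apply: lerD => //; rewrite nrmM nrm_int; apply: ler_wpM2r; first exact: nrm_ge0.
by rewrite (ger0_norm (ler0n _ _)).
Qed.

Lemma oriented_basis L : is_lattice L -> exists w tau : R[i], [/\ w != 0, 0 < complex.Im tau &
  L = [set w * x | x in range (lat tau)]].
Proof.
move=> latL; have [[w1 [w2 [LE ind]]] _ sp] := latL.
have w20 : w2 != 0.
  by apply/eqP => e; have [|_] := ind 0 1; [rewrite e mulr0 mul0r addr0|].
have i0 : complex.Im (w1 / w2) != 0.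
  apply/eqP => e.
  (* With a real ratio the whole lattice would lie on the real line through [w2], and could not span
     [w2 * 'i]. *)
  have [l1 [l2 [L1 L2 [a [b zE]]]]] := sp (w2 * 'i).
  have w1E : w1 = (complex.Re (w1 / w2))%:C * w2.
    by rewrite -[LHS](divfK w20) {1}(complex_ReIm (w1 / w2)) e rmorph0 mulr0 addr0.
  have rl l : L l -> exists r : R, l = r%:C * w2.
    rewrite LE => -[m [n ->]]; exists (m%:~R * complex.Re (w1 / w2) + n%:~R).
    by rewrite {1}w1E rmorphD rmorphM /= !rmorph_int; ring.
  have [r1 e1] := rl _ L1; have [r2 e2] := rl _ L2.
  have : 'i = (a * r1 + b * r2)%:C.
    by apply: (mulfI w20); rewrite zE e1 e2 rmorphD !rmorphM /=; ring.
  by move=> /(congr1 (@complex.Im R)) /= /eqP; rewrite oner_eq0.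
have [h|h|h] := ltgtP 0 (complex.Im (w1 / w2)); last by rewrite -h eqxx in i0.
  exists w2, (w1 / w2); split=> //; rewrite LE; apply/seteqP; split=> [x [m [n ->]]|_ [_ [[m n] _ <-] <-]].
    by exists (lat (w1 / w2) (m, n)); [exists (m, n)|rewrite /lat /=; field].
  by exists m, n; rewrite /lat /=; field.
exists w2, (- (w1 / w2)); split=> //; first by rewrite ImN oppr_gt0.
rewrite LE; apply/seteqP; split=> [x [m [n ->]]|_ [_ [[m n] _ <-] <-]].
  by exists (lat (- (w1 / w2)) (- m, n)); [exists (- m, n)|rewrite /lat /= rmorphN /=; field].
by exists (- m), n; rewrite /lat /= rmorphN /=; field.
Qed.

Lemma exists_minimal (tau : R[i]) : 0 < complex.Im tau -> exists2 p, p != 0 &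
  forall q, q != 0 -> nrm (lat tau p) <= nrm (lat tau q).
Proof.
move=> t0; have [s Hs] := zspan_bounded_finite (nrm (lat tau (0, 1))) t0.
pose s' := [seq p <- s | p != 0].
have one_s : ((0, 1) : int * int) \in s' by rewrite mem_filter Hs.
have [p ps Hp] := argmin_seq (fun p => nrm (lat tau p)) one_s.
exists p; first by move: ps; rewrite mem_filter => /andP[].
move=> q q0; case: (lerP (nrm (lat tau q)) (nrm (lat tau (0, 1)))) => h.
  by apply: Hp; rewrite mem_filter q0 Hs.
exact: le_trans (Hp _ one_s) (ltW h).
Qed.

Lemma range_lat_change (tau : R[i]) (a b c d : int) : a * d - b * c = 1 -> c%:~R * tau + d%:~R != 0 ->
  range (lat tau) = [set (c%:~R * tau + d%:~R) * x | x in range (lat ((a%:~R * tau + b%:~R) / (c%:~R * tau + d%:~R)))].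
Proof.
move=> det w0.
have key m n : (c%:~R * tau + d%:~R) * lat ((a%:~R * tau + b%:~R) / (c%:~R * tau + d%:~R)) (m, n) =
    lat tau (m * a + n * c, m * b + n * d).
  by rewrite /lat /= !(rmorphD, rmorphM) /=; field.
apply/seteqP; split=> [_ [[m n] _ <-]|_ [_ [[m n] _ <-] <-]]; last by rewrite key; eexists.
exists (lat ((a%:~R * tau + b%:~R) / (c%:~R * tau + d%:~R)) (m * d - n * c, n * a - m * b)); first by eexists.
rewrite key; congr (lat _ (_, _)).
  by transitivity (m * (a * d - b * c)); [ring|rewrite det mulr1].
by transitivity (n * (a * d - b * c)); [ring|rewrite det mulr1].
Qed.

(** A shortest vector [c tau + d] has coprime coordinates, since otherwise it could be divided.
    Completing it to a unimodular matrix gives [|tau| >= 1] by minimality, and an integral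
    translation adjusts the real part. *)
Lemma lattice_reduced L : is_lattice L -> exists w tau : R[i], [/\ w != 0, reduced tau &
  L = [set w * x | x in L0 tau]].
Proof.
move=> /oriented_basis[w [tau [w0 t0 ->]]].
have [[c d] p0 minp] := exists_minimal t0.
have lat0E q : q != 0 -> lat tau q != 0.
  move=> q0; apply: contra_neq q0 => e.
  have := congr1 (@complex.Im R) e; have := congr1 (@complex.Re R) e.
  rewrite /lat -!(rmorph_int (real_complex R)) ReD ImD cReM cImM /= !mul0r subr0 !addr0.
  case: q e => m n e /= er /eqP; rewrite mulf_eq0 (gt_eqF t0) orbF intr_eq0 => /eqP m0.
  by move: er; rewrite m0 mul0r add0r => /eqP; rewrite intr_eq0 => /eqP ->.
have v0 := lat0E _ p0; have v0' : 0 < nrm (lat tau (c, d)) by rewrite nrm_gt0.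
have g1 : gcdz c d = 1.
  pose g := gcdz c d; have /dvdzP[c' cE] : (g %| c)%Z := dvdz_gcdl _ _.
  have /dvdzP[d' dE] : (g %| d)%Z := dvdz_gcdr _ _.
  have g0 : 0 <= g by [].
  have q0 : (c', d') != 0.
    by apply: contra_neq p0 => -[c0 d0]; rewrite cE dE c0 d0 !mul0r.
  have lE : lat tau (c, d) = g%:~R * lat tau (c', d') by rewrite /lat /= cE dE !rmorphM /=; ring.
  have := minp _ q0; rewrite lE nrmM nrm_int; have := lat0E _ q0; rewrite -nrm_gt0 => h1 h2.
  have : `|g%:~R| <= 1 :> R by rewrite -(ler_pM2r h1) mul1r.
  rewrite -intr_norm lerz1 ger0_norm // => gl; apply/eqP; rewrite eq_le gl /=.
  have : g != 0 by apply: contra_neq p0 => e; rewrite cE dE e !mulr0.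
  by move: g0; clear; lia.
have [u [v bz]] := Bezoutz c d; rewrite g1 in bz.
pose t1 := (v%:~R * tau + (- u)%:~R) / (c%:~R * tau + d%:~R).
(* Rounding to the nearest integer brings the real part of [t1] into [[-1/2, 1/2]]. *)
pose k : int := - Num.floor (complex.Re t1 + 2^-1).
pose a := v + k * c; pose b := - u + k * d.
have det : a * d - b * c = 1 by rewrite /a /b -bz; ring.
have v0c : c%:~R * tau + d%:~R != 0 := v0.
have := range_lat_change det v0c; set t2 := (_ / _) => rE.
have t2E : t2 = t1 + k%:~R by rewrite /t2 /t1 /a /b !(rmorphD, rmorphM) /=; field.
exists (w * (c%:~R * tau + d%:~R)), t2; split.
- by rewrite mulf_neq0.
- split.
  + have n2 : 0 < nrm (c%:~R * tau + d%:~R) ^+ 2 by rewrite exprn_gt0.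
    have aux (t : R[i]) : t * (c%:~R * tau + d%:~R) = a%:~R * tau + b%:~R ->
        complex.Im t * nrm (c%:~R * tau + d%:~R) ^+ 2 = complex.Im tau.
      move=> e; have dR : a%:~R * d%:~R - b%:~R * c%:~R = 1 :> R by rewrite -!rmorphM -rmorphB det.
      have := congr1 (@complex.Im R) e; have := congr1 (@complex.Re R) e.
      rewrite nrm_sqr -!(rmorph_int (real_complex R)) cReM cImM !ReD !ImD !cReM !cImM /= !mul0r !subr0 !addr0.
      move: dR; clear; move: (a%:~R : R) (b%:~R : R) (c%:~R : R) (d%:~R : R) (complex.Re tau) (complex.Im tau) (complex.Re t) (complex.Im t).
      move=> A B C D X Y P Q det h1 h2.
      transitivity ((P * (C * Y) + Q * (C * X + D)) * (C * X + D) - (P * (C * X + D) - Q * (C * Y)) * (C * Y)); first by ring.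
      by rewrite h1 h2 -[Y in RHS]mul1r -det; ring.
    have := aux t2 (divfK v0c _).
    by move=> e; move: t0; rewrite -e pmulr_lgt0.
  + have : nrm (lat tau (c, d)) <= nrm (lat tau (a, b)).
      apply: minp; apply/eqP => -[a0 b0]; move/eqP: det.
      by rewrite (a0 : a = 0) (b0 : b = 0) !mul0r subr0 eq_sym oner_eq0.
    by rewrite /t2 nrmM nrmV ler_pdivlMr // mul1r.
  + have := floor_itv (complex.Re t1 + 2^-1); rewrite t2E ReD -(rmorph_int (real_complex R)) /= /k rmorphN /= => /andP[].
    rewrite rmorphD /= rmorph1; move: (_%:~R) => F; move: (complex.Re t1) => X; clear => h1 h2.
    by rewrite ler_norml; apply/andP; split; lra.
rewrite rE; apply/seteqP; split=> [_ [_ [y yL <-] <-]|_ [y yL <-]].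
  by exists y => //; rewrite mulrA.
by exists ((c%:~R * tau + d%:~R) * y); [exists y|rewrite mulrA].
Qed.

End Reduction.

(** * Consequences of a real j-invariant *)

Section RealInvariant.
Variable R : realType.
Implicit Types (x y z w l : R[i]) (L : set R[i]).

Lemma conjcD x y : (x + y)^* = x^* + y^*. Proof. exact: rmorphD. Qed.
Lemma conjcN x : (- x)^* = - x^*. Proof. exact: rmorphN. Qed.
Lemma conjcV x : (x^-1)^* = x^*^-1. Proof. exact: fmorphV. Qed.
Lemma conjcX x n : (x ^+ n)^* = x^* ^+ n. Proof. exact: rmorphXn. Qed.
Lemma conjc_nat n : (n%:R : R[i])^* = n%:R. Proof. exact: rmorph_nat. Qed.
Lemma conjc_neq0 x : (x^* != 0) = (x != 0). Proof. by rewrite fmorph_eq0. Qed.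

Lemma G_scale (tau : R[i]) w n : reduced tau -> w != 0 -> (3 <= n)%N ->
  G_ n [set w * x | x in L0 tau] = w^-1 ^+ n * gsm tau n.
Proof.
move=> red w0 n3; have [a s] := scaled_sum red w0 n3.
have H := csumP a; rewrite s in H.
rewrite /G_ /set_sum; apply: xget_unique => [|v Hv].
  apply/has_sumE; apply: hs_ext H => x /=.
  case: ifP => [|xL].
    rewrite inE => -[[_ [p _ <-] <-] x0]; rewrite asboolT ?mul1r ?exprVn //.
    exists p => //; apply/eqP => p0; apply: x0; by rewrite p0 lat0 mulr0.
  rewrite asboolF ?mul0r // => -[p p0 xE]; move/negP: xL; apply; rewrite inE; split.
    by exists (lat tau p) => //; exact: L0lat.
  by rewrite xE => /eqP; rewrite mulf_eq0 (negbTE w0) (lat_eq0 red) (negbTE p0).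
move/has_sumE: Hv => Hv; apply: hs_uniq Hv _; apply: hs_ext H => x /=.
case: ifP => [|xL].
  rewrite inE => -[[_ [p _ <-] <-] x0]; rewrite asboolT ?mul1r ?exprVn //.
  exists p => //; apply/eqP => p0; apply: x0; by rewrite p0 lat0 mulr0.
rewrite asboolF ?mul0r // => -[p p0 xE]; move/negP: xL; apply; rewrite inE; split.
  by exists (lat tau p) => //; exact: L0lat.
by rewrite xE => /eqP; rewrite mulf_eq0 (negbTE w0) (lat_eq0 red) (negbTE p0).
Qed.

Lemma reduced_conj (tau : R[i]) : reduced tau -> reduced (- tau^*).
Proof.
move=> [h1 h2 h3]; split.
- by rewrite ImN; case: (tau) h1 => a b /=; rewrite opprK.
- by rewrite nrmN nrm_conj.
- by rewrite ReN normrN; case: (tau) h3.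
Qed.

Lemma lat_neg_conj (tau : R[i]) p : lat (- tau^*) p = (lat tau (- p.1, p.2))^*.
Proof. by rewrite /lat /= conjcD conjcM !conjc_int rmorphN; ring. Qed.

Lemma L0_conj (tau : R[i]) : L0 (- tau^*) = [set l^* | l in L0 tau].
Proof.
apply/seteqP; split=> [_ [p _ <-]|_ [_ [[m n] _ <-] <-]].
  by rewrite lat_neg_conj; exists (lat tau (- p.1, p.2)); [exact: L0lat|].
by exists (- m, n) => //; rewrite lat_neg_conj /= opprK.
Qed.

Lemma gsm_conj (tau : R[i]) n : reduced tau -> (3 <= n)%N -> gsm (- tau^*) n = (gsm tau n)^*.
Proof.
move=> red n3; pose h (p : int * int) := (- p.1, p.2).
have hh : involutive h by case=> a b; rewrite /h /= opprK.
have h0 p : (h p == 0) = (p == 0).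
  by case: p => a b; rewrite /h -[RHS]/((a == 0) && (b == 0)) -[LHS]/((- a == 0) && (b == 0)) oppr_eq0.
have E p : ((fun p => (lattice_term tau n p)^*) \o h) p = lattice_term (- tau^*) n p.
  rewrite /= /lattice_term h0; case: ifP => _; first exact: conjc0.
  by rewrite conjcX conjcV lat_neg_conj.
have H : hs (fun p => (lattice_term tau n p)^*) (gsm tau n)^*.
  move=> e e0; have [s0 Hs] := csumP (absm_lattice_term red n3) e0; exists s0 => s us ss.
  have -> : \sum_(i <- s) (lattice_term tau n i)^* = (\sum_(i <- s) lattice_term tau n i)^*.
    by apply/esym; exact: rmorph_sum.
  by rewrite -conjcN -conjcD nrm_conj; exact: Hs.
rewrite /gsm -(csum_eq H).
have <- : csum ((fun p => (lattice_term tau n p)^*) \o h) = csum (fun p => (lattice_term tau n p)^*).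
  by apply: (csum_reindex (inv_inj hh)) => p /(_ (h p)); rewrite hh.
by apply: csum_ext => p; exact: (esym (E p)).
Qed.

Lemma real_conjc z : z \is Num.real -> z^* = z.
Proof.
case: z => a b; rewrite realE !lecE /= => /orP[] /andP[/eqP e _].
  have -> : b = 0 by move: e => /= ->.
  by rewrite /= oppr0.
have -> : b = 0 by move: e => /= ->.
  by rewrite /= oppr0.
Qed.

(** The form of [j_invariant] with [a = g2^3] and [b = 27 g3^2]. The cross-multiplied conclusion
    also holds for [a = b], where the quotient is 0 by convention. *)
Lemma conj_real_quotient (a b : R[i]) : 1728 * a / (a - b) \is Num.real -> a * b^* = a^* * b.
Proof.
move=> /real_conjc; rewrite conjcM conjcV conjcD conjcN conjcM conjc_nat => jE.
have [e|e] := eqVneq (a - b) 0.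
  by have -> : b = a; [apply/eqP; rewrite -subr_eq0 -opprB e oppr0|rewrite mulrC].
have e' : a^* - b^* != 0 by rewrite -conjcN -conjcD conjc_neq0.
have n0 : 1728 != 0 :> R[i] by rewrite pnatr_eq0.
move: jE => /eqP; rewrite eqr_div // -!mulrA (inj_eq (mulfI n0)) => /eqP jE.
transitivity (a * a^* - a * (a^* - b^*)); first by ring.
by rewrite -jE; ring.
Qed.

(** For nonzero [x] and [y] take a square root [mu] of the quotient of [y^* / y] by [x^* / x]; the
    hypothesis says that the square of this quotient is [x^* / x]. If one of them is 0, a single
    fourth or sixth root does. *)
Lemma conj_twist x y : x ^+ 3 * y^* ^+ 2 = x^* ^+ 3 * y ^+ 2 ->
  exists2 mu, mu != 0 & x^* = mu ^+ 4 * x /\ y^* = mu ^+ 6 * y.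
Proof.
move=> E; have rootn0 n z : (0 < n)%N -> z != 0 -> n.-root z != 0.
  by move=> n0 z0; apply: contra_neq z0 => r0; rewrite -(rootCK n0 z) r0 expr0n gtn_eqF.
have [x0|x0] := eqVneq x 0; have [y0|y0] := eqVneq y 0.
- by exists 1; rewrite ?oner_eq0 // x0 y0 conjc0 !mulr0.
- exists (6.-root (y^* / y)); first by rewrite rootn0 // mulf_neq0 ?invr_eq0 ?conjc_neq0.
  by rewrite x0 conjc0 mulr0 rootCK // divfK.
- exists (4.-root (x^* / x)); first by rewrite rootn0 // mulf_neq0 ?invr_eq0 ?conjc_neq0.
  by rewrite y0 conjc0 mulr0 rootCK // divfK.
have xc : x^* != 0 by rewrite conjc_neq0.
have yc : y^* != 0 by rewrite conjc_neq0.
pose r := (y^* / y) / (x^* / x).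
have r2 : r ^+ 2 = x^* / x.
  have e : y^* ^+ 2 = x^* ^+ 3 * y ^+ 2 / x ^+ 3 by rewrite -E; field.
  rewrite /r; transitivity (y^* ^+ 2 * x ^+ 2 / (y ^+ 2 * x^* ^+ 2)); first by field; rewrite x0 y0 xc.
  by rewrite e; field; rewrite x0 y0 xc.
have m2 : sqrtC r ^+ 2 = r by exact: sqrtCK.
exists (sqrtC r); first by rewrite rootn0 // !mulf_neq0 ?invr_eq0 // mulf_neq0 ?invr_eq0.
rewrite (exprM _ 2 2) (exprM _ 2 3) m2; split; first by rewrite r2 divfK.
rewrite exprS r2 /r; field; by rewrite x0 y0 xc.
Qed.

Lemma conj_homothetic (tau : R[i]) w : reduced tau -> w != 0 ->
  j_invariant [set w * x | x in L0 tau] \is Num.real ->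
  exists2 lam : R[i], lam != 0 & [set lam * x | x in L0 tau] = [set x^* | x in L0 tau].
Proof.
move=> red w0; rewrite /j_invariant !(G_scale red w0) //.
set x := gsm tau 4; set y := gsm tau 6.
move=> jr.
have E : x ^+ 3 * y^* ^+ 2 = x^* ^+ 3 * y ^+ 2.
  move/conj_real_quotient: jr => ab.
  pose c : R[i] := 60 ^+ 3 * 27 * 140 ^+ 2 * (w^-1 ^+ 12 * w^*^-1 ^+ 12).
  have c0 : c != 0.
    have w0' : w^*^-1 != 0 by rewrite invr_eq0 conjc_neq0.
    have w0'' : w^-1 != 0 by rewrite invr_eq0.
    by rewrite /c !mulf_neq0 // ?expf_neq0 // pnatr_eq0.
  apply: (mulfI c0); move: ab; rewrite !(conjcM, conjcX, conjcV, conjc_nat) => ab.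
  transitivity ((60 * (w^-1 ^+ 4 * x)) ^+ 3 * (27 * (140 * (w^*^-1 ^+ 6 * y^*)) ^+ 2)); first by rewrite /c; ring.
  by rewrite ab /c; ring.
have [mu mu0 [hx hy]] := conj_twist E.
have red' := reduced_conj red.
exists mu^-1; first by rewrite invr_eq0.
rewrite -L0_conj.
have -> : L0 (- tau^*) = [set 1 * x | x in L0 (- tau^*)].
  by apply/seteqP; split=> [z zL|_ [z zL <-]]; [exists z; rewrite ?mul1r|rewrite mul1r].
apply: gsm_determines => //; rewrite ?invr_eq0 ?oner_eq0 // invrK invr1 expr1n mul1r gsm_conj //.
Qed.

End RealInvariant.

(** * Elementary inequalities and cancellations for the values *)

Section Arithmetic.
Variable R : realType.

Lemma div_lt_half (M e : R) : 0 < M -> 0 < e -> 4 / e < M -> 2 / M < e / 2.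
Proof. by move=> M0 e0; rewrite !ltr_pdivrMr //; lra. Qed.

Lemma floor_half (F X : R) : F <= X / 2 -> X / 2 < F + 1 -> `|2 * F - X| <= 2.
Proof. by move=> h1 h2; rewrite ler_norml; apply/andP; split; lra. Qed.

Lemma form_ge (a b D t : R) : D <= 0 -> t <= a -> 1 <= t -> t <= a * a - b * b * D.
Proof.
move=> D0 ta t1; have h : 0 <= b * b * - D by rewrite mulr_ge0 ?oppr_ge0 // -expr2 sqr_ge0.
nra.
Qed.

Lemma approx_lt (x y v p q e : R) : y = v - q -> `|v - x| <= p -> p < e / 2 -> `|q| < e / 2 -> `|y - x| < e.
Proof.
move=> -> h1 h2 h3; have -> : v - q - x = (v - x) - q by ring.
by apply: le_lt_trans (ler_normB _ _) _; lra.
Qed.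

Lemma cancel_factors (n m w h s d Z X : R[i]) : m != 0 -> h != 0 -> s != 0 -> d != 0 -> n = m * m ->
  n * X = s * h * (2 * m * w * d) * Z -> X / (h * (d * s)) = 2 * w / m * Z.
Proof.
move=> m0 h0 s0 d0 -> E; have -> : X = s * h * (2 * m * w * d) * Z / (m * m).
  by rewrite -E mulrC mulKf // mulf_neq0.
by field; rewrite ?m0 ?h0 ?s0 ?d0.
Qed.

Lemma real_value (w Q : int) (m n : nat) :
  (2 * w%:~R / m%:R * (1 - (n%:R ^+ 2 + 1) / Q%:~R))%:C =
  2 * w%:~R / m%:R * (1 - (n%:R ^+ 2 + 1) / Q%:~R) :> R[i].
Proof.
have cd (x y : R) : (x / y)%:C = x%:C / y%:C by exact: fmorph_div.
have cm (x y : R) : (x * y)%:C = x%:C * y%:C by exact: rmorphM.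
have ca (x y : R) : (x + y)%:C = x%:C + y%:C by exact: rmorphD.
have cn (x : R) : (- x)%:C = - x%:C by exact: rmorphN.
have ci (a : int) : (a%:~R : R)%:C = a%:~R by exact: rmorph_int.
have cN (a : nat) : (a%:R : R)%:C = a%:R by exact: rmorph_nat.
have cX (x : R) : (x ^+ 2)%:C = x%:C ^+ 2 by exact: rmorphXn.
have c1 : (1 : R)%:C = 1 by [].
by rewrite cm cd cm !cN !ci ca cn cd ca cX c1 !cN !ci.
Qed.

Lemma cancel_conj (X Y k k' u d s : R[i]) : k != 0 -> k' != 0 -> u != 0 -> d != 0 -> s != 0 ->
  k' * X = - (k * Y) -> u ^+ 2 * Y / (k' * (- d * (u ^+ 2 * s))) = X / (k * (d * s)).
Proof.
move=> k0 k0' u0 d0 s0 E; have -> : X = - (k * Y) / k' by rewrite -E mulrC mulKf.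
by field; rewrite ?k0 ?k0' ?u0 ?d0 ?s0 ?oppr_eq0 ?d0.
Qed.

End Arithmetic.

(** * Reality and density of the normalized sums *)

Section Values.
Variable R : realType.
Variables (tau : R[i]) (A B C : int).
Hypotheses (red : reduced tau) (A0 : 0 < A)
  (quad : A%:~R * (tau * tau) + B%:~R * tau + C%:~R = 0)
  (prim : exists u v w : int, u * A + v * B + w * C = 1).

Let om := A%:~R * tau.
Let sD := om - om^*.
Let D : int := B ^+ 2 - 4 * (A * C).

Lemma om_quad : om * om = - (B%:~R * om) - (A * C)%:~R.
Proof.
have E : A%:~R * (tau * tau) = - (B%:~R * tau) - C%:~R.
  by apply/eqP; rewrite -subr_eq0 -quad; apply/eqP; ring.
rewrite /om rmorphM /=; transitivity (A%:~R * (A%:~R * (tau * tau))); first by ring.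
by rewrite E; ring.
Qed.

Lemma om_im : 0 < complex.Im om.
Proof.
have [i0 _ _] := red.
by rewrite /om -(rmorph_int (real_complex R)) cImM /= mul0r addr0 mulr_gt0 // ltr0z.
Qed.

Lemma multE m : mult tau m <-> zspan 1 om m.
Proof. by have := mult_zspan red A0 quad prim; rewrite -/om => <-. Qed.

Lemma mult_conj m : mult tau m -> mult tau m^*.
Proof.
move=> /multE[a [b ->]]; apply/multE; rewrite conjc_lin conjc1 (conj_om om_quad om_im).
exists (a - b * B), (- b); rewrite rmorphB rmorphN rmorphM /=; ring.
Qed.

Lemma disc_scale w : w != 0 ->
  'i * sqrtC `|(lattice_disc [set w * x | x in L0 tau])%:~R| = sD.
Proof.
move=> w0; rewrite (lattice_disc_order om_quad om_im).
  exact: sqrt_norm_disc om_quad om_im.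
by rewrite (multiplier_scale _ w0) (mult_zspan red A0 quad prim).
Qed.

(** Conjugation followed by division by [lam] preserves the lattice and carries k-torsion to torsion
    for the conjugate of [k]. The sign in [dsum_conj] is compensated by that of [sD]. *)
Lemma dsum_real lam h k T : lam != 0 -> [set lam * x | x in L0 tau] = [set x^* | x in L0 tau] ->
  k != 0 -> mult tau h -> mult tau k -> reps tau (tors tau k) T ->
  (dsum tau h T / (k * (sD * ca tau 0)))^* = dsum tau h T / (k * (sD * ca tau 0)).
Proof.
move=> l0 lE k0 mh mk rT; pose phi t := lam^-1 * t^*.
have phiL z : L0 tau (phi z) <-> L0 tau z.
  split=> zL.
    have : [set lam * x | x in L0 tau] z^* by exists (phi z) => //; rewrite /phi mulVKf.
    by rewrite lE => -[x xL /(congr1 (@conjc R))]; rewrite !conjcK => <-.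
  have : [set x^* | x in L0 tau] z^* by exists z.
  by rewrite -lE => -[x xL e]; rewrite /phi -e mulKf.
have phiB s t : phi s - phi t = phi (s - t) by rewrite /phi conjcD conjcN; ring.
have mk' := mult_conj mk; have mh' := mult_conj mh.
have torsE t : k^* * phi t = phi (k * t) by rewrite /phi conjcM; ring.
have rT' : reps tau (tors tau k^*) (map phi T).
  apply: reps_map rT _ _ _ _.
  - by move=> t kt; rewrite /tors torsE; apply/phiL.
  - by move=> s t _ _; rewrite phiB => /phiL.
  - by move=> s t h'; rewrite phiB; apply/phiL.
  - move=> z kz; exists (lam^* * z^*).
      apply/phiL; rewrite -torsE /phi conjcM !conjcK mulKf //; exact: kz.
    by rewrite /phi conjcM !conjcK mulKf // subrr; exact: L0_0.
have E1c z : (E_ 1 (L0 tau) z)^* = lam^-1 * E_ 1 (L0 tau) (phi z).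
  rewrite -E_conj -lE -[z^*](mulVKf l0) E_scale //.
have dc : (dsum tau h T)^* = lam^-1 ^+ 2 * dsum tau h^* (map phi T).
  rewrite /dsum big_map mulr_sumr.
  have -> : (\sum_(t <- T) E_ 1 (L0 tau) (h * t) * E_ 1 (L0 tau) t)^* =
      \sum_(t <- T) (E_ 1 (L0 tau) (h * t) * E_ 1 (L0 tau) t)^* by exact: rmorph_sum.
  apply: eq_bigr => t _; rewrite conjcM !E1c.
  have -> : phi (h * t) = h^* * phi t by rewrite /phi conjcM; ring.
  ring.
have sc : (ca tau 0)^* = lam^-1 ^+ 2 * ca tau 0.
  rewrite -(E2_formula red) -E_conj conjc0 -lE.
  by have := E_scale (L0 tau) 2 0 l0; rewrite mulr0.
have sDc : sD^* = - sD := sD_conj _.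
have rec := dsum_conj red k0 mh mk mh' mk' rT rT'.
rewrite conjcM conjcV (conjcM k) (conjcM sD) dc sc sDc; move: rec.
have k0' : k^* != 0 by rewrite conjc_neq0.
have sD0 : sD != 0 := sD_neq0 om_im.
move: (dsum tau h T) (dsum tau h^* (map phi T)) (ca tau 0) => X Y s rec.
have [->|s0] := eqVneq s 0; first by rewrite !mulr0 !invr0 !mulr0.
by apply: cancel_conj => //; rewrite invr_eq0.
Qed.

Lemma dsum_dense (x e : R) : ca tau 0 != 0 -> 0 < e -> exists (n : nat) (h : R[i]) Th (y : R),
  [/\ mult tau n%:R, mult tau h, h != 0, reps tau (tors tau h) Th &
      dsum tau n%:R Th / (h * (sD * ca tau 0)) = y%:C /\ `|y - x| < e].
Proof.
move=> s0 e0; have sDc : sD^* = - sD := sD_conj _.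
have sD0 : sD != 0 := sD_neq0 om_im.
have DE : sD ^+ 2 = D%:~R := sD_sqr om_quad om_im.
have Dle : (D%:~R : R) <= 0.
  have := congr1 (@complex.Re R) DE; rewrite -(rmorph_int (real_complex R)) expr2 cReM /= => <-.
  have -> : complex.Re sD = 0 by rewrite /sD; case: (om) => a b /=; rewrite subrr.
  by rewrite mul0r sub0r oppr_le0 -expr2 sqr_ge0.
(* The grid of numbers [2 * w / m] then has step below [e / 2]. *)
pose m := (Num.Def.archi_bound (4 / e)).+1.
have m0 : 0 < m%:R :> R by rewrite ltr0n.
have mR : (m%:R : R[i]) != 0 by rewrite pnatr_eq0.
have me : 2 / m%:R < e / 2.
  have := archi_boundP (ltW (divr_gt0 (ltr0n R 4) e0)) => h.
  have h2 : 4 / e < m%:R by apply: lt_le_trans h _; rewrite ler_nat leqnSn.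
  exact: div_lt_half.
pose w : int := Num.floor (x * m%:R / 2).
pose v : R := 2 * w%:~R / m%:R.
have vx : `|v - x| <= 2 / m%:R.
  have := floor_itv (x * m%:R / 2); rewrite -/w rmorphD rmorph1 => /andP[h1 h2].
  have -> : v - x = (2 * w%:~R - x * m%:R) / m%:R by rewrite /v; field; rewrite gt_eqF.
  rewrite normrM (gtr0_norm (x := m%:R^-1)) ?invr_gt0 // ler_pM2r ?invr_gt0 //.
  exact: floor_half.
pose n := (m * m)%N.
(* Large enough for the correction [|v| (n^2 + 1) / Q] to stay below [e / 2], since [Q >= t]. *)
pose t := (Num.Def.archi_bound (`|v| * (n%:R ^+ 2 + 1) / (e / 2))).+1.
have t1 : 1 <= t%:R :> R by rewrite ler1n.
have tv : `|v| * (n%:R ^+ 2 + 1) < t%:R * (e / 2).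
  have b0 : 0 <= `|v| * (n%:R ^+ 2 + 1) / (e / 2).
    apply: divr_ge0; last by rewrite ltW // divr_gt0.
    by rewrite mulr_ge0 // addr_ge0 // exprn_ge0.
  have h := archi_boundP b0.
  have e2 : 0 < e / 2 by rewrite divr_gt0.
  by rewrite -ltr_pdivrMr //; apply: lt_le_trans h _; rewrite ler_nat leqnSn.
(* With these coordinates [h * h^* - 1 = a^2 - b^2 D - 1] is divisible by [m^2 = n], with quotient
   [u], while [h - h^* = 2 m w sD]. *)
pose a : int := 1 + m%:Z ^+ 2 * t%:Z; pose b : int := m%:Z * w.
pose h : R[i] := a%:~R + b%:~R * sD.
have hc : h^* = a%:~R - b%:~R * sD by rewrite /h conjcD conjcM !conjc_int sDc mulrN.
pose Q : int := a ^+ 2 - b ^+ 2 * D.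
have hh : h * h^* = Q%:~R.
  rewrite hc /h /Q rmorphB !rmorphM /= -DE; ring.
have tQ : t%:R <= Q%:~R :> R.
  have h2 : t%:R <= a%:~R :> R.
    rewrite /a rmorphD rmorphM rmorphXn rmorph1 /= -![(Posz _)%:~R]/(_%:R).
    have m1 : 1 <= (m%:R : R) ^+ 2 by rewrite expr_ge1 // ?ler1n.
    have := ler_wpM2r (ler0n R t) m1; rewrite mul1r => /le_trans; apply.
    by rewrite ler_wpDl.
  by rewrite /Q rmorphB !rmorphM /=; exact: form_ge.
have Q0 : (Q%:~R : R) != 0 by rewrite gt_eqF // (lt_le_trans _ tQ) // (lt_le_trans _ t1).
have QR : (Q%:~R : R[i]) != 0 by rewrite intr_eq0 -(intr_eq0 R).
have h0 : h != 0 by apply: contra_neq QR => e'; rewrite -hh e' mul0r.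
have mh : mult tau h.
  apply/multE; exists (a + b * B), (2 * b).
  rewrite /h /sD (conj_om om_quad om_im) !(rmorphD, rmorphM) /=; ring.
pose u : int := 2 * t%:Z + m%:Z ^+ 2 * t%:Z ^+ 2 - w ^+ 2 * D.
have mu : mult tau u%:~R by apply/multE; exists u, 0; rewrite mul0r addr0 mulr1.
have hu : h * h^* = 1 + u%:~R * n%:R.
  rewrite hh; have -> : Q = 1 + u * n%:Z by rewrite /Q /u /a /b /n PoszM; ring.
  by rewrite rmorphD rmorphM rmorph1.
have [Th rTh] := tors_reps red h0 mh.
have n0 : (0 < n)%N by rewrite muln_gt0.
have val := dsum_value red n0 h0 mh (mult_conj mh) mu hu rTh.
exists n, h, Th, (v * (1 - (n%:R ^+ 2 + 1) / Q%:~R)); split=> //; first exact: nat_mult.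
split.
  rewrite hh in val.
  have hm : h - h^* = 2 * m%:R * w%:~R * sD.
    by rewrite hc /h /b rmorphM /= -[(m%:Z)%:~R]/(m%:R); ring.
  rewrite hm in val.
  rewrite /v real_value.
  have nE : n%:R = m%:R * m%:R :> R[i] by rewrite natrM.
  exact: (cancel_factors mR h0 s0 sD0 nE val).
have Qp : 0 < Q%:~R :> R by apply: lt_le_trans tQ; apply: lt_le_trans t1.
have d2 : `|v * ((n%:R ^+ 2 + 1) / Q%:~R)| < e / 2.
  have p0 : 0 <= n%:R ^+ 2 + 1 :> R by rewrite addr_ge0 ?exprn_ge0.
  rewrite normrM (ger0_norm (divr_ge0 p0 (ltW Qp))) mulrA ltr_pdivrMr //.
  apply: lt_le_trans tv _; rewrite [leRHS]mulrC; apply: ler_wpM2r tQ; exact: ltW (divr_gt0 e0 (ltr0n R 2)).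
by apply: approx_lt vx me d2; rewrite mulrBr mulr1.
Qed.

End Values.

Theorem theorem1 (R : realType) (L : set R[i]) (latL : is_lattice L)
    (jreal : j_invariant L \is Num.real)
    (notZ : multiplier_ring L <> range (fun n : int => n%:~R : R[i]))
    (notZi : multiplier_ring L <> Zadjoin 'i)
    (notZw : multiplier_ring L <> Zadjoin ((1 - sqrtC (- 3%:R)) / 2%:R)) :
  normalized_values L `<=` range (fun x : R => x%:C) /\
  dense ((fun x : R => x%:C) @^-1` normalized_values L).
Proof.
have [w [tau [w0 red LE]]] := lattice_reduced latL; subst L.
have mE := multiplier_scale tau w0; rewrite mE in notZ notZi notZw.
have [lam l0 lE] := conj_homothetic red w0 jreal.
have s0 : ca tau 0 != 0 := s2_neq0 red (conj_cases red l0 lE) notZi notZw.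
(* Integers always preserve the lattice, so a multiplier ring other than Z contains a further
   element. *)
have [k mk nk] : exists2 k, mult tau k & forall n : int, k <> n%:~R.
  apply: contrapT => H; apply: notZ; apply/seteqP; split=> [k /= mk|_ [n _ <-] /=].
    apply: contrapT => nk; apply: H; exists k => // n kn; apply: nk; by exists n.
  move=> _ [[a b] _ <-]; exists (n * a, n * b) => //; rewrite /lat /= !rmorphM /=; ring.
have [A [B [C [A0 quad prim]]]] := cm_quadratic mk nk.
have dE := disc_scale red A0 quad prim w0.
split=> [x [h [c [mh mc c0 ->]]]|O [x Ox] oO].
  have {}mh : mult tau h by move: mh; rewrite mE.
  have {}mc : mult tau c by move: mc; rewrite mE.
  have [T rT] := tors_reps red c0 mc.
  rewrite (normalized_scale red w0 c0 mh mc rT) dE.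
  have := dsum_real red A0 quad prim l0 lE c0 mh mc rT.
  move: (_ / _) => z zc; exists (complex.Re z) => //.
  by move: zc; case: (z) => a b /= [] b0; rewrite (_ : b = 0) //; lra.
have [e e0 He] : exists2 e : R, 0 < e & forall y, `|y - x| < e -> O y.
  have /nbhs_ballP[e /= e0 He] := open_nbhs_nbhs (conj oO Ox).
  by exists e => // y yx; apply: He; rewrite /ball /= distrC.
have [n [h [Th [y [mn mh h0 rTh [yE yx]]]]]] := dsum_dense red A0 quad prim x s0 e0.
exists y; split; first exact: He.
exists n%:R, h; split=> //; [by rewrite mE|by rewrite mE|].
by rewrite (normalized_scale red w0 h0 mn mh rTh) dE yE.
Qed.
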